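(* Let $L$ be a compact, oriented $n$-dimensional manifold without boundary and let $F:L\times[0,T_{\mathrm{sing}})\to\mathbb{C}^n$ be a smooth solution of the Lagrangian mean curvature flow $\frac{d}{dt}F=\overrightarrow{H}$. If $L_0=F(L,0)$ is monotone with monotonicity constant $\varepsilon_0>0$, then for every $t\in[0,T_{\mathrm{sing}})$, writing $F_t=F(\cdot,t)$ and $H_t$ for the mean curvature form of $F_t$, $$[F_t^*\lambda]=\frac{1}{\varepsilon_0}(1-\varepsilon_0 t)\,[H_t]\quad\text{in } H^1(L;\mathbb{R}).$$ In particular, $L_t=F(L,t)$ remains monotone for all $t\in[0,T_{\mathrm{sing}})$ with $t<\frac{1}{\varepsilon_0}$, with monotonicity constant $\varepsilon_t:=\frac{\varepsilon_0}{1-\varepsilon_0 t}>0$.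
   Context: On $\mathbb{C}^n$ let $\langle\cdot,\cdot\rangle$ be the Euclidean metric, $J$ the complex structure, $\omega(\cdot,\cdot)=\langle J\cdot,\cdot\rangle$ the standard symplectic form, and $\lambda=\frac12\sum_j(x^j dy^j-y^j dx^j)$, so $\omega=d\lambda$. An immersion $F:L\to\mathbb{C}^n$ with $\dim L=n$ is Lagrangian if $F^*\omega=0$. $\overrightarrow{H}$ is the mean curvature vector (trace of the second fundamental form), and the mean curvature form is the closed 1-form $H:=F^*(\omega(\cdot,\overrightarrow{H}))$ on $L$, i.e. $H(X)=\omega(dF(X),\overrightarrow{H})$. The Lagrangian mean curvature flow is a smooth family of immersions with $\frac{d}{dt}F=\overrightarrow{H}$ and Lagrangian initial immersion $F(\cdot,0)$; the Lagrangian condition is preserved. $[0,T_{\mathrm{sing}})$ is the maximal time interval on which a smooth solution exists. A Lagrangian $F(L)$ is monotone with monotonicity constant $\varepsilon>0$ if $\mu(u)=\frac{\varepsilon}{\pi}\int_{\mathbb{D}}u^*\omega$ for all smooth disks $u:\mathbb{D}\to\mathbb{C}^n$ with boundary on the Lagrangian, where $\mu(u)$ is the Maslov index; for an immersion, the boundary is understood to be the image of a loop in $L$. Since $\int_\gamma H=\pi\mu(u)$ and $\int_\gamma F^*\lambda=\int_{\mathbb D} u^*\omega$ for the boundary loop $\gamma$, this is equivalent to $[H]=\varepsilon[F^*\lambda]$ in $H^1(L;\mathbb{R})$. *)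

(* Defs.v *)
From HB Require Import structures.
From mathcomp Require Import all_boot all_order all_algebra.
From mathcomp Require Import all_classical all_reals all_analysis.
From mathcomp Require Import complex.

Set Implicit Arguments.
Unset Strict Implicit.
Unset Printing Implicit Defensive.

Import Order.TTheory GRing.Theory Num.Theory.
Import numFieldNormedType.Exports.

Local Open Scope classical_set_scope.
Local Open Scope ring_scope.
Local Open Scope complex_scope.

Section SmoothFunctions.
Context {R : realType} {V : normedModType R}.

(* C^k on the open set U.  Used only for V = R, R * R, 'rV_n and 'rV_n * R: in
   finite dimension, quantifying over all directions v is the usual condition
   on partial derivatives. *)
Fixpoint Ck (k : nat) (U : set V) (f : V -> R) : Prop :=
  (forall x, U x -> {for x, continuous f}) /\
  match k with
  | 0%N => True
  | k'.+1 => forall v : V,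
      (forall x, U x -> derivable f x v) /\ Ck k' U (fun x => 'D_v f x)
  end.

(* Smoothness on an arbitrary set A (a closed disk, a product with [0, T)):
   local existence of smooth extensions to open sets. *)
Definition smooth_on (A : set V) (f : V -> R) : Prop :=
  forall x, A x -> exists (U : set V) (g : V -> R),
    [/\ open U, U x, (forall k, Ck k U g) & forall y, U y -> A y -> g y = f y].

End SmoothFunctions.

Section ComplexSpace.
Context {R : realType} {n : nat}.
Local Notation Cn := 'rV[R[i]]_n.

Definition xcoord (z : Cn) (j : 'I_n) : R := complex.Re (z 0 j).
Definition ycoord (z : Cn) (j : 'I_n) : R := complex.Im (z 0 j).

Definition euclid (v w : Cn) : R :=
  \sum_(j < n) (xcoord v j * xcoord w j + ycoord v j * ycoord w j).

Definition cstruct (v : Cn) : Cn := (0 +i* 1) *: v.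

Definition omega (v w : Cn) : R := euclid (cstruct v) w.

(* The value at the point z, on the tangent vector w, of
   (1/2) \sum_j (x^j dy^j - y^j dx^j). *)
Definition lambda_form (z w : Cn) : R :=
  2^-1 * \sum_(j < n) (xcoord z j * ycoord w j - ycoord z j * xcoord w j).

Definition smooth_onC {V : normedModType R} (A : set V) (f : V -> Cn) : Prop :=
  forall j, smooth_on A (fun x => xcoord (f x) j) /\
            smooth_on A (fun x => ycoord (f x) j).

Definition derivC {V : normedModType R} (v : V) (f : V -> Cn) (x : V) : Cn :=
  \row_j ('D_v (fun y => xcoord (f y) j) x +i*
          'D_v (fun y => ycoord (f y) j) x).

End ComplexSpace.

(* A smooth n-manifold without boundary.  The type chart indexes the charts of
   an atlas; coord c is the chart map on the open set chart_dom c, and param c is its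
   inverse on coord c @` chart_dom c (both are arbitrary elsewhere). chart_at selects a
   chart around each point; the notions defined through it below do not depend on
   this selection. *)
Record smooth_manifold (R : realType) (n : nat) := SmoothManifold {
  manifold_point :> topologicalType;
  chart : Type;
  chart_dom : chart -> set manifold_point;
  coord : chart -> manifold_point -> 'rV[R]_n;
  param : chart -> 'rV[R]_n -> manifold_point;
  chart_at : manifold_point -> chart;
  manifold_hausdorff : hausdorff_space manifold_point;
  manifold_second_countable : @second_countable manifold_point;
  dom_chart_at : forall p, chart_dom (chart_at p) p;
  dom_open : forall c, open (chart_dom c);
  image_open : forall c, open (coord c @` chart_dom c);
  coordK : forall c p, chart_dom c p -> param c (coord c p) = p;
  coord_continuous : forall c p, chart_dom c p -> {for p, continuous (coord c)};
  param_continuous : forall c x, (coord c @` chart_dom c) x ->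
    {for x, continuous (param c)};
  transition_smooth : forall c d j,
    smooth_on (coord c @` (chart_dom c `&` chart_dom d))
      (fun x => (coord d (param c x)) 0 j)
}.

Section Manifolds.
Context {R : realType} {n : nat} (M : smooth_manifold R n).

Definition chart_image (c : chart M) : set 'rV[R]_n := coord c @` chart_dom c.

Definition partial_deriv (i : 'I_n) (f : 'rV[R]_n -> R) (x : 'rV[R]_n) : R :=
  'D_(delta_mx 0 i : 'rV[R]_n) f x.

Definition transition_jacobian (c d : chart M) (x : 'rV[R]_n) : 'M[R]_n :=
  \matrix_(i, j) partial_deriv i (fun y => (coord d (param c y)) 0 j) x.

(* The given atlas is an oriented atlas. *)
Definition oriented : Prop :=
  forall (c d : chart M) x, (coord c @` (chart_dom c `&` chart_dom d)) x ->
    0 < \det (transition_jacobian c d x).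

Definition smooth_function (f : M -> R) : Prop :=
  forall c : chart M, smooth_on (chart_image c) (fun x => f (param c x)).

(* A 1-form, as the family of its components in the charts: the i-th entry of
   alpha c x is the coefficient of dx^i at the point param c x. *)
Definition form1 := chart M -> 'rV[R]_n -> 'rV[R]_n.

Definition is_form1 (alpha : form1) : Prop :=
  (forall c i, smooth_on (chart_image c) (fun x => (alpha c x) 0 i)) /\
  (forall c d x, (coord c @` (chart_dom c `&` chart_dom d)) x ->
     alpha c x =
     alpha d (coord d (param c x)) *m (transition_jacobian c d x)^T).

Definition closed_form (alpha : form1) : Prop :=
  is_form1 alpha /\
  forall c x, chart_image c x -> forall i j,
    partial_deriv i (fun y => (alpha c y) 0 j) x =
    partial_deriv j (fun y => (alpha c y) 0 i) x.

Definition exact_form (alpha : form1) : Prop :=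
  exists f : M -> R, smooth_function f /\
    forall c x, chart_image c x -> forall i,
      (alpha c x) 0 i = partial_deriv i (fun y => f (param c y)) x.

Definition scale_form (a : R) (alpha : form1) : form1 :=
  fun c x => a *: alpha c x.

Definition sub_form (alpha beta : form1) : form1 :=
  fun c x => alpha c x - beta c x.

(* [alpha] = [beta] in the de Rham group H^1(M; R). *)
Definition same_class (alpha beta : form1) : Prop :=
  [/\ closed_form alpha, closed_form beta & exact_form (sub_form alpha beta)].

(* Loops are parametrized by R / 2 pi Z. *)
Definition smooth_loop (gamma : R -> M) : Prop :=
  [/\ continuous gamma,
      (forall s, gamma (s + 2 * pi) = gamma s) &
      forall c j, smooth_on (gamma @^-1` chart_dom c)
                    (fun s => (coord c (gamma s)) 0 j)].

End Manifolds.

Section Immersions.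
Context {R : realType} {n : nat} {M : smooth_manifold R n}.
Local Notation Cn := 'rV[R[i]]_n.
Implicit Type F : M -> Cn.

Definition local_rep F (c : chart M) : 'rV[R]_n -> Cn := fun x => F (param c x).

Definition tangent F (c : chart M) (x : 'rV[R]_n) (i : 'I_n) : Cn :=
  derivC (delta_mx 0 i : 'rV[R]_n) (local_rep F c) x.

Definition hessian F (c : chart M) (x : 'rV[R]_n) (i j : 'I_n) : Cn :=
  derivC (delta_mx 0 i : 'rV[R]_n) (fun y => tangent F c y j) x.

Definition immersion F : Prop :=
  (forall c : chart M, smooth_onC (chart_image c) (local_rep F c)) /\
  forall (c : chart M) x, chart_image c x -> forall a : 'rV[R]_n,
    \sum_(i < n) (a 0 i)%:C *: tangent F c x i = 0 -> a = 0.

Definition lagrangian F : Prop :=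
  immersion F /\
  forall (c : chart M) x, chart_image c x -> forall i j,
    omega (tangent F c x i) (tangent F c x j) = 0.

Definition pullback_lambda F : form1 M :=
  fun c x => \row_i lambda_form (local_rep F c x) (tangent F c x i).

Definition induced_metric F (c : chart M) (x : 'rV[R]_n) : 'M[R]_n :=
  \matrix_(i, j) euclid (tangent F c x i) (tangent F c x j).

Definition normal_part F (c : chart M) (x : 'rV[R]_n) (v : Cn) : Cn :=
  v - \sum_(k < n) \sum_(l < n)
        ((invmx (induced_metric F c x)) k l * euclid v (tangent F c x k))%:C *:
        tangent F c x l.

Definition second_fundamental_form F (c : chart M) (x : 'rV[R]_n)
    (i j : 'I_n) : Cn :=
  normal_part F c x (hessian F c x i j).

Definition mean_curvature F (p : M) : Cn :=
  let c := chart_at p in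
  let x := coord c p in
  \sum_(i < n) \sum_(j < n)
    ((invmx (induced_metric F c x)) i j)%:C *: second_fundamental_form F c x i j.

Definition mean_curvature_form F : form1 M :=
  fun c x => \row_i omega (tangent F c x i) (mean_curvature F (param c x)).

(* det^2 of the Lagrangian plane dF(T_p M): if the rows of the matrix A form a
   real basis of the plane, (det A / |det A|)^2 does not depend on that basis. *)
Definition phase F (p : M) : R[i] :=
  let c := chart_at p in
  let d := \det (\matrix_(i, j) (tangent F c (coord c p) i) 0 j) in
  (d / `|d|) ^+ 2.

(* The Maslov index of a disk u with u (e^{is}) = F (gamma s): in the trivial
   bundle u^* T C^n it is the winding number of s |-> phase F (gamma s), computed
   from a continuous determination theta of its argument. *)
Definition maslov_index F (gamma : R -> M) : int :=
  xget 0 [set k : int | exists theta : R -> R,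
    [/\ continuous theta,
        (forall s, phase F (gamma s) = cos (theta s) +i* sin (theta s)) &
        theta (2 * pi) - theta 0 = k%:~R * (2 * pi)]].

Definition closed_disk : set (R * R) := [set z | z.1 ^+ 2 + z.2 ^+ 2 <= 1].
Definition open_disk : set (R * R) := [set z | z.1 ^+ 2 + z.2 ^+ 2 < 1].

Definition smooth_disk_with_boundary F (u : R * R -> Cn) (gamma : R -> M) :=
  [/\ smooth_onC closed_disk u, smooth_loop gamma &
      forall s, u (cos s, sin s) = F (gamma s)].

(* The boundary circle is a null set, where u need not have two-sided partial
   derivatives. *)
Definition symplectic_area (u : R * R -> Cn) : R :=
  Rintegral (lebesgue_measure \x lebesgue_measure)%E open_disk
    (fun z => omega (derivC ((1, 0) : R * R) u z)
                    (derivC ((0, 1) : R * R) u z)).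

Definition monotone_lagrangian F (eps : R) : Prop :=
  [/\ lagrangian F, 0 < eps &
      forall u gamma, smooth_disk_with_boundary F u gamma ->
        (maslov_index F gamma)%:~R = eps / pi * symplectic_area u].

End Immersions.

Section Flow.
Context {R : realType} {n : nat} {M : smooth_manifold R n}.
Local Notation Cn := 'rV[R[i]]_n.

Definition time_interval (T : \bar R) : set R :=
  [set t | 0 <= t /\ (t%:E < T)%E].

(* The derivative of g at t relative to [0, T); it is one-sided at t = 0. *)
Definition is_time_derivative (T : \bar R) (g : R -> R) (t l : R) : Prop :=
  (fun s => (s - t)^-1 * (g s - g t)) @ within (time_interval T) t^' --> l.

Definition lagrangian_mcf (T : \bar R) (F : M -> R -> Cn) : Prop :=
  [/\ (0 < T)%E,
      (forall c : chart M,
         smooth_onC (chart_image c `*` time_interval T)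
           (fun xt : 'rV[R]_n * R => F (param c xt.1) xt.2)),
      (forall t, time_interval T t -> immersion (F ^~ t)),
      lagrangian (F ^~ 0) &
      forall p t, time_interval T t -> forall j,
        is_time_derivative T (fun s => xcoord (F p s) j) t
          (xcoord (mean_curvature (F ^~ t) p) j) /\
        is_time_derivative T (fun s => ycoord (F p s) j) t
          (ycoord (mean_curvature (F ^~ t) p) j)].

(* [0, T) is the maximal interval of existence for the initial map F (., 0). *)
Definition maximal_lagrangian_mcf (T : \bar R) (F : M -> R -> Cn) : Prop :=
  lagrangian_mcf T F /\
  forall (T' : \bar R) (F' : M -> R -> Cn),
    lagrangian_mcf T' F' -> (forall p, F' p 0 = F p 0) -> (T' <= T)%E.

End Flow.

(* Main.v *)
(** Everything is read off periods over smooth loops: a 1-form whose integral over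
    every smooth loop vanishes is exact, so it suffices to compare, for each loop
    gamma, P(t) = int_gamma F_t^* lambda and W(t) = int_gamma H_t.  By the symmetry of
    the second derivatives of F(gamma(s), t), the time derivative of
    lambda(F, d_s F) is d_s lambda(F, d_t F) - omega(d_s F, d_t F); the first term
    integrates to 0 over the loop and the second is H_t(gamma'), hence P' = - W.  On a
    Lagrangian, H is the differential of arg det_C dF, so W(t) is pi times the Maslov
    index; being continuous in t, it is constant.  Finally the cone over the loop is a
    disk, and Stokes' formula turns monotonicity at time 0 into W(0) = eps0 P(0).
    Therefore P(t) = (1/eps0 - t) W(t).

    The Lagrangian condition persists by a maximum principle on pairs of tangent
    vectors: for every small delta, omega(a, b) < delta e^(Ct) (|a|^2 + |b|^2) holds at
    time 0, and it cannot fail for a first time when C is large compared with the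
    second fundamental form, as one sees by moving a and b suitably along the lines of
    an orthonormal frame. *)

From HB Require Import structures.
From mathcomp Require Import all_boot all_order all_algebra.
From mathcomp Require Import all_classical all_reals all_analysis.
From mathcomp Require Import complex.
From mathcomp Require Import ring lra zify perm.
(* Last, so that [derivC] is the one of [Defs] and not MathComp's lemma. *)
Require Import Defs.

Set Implicit Arguments.
Unset Strict Implicit.
Unset Printing Implicit Defensive.

Import Order.TTheory GRing.Theory Num.Theory.
Import numFieldNormedType.Exports.

Local Open Scope classical_set_scope.
Local Open Scope ring_scope.
Local Open Scope complex_scope.

(** * Smooth functions in finite dimension *)

Section SmoothCalculus.
Context {R : realType}.
Implicit Types V W : normedModType R.

(** The flow is assumed Lagrangian at time 0 only, while the closedness of H and its description by
    an angle rest on the Lagrangian condition; so its preservation is settled before any class at a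
    later time can be compared. The quantity to control is a form on tangent vectors. Instead of a
    tensor maximum principle with a connection, pairs of tangent vectors are moved along the n lines
    of a frame orthonormal at one point, with normal velocities, and with accelerations whose sum is
    the derivative of the mean curvature vector, up to multiples of the velocities that first-order
    contact annihilates. What remains is quadratic in the velocities. It is controlled because on
    the normal space of an almost Lagrangian plane omega is about as small as on the plane; this is
    where delta e^(Ct) <= 1/4 enters. Each line costs 6 K times the quantity, K bounding the second
    fundamental form, hence C > 6 n K.

    Integrals along loops are increments of primitives. The area of a disk is a genuine double
    integral, reached through smaller concentric disks, because u has no two-sided derivatives on
    the boundary circle. *)

Definition Cinf V (U : set V) (f : V -> R) := forall k, Ck k U f.

Lemma nbhs_normP V (x : V) (P : set V) :
  nbhs x P <-> exists2 r : R, 0 < r & forall y : V, `|y - x| < r -> P y.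
Proof.
split.
  move=> /nbhs_ballP [r /= r0 h]; exists r => // y yx; apply: h.
  by rewrite -ball_normE /= distrC.
move=> [r r0 h]; apply/nbhs_ballP; exists r => //= y.
by rewrite -ball_normE /= distrC => /h.
Qed.

Lemma cont_near V W (f : V -> W) x (eps : R) : {for x, continuous f} -> 0 < eps ->
  \forall y \near x, `|f y - f x| < eps.
Proof.
move=> /cvgrPdist_lt h /h; apply: filterS => y; by rewrite distrC.
Qed.

Lemma cont_sum V W (I : Type) (r : seq I) (f : I -> V -> W) x :
  (forall i, {for x, continuous (f i)}) ->
  {for x, continuous (fun y => \sum_(i <- r) f i y)}.
Proof.
move=> cf; rewrite /prop_for /continuous_at; elim: r => [|i r IH].
  by under eq_fun do rewrite big_nil; rewrite big_nil; exact: cvg_cst.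
by under eq_fun do rewrite big_cons; rewrite big_cons; apply: cvgD; [exact: cf|exact: IH].
Qed.

Lemma Ck_cont k V (U : set V) (f : V -> R) x : Ck k U f -> U x ->
  {for x, continuous f}.
Proof. by case: k => [|k] [h _]; apply: h. Qed.

Lemma Ck_derivable k V (U : set V) (f : V -> R) x v : Ck k.+1 U f -> U x ->
  derivable f x v.
Proof. by move=> [_ h] Ux; have [+ _] := h v; apply. Qed.
Arguments Ck_derivable {k V U f x} v _ _.

Lemma Ck_derive k V (U : set V) (f : V -> R) v : Ck k.+1 U f ->
  Ck k U (fun x => 'D_v f x).
Proof. by move=> [_ h]; have [] := h v. Qed.

Lemma Ck_sub k V (U U' : set V) (f : V -> R) : U' `<=` U -> Ck k U f -> Ck k U' f.
Proof.
move=> UU; elim: k f => [|k IH] f [h1 h2]; split=> //; first by move=> x /UU /h1.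
- by move=> x /UU /h1.
- move=> v; have [h3 h4] := h2 v; split; first by move=> x /UU /h3.
  exact: IH.
Qed.

Lemma CkS k V (U : set V) (f : V -> R) : Ck k.+1 U f -> Ck k U f.
Proof.
elim: k f => [|k IH] f [h1 h2]; split=> // v; have [h3 h4] := h2 v; split=> //.
exact: IH.
Qed.

Lemma near_open_eq V (U : set V) (f g : V -> R) x : open U -> U x ->
  (forall y, U y -> f y = g y) -> \forall y \near x, f y = g y.
Proof.
move=> oU Ux fg; have := open_nbhs_nbhs (conj oU Ux).
by apply: filterS => y /fg.
Qed.

Lemma open_eq_cont V (U : set V) (f g : V -> R) x : open U -> U x ->
  (forall y, U y -> f y = g y) -> {for x, continuous f} -> {for x, continuous g}.
Proof.
move=> oU Ux fg; rewrite /prop_for /continuous_at => h; rewrite -(fg x Ux).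
by apply: cvg_trans h; apply: near_eq_cvg; apply: near_open_eq Ux _ => // y /fg.
Qed.

Lemma Ck_ext k V (U : set V) (f g : V -> R) : open U ->
  (forall x, U x -> f x = g x) -> Ck k U f -> Ck k U g.
Proof.
move=> oU; elim: k f g => [|k IH] f g fg [h1 h2]; split=> //.
- by move=> x Ux; exact: (open_eq_cont oU Ux fg (h1 x Ux)).
- by move=> x Ux; exact: (open_eq_cont oU Ux fg (h1 x Ux)).
- move=> v; have [h3 h4] := h2 v; split.
    move=> x Ux; have nfg := near_open_eq oU Ux fg.
    exact: near_eq_derivable nfg (h3 x Ux).
  apply: IH h4 => x Ux; apply: near_eq_derive.
  exact: near_open_eq oU Ux fg.
Qed.

Lemma Ck_local k V (U : set V) (f : V -> R) :
  (forall x, U x -> exists W : set V, [/\ open W, W x & Ck k W f]) -> Ck k U f.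
Proof.
elim: k f => [|k IH] f h; split=> //.
- by move=> x /h [W [oW Wx]] /Ck_cont; apply.
- by move=> x /h [W [oW Wx]] /Ck_cont; apply.
- move=> v; split; first by move=> x /h [W [oW Wx]] /Ck_derivable; apply.
  apply: IH => x /h [W [oW Wx C]]; exists W; split=> //; exact: Ck_derive.
Qed.

Lemma Cinf_derivable V (U : set V) (f : V -> R) x v : Cinf U f -> U x ->
  derivable f x v.
Proof. by move=> /(_ 1%N) Cf Ux; exact: (Ck_derivable v Cf Ux). Qed.
Arguments Cinf_derivable {V U f x} v _ _.

Lemma Cinf_cont V (U : set V) (f : V -> R) x : Cinf U f -> U x ->
  {for x, continuous f}.
Proof. by move=> /(_ 0%N) /Ck_cont; apply. Qed.

Lemma Cinf_derive V (U : set V) (f : V -> R) v : Cinf U f ->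
  Cinf U (fun x => 'D_v f x).
Proof. by move=> h k; exact: Ck_derive (h k.+1). Qed.

Lemma Cinf_sub V (U U' : set V) (f : V -> R) : U' `<=` U -> Cinf U f -> Cinf U' f.
Proof. by move=> UU h k; exact: Ck_sub UU (h k). Qed.

Lemma Cinf_ext V (U : set V) (f g : V -> R) : open U ->
  (forall x, U x -> f x = g x) -> Cinf U f -> Cinf U g.
Proof. by move=> oU fg h k; exact: Ck_ext oU fg (h k). Qed.

Lemma Cinf_local V (U : set V) (f : V -> R) :
  (forall x, U x -> exists W : set V, [/\ open W, W x & Cinf W f]) -> Cinf U f.
Proof.
move=> h k; apply: Ck_local => x /h [W [oW Wx C]]; exists W; split=> //; exact: C.
Qed.

Lemma smooth_on_open V (A : set V) (f : V -> R) : open A ->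
  smooth_on A f -> Cinf A f.
Proof.
move=> oA h; apply: Cinf_local => x Ax.
have [U [g [oU Ux Cg gf]]] := h x Ax; exists (U `&` A); split=> //.
- exact: openI.
- apply: (Cinf_ext (f := g)) => //; first exact: openI.
    by move=> y [Uy Ay]; apply: gf.
  by apply: Cinf_sub Cg => y [].
Qed.

Lemma Cinf_smooth_on V (A : set V) (f : V -> R) : open A ->
  Cinf A f -> smooth_on A f.
Proof. by move=> oA C x Ax; exists A, f. Qed.

Lemma Ck_cst k V (U : set V) (c : R) : Ck k U (fun=> c).
Proof.
elim: k c => [|k IH] c; split=> //; try by move=> x _; exact: cvg_cst.
move=> v; split; first by move=> x _; exact: derivable_cst.
by rewrite [X in Ck _ _ X](_ : _ = fun=> 0) //; apply/funext => x; exact: derive_cst.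
Qed.

Lemma Cinf_cst V (U : set V) (c : R) : Cinf U (fun=> c).
Proof. by move=> k; exact: Ck_cst. Qed.

Lemma CkD k V (U : set V) (f g : V -> R) : open U -> Ck k U f -> Ck k U g ->
  Ck k U (fun x => f x + g x).
Proof.
move=> oU; elim: k f g => [|k IH] f g Cf Cg; split=> //.
- by move=> x Ux; apply: cvgD; [exact: (Ck_cont Cf)|exact: (Ck_cont Cg)].
- by move=> x Ux; apply: cvgD; [exact: (Ck_cont Cf)|exact: (Ck_cont Cg)].
- move=> v; split.
    by move=> x Ux; apply: derivableD; [exact: Ck_derivable _ Cf _|exact: Ck_derivable _ Cg _].
  apply: (Ck_ext (f := fun x => 'D_v f x + 'D_v g x)) => //; last first.
    by apply: IH; exact: Ck_derive.
  move=> x Ux; rewrite -deriveD //; [exact: Ck_derivable _ Cf _|exact: Ck_derivable _ Cg _].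
Qed.

Lemma CkM k V (U : set V) (f g : V -> R) : open U -> Ck k U f -> Ck k U g ->
  Ck k U (fun x => f x * g x).
Proof.
move=> oU; elim: k f g => [|k IH] f g Cf Cg; split=> //.
- by move=> x Ux; apply: cvgM; [exact: (Ck_cont Cf)|exact: (Ck_cont Cg)].
- by move=> x Ux; apply: cvgM; [exact: (Ck_cont Cf)|exact: (Ck_cont Cg)].
- move=> v; split.
    by move=> x Ux; apply: derivableM; [exact: Ck_derivable _ Cf _|exact: Ck_derivable _ Cg _].
  apply: (Ck_ext (f := fun x => f x * 'D_v g x + g x * 'D_v f x)) => //; last first.
    by apply: CkD => //; apply: IH; [exact: CkS|exact: Ck_derive|exact: CkS|exact: Ck_derive].
  move=> x Ux; rewrite (_ : (fun y => _) = f * g) //.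
  rewrite deriveM //; [exact: Ck_derivable _ Cf _|exact: Ck_derivable _ Cg _].
Qed.

Lemma CinfD V (U : set V) (f g : V -> R) : open U -> Cinf U f -> Cinf U g ->
  Cinf U (fun x => f x + g x).
Proof. by move=> oU Cf Cg k; exact: CkD. Qed.

Lemma CinfM V (U : set V) (f g : V -> R) : open U -> Cinf U f -> Cinf U g ->
  Cinf U (fun x => f x * g x).
Proof. by move=> oU Cf Cg k; exact: CkM. Qed.

Lemma CinfN V (U : set V) (f : V -> R) : open U -> Cinf U f ->
  Cinf U (fun x => - f x).
Proof.
move=> oU Cf; apply: (Cinf_ext (f := fun x => -1 * f x)) => //.
  by move=> x _; rewrite mulN1r.
by apply: CinfM => //; exact: Cinf_cst.
Qed.

Lemma CinfB V (U : set V) (f g : V -> R) : open U -> Cinf U f -> Cinf U g ->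
  Cinf U (fun x => f x - g x).
Proof. by move=> oU Cf Cg; apply: CinfD => //; exact: CinfN. Qed.

Lemma Cinf_sum V (U : set V) (I : Type) (r : seq I) (P : pred I) (f : I -> V -> R) :
  open U -> (forall i, P i -> Cinf U (f i)) -> Cinf U (fun x => \sum_(i <- r | P i) f i x).
Proof.
move=> oU Cf; elim: r => [|i r IH].
  by under eq_fun do rewrite big_nil; exact: Cinf_cst.
have [Pi|/negbTE Pi] := boolP (P i); under eq_fun do rewrite big_cons Pi //.
  by apply: CinfD => //; exact: Cf.
exact: IH.
Qed.

Lemma Cinf_prod V (U : set V) (I : Type) (r : seq I) (P : pred I) (f : I -> V -> R) :
  open U -> (forall i, P i -> Cinf U (f i)) -> Cinf U (fun x => \prod_(i <- r | P i) f i x).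
Proof.
move=> oU Cf; elim: r => [|i r IH].
  by under eq_fun do rewrite big_nil; exact: Cinf_cst.
have [Pi|/negbTE Pi] := boolP (P i); under eq_fun do rewrite big_cons Pi //.
  by apply: CinfM => //; exact: Cf.
exact: IH.
Qed.

(** The derivative of 1/f is -f' times the square of 1/f, so the induction on [k] feeds on itself
    for 1/f but uses f' again at each order; hence [f] is smooth at all orders while the conclusion
    is at order [k]. *)
Lemma CkV k V (U : set V) (f : V -> R) : open U -> (forall x, U x -> f x != 0) ->
  Cinf U f -> Ck k U (fun x => (f x)^-1).
Proof.
move=> oU f0 Cf; elim: k => [|k IH]; split=> //.
- by move=> x Ux; apply: (cvgV (f0 x Ux)); exact: (Cinf_cont Cf).
- by move=> x Ux; apply: (cvgV (f0 x Ux)); exact: (Cinf_cont Cf).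
- move=> v; split.
    by move=> x Ux; apply: derivableV; [exact: f0|exact: (Cinf_derivable v Cf Ux)].
  apply: (Ck_ext (f := fun x => (-1 * 'D_v f x) * ((f x)^-1 * (f x)^-1))) => //; last first.
    apply: CkM => //; last exact: CkM.
    by apply: CkM => //; [exact: Ck_cst|exact: (Cinf_derive v Cf)].
  move=> x Ux; rewrite deriveV; [|exact: f0|exact: (Cinf_derivable v Cf Ux)].
  rewrite /GRing.scale /= expr2 invfM; ring.
Qed.

Lemma CinfV V (U : set V) (f : V -> R) : open U -> (forall x, U x -> f x != 0) ->
  Cinf U f -> Cinf U (fun x => (f x)^-1).
Proof. by move=> oU f0 Cf k; exact: CkV. Qed.

Lemma Cinf_id (U : set R) : Cinf U (fun x : R => x).
Proof.
case=> [|k]; split=> //; try by move=> x _; exact: cvg_id.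
move=> v; split; first by move=> x _; exact: derivable_id.
rewrite [X in Ck _ _ X](_ : _ = fun=> v); first exact: Ck_cst.
by apply/funext => x; exact: derive_id.
Qed.

(** The two difference quotients are the same function of the increment. This opens one-variable
    calculus, the mean value theorem above all, along lines of any normed module. *)
Lemma derivable_line V (f : V -> R) x v (h : R) : derivable f (x + h *: v) v ->
  is_derive h 1 (fun s => f (x + s *: v)) ('D_v f (x + h *: v)).
Proof.
move=> df; have E : (fun s : R => s^-1 *: (((fun s => f (x + s *: v)) \o shift h) (s *: 1) - f (x + h *: v))) =
  (fun s : R => s^-1 *: ((f \o shift (x + h *: v)) (s *: v) - f (x + h *: v))).
  apply/funext => s /=; congr (_ *: (f _ - _)).
  by rewrite [s%:A]mulr1 scalerDl addrCA.
by split; rewrite /derivable /derive E.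
Qed.

Lemma MVT_line V (f : V -> R) x v :
  (forall t : R, 0 <= t <= 1 -> derivable f (x + t *: v) v) ->
  exists2 t : R, 0 <= t <= 1 & f (x + v) - f x = 'D_v f (x + t *: v).
Proof.
move=> df.
have D (t : R) : 0 <= t <= 1 -> is_derive t 1 (fun s : R => f (x + s *: v)) ('D_v f (x + t *: v)).
  by move=> t01; apply: derivable_line; exact: df.
have [||t] := @MVT R (fun s => f (x + s *: v)) (fun s => 'D_v f (x + s *: v)) 0 1 ltr01.
- by move=> t; rewrite in_itv /= => /andP[t0 t1]; apply: D; rewrite !ltW.
- apply: continuous_in_subspaceT => t; rewrite inE /= in_itv /= => t01.
  apply: differentiable_continuous; apply/derivable1_diffP.
  by have [] := D t t01.
rewrite in_itv /= => /andP[t0 t1]; rewrite scale1r scale0r addr0 subr0 mulr1 => E.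
by exists t => //; rewrite !ltW.
Qed.

Lemma is_derive_scale V (f : V -> R) (a : R) x v : derivable f x v ->
  is_derive x (a *: v) f (a * 'D_v f x).
Proof.
move=> df; pose g := fun s : R => f (x + s *: v).
have dg : is_derive (0 : R) 1 g ('D_v f x).
  have := @derivable_line V f x v 0; rewrite scale0r addr0; exact.
have E : (fun s : R => s^-1 *: ((f \o shift x) (s *: (a *: v)) - f x)) =
         (fun s : R => s^-1 *: ((g \o shift 0) (s *: a) - g 0)).
  apply/funext => s /=; rewrite /g scale0r !addr0 scalerA; congr (_ *: (f _ - _)).
  by rewrite addrC.
have dfg : differentiable g 0 by apply/derivable1_diffP; case: dg.
split; first by rewrite /derivable E; exact: diff_derivable.
rewrite /derive E -/(derive g 0 a) deriveE // -[a in LHS]mulr1 -/(a *: (1 : R)) linearZ.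
by rewrite -deriveE //; case: dg => _ ->.
Qed.

(** A finite basis [e] with its dual coordinates [l], bounded for the norm. [Ck] speaks of
    directional derivatives in an abstract normed module; such a system turns them into
    differentiability and a chain rule, uniformly for R, row vectors and their products. *)
Record fincoord V (I : finType) (e : I -> V) (l : I -> V -> R) := FinCoord {
  fc_dec : forall v, v = \sum_i l i v *: e i;
  fc_lin : forall i a u v, l i (a *: u + v) = a * l i u + l i v;
  fc_bd : exists2 c, 0 <= c & forall i v, `|l i v| <= c * `|v| }.

Lemma open_ballP V (U : set V) x : open U -> U x ->
  exists2 r : R, 0 < r & forall y, `|y - x| < r -> U y.
Proof. by move=> oU Ux; apply/nbhs_normP; exact: open_nbhs_nbhs. Qed.

Section FinCoordTheory.
Variables (V : normedModType R) (I : finType) (e : I -> V) (l : I -> V -> R).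
Hypothesis fc : fincoord e l.

(** The displacement is performed one basis direction at a time. By the mean value theorem each new
    segment costs a partial derivative at an intermediate point, close to the one at [x] by
    continuity. Allowing an arbitrary list [s] of directions makes this an induction. *)
Lemma C1_approx (U : set V) (f : V -> R) x (s : seq I) : open U -> U x ->
  Ck 1 U f -> forall eps : R, 0 < eps -> \forall v \near (0 : V),
  `|f (x + \sum_(i <- s) l i v *: e i) - f x - \sum_(i <- s) l i v * 'D_(e i) f x|
    <= eps * `|v|.
Proof.
move=> oU Ux Cf; have [c c0 lc] := fc_bd fc.
elim: s => [|i s IH] eps e0.
  by near=> v; rewrite !big_nil addr0 !subrr normr0 mulr_ge0 // ltW.
(* Half of [eps] goes to the new direction, whose coordinate is at most c |v|; the + 1 covers c = 0.
   The other half goes to the directions already treated. *)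
pose eta := eps / (2 * (c + 1)).
have eta0 : 0 < eta by rewrite divr_gt0 // mulr_gt0 // ltr_wpDl.
have : \forall y \near x, U y /\ `|'D_(e i) f y - 'D_(e i) f x| < eta.
  have cD := Ck_cont (Ck_derive (e i) Cf) Ux.
  near=> y; split; first by near: y; exact: open_nbhs_nbhs.
  near: y; exact: cont_near cD eta0.
move=> /nbhs_normP [r r0 hr].
pose C := \sum_(j <- i :: s) c * `|e j| + 1.
have C0 : 0 < C by rewrite ltr_wpDl // sumr_ge0 // => j _; rewrite mulr_ge0.
have e20 : 0 < eps / 2 by rewrite divr_gt0.
have hs (v : V) (t : R) : 0 <= t <= 1 ->
  `|\sum_(j <- s) l j v *: e j + t *: (l i v *: e i)| <= C * `|v|.
  move=> /andP[t0 t1]; rewrite /C mulrDl mul1r ler_wpDr // big_cons addrC.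
  rewrite mulrDl (le_trans (ler_normD _ _)) // lerD //.
    rewrite !normrZ (ger0_norm t0) -[leRHS]mul1r ler_pM // ?mulr_ge0 //.
    by rewrite mulrAC ler_wpM2r.
  rewrite mulr_suml (le_trans (ler_norm_sum _ _ _)) // ler_sum // => j _.
  by rewrite normrZ mulrAC ler_wpM2r.
have nv : \forall v \near (0 : V), C * `|v| < r.
  apply/nbhs_normP; exists (r / C); first by rewrite divr_gt0.
  by move=> y; rewrite subr0 ltr_pdivlMr // mulrC.
near=> v.
have Cv : C * `|v| < r by near: v.
have IHv : `|f (x + \sum_(j <- s) l j v *: e j) - f x - \sum_(j <- s) l j v * 'D_(e j) f x|
    <= eps / 2 * `|v| by near: v; exact: (IH _ e20).
have hy (t : R) : 0 <= t <= 1 ->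
  `|(x + \sum_(j <- s) l j v *: e j) + t *: (l i v *: e i) - x| < r.
  move=> t01; rewrite addrAC (addrAC x) subrr add0r.
  exact: le_lt_trans (hs v t t01) Cv.
have [|t t01] := @MVT_line V f (x + \sum_(j <- s) l j v *: e j) (l i v *: e i).
  move=> t t01; apply: (ex_derive (is_derive := is_derive_scale _ _)).
  by apply: Ck_derivable _ Cf _; apply: (hr _ (hy t t01)).1.
set y := _ + t *: _ => E.
have [Uy Dy] := hr _ (hy t t01).
have D : 'D_(l i v *: e i) f y = l i v * 'D_(e i) f y.
  by have [] := is_derive_scale (l i v) (Ck_derivable (e i) Cf Uy).
rewrite !big_cons (addrC (l i v *: e i)) addrA.
rewrite -[X in `|X - _ - _|](subrK (f (x + \sum_(j <- s) l j v *: e j))) E D.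
set A := f (x + _); set B := \sum_(j <- s) _.
have -> : l i v * 'D_(e i) f y + A - f x - (l i v * 'D_(e i) f x + B) =
  l i v * ('D_(e i) f y - 'D_(e i) f x) + (A - f x - B) by ring.
rewrite (le_trans (ler_normD _ _)) // [leRHS](_ : _ = (eps / 2) * `|v| + (eps / 2) * `|v|); last first.
  by rewrite -mulrDl; congr (_ * _); field.
rewrite lerD //.
rewrite normrM (@le_trans _ _ (c * `|v| * eta)) //.
  by rewrite ler_pM // ltW.
rewrite mulrAC ler_wpM2r // /eta.
rewrite mulrCA ler_pM2l // invfM mulrA ler_pdivrMr ?ltr_wpDl //.
rewrite mulrC -subr_ge0 (_ : _ - _ = 2^-1) //; by field.
Unshelve. all: by end_near. Qed.

Lemma fc_cont i : continuous (l i).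
Proof.
have [c c0 lc] := fc_bd fc => x; apply/cvgrPdist_le => eps e0.
apply/nbhs_normP; exists (eps / (c + 1)); first by rewrite divr_gt0 // ltr_wpDl.
move=> y yx.
have -> : l i x - l i y = l i (x - y).
  by have := fc_lin fc i (-1) y x; rewrite mulN1r scaleN1r addrC => ->; rewrite addrC.
rewrite (le_trans (lc _ _)) // distrC.
rewrite (le_trans (ler_wpM2l c0 (ltW yx))) // mulrCA ger_pMr //.
by rewrite ler_pdivrMr ?ltr_wpDl // mul1r lerDl.
Qed.

Lemma C1_is_diff (U : set V) (f : V -> R) x : open U -> U x -> Ck 1 U f ->
  is_diff x f (fun v => \sum_i l i v * 'D_(e i) f x).
Proof.
move=> oU Ux Cf.
pose df (v : V) : R := \sum_i l i v * 'D_(e i) f x.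
have dflin : linear df.
  move=> a u v; rewrite /df scaler_sumr -big_split /=; apply: eq_bigr => i _.
  by rewrite (fc_lin fc) mulrDl /GRing.scale /= mulrA.
pose L : {linear V -> R} := HB.pack df (GRing.isLinear.Build _ _ _ _ df dflin).
have Lc : continuous L.
  move=> v; rewrite [_ L](_ : _ = df) // /df.
  by apply: cont_sum => i; apply: cvgM; [exact: fc_cont|exact: cvg_cst].
have Lo : f \o shift x = cst (f x) + L +o_ (0 : V) id.
  apply/eqaddoP => eps e0; have := C1_approx (index_enum I) oU Ux Cf e0.
  apply: filterS => v; rewrite -(fc_dec fc) /= => h.
  by rewrite [X in `|X|](_ : _ = f (x + v) - f x - df v) // !fctE /= (addrC v) opprD addrA.
have dE : 'd f x = L :> (V -> R) by exact: diff_unique.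
split=> //; apply/diff_locallyP; rewrite dE; split=> //; exact: Lc.
Qed.

Lemma C1_differentiable (U : set V) (f : V -> R) x : open U -> U x -> Ck 1 U f ->
  differentiable f x.
Proof. by move=> oU Ux Cf; case: (C1_is_diff oU Ux Cf). Qed.

Lemma C1_derive_sum (U : set V) (f : V -> R) x v : open U -> U x -> Ck 1 U f ->
  'D_v f x = \sum_i l i v * 'D_(e i) f x.
Proof.
by move=> oU Ux Cf; have [d dE] := C1_is_diff oU Ux Cf; rewrite deriveE // dE.
Qed.

(** The coordinates of [phi] are derivable along the single direction [w], so [phi] is restricted to
    the curve h |-> phi (x + h w), which is differentiable in one variable, before the differential
    of [f] is applied. *)
Lemma chain_rule W (U : set V) (f : V -> R) (phi : W -> V) x w :
  open U -> U (phi x) -> Ck 1 U f -> (forall i, derivable (fun y => l i (phi y)) x w) ->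
  is_derive x w (fun y => f (phi y))
    (\sum_i 'D_(e i) f (phi x) * 'D_w (fun y => l i (phi y)) x).
Proof.
move=> oU Ux Cf dphi.
pose c (h : R) : V := phi (x + h *: w).
have dc i : is_derive (0 : R) 1 (fun h => l i (c h)) ('D_w (fun y => l i (phi y)) x).
  have := @derivable_line W (fun y => l i (phi y)) x w 0; rewrite scale0r addr0; exact.
have cE : c = fun h => \sum_i l i (c h) *: e i by apply/funext => h; exact: fc_dec.
have dc' : is_derive (0 : R) 1 c (\sum_i 'D_w (fun y => l i (phi y)) x *: e i).
  rewrite cE; elim: (index_enum I) => [|i s IH].
    by under eq_fun do rewrite big_nil; rewrite big_nil; exact: is_derive_cst.
  under eq_fun do rewrite big_cons; rewrite big_cons.
  apply: is_deriveD => //; have [/derivable1_diffP d1 d2] := dc i.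
  split; first by apply/derivable1_diffP; exact: differentiableZl.
  rewrite deriveE; last exact: differentiableZl.
  by rewrite diffZl // -deriveE // d2.
have c0 : c 0 = phi x by rewrite /c scale0r addr0.
have [dc1 dc2] := dc'; move: dc1 => /derivable1_diffP dc1.
have dfc := C1_differentiable oU Ux Cf.
have dcomp : differentiable (f \o c) 0 by apply: differentiable_comp; rewrite ?c0.
have E : (fun h : R => h^-1 *: (((fun y => f (phi y)) \o shift x) (h *: w) - f (phi x))) =
  (fun h : R => h^-1 *: (((f \o c) \o shift 0) (h *: 1) - (f \o c) 0)).
  apply/funext => h /=; rewrite c0 addr0 [h%:A]mulr1 /c (addrC x) //.
split; first by rewrite /derivable E; exact: diff_derivable.
rewrite /derive E -/(derive (f \o c) 0 1) deriveE // diff_comp ?c0 //=.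
rewrite -(deriveE _ dc1) dc2 -(deriveE _ dfc).
rewrite (deriveE _ dfc) linear_sum; apply: eq_bigr => i _.
by rewrite linearZ -(deriveE _ dfc) mulrC.
Qed.

Lemma Ck_comp k W (U : set V) (U' : set W) (f : V -> R) (phi : W -> V) :
  open U -> open U' -> (forall x, U' x -> U (phi x)) -> Cinf U f ->
  (forall i, Cinf U' (fun x => l i (phi x))) -> Ck k U' (fun x => f (phi x)).
Proof.
move=> oU oU' UU Cf Cphi.
have cphi x : U' x -> {for x, continuous phi}.
  move=> Ux; rewrite (_ : phi = fun y => \sum_i l i (phi y) *: e i); last first.
    by apply/funext => y; exact: fc_dec.
  apply: cont_sum => i; apply: cvgZ; [exact: (Cinf_cont (Cphi i))|exact: cvg_cst].
elim: k f Cf => [|k IH] f Cf; split=> //.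
- move=> x Ux; apply: (@continuous_comp _ _ _ phi f); first exact: cphi.
  by apply: (Cinf_cont Cf); exact: UU.
- move=> x Ux; apply: (@continuous_comp _ _ _ phi f); first exact: cphi.
  by apply: (Cinf_cont Cf); exact: UU.
- move=> w.
  have D x : U' x -> is_derive x w (fun y => f (phi y))
     (\sum_i 'D_(e i) f (phi x) * 'D_w (fun y => l i (phi y)) x).
    move=> Ux; apply: (chain_rule oU (UU _ Ux) (Cf 1%N)) => i.
    exact: (Cinf_derivable w (Cphi i) Ux).
  split; first by move=> x /D [].
  apply: (Ck_ext (f := fun x => \sum_i 'D_(e i) f (phi x) * 'D_w (fun y => l i (phi y)) x)) => //.
    by move=> x /D [_ ->].
  elim: (index_enum I) => [|i s IHs].
    by under eq_fun do rewrite big_nil; exact: Ck_cst.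
  under eq_fun do rewrite big_cons; apply: CkD => //; apply: CkM => //.
    exact: (IH _ (Cinf_derive (e i) Cf)).
  exact: (Cinf_derive w (Cphi i)).
Qed.

Lemma Cinf_comp W (U : set V) (U' : set W) (f : V -> R) (phi : W -> V) :
  open U -> open U' -> (forall x, U' x -> U (phi x)) -> Cinf U f ->
  (forall i, Cinf U' (fun x => l i (phi x))) -> Cinf U' (fun x => f (phi x)).
Proof. by move=> oU oU' UU Cf Cphi k; exact: (Ck_comp _ oU oU' UU Cf Cphi). Qed.

End FinCoordTheory.

(** Two mean value theorems: in direction [a] for z |-> f (z + b) - f z, then in direction [b] for
    the derivative of [f] along [a]. The intermediate point stays in the parallelogram, hence within
    |a| + |b| of [x]. *)
Lemma second_diff V (U : set V) (f : V -> R) x (a b : V) (r : R) :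
  Ck 2 U f -> (forall y, `|y - x| < r -> U y) -> `|a| + `|b| < r ->
  exists2 y, `|y - x| <= `|a| + `|b| &
   f (x + a + b) - f (x + a) - f (x + b) + f x = 'D_b (fun z => 'D_a f z) y.
Proof.
move=> Cf hU ab.
have lt (t s : R) : 0 <= t <= 1 -> 0 <= s <= 1 ->
  `|x + t *: a + s *: b - x| <= `|a| + `|b|.
  move=> /andP[t0 t1] /andP[s0 s1].
  rewrite addrAC (addrAC x) subrr add0r (le_trans (ler_normD _ _)) // !normrZ !ger0_norm //.
  by rewrite lerD // ler_piMl.
have Us (t s : R) : 0 <= t <= 1 -> 0 <= s <= 1 -> U (x + t *: a + s *: b).
  by move=> t01 s01; apply: hU; exact: le_lt_trans (lt _ _ t01 s01) ab.
have i0 : 0 <= (0 : R) <= 1 by rewrite lexx ler01.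
have i1 : 0 <= (1 : R) <= 1 by rewrite ler01 lexx.
pose g z := f (z + b) - f z.
have dshift z : derivable f (z + b) a ->
   is_derive z a (fun z => f (z + b)) ('D_a f (z + b)).
  move=> df; have E : (fun h : R => h^-1 *: (((fun z => f (z + b)) \o shift z) (h *: a) - f (z + b)))
    = (fun h : R => h^-1 *: ((f \o shift (z + b)) (h *: a) - f (z + b))).
    by apply/funext => h /=; rewrite addrA.
  by split; rewrite /derivable /derive E.
have Ud (t : R) : 0 <= t <= 1 -> derivable f (x + t *: a + b) a /\ derivable f (x + t *: a) a.
  move=> t01; split; first by apply: (Ck_derivable _ Cf); rewrite -[b]scale1r; exact: Us.
  by apply: (Ck_derivable _ Cf); have := Us t 0 t01 i0; rewrite scale0r addr0.
have dg (t : R) : 0 <= t <= 1 -> is_derive (x + t *: a) a g ('D_a f (x + t *: a + b) - 'D_a f (x + t *: a)).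
  move=> /Ud [d1 d2]; apply: is_deriveB; [exact: dshift|exact: derivableP].
have [|t t01 E] := @MVT_line V g x a; first by move=> t /dg [].
have [s s01|s s01 E'] := @MVT_line V (fun z => 'D_a f z) (x + t *: a) b.
  exact: (Ck_derivable b (Ck_derive a Cf) (Us _ _ t01 s01)).
exists (x + t *: a + s *: b); first exact: lt.
rewrite -E'; have [_ <-] := dg t t01; rewrite -E /g; ring.
Qed.

Lemma cont2_ball V (U : set V) (f g : V -> R) x (eps : R) : open U -> U x ->
  {for x, continuous f} -> {for x, continuous g} -> 0 < eps ->
  exists2 r : R, 0 < r & forall y : V, `|y - x| < r ->
    [/\ U y, `|f y - f x| < eps & `|g y - g x| < eps].
Proof.
move=> oU Ux cf cg e0; apply/nbhs_normP.
have nU : nbhs x U by exact: open_nbhs_nbhs.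
by move: nU (cont_near cf e0) (cont_near cg e0); apply: filterS3.
Qed.

Lemma near_common_value (a b c d eps : R) : b = a -> `|b - c| < eps / 2 ->
  `|a - d| < eps / 2 -> `|d - c| <= eps.
Proof.
move=> -> h1 h2; rewrite -(subrK a d) -addrA (le_trans (ler_normD _ _)) //.
by rewrite (splitr eps) lerD // ltW // distrC.
Qed.

Local Opaque derive.

(** The second difference with sides h v and h w is symmetric in them, so the two mixed derivatives
    take a common value, each at its own point near [x]; continuity brings both points back to
    [x]. *)
Lemma Clairaut V (U : set V) (f : V -> R) x (v w : V) : open U -> U x ->
  Ck 2 U f -> 'D_v (fun y => 'D_w f y) x = 'D_w (fun y => 'D_v f y) x.
Proof.
move=> oU Ux Cf; apply/eqP; rewrite -subr_eq0 -normr_le0; apply/ler_addgt0Pr => eps e0.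
rewrite add0r.
have e20 : 0 < eps / 2 by rewrite divr_gt0.
have [r r0 hr] := cont2_ball oU Ux (Ck_cont (Ck_derive v (Ck_derive w Cf)) Ux)
  (Ck_cont (Ck_derive w (Ck_derive v Cf)) Ux) e20.
have hU y : `|y - x| < r -> U y by move=> /hr [].
have N0 : 0 < `|v| + `|w| + 1 by rewrite ltr_wpDl // addr_ge0.
have [h h0 hE] : exists2 h : R, 0 < h & h = r / (2 * (`|v| + `|w| + 1)).
  by eexists; [|reflexivity]; rewrite divr_gt0 // mulr_gt0.
have ab : `|h *: v| + `|h *: w| < r.
  rewrite !normrZ (gtr0_norm h0) -mulrDr hE mulrAC ltr_pdivrMr ?mulr_gt0 //.
  rewrite ltr_pM2l //; have := addr_ge0 (normr_ge0 v) (normr_ge0 w); lra.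
have ba : `|h *: w| + `|h *: v| < r by rewrite addrC.
have [y yx E] := second_diff Cf hU ab.
have [z zx E'] := second_diff Cf hU ba.
have [Uy _ Dy] := hr y (le_lt_trans yx ab).
have [Uz Dz _] := hr z (le_lt_trans zx ba).
have DD (a b : V) u : U u -> 'D_(h *: b) (fun z => 'D_(h *: a) f z) u = h * h * 'D_b (fun z => 'D_a f z) u.
  move=> Uu; have E1 : 'D_(h *: b) (fun z => 'D_(h *: a) f z) u = 'D_(h *: b) (fun z => h * 'D_a f z) u.
    apply: near_eq_derive; apply: (near_open_eq oU Uu) => q Uq.
    by have [] := is_derive_scale h (Ck_derivable a (CkS Cf) Uq).
  have d1 := Ck_derivable b (Ck_derive a Cf) Uu.
  rewrite E1; have [|_ ->] := @is_derive_scale V (fun z => h * 'D_a f z) h u b.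
    exact: derivableZ.
  by rewrite -mulrA (deriveZ h d1).
rewrite (DD v w y Uy) in E; rewrite (DD w v z Uz) in E'.
have EE : 'D_w (fun z => 'D_v f z) y = 'D_v (fun z => 'D_w f z) z.
  apply: (@mulfI _ (h * h)); first by rewrite mulf_neq0 // gt_eqF.
  apply: (etrans (esym E)); apply: (etrans _ E').
  by rewrite (addrAC x (h *: w)); congr (_ + _); exact: addrAC.
exact: (near_common_value EE Dy Dz).
Qed.

Lemma fincoord_R : @fincoord R unit (fun=> 1) (fun _ x => x).
Proof.
split.
- by move=> v; rewrite (bigD1 tt) //= big1 ?addr0; [rewrite [_%:A]mulr1|case].
- by [].
- by exists 1 => // i v; rewrite mul1r.
Qed.

Lemma fincoord_rV n : @fincoord 'rV[R]_n 'I_n (fun i => delta_mx 0 i) (fun i v => v 0 i).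
Proof.
split.
- exact: row_sum_delta.
- by move=> i a u v; rewrite !mxE.
- exists 1 => // i v; rewrite mul1r [`|v|]mx_normrE.
  by apply: (le_bigmax _ (fun ij => `|v ij.1 ij.2|) (0, i)).
Qed.

Lemma fincoord_prod V W (I J : finType) (e : I -> V) (l : I -> V -> R)
   (e' : J -> W) (l' : J -> W -> R) : fincoord e l -> fincoord e' l' ->
  @fincoord (V * W)%type (I + J)%type
   (fun k => match k with inl i => (e i, 0) | inr j => (0, e' j) end)
   (fun k v => match k with inl i => l i v.1 | inr j => l' j v.2 end).
Proof.
move=> fc fc'; split.
- move=> [v w]; rewrite big_sumType /=.
  rewrite [X in (X, _)](fc_dec fc) [X in (_, X)](fc_dec fc').
  rewrite (_ : (\sum_i l i v *: e i, \sum_i l' i w *: e' i) = (\sum_i l i v *: e i, 0) + (0, \sum_i l' i w *: e' i)).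
    congr (_ + _).
      elim: (index_enum I) => [|i s IH]; first by rewrite !big_nil.
      rewrite !big_cons -IH; congr pair; rewrite /= ?scaler0 ?addr0 //.
    elim: (index_enum J) => [|i s IH]; first by rewrite !big_nil.
    rewrite !big_cons -IH; congr pair; rewrite /= ?scaler0 ?addr0 //.
  by congr pair; rewrite /= ?addr0 ?add0r.
- by move=> [i|j] a u v /=; [exact: fc_lin fc i _ _ _|exact: fc_lin fc' j _ _ _].
- have [c c0 hc] := fc_bd fc; have [c' c0' hc'] := fc_bd fc'.
  exists (c + c'); first exact: addr_ge0.
  move=> [i|j] [v w]; rewrite prod_normE /=.
    rewrite (le_trans (hc i v)) // ler_pM // ?lerDl // le_max lexx //.
  by rewrite (le_trans (hc' j w)) // ler_pM // ?lerDr // le_max lexx orbT.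
Qed.

End SmoothCalculus.

Arguments Ck_derivable {R k V U f x} v _ _.
Arguments Cinf_derivable {R V U f x} v _ _.

(** * Hermitian geometry of C^n *)

Section HermitianSpace.
Context {R : realType} {n : nat}.
Local Notation Cn := 'rV[R[i]]_n.
Implicit Types u v w : Cn.

Lemma vecC_ext u v : (forall j, xcoord u j = xcoord v j) ->
  (forall j, ycoord u j = ycoord v j) -> u = v.
Proof.
move=> hx hy; apply/rowP => j; have := hx j; have := hy j.
rewrite /xcoord /ycoord; case: (u 0 j) (v 0 j) => [a b] [c d] /= -> -> //.
Qed.

Lemma xcoordD u v j : xcoord (u + v) j = xcoord u j + xcoord v j.
Proof. by rewrite /xcoord mxE; case: (u 0 j) (v 0 j) => [a b] [c d]. Qed.
Lemma ycoordD u v j : ycoord (u + v) j = ycoord u j + ycoord v j.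
Proof. by rewrite /ycoord mxE; case: (u 0 j) (v 0 j) => [a b] [c d]. Qed.
Lemma xcoordN u j : xcoord (- u) j = - xcoord u j.
Proof. by rewrite /xcoord mxE; case: (u 0 j). Qed.
Lemma ycoordN u j : ycoord (- u) j = - ycoord u j.
Proof. by rewrite /ycoord mxE; case: (u 0 j). Qed.
Lemma xcoord0 j : xcoord (0 : Cn) j = 0.
Proof. by rewrite /xcoord mxE. Qed.
Lemma ycoord0 j : ycoord (0 : Cn) j = 0.
Proof. by rewrite /ycoord mxE. Qed.
Lemma xcoordZ (r : R) u j : xcoord (r%:C *: u) j = r * xcoord u j.
Proof. by rewrite /xcoord mxE; case: (u 0 j) => a b /=; rewrite mul0r subr0. Qed.
Lemma ycoordZ (r : R) u j : ycoord (r%:C *: u) j = r * ycoord u j.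
Proof. by rewrite /ycoord mxE; case: (u 0 j) => a b /=; rewrite mul0r addr0. Qed.
Lemma xcoordJ u j : xcoord (cstruct u) j = - ycoord u j.
Proof. by rewrite /xcoord /ycoord mxE; case: (u 0 j) => a b /=; rewrite mul0r sub0r mul1r. Qed.
Lemma ycoordJ u j : ycoord (cstruct u) j = xcoord u j.
Proof. by rewrite /xcoord /ycoord mxE; case: (u 0 j) => a b /=; rewrite mul0r add0r mul1r. Qed.

Definition coordE := (xcoordD, ycoordD, xcoordN, ycoordN, xcoord0, ycoord0,
  xcoordZ, ycoordZ, xcoordJ, ycoordJ).

Lemma cstructD u v : cstruct (u + v) = cstruct u + cstruct v.
Proof. exact: scalerDr. Qed.
Lemma cstructZ (r : R) u : cstruct (r%:C *: u) = r%:C *: cstruct u.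
Proof. by rewrite /cstruct scalerA mulrC -scalerA. Qed.
Lemma cstructK u : cstruct (cstruct u) = - u.
Proof. by apply: vecC_ext => j; rewrite !coordE. Qed.

Lemma euclidC u v : euclid u v = euclid v u.
Proof. by apply: eq_bigr => j _; rewrite mulrC (mulrC (ycoord _ _)). Qed.
Lemma euclidDl u v w : euclid (u + v) w = euclid u w + euclid v w.
Proof. by rewrite /euclid -big_split /=; apply: eq_bigr => j _; rewrite !coordE; ring. Qed.
Lemma euclidDr u v w : euclid w (u + v) = euclid w u + euclid w v.
Proof. by rewrite euclidC euclidDl !(euclidC w). Qed.
Lemma euclidZl (r : R) u v : euclid (r%:C *: u) v = r * euclid u v.
Proof. by rewrite /euclid mulr_sumr; apply: eq_bigr => j _; rewrite !coordE; ring. Qed.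
Lemma euclidZr (r : R) u v : euclid u (r%:C *: v) = r * euclid u v.
Proof. by rewrite euclidC euclidZl euclidC. Qed.
Lemma euclid0l v : euclid 0 v = 0.
Proof. by rewrite /euclid big1 // => j _; rewrite !coordE; ring. Qed.
Lemma euclid0r v : euclid v 0 = 0.
Proof. by rewrite euclidC euclid0l. Qed.
Lemma euclidNl u v : euclid (- u) v = - euclid u v.
Proof. by apply/eqP; rewrite -addr_eq0 -euclidDl addNr euclid0l. Qed.
Lemma euclidNr u v : euclid u (- v) = - euclid u v.
Proof. by rewrite euclidC euclidNl euclidC. Qed.
Lemma euclid_suml (I : Type) (r : seq I) (P : pred I) (f : I -> Cn) v :
  euclid (\sum_(i <- r | P i) f i) v = \sum_(i <- r | P i) euclid (f i) v.
Proof. by apply: (big_morph (euclid^~ v)); [move=> x y; exact: euclidDl|exact: euclid0l]. Qed.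
Lemma euclid_sumr (I : Type) (r : seq I) (P : pred I) (f : I -> Cn) v :
  euclid v (\sum_(i <- r | P i) f i) = \sum_(i <- r | P i) euclid v (f i).
Proof. by rewrite euclidC euclid_suml; apply: eq_bigr => i _; rewrite euclidC. Qed.
Lemma euclidJ u v : euclid (cstruct u) (cstruct v) = euclid u v.
Proof. by apply: eq_bigr => j _; rewrite !coordE; ring. Qed.
Lemma euclid_ge0 u : 0 <= euclid u u.
Proof. by apply: sumr_ge0 => j _; rewrite addr_ge0 // -expr2 sqr_ge0. Qed.
Lemma euclid_eq0 u : euclid u u = 0 -> u = 0.
Proof.
move=> /eqP; rewrite psumr_eq0; last by move=> j _; rewrite addr_ge0 // -expr2 sqr_ge0.
move=> /allP h; apply: vecC_ext => j; have /h := mem_index_enum j.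
all: rewrite /= -!expr2 paddr_eq0 ?sqr_ge0 // !sqrf_eq0 => /andP[/eqP hx /eqP hy].
- by rewrite hx coordE.
- by rewrite hy coordE.
Qed.

Lemma omegaDl u v w : omega (u + v) w = omega u w + omega v w.
Proof. by rewrite /omega cstructD euclidDl. Qed.
Lemma omegaDr u v w : omega w (u + v) = omega w u + omega w v.
Proof. exact: euclidDr. Qed.
Lemma omegaZl (r : R) u v : omega (r%:C *: u) v = r * omega u v.
Proof. by rewrite /omega cstructZ euclidZl. Qed.
Lemma omegaZr (r : R) u v : omega u (r%:C *: v) = r * omega u v.
Proof. exact: euclidZr. Qed.
Lemma omegaC u v : omega u v = - omega v u.
Proof. by rewrite /omega -[in LHS]euclidJ cstructK euclidNl euclidC. Qed.
Lemma omega0l v : omega 0 v = 0.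
Proof. by rewrite /omega /cstruct scaler0 euclid0l. Qed.
Lemma omega0r v : omega v 0 = 0.
Proof. exact: euclid0r. Qed.
Lemma omegaNl u v : omega (- u) v = - omega u v.
Proof. by apply/eqP; rewrite -addr_eq0 -omegaDl addNr omega0l. Qed.
Lemma omegaNr u v : omega u (- v) = - omega u v.
Proof. exact: euclidNr. Qed.
Lemma omegaxx u : omega u u = 0.
Proof. by apply/eqP; have /eqP := omegaC u u; rewrite -addr_eq0 -mulr2n mulrn_eq0. Qed.
Lemma omega_suml (I : Type) (r : seq I) (P : pred I) (f : I -> Cn) v :
  omega (\sum_(i <- r | P i) f i) v = \sum_(i <- r | P i) omega (f i) v.
Proof. by apply: (big_morph (omega^~ v)); [move=> x y; exact: omegaDl|exact: omega0l]. Qed.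
Lemma omega_sumr (I : Type) (r : seq I) (P : pred I) (f : I -> Cn) v :
  omega v (\sum_(i <- r | P i) f i) = \sum_(i <- r | P i) omega v (f i).
Proof. exact: euclid_sumr. Qed.
Lemma omegaJr u v : omega u (cstruct v) = euclid u v.
Proof. exact: euclidJ. Qed.
Lemma omegaJl u v : omega (cstruct u) v = - euclid u v.
Proof. by rewrite /omega cstructK euclidNl. Qed.

Lemma omegaE u v : omega u v = \sum_j (xcoord u j * ycoord v j - ycoord u j * xcoord v j).
Proof. by apply: eq_bigr => j _; rewrite !coordE; ring. Qed.
Lemma lambda_formE u v : lambda_form u v = 2^-1 * omega u v.
Proof. by rewrite omegaE. Qed.

End HermitianSpace.

Section VectorCalculus.
Context {R : realType} {n : nat}.
Local Notation Cn := 'rV[R[i]]_n.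
Implicit Types (V W : normedModType R).

Definition CinfC V (U : set V) (f : V -> Cn) := forall j,
  Cinf U (fun x => xcoord (f x) j) /\ Cinf U (fun x => ycoord (f x) j).

Lemma xcoord_derivC V (v : V) (f : V -> Cn) x j :
  xcoord (derivC v f x) j = 'D_v (fun y => xcoord (f y) j) x.
Proof. by rewrite /xcoord mxE. Qed.
Lemma ycoord_derivC V (v : V) (f : V -> Cn) x j :
  ycoord (derivC v f x) j = 'D_v (fun y => ycoord (f y) j) x.
Proof. by rewrite /ycoord mxE. Qed.

Local Opaque derivC xcoord ycoord.

Lemma CinfC_sub V (U U' : set V) (f : V -> Cn) : U' `<=` U -> CinfC U f -> CinfC U' f.
Proof. by move=> UU h j; have [h1 h2] := h j; split; exact: Cinf_sub UU _. Qed.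

Lemma CinfC_ext V (U : set V) (f g : V -> Cn) : open U ->
  (forall x, U x -> f x = g x) -> CinfC U f -> CinfC U g.
Proof.
move=> oU fg Cf j; have [h1 h2] := Cf j; split.
  by apply: (Cinf_ext oU _ h1) => x /fg ->.
by apply: (Cinf_ext oU _ h2) => x /fg ->.
Qed.

Lemma CinfC_local V (U : set V) (f : V -> Cn) :
  (forall x, U x -> exists W : set V, [/\ open W, W x & CinfC W f]) -> CinfC U f.
Proof.
move=> h j; split; apply: Cinf_local => x /h [W [oW Wx C]]; exists W; split=> //.
  by have [] := C j.
by have [] := C j.
Qed.

Lemma derivC_near V (f g : V -> Cn) (v x : V) : (\forall y \near x, f y = g y) ->
  derivC v f x = derivC v g x.
Proof.
move=> fg; apply: vecC_ext => j; rewrite ?xcoord_derivC ?ycoord_derivC.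
  by apply: near_eq_derive; apply: filterS fg => y ->.
by apply: near_eq_derive; apply: filterS fg => y ->.
Qed.

Lemma derivC_ext V (U : set V) (f g : V -> Cn) (v x : V) : open U -> U x ->
  (forall y, U y -> f y = g y) -> derivC v f x = derivC v g x.
Proof.
move=> oU Ux fg; apply: derivC_near; have := open_nbhs_nbhs (conj oU Ux).
by apply: filterS => y /fg.
Qed.

Lemma CinfC_derivC V (U : set V) (f : V -> Cn) v : CinfC U f -> CinfC U (derivC v f).
Proof.
move=> Cf j; have [h1 h2] := Cf j; split.
  by under eq_fun do rewrite xcoord_derivC; exact: Cinf_derive.
by under eq_fun do rewrite ycoord_derivC; exact: Cinf_derive.
Qed.

Lemma CinfC_cst V (U : set V) (c : Cn) : CinfC U (fun=> c).
Proof. by move=> j; split; exact: Cinf_cst. Qed.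

Lemma CinfCD V (U : set V) (f g : V -> Cn) : open U -> CinfC U f -> CinfC U g ->
  CinfC U (fun x => f x + g x).
Proof.
move=> oU Cf Cg j; have [h1 h2] := Cf j; have [h3 h4] := Cg j; split.
  by under eq_fun do rewrite coordE; exact: CinfD.
by under eq_fun do rewrite coordE; exact: CinfD.
Qed.

Lemma CinfCZ V (U : set V) (r : V -> R) (f : V -> Cn) : open U -> Cinf U r -> CinfC U f ->
  CinfC U (fun x => (r x)%:C *: f x).
Proof.
move=> oU Cf Cg j; have [h3 h4] := Cg j; split.
  by under eq_fun do rewrite coordE; exact: CinfM.
by under eq_fun do rewrite coordE; exact: CinfM.
Qed.

Lemma CinfCN V (U : set V) (f : V -> Cn) : open U -> CinfC U f -> CinfC U (fun x => - f x).
Proof.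
move=> oU Cg j; have [h3 h4] := Cg j; split.
  by under eq_fun do rewrite coordE; exact: CinfN.
by under eq_fun do rewrite coordE; exact: CinfN.
Qed.

Lemma CinfC_sum V (U : set V) (I : Type) (s : seq I) (f : I -> V -> Cn) : open U ->
  (forall i, CinfC U (f i)) -> CinfC U (fun x => \sum_(i <- s) f i x).
Proof.
move=> oU Cf; elim: s => [|i s IH].
  by under eq_fun do rewrite big_nil; exact: CinfC_cst.
by under eq_fun do rewrite big_cons; exact: CinfCD.
Qed.

Lemma CinfC_cstruct V (U : set V) (f : V -> Cn) : open U -> CinfC U f ->
  CinfC U (fun x => cstruct (f x)).
Proof.
move=> oU Cf j; have [h1 h2] := Cf j; split.
  by under eq_fun do rewrite coordE; exact: CinfN.
by under eq_fun do rewrite coordE.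
Qed.

Lemma Cinf_euclid V (U : set V) (f g : V -> Cn) : open U -> CinfC U f -> CinfC U g ->
  Cinf U (fun x => euclid (f x) (g x)).
Proof.
move=> oU Cf Cg; apply: Cinf_sum => // j _; have [h1 h2] := Cf j; have [h3 h4] := Cg j.
by apply: CinfD => //; exact: CinfM.
Qed.

Lemma Cinf_omega V (U : set V) (f g : V -> Cn) : open U -> CinfC U f -> CinfC U g ->
  Cinf U (fun x => omega (f x) (g x)).
Proof. by move=> oU Cf Cg; apply: Cinf_euclid => //; exact: CinfC_cstruct. Qed.

(* Differentiability of the coordinates at a point; weaker than smoothness on a
   neighbourhood, so that it also applies to curves. *)
Definition derivableC V (v : V) (f : V -> Cn) x := forall j,
  derivable (fun y => xcoord (f y) j) x v /\ derivable (fun y => ycoord (f y) j) x v.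

Lemma CinfC_derivable V (U : set V) (f : V -> Cn) v x : CinfC U f -> U x -> derivableC v f x.
Proof. by move=> Cf Ux j; have [h1 h2] := Cf j; split; [exact: (Cinf_derivable v h1 Ux)|exact: (Cinf_derivable v h2 Ux)]. Qed.

Lemma derivCD V (f g : V -> Cn) v x : derivableC v f x -> derivableC v g x ->
  derivC v (fun y => f y + g y) x = derivC v f x + derivC v g x.
Proof.
move=> df dg; apply: vecC_ext => j; have [d1 d2] := df j; have [d3 d4] := dg j;
  rewrite coordE ?xcoord_derivC ?ycoord_derivC.
  by under eq_fun do rewrite coordE; rewrite (deriveD d1 d3).
by under eq_fun do rewrite coordE; rewrite (deriveD d2 d4).
Qed.

Lemma derivCZ V (r : V -> R) (f : V -> Cn) v x : derivable r x v -> derivableC v f x ->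
  derivC v (fun y => (r y)%:C *: f y) x =
  (r x)%:C *: derivC v f x + ('D_v r x)%:C *: f x.
Proof.
move=> dr df; apply: vecC_ext => j; have [d1 d2] := df j;
  rewrite !coordE ?xcoord_derivC ?ycoord_derivC.
  by under eq_fun do rewrite coordE; rewrite (deriveM dr d1) /GRing.scale /= (mulrC (xcoord _ _)).
by under eq_fun do rewrite coordE; rewrite (deriveM dr d2) /GRing.scale /= (mulrC (ycoord _ _)).
Qed.

Lemma is_derive_euclid V (f g : V -> Cn) v x : derivableC v f x -> derivableC v g x ->
  is_derive x v (fun y => euclid (f y) (g y))
    (euclid (derivC v f x) (g x) + euclid (f x) (derivC v g x)).
Proof.
move=> df dg; rewrite /euclid -big_split /=; elim: (index_enum 'I_n) => [|j s IH].
  by under eq_fun do rewrite big_nil; rewrite big_nil; exact: is_derive_cst.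
under eq_fun do rewrite big_cons; rewrite big_cons; apply: is_deriveD => //.
have [d1 d2] := df j; have [d3 d4] := dg j; rewrite !xcoord_derivC !ycoord_derivC.
have m1 := is_deriveM (derivableP d1) (derivableP d3).
have m2 := is_deriveM (derivableP d2) (derivableP d4).
apply: (is_derive_eq (is_deriveD m1 m2)).
by rewrite /GRing.scale /=; ring.
Qed.

Lemma derivC_cstruct V (f : V -> Cn) v x : derivableC v f x ->
  derivC v (fun y => cstruct (f y)) x = cstruct (derivC v f x).
Proof.
move=> df; apply: vecC_ext => j; have [d1 d2] := df j;
  rewrite coordE ?xcoord_derivC ?ycoord_derivC.
  by under eq_fun do rewrite coordE; rewrite (deriveN d2).
by under eq_fun do rewrite coordE.
Qed.

Lemma derivableC_cstruct V (f : V -> Cn) v x : derivableC v f x ->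
  derivableC v (fun y => cstruct (f y)) x.
Proof.
move=> df j; have [d1 d2] := df j; split.
  by under eq_fun do rewrite coordE; exact: derivableN.
by under eq_fun do rewrite coordE.
Qed.

Lemma is_derive_omega V (f g : V -> Cn) v x : derivableC v f x -> derivableC v g x ->
  is_derive x v (fun y => omega (f y) (g y))
    (omega (derivC v f x) (g x) + omega (f x) (derivC v g x)).
Proof.
move=> df dg; rewrite /omega -(derivC_cstruct df).
exact: (is_derive_euclid (derivableC_cstruct df) dg).
Qed.

Lemma derive_euclid V (f g : V -> Cn) v x : derivableC v f x -> derivableC v g x ->
  'D_v (fun y => euclid (f y) (g y)) x =
    (euclid (derivC v f x) (g x) + euclid (f x) (derivC v g x)).
Proof. by move=> df dg; have [_ ->] := is_derive_euclid df dg. Qed.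

Lemma derive_omega V (f g : V -> Cn) v x : derivableC v f x -> derivableC v g x ->
  'D_v (fun y => omega (f y) (g y)) x =
    (omega (derivC v f x) (g x) + omega (f x) (derivC v g x)).
Proof. by move=> df dg; have [_ ->] := is_derive_omega df dg. Qed.

Lemma ClairautC V (U : set V) (f : V -> Cn) x (v w : V) : open U -> U x -> CinfC U f ->
  derivC v (derivC w f) x = derivC w (derivC v f) x.
Proof.
move=> oU Ux Cf; apply: vecC_ext => j; have [h1 h2] := Cf j.
  have E a b : xcoord (derivC a (derivC b f) x) j = 'D_a (fun y => 'D_b (fun z => xcoord (f z) j) y) x.
    rewrite xcoord_derivC; congr (derive _ x a).
    by apply/funext => y; exact: xcoord_derivC.
  exact: (etrans (E v w) (etrans (Clairaut v w oU Ux (h1 2%N)) (esym (E w v)))).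
have E a b : ycoord (derivC a (derivC b f) x) j = 'D_a (fun y => 'D_b (fun z => ycoord (f z) j) y) x.
  rewrite ycoord_derivC; congr (derive _ x a).
  by apply/funext => y; exact: ycoord_derivC.
exact: (etrans (E v w) (etrans (Clairaut v w oU Ux (h2 2%N)) (esym (E w v)))).
Qed.

Section FinCoordC.
Variables (V : normedModType R) (I : finType) (e : I -> V) (l : I -> V -> R).
Hypothesis fc : fincoord e l.

Lemma xcoord_sum (J : Type) (s : seq J) (f : J -> Cn) j :
  xcoord (\sum_(i <- s) f i) j = \sum_(i <- s) xcoord (f i) j.
Proof. by apply: (big_morph (xcoord^~ j)); [move=> x y; exact: xcoordD|exact: xcoord0]. Qed.
Lemma ycoord_sum (J : Type) (s : seq J) (f : J -> Cn) j :
  ycoord (\sum_(i <- s) f i) j = \sum_(i <- s) ycoord (f i) j.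
Proof. by apply: (big_morph (ycoord^~ j)); [move=> x y; exact: ycoordD|exact: ycoord0]. Qed.

Lemma derivC_sum (U : set V) (f : V -> Cn) x v : open U -> U x -> CinfC U f ->
  derivC v f x = \sum_i (l i v)%:C *: derivC (e i) f x.
Proof.
move=> oU Ux Cf; apply: vecC_ext => j; have [h1 h2] := Cf j.
  rewrite xcoord_sum xcoord_derivC (C1_derive_sum fc v oU Ux (h1 1%N)).
  by apply: eq_bigr => i _; rewrite coordE xcoord_derivC.
rewrite ycoord_sum ycoord_derivC (C1_derive_sum fc v oU Ux (h2 1%N)).
by apply: eq_bigr => i _; rewrite coordE ycoord_derivC.
Qed.

Lemma chain_ruleC W (U : set V) (f : V -> Cn) (phi : W -> V) x w : open U -> U (phi x) ->
  CinfC U f -> (forall i, derivable (fun y => l i (phi y)) x w) ->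
  derivableC w (fun y => f (phi y)) x /\
  derivC w (fun y => f (phi y)) x =
   \sum_i ('D_w (fun y => l i (phi y)) x)%:C *: derivC (e i) f (phi x).
Proof.
move=> oU Ux Cf dphi; split.
  move=> j; have [h1 h2] := Cf j.
  by have [d1 _] := chain_rule fc oU Ux (h1 1%N) dphi; have [d2 _] := chain_rule fc oU Ux (h2 1%N) dphi.
apply: vecC_ext => j; have [h1 h2] := Cf j.
  have [_ E] := chain_rule fc oU Ux (h1 1%N) dphi.
  rewrite xcoord_sum xcoord_derivC E.
  by apply: eq_bigr => i _; rewrite coordE xcoord_derivC mulrC.
have [_ E] := chain_rule fc oU Ux (h2 1%N) dphi.
rewrite ycoord_sum ycoord_derivC E.
by apply: eq_bigr => i _; rewrite coordE ycoord_derivC mulrC.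
Qed.

Lemma CinfC_comp W (U : set V) (U' : set W) (f : V -> Cn) (phi : W -> V) :
  open U -> open U' -> (forall x, U' x -> U (phi x)) -> CinfC U f ->
  (forall i, Cinf U' (fun x => l i (phi x))) -> CinfC U' (fun x => f (phi x)).
Proof.
move=> oU oU' UU Cf Cphi j; have [h1 h2] := Cf j.
by split; [exact: (Cinf_comp fc oU oU' UU h1 Cphi)|exact: (Cinf_comp fc oU oU' UU h2 Cphi)].
Qed.

End FinCoordC.

Lemma smooth_onC_open V (A : set V) (f : V -> Cn) : open A -> smooth_onC A f -> CinfC A f.
Proof. by move=> oA h j; have [h1 h2] := h j; split; exact: smooth_on_open. Qed.

End VectorCalculus.

(** * Tangent frames and the mean curvature in a chart *)

Section Frames.
Context {R : realType} {n : nat}.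
Local Notation Cn := 'rV[R[i]]_n.
Implicit Types (t : 'I_n -> Cn) (v w : Cn) (a b : 'rV[R]_n).

(** Chart-free versions of the induced metric, the normal part and the mean curvature, for an
    arbitrary frame [t] and an arbitrary array [h] of second derivatives. On a coordinate frame they
    unfold to the original definitions, but they can also be evaluated in a frame orthonormal at a
    point. *)
Definition gram t : 'M[R]_n := \matrix_(i, j) euclid (t i) (t j).
Definition comb a t : Cn := \sum_(i < n) (a 0 i)%:C *: t i.
Definition nrm t v := v - \sum_(k < n) \sum_(l < n)
   (invmx (gram t) k l * euclid v (t k))%:C *: t l.
Definition mcurv t (h : 'I_n -> 'I_n -> Cn) :=
  \sum_(i < n) \sum_(j < n) (invmx (gram t) i j)%:C *: nrm t (h i j).

Lemma gramE t i j : gram t i j = euclid (t i) (t j).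
Proof. by rewrite mxE. Qed.

Lemma gram_sym t : (gram t)^T = gram t.
Proof. by apply/matrixP => i j; rewrite !mxE euclidC. Qed.

Lemma invmx_gram_sym t i j : invmx (gram t) i j = invmx (gram t) j i.
Proof. by rewrite -[in LHS]gram_sym -trmx_inv mxE. Qed.

Lemma comb_lin (r : R) a b t : comb (r *: a + b) t = r%:C *: comb a t + comb b t.
Proof.
rewrite /comb scaler_sumr -big_split /=; apply: eq_bigr => i _.
by rewrite !mxE rmorphD rmorphM scalerDl scalerA.
Qed.

Lemma combD a b t : comb (a + b) t = comb a t + comb b t.
Proof. by rewrite -[a in LHS]scale1r comb_lin scale1r. Qed.

Lemma comb0 t : comb 0 t = 0.
Proof. by rewrite /comb big1 // => i _; rewrite mxE scale0r. Qed.

Lemma combZ (r : R) a t : comb (r *: a) t = r%:C *: comb a t.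
Proof. by rewrite -[r *: a]addr0 comb_lin comb0 addr0. Qed.

Lemma euclid_comb_l a t v : euclid (comb a t) v = \sum_i a 0 i * euclid (t i) v.
Proof. by rewrite euclid_suml; apply: eq_bigr => i _; rewrite euclidZl. Qed.

Lemma euclid_comb_r a t v : euclid v (comb a t) = \sum_i a 0 i * euclid v (t i).
Proof. by rewrite euclidC euclid_comb_l; apply: eq_bigr => i _; rewrite euclidC. Qed.

Lemma omega_comb_l a t v : omega (comb a t) v = \sum_i a 0 i * omega (t i) v.
Proof. by rewrite omega_suml; apply: eq_bigr => i _; rewrite omegaZl. Qed.

Lemma omega_comb_r a t v : omega v (comb a t) = \sum_i a 0 i * omega v (t i).
Proof. by rewrite omegaC omega_comb_l -sumrN; apply: eq_bigr => i _; rewrite (omegaC v) mulrN. Qed.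

Lemma euclid_comb_gram a t i : euclid (comb a t) (t i) = (a *m gram t) 0 i.
Proof. by rewrite euclid_comb_l mxE; apply: eq_bigr => j _; rewrite mxE. Qed.

(** A row [a] in the kernel of the Gram matrix makes [comb a t] orthogonal to every vector of the
    frame, hence to itself. *)
Lemma gram_unit t : (forall a, comb a t = 0 -> a = 0) -> gram t \in unitmx.
Proof.
move=> h; rewrite -row_free_unit -kermx_eq0; apply/eqP/row_matrixP => k.
rewrite row0; apply: h; apply: euclid_eq0.
rewrite euclid_comb_r big1 // => i _.
by rewrite euclid_comb_gram -row_mul mulmx_ker row0 [X in _ * X]mxE mulr0.
Qed.

Lemma gram_unit_inj t a : gram t \in unitmx -> comb a t = 0 -> a = 0.
Proof.
move=> gu a0; rewrite -[a]mulmx1 -(mulmxV gu) mulmxA.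
rewrite (_ : a *m gram t = 0) ?mul0mx //; apply/rowP => i.
by rewrite -euclid_comb_gram a0 euclid0l mxE.
Qed.

Lemma nrm_combE t v : nrm t v = v - comb ((\row_k euclid v (t k)) *m invmx (gram t)) t.
Proof.
rewrite /nrm /comb exchange_big /=; congr (_ - _); apply: eq_bigr => l _.
rewrite -scaler_suml mxE rmorph_sum /=; congr (_ *: _).
by apply: eq_bigr => k _; rewrite mxE mulrC.
Qed.

Lemma nrm_perp t v m : gram t \in unitmx -> euclid (nrm t v) (t m) = 0.
Proof.
move=> gu; rewrite nrm_combE euclidDl euclidNl euclid_comb_gram.
by rewrite -mulmxA (mulVmx gu) mulmx1 mxE subrr.
Qed.

Lemma nrm_uniq t w a : gram t \in unitmx -> (forall m, euclid w (t m) = 0) ->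
  nrm t (w + comb a t) = w.
Proof.
move=> gu wt; rewrite nrm_combE.
rewrite (_ : \row_k _ = a *m gram t); last first.
  by apply/rowP => k; rewrite mxE euclidDl wt add0r euclid_comb_gram.
by rewrite -mulmxA (mulmxV gu) mulmx1 addrK.
Qed.

Lemma nrmD t v w : nrm t (v + w) = nrm t v + nrm t w.
Proof.
rewrite !nrm_combE (_ : \row_k euclid (v + w) (t k) = (\row_k euclid v (t k)) + (\row_k euclid w (t k))).
  by rewrite mulmxDl combD opprD addrACA.
by apply/rowP => k; rewrite !mxE euclidDl.
Qed.

Lemma nrmZ t (r : R) v : nrm t (r%:C *: v) = r%:C *: nrm t v.
Proof.
rewrite !nrm_combE (_ : \row_k euclid (r%:C *: v) (t k) = r *: (\row_k euclid v (t k))).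
  by rewrite -scalemxAl combZ scalerBr.
by apply/rowP => k; rewrite !mxE euclidZl.
Qed.

Lemma nrm0 t : nrm t 0 = 0.
Proof. by have := nrmZ t 0 0; rewrite !scale0r. Qed.

Lemma nrm_sum t (I : Type) (s : seq I) (f : I -> Cn) :
  nrm t (\sum_(i <- s) f i) = \sum_(i <- s) nrm t (f i).
Proof. by apply: (big_morph (nrm t)); [move=> x y; exact: nrmD|exact: nrm0]. Qed.

Lemma nrm_comb t a : gram t \in unitmx -> nrm t (comb a t) = 0.
Proof. by move=> gu; rewrite -[comb a t]add0r nrm_uniq // => m; exact: euclid0l. Qed.

Section Reparam.
Variables (t : 'I_n -> Cn) (B : 'M[R]_n).
Let t' i := comb (row i B) t.
Hypotheses (gu : gram t \in unitmx) (Bu : B \in unitmx).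

Lemma comb_reparam a : comb a t' = comb (a *m B) t.
Proof.
rewrite /comb; under eq_bigr do rewrite /t' /comb scaler_sumr.
rewrite exchange_big /=; apply: eq_bigr => l _.
rewrite mxE rmorph_sum scaler_suml; apply: eq_bigr => k _.
by rewrite mxE rmorphM scalerA.
Qed.

Lemma gram_reparam : gram t' = B *m gram t *m B^T.
Proof.
apply/matrixP => i j; rewrite mxE /t' euclid_comb_r mxE; apply: eq_bigr => l _.
rewrite mulrC euclid_comb_gram !mxE; congr (_ * _).
by apply: eq_bigr => k _; rewrite mxE.
Qed.

Lemma gram_reparam_unit : gram t' \in unitmx.
Proof. by rewrite gram_reparam !unitmx_mul Bu gu unitmx_tr Bu. Qed.

(** The normal projection depends on the span alone: [nrm_uniq] characterises it by the
    decomposition into a vector orthogonal to the frame and a combination of the frame. *)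
Lemma nrm_reparam v : nrm t' v = nrm t v.
Proof.
pose w := nrm t v; pose a := (\row_k euclid v (t k)) *m invmx (gram t).
have vE : v = w + comb (a *m invmx B) t'.
  by rewrite comb_reparam -mulmxA (mulVmx Bu) mulmx1 /w nrm_combE subrK.
rewrite {1}vE nrm_uniq //; first exact: gram_reparam_unit.
move=> m; rewrite /t' euclid_comb_r big1 // => i _.
by rewrite nrm_perp // mulr0.
Qed.

(** The extra [comb (c i j) t] is what the second derivatives of a change of coordinates contribute;
    it is tangent, so [nrm] kills it. The rest is invariance of the trace: B^T G'^-1 B = G^-1 for
    the two Gram matrices. *)
Lemma mcurv_reparam (h h' : 'I_n -> 'I_n -> Cn) (c : 'I_n -> 'I_n -> 'rV[R]_n) :
  (forall i j, h' i j = \sum_k \sum_l (B i k * B j l)%:C *: h k l + comb (c i j) t) ->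
  mcurv t' h' = mcurv t h.
Proof.
move=> hE; rewrite /mcurv.
have N i j : nrm t' (h' i j) = \sum_k \sum_l (B i k * B j l)%:C *: nrm t (h k l).
  rewrite nrm_reparam hE nrmD nrm_comb // addr0 nrm_sum; apply: eq_bigr => k _.
  by rewrite nrm_sum; apply: eq_bigr => l _; rewrite nrmZ.
have I : B^T *m invmx (gram t') *m B = invmx (gram t).
  have gu' := gram_reparam_unit.
  have H : gram t *m (B^T *m invmx (gram t') *m B) = 1%:M.
    apply: (can_inj (mulKmx Bu)).
    by rewrite mulmx1 !mulmxA -gram_reparam (mulmxV gu') mul1mx.
  by rewrite -[LHS]mul1mx -(mulVmx gu) -[LHS]mulmxA H mulmx1.
transitivity (\sum_k \sum_l \sum_i \sum_j (invmx (gram t') i j * (B i k * B j l))%:C *: nrm t (h k l)).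
  under eq_bigr => i _.
    under eq_bigr => j _.
      rewrite N scaler_sumr.
      under eq_bigr => k _.
        rewrite scaler_sumr; under eq_bigr do rewrite scalerA -rmorphM.
        over.
      over.
    rewrite exchange_big /=.
    under eq_bigr do rewrite exchange_big /=.
    over.
  rewrite exchange_big /=; apply: eq_bigr => k _.
  by rewrite exchange_big /=.
apply: eq_bigr => k _; apply: eq_bigr => l _.
rewrite -I mxE rmorph_sum scaler_suml exchange_big /=; apply: eq_bigr => j _.
rewrite mxE mulr_suml rmorph_sum scaler_suml; apply: eq_bigr => i _.
by rewrite mxE; congr (_%:C *: _); rewrite mulrCA mulrA.
Qed.

End Reparam.

End Frames.

Section SmoothMatrix.
Context {R : realType}.
Implicit Types V : normedModType R.

Lemma Cinf_det V (U : set V) m (A : V -> 'M[R]_m) : open U ->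
  (forall i j, Cinf U (fun x => A x i j)) -> Cinf U (fun x => \det (A x)).
Proof.
move=> oU CA; apply: Cinf_sum => // s _; apply: CinfM => //; first exact: Cinf_cst.
by apply: Cinf_prod.
Qed.

Lemma Cinf_invmx V (U : set V) m (A : V -> 'M[R]_m) i j : open U ->
  (forall i j, Cinf U (fun x => A x i j)) -> (forall x, U x -> A x \in unitmx) ->
  Cinf U (fun x => invmx (A x) i j).
Proof.
move=> oU CA Au; apply: (Cinf_ext (f := fun x => (\det (A x))^-1 * cofactor (A x) j i)) => //.
  by move=> x Ux; rewrite /invmx (Au x Ux) !mxE.
apply: CinfM => //; first by apply: CinfV => //; [move=> x /Au; rewrite unitmxE unitfE|exact: Cinf_det].
apply: CinfM => //; first exact: Cinf_cst.
apply: Cinf_det => // k l; under eq_fun do rewrite !mxE; exact: CA.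
Qed.

End SmoothMatrix.

(** * Immersions in coordinates and their reparametrizations *)

Section LocalImmersion.
Context {R : realType} {n : nat}.
Local Notation Cn := 'rV[R[i]]_n.
Local Notation Rn := 'rV[R]_n.
Implicit Types (f : Rn -> Cn) (U W : set Rn).

Let ei (i : 'I_n) : Rn := delta_mx 0 i.

Definition ltan f (x : Rn) (i : 'I_n) : Cn := derivC (delta_mx 0 i : Rn) f x.
Definition lhess f (x : Rn) (i j : 'I_n) : Cn :=
  derivC (delta_mx 0 i : Rn) (fun y => ltan f y j) x.
Definition lH f x := mcurv (ltan f x) (lhess f x).

Lemma ltan_comb f U x a : open U -> U x -> CinfC U f -> derivC a f x = comb a (ltan f x).
Proof. by move=> oU Ux Cf; exact: (derivC_sum (fincoord_rV n) a oU Ux Cf). Qed.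

Lemma CinfC_lH f U : open U -> CinfC U f -> (forall x, U x -> gram (ltan f x) \in unitmx) ->
  CinfC U (lH f).
Proof.
move=> oU Cf gu.
have Ct i : CinfC U (fun x => ltan f x i) by exact: CinfC_derivC.
have Cg i j : Cinf U (fun x => invmx (gram (ltan f x)) i j).
  apply: Cinf_invmx => // k l; under eq_fun do rewrite mxE; exact: Cinf_euclid.
apply: CinfC_sum => // i; apply: CinfC_sum => // j; apply: CinfCZ => //.
have Ch : CinfC U (fun x => lhess f x i j) by exact: CinfC_derivC.
apply: CinfCD => //; apply: CinfCN => //; apply: CinfC_sum => // k.
apply: CinfC_sum => // l; apply: CinfCZ => //; apply: CinfM => //.
exact: Cinf_euclid.
Qed.

Lemma lH_ext f g U x : open U -> U x -> (forall y, U y -> f y = g y) -> lH f x = lH g x.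
Proof.
move=> oU Ux fg; have E y i : U y -> ltan f y i = ltan g y i.
  by move=> Uy; exact: derivC_ext oU Uy fg.
have -> : lH f x = mcurv (ltan g x) (lhess f x).
  by rewrite /lH (_ : ltan f x = ltan g x) //; apply/funext => i; exact: E.
have -> // : lhess f x = lhess g x.
apply/funext => i; apply/funext => j; rewrite /lhess.
by apply: (derivC_ext _ oU Ux) => y Uy; exact: E.
Qed.

Section Reparametrization.
Variables (f : Rn -> Cn) (phi : Rn -> Rn) (U W : set Rn).
Hypotheses (oU : open U) (oW : open W) (WU : forall y, W y -> U (phi y)).
Hypotheses (Cf : CinfC U f) (Cphi : forall k, Cinf W (fun y => phi y 0 k)).

Definition jac y : 'M[R]_n := \matrix_(i, k) 'D_(delta_mx 0 i : Rn) (fun z => phi z 0 k) y.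

Lemma ltan_reparam y i : W y -> ltan (fun z => f (phi z)) y i = comb (row i (jac y)) (ltan f (phi y)).
Proof.
move=> Wy; have [_ E] := chain_ruleC (fincoord_rV n) oU (WU Wy) Cf
   (fun k => Cinf_derivable (delta_mx 0 i) (Cphi k) Wy).
by rewrite /ltan E; apply: eq_bigr => k _; rewrite !mxE.
Qed.

Lemma CinfC_reparam : CinfC W (fun z => f (phi z)).
Proof. exact: (CinfC_comp (fincoord_rV n) oU oW WU Cf). Qed.

(** The product rule on the transformed tangent vectors. The witness collects the second derivatives
    of [phi] in the directions i and j, a tangential term that disappears from the mean
    curvature. *)
Lemma lhess_reparam y i j : W y -> exists c : Rn, lhess (fun z => f (phi z)) y i j =
  \sum_k \sum_l (jac y i k * jac y j l)%:C *: lhess f (phi y) k l + comb c (ltan f (phi y)).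
Proof.
move=> Wy.
have CT k : CinfC U (fun x => ltan f x k) by exact: CinfC_derivC.
have CTp k : CinfC W (fun z => ltan f (phi z) k).
  exact: (CinfC_comp (fincoord_rV n) oU oW WU (CT k)).
have CJ a k : Cinf W (fun z => jac z a k).
  by under eq_fun do rewrite mxE; exact: Cinf_derive.
exists (\row_k 'D_(ei i) (fun z => jac z j k) y).
have -> : lhess (fun z => f (phi z)) y i j =
   derivC (ei i) (fun z => \sum_k (jac z j k)%:C *: ltan f (phi z) k) y.
  rewrite /lhess; apply: (derivC_ext _ oW Wy) => z Wz; rewrite ltan_reparam //.
  by apply: eq_bigr => k _; rewrite mxE.
have dS (s : seq 'I_n) : derivC (ei i) (fun z => \sum_(k <- s) (jac z j k)%:C *: ltan f (phi z) k) y =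
   \sum_(k <- s) ((jac y j k)%:C *: derivC (ei i) (fun z => ltan f (phi z) k) y
      + ('D_(ei i) (fun z => jac z j k) y)%:C *: ltan f (phi y) k).
  elim: s => [|k s IH].
    under eq_fun do rewrite big_nil; rewrite big_nil.
    by apply: vecC_ext => a; rewrite ?xcoord_derivC ?ycoord_derivC ?coordE derive_cst.
  under eq_fun do rewrite big_cons; rewrite big_cons derivCD.
  - rewrite IH derivCZ //; first exact: (Cinf_derivable _ (CJ j k) Wy).
    exact: (CinfC_derivable _ (CTp k) Wy).
  - apply: (CinfC_derivable _ _ Wy); exact: CinfCZ.
  - by apply: (CinfC_derivable _ _ Wy); apply: CinfC_sum => // m; exact: CinfCZ.
rewrite dS big_split /=; congr (_ + _); last first.
  by apply: eq_bigr => k _; rewrite !mxE.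
rewrite exchange_big /=; apply: eq_bigr => k _.
have [_ E] := chain_ruleC (fincoord_rV n) oU (WU Wy) (CT k)
   (fun k => Cinf_derivable (ei i) (Cphi k) Wy).
rewrite E scaler_sumr; apply: eq_bigr => l _.
rewrite scalerA -rmorphM; congr (_%:C *: _).
by rewrite mulrC !mxE.
Qed.

Lemma lH_reparam y : W y -> gram (ltan f (phi y)) \in unitmx -> jac y \in unitmx ->
  lH (fun z => f (phi z)) y = lH f (phi y).
Proof.
move=> Wy gu Ju.
have [c hc] : exists c : 'I_n -> 'I_n -> Rn, forall i j, lhess (fun z => f (phi z)) y i j =
  \sum_k \sum_l (jac y i k * jac y j l)%:C *: lhess f (phi y) k l + comb (c i j) (ltan f (phi y)).
  pose P i j c := lhess (fun z => f (phi z)) y i j =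
    \sum_k \sum_l (jac y i k * jac y j l)%:C *: lhess f (phi y) k l + comb c (ltan f (phi y)).
  exists (fun i j => xget 0 (P i j)) => i j.
  by have [c h] := lhess_reparam i j Wy; exact: (@xgetPex _ 0 (P i j) (ex_intro _ c h)).
rewrite /lH (_ : ltan (fun z => f (phi z)) y = fun i => comb (row i (jac y)) (ltan f (phi y))).
  exact: mcurv_reparam hc.
by apply/funext => i; exact: ltan_reparam.
Qed.

End Reparametrization.

End LocalImmersion.

Section Slices.
Context {R : realType}.
Implicit Types V W : normedModType R.

(** Partial and directional difference quotients coincide before any limit is taken, so derivatives
    along slices need no differentiability of [f]. *)
Lemma slice1_quotient V W (f : V * W -> R) (v x : V) (t : W) :
  (fun h : R => h^-1 *: (((fun y => f (y, t)) \o shift x) (h *: v) - f (x, t))) =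
  (fun h : R => h^-1 *: ((f \o shift (x, t)) (h *: ((v, 0) : V * W)) - f (x, t))).
Proof.
apply/funext => h /=; congr (_ *: (f _ - _)).
by rewrite [RHS](_ : _ = (h *: v + x, h *: 0 + t)) // scaler0 add0r.
Qed.

Lemma slice2_quotient V W (f : V * W -> R) (w t : W) (x : V) :
  (fun h : R => h^-1 *: (((fun s => f (x, s)) \o shift t) (h *: w) - f (x, t))) =
  (fun h : R => h^-1 *: ((f \o shift (x, t)) (h *: ((0, w) : V * W)) - f (x, t))).
Proof.
apply/funext => h /=; congr (_ *: (f _ - _)).
by rewrite [RHS](_ : _ = (h *: 0 + x, h *: w + t)) // scaler0 add0r.
Qed.

Local Transparent derive.

Lemma derive_slice1 V W (f : V * W -> R) (v x : V) (t : W) :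
  'D_v (fun y => f (y, t)) x = 'D_((v, 0) : V * W) f (x, t).
Proof. by rewrite /derive slice1_quotient. Qed.

Lemma derive_slice2 V W (f : V * W -> R) (w t : W) (x : V) :
  'D_w (fun s => f (x, s)) t = 'D_((0, w) : V * W) f (x, t).
Proof. by rewrite /derive slice2_quotient. Qed.

Lemma derivable_slice1 V W (f : V * W -> R) (v x : V) (t : W) :
  derivable f (x, t) ((v, 0) : V * W) -> derivable (fun y => f (y, t)) x v.
Proof. by rewrite /derivable slice1_quotient. Qed.

Lemma derivable_slice2 V W (f : V * W -> R) (w t : W) (x : V) :
  derivable f (x, t) ((0, w) : V * W) -> derivable (fun s => f (x, s)) t w.
Proof. by rewrite /derivable slice2_quotient. Qed.

Local Opaque derive.

Lemma open_slice1 V W (U : set (V * W)) (t : W) : open U -> open [set y | U (y, t)].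
Proof.
move=> oU; rewrite openE => x Ux; have /nbhs_normP [r r0 h] := open_nbhs_nbhs (conj oU Ux).
apply/nbhs_normP; exists r => // y yx; apply: h.
by rewrite prod_normE /= subrr normr0 gt_max yx.
Qed.

Lemma open_slice2 V W (U : set (V * W)) (x : V) : open U -> open [set s | U (x, s)].
Proof.
move=> oU; rewrite openE => t Ut; have /nbhs_normP [r r0 h] := open_nbhs_nbhs (conj oU Ut).
apply/nbhs_normP; exists r => // y yx; apply: h.
by rewrite prod_normE /= subrr normr0 gt_max yx r0.
Qed.

Lemma Ck_slice1 k V W (U : set (V * W)) (f : V * W -> R) (t : W) : open U ->
  Ck k U f -> Ck k [set y | U (y, t)] (fun y => f (y, t)).
Proof.
move=> oU; elim: k f => [|k IH] f Cf; split=> //.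
- move=> x Ux; apply: (@continuous_comp _ _ _ (fun y => (y, t)) f).
    by apply: cvg_pair; [exact: cvg_id|exact: cvg_cst].
  exact: (Ck_cont Cf).
- move=> x Ux; apply: (@continuous_comp _ _ _ (fun y => (y, t)) f).
    by apply: cvg_pair; [exact: cvg_id|exact: cvg_cst].
  exact: (Ck_cont Cf).
- move=> v; split.
    move=> x Ux; apply: derivable_slice1; exact: (Ck_derivable _ Cf).
  have -> : (fun x => 'D_v (fun y => f (y, t)) x) = (fun x => 'D_((v, 0) : V * W) f (x, t)).
    by apply/funext => x; exact: derive_slice1.
  exact: (IH _ (Ck_derive _ Cf)).
Qed.

Lemma Ck_slice2 k V W (U : set (V * W)) (f : V * W -> R) (x : V) : open U ->
  Ck k U f -> Ck k [set s | U (x, s)] (fun s => f (x, s)).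
Proof.
move=> oU; elim: k f => [|k IH] f Cf; split=> //.
- move=> t Ut; apply: (@continuous_comp _ _ _ (fun s => (x, s)) f).
    by apply: cvg_pair; [exact: cvg_cst|exact: cvg_id].
  exact: (Ck_cont Cf).
- move=> t Ut; apply: (@continuous_comp _ _ _ (fun s => (x, s)) f).
    by apply: cvg_pair; [exact: cvg_cst|exact: cvg_id].
  exact: (Ck_cont Cf).
- move=> w; split.
    move=> t Ut; apply: derivable_slice2; exact: (Ck_derivable _ Cf).
  have -> : (fun t => 'D_w (fun s => f (x, s)) t) = (fun t => 'D_((0, w) : V * W) f (x, t)).
    by apply/funext => t; exact: derive_slice2.
  exact: (IH _ (Ck_derive _ Cf)).
Qed.

End Slices.

(** The numbers stand for squared norms: A, A' of the components along a plane, B, B' of those along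
    its image by J. From 3 A <= B and 3 A' <= B' follow A + A' <= (B + B')/3 and B - A + B' - A' >=
    2 (B + B')/3; the two bounds on w1 and w2 then add up to 4/3 d (B + B'), exactly covered by the
    factor 2. A negative [d] forces all four numbers to be 0. *)
Lemma normal_omega_real (R : realType) (d A A' B B' w1 w2 : R) : 0 <= A -> 0 <= A' ->
  3 * A <= B -> 3 * A' <= B' -> `|w1| <= d * (A + A') -> `|w2| <= d * (B + B') ->
  - (w1 - w2) <= 2 * d * (B - A + (B' - A')).
Proof.
move=> A0 A0' AB AB' h1 h2.
have d0 : 0 <= d * (B + B') by apply: le_trans h2.
have dAB : d * (A + A') <= d * ((B + B') / 3).
  have [d1|dn] := leP 0 d; first by rewrite ler_wpM2l //; lra.
  have i5 : B + B' <= 0 by rewrite -(nmulr_rge0 _ dn).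
  have -> : A + A' = 0 by lra.
  have -> : B + B' = 0 by lra.
  by rewrite mul0r.
rewrite ler_norml in h1; rewrite ler_norml in h2.
move/andP: h1 => [h1 h1']; move/andP: h2 => [h2 h2'].
lra.
Qed.

(** * Orthonormal frames and omega on the normal space *)

Section OrthonormalFrames.
Context {R : realType} {n : nat}.
Local Notation Cn := 'rV[R[i]]_n.
Implicit Types (t : 'I_n -> Cn) (v w : Cn) (a b : 'rV[R]_n).

Definition sqn a : R := \sum_i a 0 i ^+ 2.

Lemma sqn_ge0 a : 0 <= sqn a.
Proof. by apply: sumr_ge0 => i _; exact: sqr_ge0. Qed.

Lemma sqn_eq0 a : sqn a = 0 -> a = 0.
Proof.
move=> /eqP; rewrite psumr_eq0; last by move=> i _; exact: sqr_ge0.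
move=> /allP h; apply/rowP => i; have := h i (mem_index_enum i).
by rewrite /= sqrf_eq0 mxE => /eqP.
Qed.

Lemma euclid_comb_comb a b t : gram t = 1%:M ->
  euclid (comb a t) (comb b t) = \sum_i a 0 i * b 0 i.
Proof.
move=> g1; rewrite euclid_comb_r; apply: eq_bigr => i _.
by rewrite euclid_comb_gram g1 mulmx1 mulrC.
Qed.

Lemma euclid_comb_sqn a t : gram t = 1%:M -> euclid (comb a t) (comb a t) = sqn a.
Proof. by move=> g1; rewrite euclid_comb_comb //; apply: eq_bigr => i _; rewrite expr2. Qed.

(** Gram-Schmidt by a rank count: as long as there are fewer than n rows, some nonzero vector is
    orthogonal to all of them, and it is normalised and appended. *)
Lemma orthonormal_rows t k : gram t \in unitmx -> (k <= n)%N ->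
  exists A : 'M[R]_(k, n), A *m gram t *m A^T = 1%:M.
Proof.
move=> gu; elim: k => [|k IH] kn.
  by exists 0; apply/matrixP => -[].
have [A hA] := IH (ltnW kn).
have [v v0 vA] : exists2 v : 'rV[R]_n, v != 0 & v *m (gram t *m A^T) = 0.
  have : kermx (gram t *m A^T) != 0.
    rewrite kermx_eq0 -row_leq_rank -ltnNge (leq_ltn_trans _ kn) //.
    exact: rank_leq_col.
  move=> /rowV0Pn [v /sub_kermxP vk v0]; by exists v.
pose q := euclid (comb v t) (comb v t).
have q0 : 0 < q.
  rewrite lt_neqAle euclid_ge0 andbT eq_sym; apply/eqP => /euclid_eq0 h.
  by move/eqP: v0; apply; exact: gram_unit_inj h.
have qE : (v *m gram t *m v^T) = q%:M.
  rewrite [LHS]mx11_scalar; congr (_%:M).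
  rewrite mxE /q euclid_comb_r; apply: eq_bigr => i _.
  by rewrite euclid_comb_gram [v^T i 0]mxE mulrC.
pose u := (Num.sqrt q)^-1 *: v.
have uu : u *m gram t *m u^T = 1%:M.
  rewrite (_ : u^T = (Num.sqrt q)^-1 *: v^T); last by apply/matrixP => i j; rewrite !mxE.
  rewrite /u -!scalemxAl -scalemxAr qE scalerA.
  have s0 : Num.sqrt q != 0 by rewrite gt_eqF // sqrtr_gt0.
  rewrite -invfM -expr2 sqr_sqrtr ?ltW // scale_scalar_mx mulVf //.
  by rewrite gt_eqF.
have uA : u *m gram t *m A^T = 0 by rewrite /u -!scalemxAl -mulmxA vA scaler0.
have Au : A *m gram t *m u^T = 0.
  by apply: trmx_inj; rewrite trmx0 !trmx_mul trmxK gram_sym mulmxA.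
rewrite -addn1; exists (col_mx A u).
rewrite tr_col_mx mul_col_mx mul_col_row hA uA Au uu.
by rewrite -scalar_mx_block.
Qed.

Lemma orthonormal_frame t : gram t \in unitmx ->
  exists2 A : 'M[R]_n, A \in unitmx & gram (fun i => comb (row i A) t) = 1%:M.
Proof.
move=> gu; have [A hA] := orthonormal_rows gu (leqnn n).
exists A; last by rewrite gram_reparam.
by have [|] := @mulmx1_unit _ _ A (gram t *m A^T); rewrite ?mulmxA.
Qed.

(* The rows of the complex matrix of an orthonormal frame form a C-basis as soon as
   omega is small on its span, so that each normal vector can be written
   nu = comb x t + J (comb y t); orthogonality to the frame turns omega (nu, nu')
   into omega (x, x') - omega (y, y'). *)
Section NormalOmega.
Variables (t : 'I_n -> Cn) (d : R).
Hypotheses (g1 : gram t = 1%:M) (d4 : d <= 4^-1).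
Hypothesis small : forall a b, omega (comb a t) (comb b t) <= d * (sqn a + sqn b).

Let wv a b := comb a t + cstruct (comb b t).

Lemma sqn_opp a : sqn (- a) = sqn a.
Proof. by apply: eq_bigr => i _; rewrite mxE sqrrN. Qed.

Lemma comb_opp a : comb (- a) t = - comb a t.
Proof. by rewrite -scaleN1r combZ rmorphN1 scaleN1r. Qed.

Lemma small_abs a b : `|omega (comb a t) (comb b t)| <= d * (sqn a + sqn b).
Proof. by rewrite ler_norml small andbT lerNl -omegaNl -comb_opp -(sqn_opp a) small. Qed.

(** Orthogonality to the frame gives |a|^2 = - omega (b, a), which smallness bounds by (|a|^2 +
    |b|^2)/4; this is where [d <= 4^-1] makes the component along J of the plane dominate. *)
Lemma normal_parts a b : (forall m, euclid (wv a b) (t m) = 0) ->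
  (forall c, euclid (comb a t) (comb c t) = - omega (comb b t) (comb c t)) /\
  euclid (wv a b) (wv a b) = sqn b - sqn a /\ 3 * sqn a <= sqn b.
Proof.
move=> h.
have E c : euclid (comb a t) (comb c t) = - omega (comb b t) (comb c t).
  apply/eqP; rewrite -addr_eq0 /omega -euclidDl euclid_comb_r; apply/eqP/big1 => i _.
  by rewrite -/(wv a b) h mulr0.
have Ea := E a; rewrite euclid_comb_sqn // in Ea.
split=> //; split.
  rewrite /wv euclidDl !euclidDr euclidJ !euclid_comb_sqn // -/(omega _ _).
  rewrite (euclidC (comb a t)) -/(omega _ _).
  have -> : omega (comb b t) (comb a t) = - sqn a by rewrite Ea opprK.
  ring.
have := small_abs b a; rewrite -normrN -Ea (ger0_norm (sqn_ge0 a)) => h1.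
have h2 : d * (sqn b + sqn a) <= 4^-1 * (sqn b + sqn a).
  by rewrite ler_wpM2r // addr_ge0 ?sqn_ge0.
lra.
Qed.

(** Complex combinations of the frame are exactly the vectors [wv a b]. A complex relation is a zero
    vector, in particular orthogonal to the frame, so [normal_parts] gives |a| = |b| together with 3
    |a|^2 <= |b|^2, and the relation is trivial. *)
Lemma wv_surj v : exists a b, v = wv a b.
Proof.
pose M : 'M[R[i]]_n := \matrix_i t i.
have zM (z : 'rV[R[i]]_n) : z *m M = wv (\row_k complex.Re (z 0 k)) (\row_k complex.Im (z 0 k)).
  apply: vecC_ext => j; rewrite /wv /comb !coordE.
    rewrite ?xcoord_sum ?ycoord_sum.
    Local Transparent xcoord ycoord.
    rewrite /xcoord /ycoord mxE raddf_sum -sumrB; apply: eq_bigr => k _ /=.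
    by rewrite !mxE; case: (z 0 k) (t k 0 j) => [x y] [p q] /=; ring.
  rewrite ?xcoord_sum ?ycoord_sum /xcoord /ycoord mxE raddf_sum -big_split; apply: eq_bigr => k _ /=.
  by rewrite !mxE; case: (z 0 k) (t k 0 j) => [x y] [p q] /=; ring.
Local Opaque xcoord ycoord.
have Mu : M \in unitmx.
  rewrite -row_free_unit -kermx_eq0; apply/eqP/row_matrixP => k; rewrite row0.
  set z := row k _.
  have z0 : wv (\row_k complex.Re (z 0 k)) (\row_k complex.Im (z 0 k)) = 0.
    by rewrite -zM /z -row_mul mulmx_ker row0.
  have [|_ [q1 q2]] := @normal_parts (\row_k complex.Re (z 0 k)) (\row_k complex.Im (z 0 k)).
    by move=> m; rewrite z0 euclid0l.
  rewrite z0 euclid0l in q1.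
  have ha := sqn_ge0 (\row_k complex.Re (z 0 k)).
  have /sqn_eq0 /rowP A0 : sqn (\row_k complex.Re (z 0 k)) = 0 by lra.
  have /sqn_eq0 /rowP B0 : sqn (\row_k complex.Im (z 0 k)) = 0 by lra.
  apply/rowP => i; have := A0 i; have := B0 i; rewrite /z.
  rewrite ![(\row_k _) 0 i]mxE ![(0 : 'rV_n) 0 i]mxE.
  by move=> h1 h2; apply/eqP; rewrite eq_complex h1 h2 /= eqxx.
by exists (\row_k complex.Re ((v *m invmx M) 0 k)), (\row_k complex.Im ((v *m invmx M) 0 k));
  rewrite -zM -mulmxA (mulVmx Mu) mulmx1.
Qed.

Lemma normal_omega v w : (forall m, euclid v (t m) = 0) -> (forall m, euclid w (t m) = 0) ->
  - omega v w <= 2 * d * (euclid v v + euclid w w).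
Proof.
move=> hv hw; have [a [b vE]] := wv_surj v; have [a' [b' wE]] := wv_surj w.
subst v w; have [E [q1 q2]] := normal_parts hv; have [E' [q1' q2']] := normal_parts hw.
have -> : omega (wv a b) (wv a' b') = omega (comb a t) (comb a' t) - omega (comb b t) (comb b' t).
  (* The four terms are omega (a, a') + <a, b'> - <b, a'> + omega (b, b'). By [E] and [E'] each of
     the two middle terms equals - omega (b, b'). *)
  rewrite /wv omegaDl !omegaDr !omegaJr !omegaJl E.
  rewrite (euclidC (comb b t)) E' opprK -/(omega (comb b t) (comb b' t)).
  by rewrite (omegaC (comb b' t)) addNr addr0.
rewrite q1 q1'.
exact: (normal_omega_real (sqn_ge0 a) (sqn_ge0 a') q2 q2' (small_abs a a') (small_abs b b')).
Qed.

End NormalOmega.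

End OrthonormalFrames.

(** * Maximum principle for the symplectic form *)

Section LineTests.
Context {R : realType}.

Lemma min_derive0 (U : set R) (f : R -> R) : open U -> U 0 -> Cinf U f ->
  (forall h, U h -> f 0 <= f h) -> 'D_1 f 0 = 0.
Proof.
move=> oU U0 Cf mf; have [r r0 hU] := open_ballP oU U0.
have itvU t : t \in `]- r, r[ -> U t.
  by rewrite in_itv /= => /andP[t1 t2]; apply: hU; rewrite subr0 ltr_norml t1 t2.
have [||||_ ->//] := @derive1_at_min R f (- r) r 0.
- lra.
- by move=> t /itvU Ut; exact: (Cinf_derivable (1 : R) Cf Ut).
- by rewrite in_itv /=; apply/andP; split; lra.
- by move=> t /itvU /mf.
Qed.

(** If [f2 0] were negative, it would be so on a short interval to the right of 0, and two mean
    value theorems would give f h - f 0 = f2 (c') c h < 0. *)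
Lemma min_second_ge0 (U : set R) (f f1 f2 : R -> R) : open U -> U 0 ->
  (forall x, U x -> is_derive x 1 f (f1 x)) -> (forall x, U x -> is_derive x 1 f1 (f2 x)) ->
  {for 0, continuous f2} -> f1 0 = 0 ->
  (forall h, U h -> f 0 <= f h) -> 0 <= f2 0.
Proof.
move=> oU U0 d1 d2 c2 f10 mf; rewrite leNgt; apply/negP => neg.
have e0 : 0 < - f2 0 by rewrite oppr_gt0.
have [r r0 hr] := cont2_ball oU U0 c2 c2 e0.
have [h h0 hE] : exists2 h : R, 0 < h & h < r by exists (r / 2); lra.
have hU (t : R) : 0 <= t <= h -> U t /\ f2 t < 0.
  move=> /andP[t0 t1]; have tr : `|t - 0| < r.
    by rewrite subr0 ger0_norm // (le_lt_trans t1).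
  have [Ut + _] := hr t tr; rewrite ltr_norml => /andP[_ h2]; split=> //; lra.
have mvt (g g1 : R -> R) (b : R) : 0 < b -> b <= h -> (forall x, U x -> is_derive x 1 g (g1 x)) ->
    exists2 c : R, 0 < c < b & g b - g 0 = g1 c * b.
  move=> b0 bh dg; have [||c] := @MVT R g g1 0 b b0.
  - move=> x; rewrite in_itv /= => /andP[x0 xb]; apply: dg.
    by have [|Ux _] := hU x; first by apply/andP; split; lra.
  - apply: continuous_in_subspaceT => x; rewrite inE /= in_itv /= => /andP[x0 xb].
    have [|Ux _] := hU x; first by apply/andP; split; lra.
    by apply: differentiable_continuous; apply/derivable1_diffP; have [] := dg x Ux.
  - by rewrite in_itv /= subr0; exists c.
have [c /andP[c0 ch] E1] := mvt f f1 h h0 (lexx _) d1.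
have [c' /andP[c0' ch'] E2] := mvt f1 f2 c c0 (ltW ch) d2.
have [|_ neg'] := hU c'; first by apply/andP; split; lra.
have [|Uh _] := hU h; first by rewrite lexx ltW.
have := mf h Uh; rewrite -subr_ge0 E1; rewrite f10 subr0 in E2; rewrite E2 leNgt => /negP; apply.
by rewrite -mulrA nmulr_rlt0 // mulr_gt0.
Qed.

Lemma min_derive2 (U : set R) (f : R -> R) : open U -> U 0 -> Cinf U f ->
  (forall h, U h -> f 0 <= f h) -> 0 <= 'D_1 (fun x => 'D_1 f x) 0.
Proof.
move=> oU U0 Cf mf; have C1 := Cinf_derive (1 : R) Cf; have C2 := Cinf_derive (1 : R) C1.
apply: (@min_second_ge0 U f (fun x => 'D_1 f x) (fun x => 'D_1 (fun x => 'D_1 f x) x) oU U0 _ _ (Cinf_cont C2 U0)).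
- by move=> x Ux; apply: derivableP; exact: (Cinf_derivable (1 : R) Cf Ux).
- by move=> x Ux; apply: derivableP; exact: (Cinf_derivable (1 : R) C1 Ux).
- exact: (min_derive0 oU U0 Cf mf).
- exact: mf.
Qed.

(** Minimality is known for earlier times alone, so the difference quotient is tested on negative
    increments, where it is at most 0. *)
Lemma left_min_derive_le0 (f : R -> R) (t0 r : R) : 0 < r -> derivable f t0 1 ->
  (forall t, t0 - r < t -> t <= t0 -> f t0 <= f t) -> 'D_1 f t0 <= 0.
Proof.
move=> r0 df mf; rewrite leNgt; apply/negP => pos.
have : \forall h \near 0^', 0 < h^-1 *: ((f \o shift t0) (h *: 1) - f t0).
  by apply: cvgr_gt pos; exact: df.
rewrite /dnbhs /within => /nbhs_normP [e e0 he].
pose h := - (Num.min e r / 2).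
have m0 : 0 < Num.min e r by rewrite lt_min e0 r0.
have hn : h < 0 by rewrite oppr_lt0 divr_gt0.
have he' : `|h - 0| < e.
  rewrite subr0 ltr0_norm // opprK (@lt_le_trans _ _ (Num.min e r)) // ?ge_min ?lexx //.
  lra.
have hr : t0 - r < h + t0.
  have : Num.min e r <= r by rewrite ge_min lexx orbT.
  rewrite /h; lra.
have hn0 : h != 0 by rewrite lt_eqF.
have := he h he' hn0; rewrite /= [h%:A]mulr1 /GRing.scale /= nmulr_rgt0 ?invr_lt0 // subr_lt0 ltNge => /negP; apply.
apply: mf; [by []|lra].
Qed.

End LineTests.

Section VectorDerivatives.
Context {R : realType} {n : nat}.
Local Notation Cn := 'rV[R[i]]_n.
Implicit Types V : normedModType R.

Lemma derivableC_cst V (v : V) (c : Cn) x : derivableC v (fun=> c) x.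
Proof. by move=> j; split; exact: derivable_cst. Qed.

Lemma derivC_cst V (v : V) (c : Cn) x : derivC v (fun=> c) x = 0.
Proof. by apply: vecC_ext => j; rewrite ?xcoord_derivC ?ycoord_derivC coordE derive_cst. Qed.

Lemma derivableCD V (v : V) (f g : V -> Cn) x : derivableC v f x -> derivableC v g x ->
  derivableC v (fun y => f y + g y) x.
Proof.
move=> df dg j; have [d1 d2] := df j; have [d3 d4] := dg j; split.
  by under eq_fun do rewrite coordE; exact: derivableD.
by under eq_fun do rewrite coordE; exact: derivableD.
Qed.

Lemma derivC_bigsum V (v : V) (I : Type) (s : seq I) (f : I -> V -> Cn) x :
  (forall i, derivableC v (f i) x) ->
  derivableC v (fun y => \sum_(i <- s) f i y) x /\
  derivC v (fun y => \sum_(i <- s) f i y) x = \sum_(i <- s) derivC v (f i) x.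
Proof.
move=> df; elim: s => [|i s [IH1 IH2]].
  by under eq_fun do rewrite big_nil; rewrite big_nil derivC_cst; split=> //; exact: derivableC_cst.
under eq_fun do rewrite big_cons; rewrite big_cons; split; first exact: derivableCD.
by rewrite (derivCD (df i) IH1) IH2.
Qed.

Lemma derivCN V (v : V) (f : V -> Cn) x : derivableC v f x ->
  derivC v (fun y => - f y) x = - derivC v f x.
Proof.
move=> df; apply: vecC_ext => j; have [d1 d2] := df j.
  by rewrite coordE !xcoord_derivC; under eq_fun do rewrite coordE; rewrite (deriveN d1).
by rewrite coordE !ycoord_derivC; under eq_fun do rewrite coordE; rewrite (deriveN d2).
Qed.

Lemma CinfC_comb V (U : set V) (a : V -> 'rV[R]_n) (tau : V -> 'I_n -> Cn) : open U ->
  (forall k, Cinf U (fun y => a y 0 k)) -> (forall k, CinfC U (fun y => tau y k)) ->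
  CinfC U (fun y => comb (a y) (tau y)).
Proof. by move=> oU Ca Ct; apply: CinfC_sum => // k; exact: CinfCZ. Qed.

Lemma CinfC_nrm V (U : set V) (tau : V -> 'I_n -> Cn) (w : V -> Cn) : open U ->
  (forall k, CinfC U (fun y => tau y k)) ->
  (forall i j, Cinf U (fun y => invmx (gram (tau y)) i j)) -> CinfC U w ->
  CinfC U (fun y => nrm (tau y) (w y)).
Proof.
move=> oU Ct Ci Cw; rewrite /nrm; apply: CinfCD => //.
apply: CinfCN => //; apply: CinfC_sum => // k; apply: CinfC_sum => // l.
by apply: CinfCZ => //; apply: CinfM => //; exact: Cinf_euclid.
Qed.

Lemma derivC_comb V (U : set V) (v : V) (a : V -> 'rV[R]_n) (tau : V -> 'I_n -> Cn) x :
  open U -> U x -> (forall k, Cinf U (fun y => a y 0 k)) ->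
  (forall k, CinfC U (fun y => tau y k)) ->
  derivC v (fun y => comb (a y) (tau y)) x =
  comb (\row_k 'D_v (fun y => a y 0 k) x) (tau x) +
  comb (a x) (fun k => derivC v (fun y => tau y k) x).
Proof.
move=> oU Ux Ca Ct; rewrite /comb.
have d k : derivableC v (fun y => (a y 0 k)%:C *: tau y k) x.
  by apply: (CinfC_derivable v _ Ux); exact: CinfCZ.
have [_ ->] := derivC_bigsum (index_enum 'I_n) d.
rewrite -big_split /=; apply: eq_bigr => k _; rewrite mxE addrC.
apply: derivCZ; first exact: (Cinf_derivable v (Ca k) Ux).
exact: (CinfC_derivable v (Ct k) Ux).
Qed.

End VectorDerivatives.

Local Opaque Cinf CinfC gram nrm mcurv lH.

(** * Derivative of the mean curvature vector in a frame orthonormal at one point *)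

Section FrameDerivative.
Context {R : realType} {n : nat}.
Local Notation Cn := 'rV[R[i]]_n.
Local Notation Rn := 'rV[R]_n.
Variables (g : Rn -> Cn) (U : set Rn) (x0 : Rn) (A : 'M[R]_n).
Hypotheses (oU : open U) (Ux0 : U x0) (Cg : CinfC U g).
Hypothesis gu : forall x, U x -> gram (ltan g x) \in unitmx.
Hypothesis Au : A \in unitmx.
Hypothesis A1 : gram (fun i => comb (row i A) (ltan g x0)) = 1%:M.

Local Notation e i := (row i A : Rn).
(** The directions, rows of [A], are constant in the chart, so all derivatives along them commute;
    their images are orthonormal at [x0] only. [T] and [Hs] are given by equations rather than as
    definitions, which keeps them atomic under rewriting. *)
Variables (T : Rn -> 'I_n -> Cn) (Hs : Rn -> 'I_n -> 'I_n -> Cn).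
Hypothesis TE : T = fun x i => derivC (e i) g x.
Hypothesis HsE : Hs = fun x i j => derivC (e i) (derivC (e j) g) x.

Lemma frameTE x : U x -> T x = fun i => comb (row i A) (ltan g x).
Proof. by move=> Ux; rewrite TE; apply/funext => i; rewrite (ltan_comb _ oU Ux Cg). Qed.

Lemma frameT_unit x : U x -> gram (T x) \in unitmx.
Proof. by move=> Ux; rewrite (frameTE Ux); exact: (gram_reparam_unit (gu Ux) Au). Qed.

Lemma frameT1 : gram (T x0) = 1%:M.
Proof. by rewrite (frameTE Ux0). Qed.

Lemma frameT_Cinf i : CinfC U (fun x => T x i).
Proof. rewrite TE; exact: CinfC_derivC. Qed.

Lemma frameTg_Cinf i j : Cinf U (fun x => gram (T x) i j).
Proof.
under eq_fun do rewrite gramE.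
by apply: Cinf_euclid => //; exact: frameT_Cinf.
Qed.

Lemma frameTi_Cinf i j : Cinf U (fun x => invmx (gram (T x)) i j).
Proof. exact: (Cinf_invmx i j oU frameTg_Cinf frameT_unit). Qed.

Lemma frameHs_Cinf i j : CinfC U (fun x => Hs x i j).
Proof. rewrite HsE; by apply: CinfC_derivC; exact: CinfC_derivC. Qed.

(** The change of frame [A] is constant, so the tangential correction of [mcurv_reparam] is 0. *)
Lemma frame_lH x : U x -> lH g x = mcurv (T x) (Hs x).
Proof.
move=> Ux; rewrite (frameTE Ux).
have -> : lH g x = mcurv (ltan g x) (lhess g x) by [].
apply: esym; apply: (mcurv_reparam (gu Ux) Au (c := fun _ _ => 0)) => i j.
rewrite comb0 addr0.
have E : Hs x i j = derivC (e i) (fun y => comb (row j A) (ltan g y)) x.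
  by rewrite HsE; apply: (derivC_ext _ oU Ux) => y Uy; exact: (ltan_comb _ oU Uy Cg).
rewrite E.
have Cc k : Cinf U (fun _ : Rn => row j A 0 k) by exact: Cinf_cst.
have Ct k : CinfC U (fun x => ltan g x k) by exact: CinfC_derivC.
rewrite (ltan_comb (e i) oU Ux); last exact: CinfC_comb.
rewrite /comb; apply: eq_bigr => k _; rewrite /ltan (derivC_comb _ oU Ux Cc Ct).
rewrite (_ : \row_k _ = 0) ?comb0 ?add0r; last by apply/rowP => l; rewrite !mxE derive_cst.
rewrite /comb scaler_sumr; apply: eq_bigr => l _.
by rewrite scalerA -rmorphM !mxE.
Qed.

(** Differentiating G G^-1 = 1 at [x0], where the Gram matrix G is the identity, gives D (G^-1) = -
    D G. *)
Lemma derive_invgram a i j :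
  'D_a (fun x => invmx (gram (T x)) i j) x0 =
  - (euclid (derivC a (T^~ i) x0) (T x0 j) + euclid (T x0 i) (derivC a (T^~ j) x0)).
Proof.
have Cgr := frameTg_Cinf; have Ci := frameTi_Cinf.
have dM k l m : is_derive x0 a (fun x => gram (T x) k m * invmx (gram (T x)) m l)
   (gram (T x0) k m * 'D_a (fun x => invmx (gram (T x)) m l) x0 +
    invmx (gram (T x0)) m l * 'D_a (fun x => gram (T x) k m) x0).
  exact: (is_deriveM (derivableP (Cinf_derivable a (Cgr k m) Ux0))
     (derivableP (Cinf_derivable a (Ci m l) Ux0))).
have dS (s : seq 'I_n) k l : is_derive x0 a (fun x => \sum_(m <- s) gram (T x) k m * invmx (gram (T x)) m l)
   (\sum_(m <- s) (gram (T x0) k m * 'D_a (fun x => invmx (gram (T x)) m l) x0 +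
    invmx (gram (T x0)) m l * 'D_a (fun x => gram (T x) k m) x0)).
  elim: s => [|m s IH].
    by under eq_fun do rewrite big_nil; rewrite big_nil; exact: is_derive_cst.
  under eq_fun do rewrite big_cons; rewrite big_cons.
  exact: (is_deriveD (dM k l m) IH).
have [_ d1] := dS (index_enum 'I_n) i j.
have d2 : 'D_a (fun x => \sum_(m <- index_enum 'I_n) gram (T x) i m * invmx (gram (T x)) m j) x0 =
   'D_a (fun x : Rn => (1%:M : 'M[R]_n) i j) x0.
  apply: near_eq_derive; apply: (near_open_eq oU Ux0) => x Ux.
  by rewrite -(mulmxV (frameT_unit Ux)) mxE.
rewrite derive_cst d1 in d2.
rewrite frameT1 invmx1 big_split /= in d2.
rewrite (bigD1 i) //= [X in _ + X + _]big1 ?addr0 in d2; last first.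
  by move=> k ki; rewrite mxE eq_sym (negbTE ki) mul0r.
rewrite [X in _ + X](bigD1 j) //= [X in _ + (_ + X)]big1 ?addr0 in d2; last first.
  by move=> k kj; rewrite mxE (negbTE kj) mul0r.
rewrite ![1%:M _ _]mxE !eqxx !mul1r in d2.
apply/eqP; rewrite -addr_eq0; apply/eqP; rewrite -[RHS]d2; congr (_ + _).
rewrite -derive_euclid.
- by congr (derive _ x0 a); apply/funext => x; rewrite gramE.
- exact: (CinfC_derivable a (frameT_Cinf i) Ux0).
- exact: (CinfC_derivable a (frameT_Cinf j) Ux0).
Qed.

Lemma nrm_idem t v : gram t \in unitmx -> nrm t (nrm t v) = nrm t v :> Cn.
Proof.
move=> gt; rewrite -[X in nrm t X]addr0 -[X in _ + X](comb0 t) nrm_uniq //.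
by move=> m; exact: nrm_perp.
Qed.

Lemma nrmN t v : nrm t (- v) = - nrm t v :> Cn.
Proof. by have := nrmZ t (-1) v; rewrite rmorphN1 !scaleN1r. Qed.

(** With nrm Hs = Hs - comb rho T, the derivative of the coefficients [rho] is tangential and dies
    under [nrm]; the derivative of the frame survives, weighted by the tangential components of
    [Hs]. *)
Lemma nrm_derive_nrm a i j :
  nrm (T x0) (derivC a (fun x => nrm (T x) (Hs x i j)) x0) =
  nrm (T x0) (derivC a (Hs^~ i ^~ j) x0) -
  \sum_k (euclid (Hs x0 i j) (T x0 k))%:C *: nrm (T x0) (derivC a (T^~ k) x0).
Proof.
have Ci := frameTi_Cinf.
pose rho x : Rn := (\row_k euclid (Hs x i j) (T x k)) *m invmx (gram (T x)).
have Cr k : Cinf U (fun x => rho x 0 k).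
  under eq_fun do rewrite mxE.
  apply: Cinf_sum => // m _; apply: CinfM => //.
  under eq_fun do rewrite mxE; apply: Cinf_euclid => //; [exact: frameHs_Cinf|exact: frameT_Cinf].
have CTk k : CinfC U (fun x => T x k) by exact: frameT_Cinf.
under eq_fun do rewrite nrm_combE.
have Cc : CinfC U (fun x => comb (rho x) (T x)) by exact: CinfC_comb.
rewrite derivCD; last 2 first.
- exact: (CinfC_derivable a (frameHs_Cinf i j) Ux0).
- exact: (CinfC_derivable a (CinfCN oU Cc) Ux0).
rewrite derivCN; last exact: (CinfC_derivable a Cc Ux0).
rewrite (derivC_comb a oU Ux0 Cr CTk) nrmD nrmN nrmD nrm_comb ?add0r; last exact: frameT_unit.
congr (_ - _); rewrite /comb nrm_sum; apply: eq_bigr => k _.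
by rewrite nrmZ /rho frameT1 invmx1 mulmx1 mxE.
Qed.

Section Direction.
Variable a : Rn.
Variable P : 'I_n -> Cn.
Hypothesis PE : P = fun k => derivC (e k) (derivC a g) x0.

Lemma P_swap k : derivC a (T^~ k) x0 = P k.
Proof. rewrite TE PE; exact: (ClairautC a (e k) oU Ux0 Cg). Qed.

Lemma third_swap i : derivC a (fun x => Hs x i i) x0 =
  derivC (e i) (derivC (e i) (derivC a g)) x0.
Proof.
have C1 : CinfC U (derivC (e i) g) by exact: CinfC_derivC.
rewrite HsE (ClairautC a (e i) oU Ux0 C1).
by apply: (derivC_ext _ oU Ux0) => y Uy; rewrite (ClairautC a (e i) oU Uy Cg).
Qed.

(** The three sums come from differentiating, in turn, the second derivatives of the immersion, the
    normal projection and the inverse metric. The factor 2 merges the two halves of the derivative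
    of the metric, by symmetry of [Hs]. *)
Lemma nrm_derive_lH : nrm (T x0) (derivC a (lH g) x0) =
  \sum_i nrm (T x0) (derivC (e i) (derivC (e i) (derivC a g)) x0) -
  \sum_i \sum_k (euclid (Hs x0 i i) (T x0 k))%:C *: nrm (T x0) (P k) -
  \sum_i \sum_j (2 * euclid (P i) (T x0 j))%:C *: nrm (T x0) (Hs x0 i j).
Proof.
have Ci := frameTi_Cinf.
have CN i j : CinfC U (fun x => nrm (T x) (Hs x i j)).
  exact: (CinfC_nrm oU frameT_Cinf frameTi_Cinf (frameHs_Cinf i j)).
have -> : derivC a (lH g) x0 = derivC a (fun x => \sum_i \sum_j
   (invmx (gram (T x)) i j)%:C *: nrm (T x) (Hs x i j)) x0.
  by apply: (derivC_ext _ oU Ux0) => x Ux; exact: frame_lH.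
have dN i j : derivableC a (fun x => (invmx (gram (T x)) i j)%:C *: nrm (T x) (Hs x i j)) x0.
  by apply: (CinfC_derivable a _ Ux0); exact: CinfCZ.
have [_ ->] := derivC_bigsum (index_enum 'I_n) (fun i => proj1 (derivC_bigsum (index_enum 'I_n) (dN i))).
under eq_bigr do rewrite (proj2 (derivC_bigsum (index_enum 'I_n) (dN _))).
have dE i j : derivC a (fun x => (invmx (gram (T x)) i j)%:C *: nrm (T x) (Hs x i j)) x0 =
  ((i == j)%:R : R)%:C *: derivC a (fun x => nrm (T x) (Hs x i j)) x0 -
  (euclid (P i) (T x0 j) + euclid (T x0 i) (P j))%:C *: nrm (T x0) (Hs x0 i j).
  rewrite derivCZ; last 2 first.
  - exact: (Cinf_derivable a (Ci i j) Ux0).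
  - exact: (CinfC_derivable a (CN i j) Ux0).
  by rewrite derive_invgram !P_swap frameT1 invmx1 mxE rmorphN scaleNr.
have uT := frameT_unit Ux0.
rewrite nrm_sum; under eq_bigr => i _.
  rewrite nrm_sum; under eq_bigr => j _.
    rewrite dE nrmD nrmN !nrmZ nrm_idem //; over.
  rewrite sumrB (bigD1 i) //= eqxx scale1r big1 ?addr0; last first.
    by move=> j ji; rewrite eq_sym (negbTE ji) scale0r.
  rewrite nrm_derive_nrm; over.
rewrite sumrB; congr (_ - _).
  under eq_bigr do (rewrite third_swap; under eq_bigr do rewrite P_swap).
  by rewrite sumrB.
have HsC i j : Hs x0 i j = Hs x0 j i by rewrite HsE; exact: (ClairautC (e i) (e j) oU Ux0 Cg).
transitivity (\sum_i \sum_j (euclid (P i) (T x0 j))%:C *: nrm (T x0) (Hs x0 i j) +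
   \sum_i \sum_j (euclid (T x0 i) (P j))%:C *: nrm (T x0) (Hs x0 i j)).
  rewrite -big_split; apply: eq_bigr => i _; rewrite -big_split; apply: eq_bigr => j _ /=.
  by rewrite rmorphD scalerDl.
rewrite [X in _ + X]exchange_big /= -big_split; apply: eq_bigr => i _.
rewrite -big_split; apply: eq_bigr => j _ /=.
by rewrite (HsC j i) (euclidC (T x0 j)) -scalerDl -rmorphD -mulr2n mulr_natl.
Qed.

End Direction.
End FrameDerivative.

Section LineContact.
Context {R : realType} {n : nat}.
Local Notation Cn := 'rV[R[i]]_n.

Lemma derivC_line (V : normedModType R) (U : set V) (tau : V -> Cn) (x e : V) (h : R) :
  CinfC U tau -> U (x + h *: e) ->
  derivC (1 : R) (fun s => tau (x + s *: e)) h = derivC e tau (x + h *: e).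
Proof.
move=> Ct Uh; have dt := CinfC_derivable e Ct Uh.
apply: vecC_ext => j; have [d1 d2] := dt j.
  by rewrite !xcoord_derivC; have [_ ->] := derivable_line d1.
by rewrite !ycoord_derivC; have [_ ->] := derivable_line d2.
Qed.

Lemma derive_contact (d : R) (V : normedModType R) (U : set V) (E F : V -> Cn) v x : U x ->
  CinfC U E -> CinfC U F ->
  is_derive x v (fun y => d * (euclid (E y) (E y) + euclid (F y) (F y)) - omega (E y) (F y))
   (d * (2 * euclid (derivC v E x) (E x) + 2 * euclid (derivC v F x) (F x)) -
    omega (derivC v E x) (F x) - omega (E x) (derivC v F x)).
Proof.
move=> Ux CE CF; have dE := CinfC_derivable v CE Ux; have dF := CinfC_derivable v CF Ux.
have i1 := is_derive_euclid dE dE; have i2 := is_derive_euclid dF dF.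
have i3 := is_derive_omega dE dF.
have i4 := is_deriveB (is_deriveM (is_derive_cst d x v) (is_deriveD i1 i2)) i3.
apply: (is_derive_eq i4); rewrite /GRing.scale /= mulr0 addr0.
rewrite (euclidC (E x) (derivC v E x)) (euclidC (F x) (derivC v F x)); ring.
Qed.

Lemma derive_contact2 (d : R) (V : normedModType R) (U : set V) (E F : V -> Cn) v x :
  open U -> U x -> CinfC U E -> CinfC U F ->
  'D_v (fun y => d * (2 * euclid (derivC v E y) (E y) + 2 * euclid (derivC v F y) (F y)) -
    omega (derivC v E y) (F y) - omega (E y) (derivC v F y)) x =
  d * (2 * euclid (derivC v (derivC v E) x) (E x) + 2 * euclid (derivC v (derivC v F) x) (F x)) -
    omega (derivC v (derivC v E) x) (F x) - omega (E x) (derivC v (derivC v F) x) +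
  (2 * d * (euclid (derivC v E x) (derivC v E x) + euclid (derivC v F x) (derivC v F x)) -
    2 * omega (derivC v E x) (derivC v F x)).
Proof.
move=> oU Ux CE CF; have CE' := CinfC_derivC v CE; have CF' := CinfC_derivC v CF.
have dE := CinfC_derivable v CE Ux; have dF := CinfC_derivable v CF Ux.
have dE' := CinfC_derivable v CE' Ux; have dF' := CinfC_derivable v CF' Ux.
have i1 := is_derive_euclid dE' dE; have i2 := is_derive_euclid dF' dF.
have i3 := is_derive_omega dE' dF; have i4 := is_derive_omega dE dF'.
have j1 := is_deriveM (is_derive_cst (2 : R) x v) i1.
have j2 := is_deriveM (is_derive_cst (2 : R) x v) i2.
have j3 := is_deriveM (is_derive_cst d x v) (is_deriveD j1 j2).
have [_ ->] := is_deriveB (is_deriveB j3 i3) i4.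
rewrite /GRing.scale /= !mulr0 !addr0; ring.
Qed.

(** The second derivative is split into a part linear in the accelerations, the form later named
    [Lam], and a part quadratic in the velocities. The first will be matched with the time
    derivative, the second estimated. *)
Lemma line_contact (d : R) (U : set R) (E F : R -> Cn) : open U -> U 0 ->
  CinfC U E -> CinfC U F ->
  (forall h, U h -> omega (E h) (F h) <= d * (euclid (E h) (E h) + euclid (F h) (F h))) ->
  omega (E 0) (F 0) = d * (euclid (E 0) (E 0) + euclid (F 0) (F 0)) ->
  d * (2 * euclid (derivC (1 : R) E 0) (E 0) + 2 * euclid (derivC (1 : R) F 0) (F 0)) -
    omega (derivC (1 : R) E 0) (F 0) - omega (E 0) (derivC (1 : R) F 0) = 0 /\
  0 <= d * (2 * euclid (derivC (1 : R) (derivC (1 : R) E) 0) (E 0) +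
            2 * euclid (derivC (1 : R) (derivC (1 : R) F) 0) (F 0)) -
    omega (derivC (1 : R) (derivC (1 : R) E) 0) (F 0) -
    omega (E 0) (derivC (1 : R) (derivC (1 : R) F) 0) +
  (2 * d * (euclid (derivC (1 : R) E 0) (derivC (1 : R) E 0) +
            euclid (derivC (1 : R) F 0) (derivC (1 : R) F 0)) -
    2 * omega (derivC (1 : R) E 0) (derivC (1 : R) F 0)).
Proof.
move=> oU U0 CE CF le0 eq0.
pose s (h : R) := d * (euclid (E h) (E h) + euclid (F h) (F h)) - omega (E h) (F h).
have Cs : Cinf U s.
  apply: CinfB => //; last exact: Cinf_omega.
  by apply: CinfM => //; [exact: Cinf_cst|apply: CinfD => //; exact: Cinf_euclid].
have s0 : s 0 = 0 by rewrite /s eq0 subrr.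
have ms h : U h -> s 0 <= s h by move=> Uh; rewrite s0 /s subr_ge0 le0.
have D1 h : U h -> is_derive h (1 : R) s (d * (2 * euclid (derivC (1 : R) E h) (E h) +
    2 * euclid (derivC (1 : R) F h) (F h)) -
    omega (derivC (1 : R) E h) (F h) - omega (E h) (derivC (1 : R) F h)).
  by move=> Uh; exact: (derive_contact d (1 : R) Uh CE CF).
split; first by have [_ <-] := D1 0 U0; exact: (min_derive0 oU U0 Cs ms).
rewrite -(derive_contact2 d (1 : R) oU U0 CE CF).
rewrite (_ : 'D_(1 : R) _ 0 = 'D_(1 : R) (fun h => 'D_(1 : R) s h) 0); first exact: (min_derive2 oU U0 Cs ms).
apply: near_eq_derive; apply: (near_open_eq oU U0) => h Uh.
by have [_ ->] := D1 h Uh.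
Qed.

End LineContact.

Section GoodField.
Context {R : realType} {n : nat}.
Local Notation Cn := 'rV[R[i]]_n.
Local Notation Rn := 'rV[R]_n.
Variables (g : Rn -> Cn) (U : set Rn) (x0 : Rn) (A : 'M[R]_n).
Hypotheses (oU : open U) (Ux0 : U x0) (Cg : CinfC U g).
Hypothesis gu : forall x, U x -> gram (ltan g x) \in unitmx.
Hypothesis Au : A \in unitmx.
Hypothesis A1 : gram (fun i => comb (row i A) (ltan g x0)) = 1%:M.
Local Notation e i := (row i A : Rn).
Variables (T : Rn -> 'I_n -> Cn) (Hs : Rn -> 'I_n -> 'I_n -> Cn).
Hypothesis TE : T = fun x i => derivC (e i) g x.
Hypothesis HsE : Hs = fun x i j => derivC (e i) (derivC (e j) g) x.

Lemma derivC_frame x (al : Rn) : U x -> derivC (al *m A) g x = comb al (T x).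
Proof.
move=> Ux; rewrite (ltan_comb _ oU Ux Cg) (frameTE oU Cg TE Ux).
by rewrite comb_reparam.
Qed.

Lemma open_line i : open [set h : R | U (x0 + h *: e i)].
Proof.
have c : continuous (fun h : R => x0 + h *: e i).
  move=> h; apply: cvgD; first exact: cvg_cst.
  by apply: cvgZ; [exact: cvg_id|exact: cvg_cst].
by move: oU; apply: open_comp => h _; exact: c.
Qed.

Lemma line0 i : [set h : R | U (x0 + h *: e i)] 0.
Proof. by rewrite /= scale0r addr0. Qed.

Lemma CinfC_line i (tau : Rn -> Cn) : CinfC U tau ->
  CinfC [set h : R | U (x0 + h *: e i)] (fun h => tau (x0 + h *: e i)).
Proof.
move=> Ct; have oW : open [set h : R | U (x0 + h *: e i)] by exact: open_line.
apply: (CinfC_comp (fincoord_rV n) oU oW _ Ct) => // k.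
rewrite (_ : (fun h : R => _) = fun h => x0 0 k + h * A i k); last first.
  by apply/funext => h; rewrite !mxE.
apply: CinfD => //; first exact: Cinf_cst.
by apply: CinfM => //; [exact: Cinf_id|exact: Cinf_cst].
Qed.

Variable al : Rn.
Variables P Th : 'I_n -> Cn.
Hypothesis PE : P = fun k => derivC (e k) (derivC (al *m A) g) x0.
Hypothesis ThE : Th = fun k => derivC (e k) (derivC (e k) (derivC (al *m A) g)) x0.

(** The factor 2^-1 makes [b] and [c] the first and second derivatives at 0. *)
Definition quad_path (a b c : Rn) (h : R) : Rn := a + h *: b + (2^-1 * h ^+ 2) *: c.

Lemma Cinf_quad_path (W : set R) a b c k : open W -> Cinf W (fun h => quad_path a b c h 0 k).
Proof.
move=> oW; under eq_fun do rewrite !mxE.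
apply: CinfD => //; [apply: CinfD => //|]; [exact: Cinf_cst| |].
  by apply: CinfM => //; [exact: Cinf_id|exact: Cinf_cst].
apply: CinfM => //; last exact: Cinf_cst.
by apply: CinfM => //; [exact: Cinf_cst|under eq_fun do rewrite expr2; apply: CinfM => //; exact: Cinf_id].
Qed.

Lemma derive_quad_path a b c h :
  \row_k 'D_(1 : R) (fun h => quad_path a b c h 0 k) h = b + h *: c.
Proof.
apply/rowP => k; rewrite mxE.
have E : (fun h => quad_path a b c h 0 k) = fun h => a 0 k + h * b 0 k + 2^-1 * (h * h) * c 0 k.
  by apply/funext => s; rewrite !mxE expr2.
rewrite E.
have i0 := is_derive_id h (1 : R).
have i1 := is_deriveM i0 (is_derive_cst (b 0 k) h (1 : R)).
have i2 := is_deriveM (is_deriveM (is_derive_cst (2^-1 : R) h (1 : R)) (is_deriveM i0 i0))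
  (is_derive_cst (c 0 k) h (1 : R)).
have [_ ->] := is_deriveD (is_deriveD (is_derive_cst (a 0 k) h (1 : R)) i1) i2.
rewrite !mxE /GRing.scale /= !mulr0 !add0r !addr0 !mulr1; by field.
Qed.

Lemma path_derive i (a b c : Rn) h : U (x0 + h *: e i) ->
  derivC (1 : R) (fun h => comb (quad_path a b c h) (T (x0 + h *: e i))) h =
  comb (b + h *: c) (T (x0 + h *: e i)) + comb (quad_path a b c h) (Hs (x0 + h *: e i) i).
Proof.
move=> Uh; have oW : open [set h : R | U (x0 + h *: e i)] by exact: open_line.
rewrite (derivC_comb (1 : R) oW (x := h) Uh); last 2 first.
- by move=> k; exact: Cinf_quad_path.
- by move=> k; apply: (CinfC_line i (tau := fun x => T x k)); exact: (frameT_Cinf Cg TE).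
rewrite derive_quad_path; congr (_ + _); congr comb; apply/funext => k.
rewrite (derivC_line (tau := fun x => T x k) (frameT_Cinf Cg TE k) Uh).
by rewrite TE HsE.
Qed.

Lemma path_derive2 i (a b c : Rn) :
  derivC (1 : R) (derivC (1 : R) (fun h => comb (quad_path a b c h) (T (x0 + h *: e i)))) 0 =
  comb c (T x0) + (comb b (Hs x0 i) + comb b (Hs x0 i)) +
  comb a (fun k => derivC (e i) (fun x => Hs x i k) x0).
Proof.
have oW : open [set h : R | U (x0 + h *: e i)] by exact: open_line.
have W0 : [set h : R | U (x0 + h *: e i)] 0 by exact: line0.
have CT k : CinfC [set h : R | U (x0 + h *: e i)] (fun h => T (x0 + h *: e i) k).
  by apply: (CinfC_line i (tau := fun x => T x k)); exact: (frameT_Cinf Cg TE).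
have CH k : CinfC [set h : R | U (x0 + h *: e i)] (fun h => Hs (x0 + h *: e i) i k).
  by apply: (CinfC_line i (tau := fun x => Hs x i k)); exact: (frameHs_Cinf Cg HsE).
have Cq a' b' c' k : Cinf [set h : R | U (x0 + h *: e i)] (fun h => quad_path a' b' c' h 0 k).
  exact: Cinf_quad_path.
rewrite (derivC_ext (1 : R) oW W0 (g := fun h => comb (quad_path b c 0 h) (T (x0 + h *: e i)) +
   comb (quad_path a b c h) (Hs (x0 + h *: e i) i))); last first.
  by move=> h Uh; rewrite (path_derive _ _ _ Uh) /quad_path scaler0 addr0.
have C1 : CinfC [set h : R | U (x0 + h *: e i)] (fun h => comb (quad_path b c 0 h) (T (x0 + h *: e i))).
  exact: CinfC_comb.
have C2 : CinfC [set h : R | U (x0 + h *: e i)] (fun h => comb (quad_path a b c h) (Hs (x0 + h *: e i) i)).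
  exact: CinfC_comb.
rewrite (derivCD (CinfC_derivable (1 : R) C1 W0) (CinfC_derivable (1 : R) C2 W0)).
rewrite path_derive; last exact: W0.
rewrite (derivC_comb (1 : R) oW W0 (Cq a b c) CH) derive_quad_path.
rewrite /quad_path !scale0r expr0n /= mulr0 !scale0r !addr0 -!addrA; congr (_ + (_ + (_ + _))).
congr comb; apply/funext => k.
rewrite (derivC_line (tau := fun x => Hs x i k) (frameHs_Cinf Cg HsE i k) W0).
by rewrite scale0r addr0.
Qed.

Lemma P_comb k : P k = comb al (Hs x0 k).
Proof.
rewrite PE (derivC_ext (e k) oU Ux0 (g := fun x => comb al (T x))); last first.
  by move=> x Ux; exact: derivC_frame.
have Cc j : Cinf U (fun _ : Rn => al 0 j) by exact: Cinf_cst.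
rewrite (derivC_comb (e k) oU Ux0 Cc (frameT_Cinf Cg TE)).
rewrite (_ : \row_k _ = 0) ?comb0 ?add0r; last by apply/rowP => l; rewrite !mxE derive_cst.
by rewrite TE HsE.
Qed.

Lemma Th_comb i : Th i = comb al (fun k => derivC (e i) (fun x => Hs x i k) x0).
Proof.
have Cc j : Cinf U (fun _ : Rn => al 0 j) by exact: Cinf_cst.
have z : \row_k 'D_(e i) (fun _ : Rn => al 0 k) x0 = 0 by apply/rowP => l; rewrite !mxE derive_cst.
have Cs k : CinfC U (fun x => Hs x i k) by exact: (frameHs_Cinf Cg HsE).
have -> : Th i = derivC (e i) (fun x => comb al (Hs x i)) x0.
  rewrite ThE; apply: (derivC_ext _ oU Ux0) => x Ux.
  rewrite (derivC_ext (e i) oU Ux (g := fun x => comb al (T x))); last first.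
    by move=> y Uy; exact: derivC_frame.
  rewrite (derivC_comb (e i) oU Ux Cc (frameT_Cinf Cg TE)).
  rewrite (_ : \row_k _ = 0) ?comb0 ?add0r; last by apply/rowP => l; rewrite !mxE derive_cst.
  by rewrite TE HsE.
by rewrite (derivC_comb (e i) oU Ux0 Cc Cs) z comb0 add0r.
Qed.

(* Along each line x0 + h e_i the direction al is prolonged by a quadratic path.
   Its linear part makes the derivative at 0 normal; its quadratic part is chosen
   so that the sum over i of the second derivatives reproduces the derivative of the
   mean curvature vector. *)
Lemma good_field : (0 < n)%N -> exists f : 'I_n -> R -> Rn,
  (forall i, CinfC [set h : R | U (x0 + h *: e i)]
     (fun h => comb (f i h) (T (x0 + h *: e i)))) /\
  [/\ (forall i, f i 0 = al),
   (forall i, derivC (1 : R) (fun h => comb (f i h) (T (x0 + h *: e i))) 0 = nrm (T x0) (P i)) &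
   \sum_i derivC (1 : R) (derivC (1 : R) (fun h => comb (f i h) (T (x0 + h *: e i)))) 0 -
   \sum_k (\sum_i euclid (Hs x0 i i) (T x0 k))%:C *: nrm (T x0) (P k) =
   derivC (al *m A) (lH g) x0].
Proof.
move=> n0.
have T1 : gram (T x0) = 1%:M := frameT1 oU Ux0 Cg A1 TE.
have Tu : gram (T x0) \in unitmx by rewrite T1 unitmx1.
(* Minus the tangential part of [P i] in frame coordinates, so that the velocity at 0 becomes the
   normal part of [P i]. *)
pose b i : Rn := - \row_j euclid (P i) (T x0 j).
have nrm1 v : nrm (T x0) v = v - comb (\row_k euclid v (T x0 k)) (T x0).
  by rewrite nrm_combE T1 invmx1 mulmx1.
(* The defect in the required identity when there is no quadratic term. By [nrm_derive_lH] its
   normal part is 0, so it is a combination [xi] of the frame, and each of the n lines absorbs - xi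
   / n. *)
pose Y := \sum_i (Th i + (comb (b i) (Hs x0 i) + comb (b i) (Hs x0 i))) -
  \sum_k (\sum_i euclid (Hs x0 i i) (T x0 k))%:C *: nrm (T x0) (P k) -
  derivC (al *m A) (lH g) x0.
pose xi : Rn := \row_k euclid Y (T x0 k).
have Y0 : nrm (T x0) Y = 0.
  rewrite /Y nrmD nrmN (nrm_derive_lH oU Ux0 Cg gu Au A1 TE HsE (a := al *m A) PE).
  rewrite nrmD nrmN !nrm_sum.
  have -> : \sum_i nrm (T x0) (Th i + (comb (b i) (Hs x0 i) + comb (b i) (Hs x0 i))) =
    \sum_i nrm (T x0) (Th i) - \sum_i \sum_j (2 * euclid (P i) (T x0 j))%:C *: nrm (T x0) (Hs x0 i j).
    rewrite -sumrB; apply: eq_bigr => i _; rewrite !nrmD; congr (_ + _).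
    rewrite /comb nrm_sum -big_split -sumrN; apply: eq_bigr => j _ /=.
    rewrite nrmZ -scalerDl -scaleNr -rmorphD -rmorphN; congr (_%:C *: _).
    by rewrite !mxE; ring.
  have -> : \sum_k nrm (T x0) ((\sum_i euclid (Hs x0 i i) (T x0 k))%:C *: nrm (T x0) (P k)) =
    \sum_i \sum_k (euclid (Hs x0 i i) (T x0 k))%:C *: nrm (T x0) (P k).
    rewrite exchange_big /=; apply: eq_bigr => k _.
    by rewrite nrmZ nrm_idem // rmorph_sum scaler_suml.
  have -> : \sum_i nrm (T x0) (Th i) =
    \sum_i nrm (T x0) (derivC (e i) (derivC (e i) (derivC (al *m A) g)) x0) by rewrite ThE.
  set X1 := (\sum_i nrm _ _); set X2 := (\sum_i \sum_j _); set X3 := (\sum_i \sum_k _).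
  by rewrite (addrAC X1 (- X3)) subrr.
have YE : Y = comb xi (T x0) by rewrite -[LHS](subrK (comb xi (T x0))) -nrm1 Y0 add0r.
exists (fun i => quad_path al (b i) (- (n%:R^-1 *: xi))); split.
  move=> i; apply: CinfC_comb; first exact: open_line.
    by move=> k; apply: Cinf_quad_path; exact: open_line.
  by move=> k; apply: (CinfC_line i (tau := fun x => T x k)); exact: (frameT_Cinf Cg TE).
split.
- by move=> i; rewrite /quad_path expr0n /= mulr0 !scale0r !addr0.
- move=> i; rewrite path_derive; last exact: line0.
  rewrite /quad_path expr0n /= mulr0 !scale0r !addr0 -P_comb nrm1 addrC; congr (_ + _).
  by rewrite comb_opp.
- under eq_bigr do rewrite path_derive2 -Th_comb -addrA.
  rewrite big_split /= sumr_const card_ord comb_opp combZ.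
  rewrite -scaleNr -scaler_nat scalerA.
  have -> : n%:R * - (n%:R^-1 : R)%:C = -1 :> R[i].
    rewrite mulrN rmorphV ?unitfE ?pnatr_eq0 -?lt0n // rmorph_nat mulfV // pnatr_eq0 -lt0n //.
  rewrite scaleN1r -YE /Y.
  have eqS : \sum_(i < n) (comb (b i) (Hs x0 i) + comb (b i) (Hs x0 i) + Th i) =
    \sum_i (Th i + (comb (b i) (Hs x0 i) + comb (b i) (Hs x0 i))).
    by apply: eq_bigr => i _; rewrite addrC.
  rewrite eqS.
  by rewrite opprB -[LHS]addrA subrK.
Qed.

End GoodField.

Section ContactForm.
Context {R : realType} {n : nat}.
Local Notation Cn := 'rV[R[i]]_n.

(* The derivative of d (|E|^2 + |F|^2) - omega E F at E = u, F = v in the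
   direction (X, Y). *)
Definition Lam (d : R) (u v X Y : Cn) : R :=
  d * (2 * euclid X u + 2 * euclid Y v) - omega X v - omega u Y.

Lemma LamD d u v X Y X' Y' : Lam d u v (X + X') (Y + Y') = Lam d u v X Y + Lam d u v X' Y'.
Proof. by rewrite /Lam !euclidDl omegaDl omegaDr; ring. Qed.

Lemma LamZ d u v (r : R) X Y : Lam d u v (r%:C *: X) (r%:C *: Y) = r * Lam d u v X Y.
Proof. by rewrite /Lam !euclidZl omegaZl omegaZr; ring. Qed.

Lemma Lam_sum d u v (I : Type) (s : seq I) (f g : I -> Cn) :
  Lam d u v (\sum_(i <- s) f i) (\sum_(i <- s) g i) = \sum_(i <- s) Lam d u v (f i) (g i).
Proof.
elim: s => [|i s IH]; last by rewrite !big_cons LamD IH.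
by rewrite !big_nil /Lam !euclid0l omega0l omega0r; ring.
Qed.

(** [Z] differs from the sum of the accelerations by multiples of the velocities, and on those [Lam]
    vanishes because the contact is critical along each line. *)
Lemma Lam_balance d u v (m : nat) (X Y N N' : 'I_m -> Cn) (r : 'I_m -> R) Z Z' :
  \sum_i X i - \sum_k (r k)%:C *: N k = Z -> \sum_i Y i - \sum_k (r k)%:C *: N' k = Z' ->
  (forall k, Lam d u v (N k) (N' k) = 0) -> Lam d u v Z Z' = \sum_i Lam d u v (X i) (Y i).
Proof.
move=> <- <- h; rewrite -!sumrN LamD !Lam_sum [X in _ + X]big1 ?addr0 // => k _.
by rewrite -!scaleNr -rmorphN LamZ h mulr0.
Qed.

End ContactForm.

Section SlicesC.
Context {R : realType} {n : nat}.
Local Notation Cn := 'rV[R[i]]_n.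
Implicit Types V W : normedModType R.

Lemma derivC_slice1 V W (f : V * W -> Cn) (v x : V) (t : W) :
  derivC v (fun y => f (y, t)) x = derivC ((v, 0) : V * W) f (x, t).
Proof.
apply: vecC_ext => j; [rewrite !xcoord_derivC|rewrite !ycoord_derivC].
  exact: (derive_slice1 (fun p => xcoord (f p) j)).
exact: (derive_slice1 (fun p => ycoord (f p) j)).
Qed.

Lemma derivC_slice2 V W (f : V * W -> Cn) (w t : W) (x : V) :
  derivC w (fun s => f (x, s)) t = derivC ((0, w) : V * W) f (x, t).
Proof.
apply: vecC_ext => j; [rewrite !xcoord_derivC|rewrite !ycoord_derivC].
  exact: (derive_slice2 (fun p => xcoord (f p) j)).
exact: (derive_slice2 (fun p => ycoord (f p) j)).
Qed.

Local Transparent Cinf CinfC.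

Lemma CinfC_slice1 V W (U : set (V * W)) (f : V * W -> Cn) (t : W) : open U ->
  CinfC U f -> CinfC [set y | U (y, t)] (fun y => f (y, t)).
Proof.
move=> oU Cf j; have [h1 h2] := Cf j; split => k.
  exact: (Ck_slice1 (f := fun p => xcoord (f p) j) t oU (h1 k)).
exact: (Ck_slice1 (f := fun p => ycoord (f p) j) t oU (h2 k)).
Qed.

Lemma CinfC_slice2 V W (U : set (V * W)) (f : V * W -> Cn) (x : V) : open U ->
  CinfC U f -> CinfC [set s | U (x, s)] (fun s => f (x, s)).
Proof.
move=> oU Cf j; have [h1 h2] := Cf j; split => k.
  exact: (Ck_slice2 (f := fun p => xcoord (f p) j) x oU (h1 k)).
exact: (Ck_slice2 (f := fun p => ycoord (f p) j) x oU (h2 k)).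
Qed.

Local Opaque Cinf CinfC.
End SlicesC.

(** From - w <= 2 D (p + q), the quadratic part 2 D (p + q) - 2 w is at most 6 D (p + q): 2 from the
    norms and 4 from omega. This is the 6 in the lower bound on C. *)
Lemma contact_remainder (R : realType) (D K w p q A B : R) : 0 < D ->
  - w <= 2 * D * (p + q) -> p <= K * A -> q <= K * B ->
  2 * D * (p + q) - 2 * w <= 6 * K * (D * (A + B)).
Proof.
move=> D0 No k1 k2.
have h1 : D * p <= D * (K * A) by rewrite ler_pM2l.
have h2 : D * q <= D * (K * B) by rewrite ler_pM2l.
have -> : 6 * K * (D * (A + B)) = 6 * (D * (K * A)) + 6 * (D * (K * B)) by ring.
have e1 : 2 * D * (p + q) = 2 * (D * p) + 2 * (D * q) by ring.
rewrite e1 in No *; lra.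
Qed.

Lemma sum_add_bound_ge0 (R : realType) m (X r : 'I_m -> R) (B : R) :
  (forall i, 0 <= X i + r i) -> (forall i, r i <= B) -> 0 <= \sum_i X i + m%:R * B.
Proof.
move=> h1 h2; have -> : m%:R * B = \sum_(i < m) B by rewrite sumr_const card_ord mulr_natl.
rewrite -big_split /=; apply: sumr_ge0 => i _; apply: le_trans (h1 i) _.
by rewrite lerD2l.
Qed.

Lemma contact_contra (R : realType) (C L K D M v : R) : 0 < D * M -> 6 * v * K < C ->
  C * D * M + L <= 0 -> 0 <= L + v * (6 * K * (D * M)) -> False.
Proof.
move=> N0 CK; have : 6 * v * K * (D * M) < C * (D * M) by rewrite ltr_pM2r.
have -> : v * (6 * K * (D * M)) = 6 * v * K * (D * M) by ring.
rewrite -mulrA; lra.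
Qed.

(** * Impossibility of a first contact *)

Section NoContact.
Context {R : realType} {n : nat}.
Local Notation Cn := 'rV[R[i]]_n.
Local Notation Rn := 'rV[R]_n.

Local Notation nsq u := (euclid u u).

Lemma exp_contact_derive (d C : R) (E F : R -> Cn) (W : set R) t : W t ->
  CinfC W E -> CinfC W F ->
  is_derive t (1 : R) (fun s => d * expR (C * s) * (nsq (E s) + nsq (F s)) - omega (E s) (F s))
   (C * (d * expR (C * t)) * (nsq (E t) + nsq (F t)) +
    Lam (d * expR (C * t)) (E t) (F t) (derivC (1 : R) E t) (derivC (1 : R) F t)).
Proof.
move=> Wt CE CF; have dE := CinfC_derivable (1 : R) CE Wt; have dF := CinfC_derivable (1 : R) CF Wt.
have i1 := is_derive_euclid dE dE; have i2 := is_derive_euclid dF dF.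
have i3 := is_derive_omega dE dF.
have i4 : is_derive t (1 : R) (fun s => expR (C * s)) (C * expR (C * t)).
  have l : is_derive t (1 : R) (fun s => C * s) C.
    have := is_deriveM (is_derive_cst C t (1 : R)) (is_derive_id t (1 : R)).
    by rewrite /GRing.scale /= mulr0 addr0 mulr1.
  have [d1 d2] := l; have [e1 e2] := is_derive_expR (C * t).
  have dc : derivable (expR \o (fun s => C * s)) t 1.
    apply/derivable1_diffP; apply: differentiable_comp; first exact/derivable1_diffP.
    exact/derivable1_diffP.
  split; first exact: dc.
  by have := derive1_comp d1 e1; rewrite !derive1E d2 e2 mulrC.
have i5 := is_deriveM (is_deriveM (is_derive_cst d t (1 : R)) i4) (is_deriveD i1 i2).
apply: (is_derive_eq (is_deriveB i5 i3)); rewrite /GRing.scale /= mulr0 addr0 /Lam.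
have -> : (fun y => nsq (E y)) + (fun y => nsq (F y)) = fun y => nsq (E y) + nsq (F y) by [].
rewrite (_ : (cst d * (fun s => expR (C * s))) t = d * expR (C * t)) //.
rewrite (euclidC (E t) (derivC _ E t)) (euclidC (F t) (derivC _ F t)); ring.
Qed.

Variables (G : Rn * R -> Cn) (O : set (Rn * R)) (x0 : Rn) (t0 d C K : R) (a0 b0 : Rn).
Variables (g : Rn -> Cn) (U : set Rn).
Hypotheses (gE : g = fun x => G (x, t0)) (UE : U = [set x | O (x, t0)]).
Hypotheses (oO : open O) (Oxt : O (x0, t0)) (CG : CinfC O G).
Hypothesis gu : forall x, U x -> gram (ltan g x) \in unitmx.
Hypothesis flow : forall x, U x -> derivC ((0, 1) : Rn * R) G (x, t0) = lH g x.
Hypotheses (d0 : 0 < d) (d4 : d * expR (C * t0) <= 4^-1).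
Local Notation Gd a x t := (derivC ((a, 0) : Rn * R) G (x, t)).
Hypothesis pos : forall x t (a b : Rn), O (x, t) -> t <= t0 ->
  omega (Gd a x t) (Gd b x t) <= d * expR (C * t) * (nsq (Gd a x t) + nsq (Gd b x t)).
Hypothesis contact : omega (Gd a0 x0 t0) (Gd b0 x0 t0) =
  d * expR (C * t0) * (nsq (Gd a0 x0 t0) + nsq (Gd b0 x0 t0)).
Hypothesis nz : a0 != 0 \/ b0 != 0.
Hypothesis Kbound : forall a b, nsq (nrm (ltan g x0) (derivC a (derivC b g) x0)) <=
  K * nsq (derivC a g x0) * nsq (derivC b g x0).
Hypothesis CK : 6 * n%:R * K < C.

Lemma slice_derivC a x : derivC a g x = Gd a x t0.
Proof. by rewrite gE derivC_slice1. Qed.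

(** Time and space derivatives commute, so a tangent vector evolves by the derivative of the mean
    curvature vector. *)
Lemma time_derivC a : derivC (1 : R) (fun t => Gd a x0 t) t0 = derivC a (lH g) x0.
Proof.
rewrite (derivC_slice2 (derivC ((a, 0) : Rn * R) G)).
rewrite (ClairautC _ _ oO Oxt CG) -(derivC_slice1 (derivC ((0, 1) : Rn * R) G)).
have oU : open U by rewrite UE; exact: open_slice1.
by apply: (derivC_ext _ oU) => [|y Uy]; [rewrite UE|exact: flow].
Qed.

(** Let m = |a|^2 + |b|^2 at the contact. Minimality over earlier times gives C D m + Lam <= 0, with
    [Lam] taken on the derivatives of the mean curvature vector; minimality along the n lines gives
    Lam + 6 n K D m >= 0. The two exclude each other since 6 n K < C and D m > 0. *)
Lemma no_contact : False.
Proof.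
(* [good_field] divides by n; in dimension 0 every row vector is 0, against [nz]. *)
have n0 : (0 < n)%N.
  rewrite lt0n; apply/eqP => n0; have z (a : Rn) : a = 0.
    by apply/rowP => i; have := ltn_ord i; rewrite [X in (_ < X)%N]n0.
  by case: nz; rewrite [X in X != _]z eqxx.
have oU : open U by rewrite UE; exact: open_slice1.
have Ux0 : U x0 by rewrite UE.
have Cg : CinfC U g by rewrite UE gE; exact: CinfC_slice1.
have [A Au A1] := orthonormal_frame (gu Ux0).
have [T TE] : exists T : Rn -> 'I_n -> Cn, T = fun x i => derivC (row i A : Rn) g x by eexists.
have [Hs HsE] : exists Hs : Rn -> 'I_n -> 'I_n -> Cn,
  Hs = fun x i j => derivC (row i A : Rn) (derivC (row j A : Rn) g) x by eexists.
have T1 : gram (T x0) = 1%:M := frameT1 oU Ux0 Cg A1 TE.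
have [D DE] : exists D : R, D = d * expR (C * t0) by eexists.
have D0 : 0 < D by rewrite DE mulr_gt0 // expR_gt0.
have posU x (a b : Rn) : U x -> omega (derivC a g x) (derivC b g x) <=
    D * (nsq (derivC a g x) + nsq (derivC b g x)).
  by move=> Ux; rewrite !slice_derivC DE; apply: pos => //; rewrite UE in Ux.
have [Ga GaE] : exists Ga, Ga = derivC a0 g x0 by eexists.
have [Gb GbE] : exists Gb, Gb = derivC b0 g x0 by eexists.
have ctc : omega Ga Gb = D * (nsq Ga + nsq Gb).
  by rewrite GaE GbE !slice_derivC DE; exact: contact.
pose al := a0 *m invmx A; pose be := b0 *m invmx A.
have alE : al *m A = a0 by rewrite /al -mulmxA (mulVmx Au) mulmx1.
have beE : be *m A = b0 by rewrite /be -mulmxA (mulVmx Au) mulmx1.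
have [f [Cf [f0 f1 f2]]] := good_field oU Ux0 Cg gu Au A1 TE HsE (al := al) erefl erefl n0.
have [f' [Cf' [f0' f1' f2']]] := good_field oU Ux0 Cg gu Au A1 TE HsE (al := be) erefl erefl n0.
rewrite alE in f1 f2; rewrite beE in f1' f2'.
have [E EE] : exists E : 'I_n -> R -> Cn, E = fun i h => comb (f i h) (T (x0 + h *: (row i A : Rn))) by eexists.
have [E' EE'] : exists E : 'I_n -> R -> Cn, E = fun i h => comb (f' i h) (T (x0 + h *: (row i A : Rn))) by eexists.
have E0 i : E i 0 = Ga.
  by rewrite EE f0 scale0r addr0 -(derivC_frame oU Cg TE al Ux0) alE GaE.
have E0' i : E' i 0 = Gb.
  by rewrite EE' f0' scale0r addr0 -(derivC_frame oU Cg TE be Ux0) beE GbE.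
have Q i : Lam D Ga Gb (derivC (1 : R) (E i) 0) (derivC (1 : R) (E' i) 0) = 0 /\
   0 <= Lam D Ga Gb (derivC (1 : R) (derivC (1 : R) (E i)) 0) (derivC (1 : R) (derivC (1 : R) (E' i)) 0) +
   (2 * D * (nsq (derivC (1 : R) (E i) 0) + nsq (derivC (1 : R) (E' i) 0)) -
    2 * omega (derivC (1 : R) (E i) 0) (derivC (1 : R) (E' i) 0)).
  have oW : open [set h : R | U (x0 + h *: (row i A : Rn))] by exact: open_line.
  have W0 : [set h : R | U (x0 + h *: (row i A : Rn))] 0 by exact: line0.
  have CE : CinfC [set h : R | U (x0 + h *: (row i A : Rn))] (E i) by rewrite EE; exact: Cf.
  have CE' : CinfC [set h : R | U (x0 + h *: (row i A : Rn))] (E' i) by rewrite EE'; exact: Cf'.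
  have := line_contact (d := D) oW W0 CE CE'; rewrite E0 E0'; apply; last exact: ctc.
  move=> h Uh; rewrite EE EE' -(derivC_frame oU Cg TE (f i h) Uh) -(derivC_frame oU Cg TE (f' i h) Uh).
  exact: posU.
have W0 : [set s | O (x0, s)] t0 by [].
have oW : open [set s | O (x0, s)] by exact: open_slice2.
have CA (a : Rn) : CinfC [set s | O (x0, s)] (fun s => Gd a x0 s).
  by apply: (CinfC_slice2 (f := derivC ((a, 0) : Rn * R) G)) => //; exact: CinfC_derivC.
have ts : C * D * (nsq Ga + nsq Gb) + Lam D Ga Gb (derivC a0 (lH g) x0) (derivC b0 (lH g) x0) <= 0.
  have [dr dv] := exp_contact_derive d C W0 (CA a0) (CA b0).
  rewrite (time_derivC a0) (time_derivC b0) -(slice_derivC a0) -(slice_derivC b0) -GaE -GbE -DE in dv.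
  have [r r0 hr] := open_ballP oW W0.
  rewrite -dv; apply: (left_min_derive_le0 r0 dr) => t tr tt.
  rewrite -!slice_derivC -GaE -GbE -DE ctc subrr subr_ge0; apply: pos => //.
  by apply: hr; rewrite ler0_norm ?subr_le0 // opprB ltrBlDr; lra.
have TxE : T x0 = fun i => comb (row i A) (ltan g x0) := frameTE oU Cg TE Ux0.
have Kb (a : Rn) i : nsq (nrm (T x0) (derivC (row i A : Rn) (derivC a g) x0)) <= K * nsq (derivC a g x0).
  rewrite TxE nrm_reparam //; last exact: gu.
  apply: le_trans (Kbound _ _) _.
  have -> : nsq (derivC (row i A : Rn) g x0) = 1.
    by have := gramE (T x0) i i; rewrite T1 mxE eqxx TE => <-.
  by rewrite mulr1.
have small (a b : Rn) : omega (comb a (T x0)) (comb b (T x0)) <= D * (sqn a + sqn b).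
  by rewrite -!(euclid_comb_sqn _ T1) -!(derivC_frame oU Cg TE _ Ux0); exact: posU.
have D4 : D <= 4^-1 by rewrite DE.
have Ri i : 2 * D * (nsq (derivC (1 : R) (E i) 0) + nsq (derivC (1 : R) (E' i) 0)) -
    2 * omega (derivC (1 : R) (E i) 0) (derivC (1 : R) (E' i) 0) <= 6 * K * (D * (nsq Ga + nsq Gb)).
  have Ei : derivC (1 : R) (E i) 0 = nrm (T x0) (derivC (row i A : Rn) (derivC a0 g) x0) by rewrite EE; exact: (f1 i).
  have Ei' : derivC (1 : R) (E' i) 0 = nrm (T x0) (derivC (row i A : Rn) (derivC b0 g) x0) by rewrite EE'; exact: (f1' i).
  have Tu : gram (T x0) \in unitmx by rewrite T1 unitmx1.
  have No := normal_omega T1 D4 small (fun m => nrm_perp (derivC (row i A : Rn) (derivC a0 g) x0) m Tu)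
    (fun m => nrm_perp (derivC (row i A : Rn) (derivC b0 g) x0) m Tu).
  have k1 := Kb a0 i; have k2 := Kb b0 i.
  rewrite Ei Ei'; rewrite -GaE in k1; rewrite -GbE in k2.
  exact: (contact_remainder D0 No k1 k2).
have sumQ : 0 <= Lam D Ga Gb (derivC a0 (lH g) x0) (derivC b0 (lH g) x0) + n%:R * (6 * K * (D * (nsq Ga + nsq Gb))).
  have -> : Lam D Ga Gb (derivC a0 (lH g) x0) (derivC b0 (lH g) x0) =
    \sum_i Lam D Ga Gb (derivC (1 : R) (derivC (1 : R) (E i)) 0) (derivC (1 : R) (derivC (1 : R) (E' i)) 0).
    have Q1 k := (Q k).1; rewrite EE EE' in Q1 *.
    exact: (Lam_balance f2 f2' (fun k => etrans (congr2 (Lam D Ga Gb) (esym (f1 k)) (esym (f1' k))) (Q1 k))).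
  exact: (sum_add_bound_ge0 (fun i => (Q i).2) Ri).
have N0 : 0 < D * (nsq Ga + nsq Gb).
  rewrite mulr_gt0 // lt_neqAle eq_sym addr_ge0 ?euclid_ge0 // andbT paddr_eq0 ?euclid_ge0 //.
  apply/negP => /andP[/eqP /euclid_eq0 za /eqP /euclid_eq0 zb].
  rewrite GaE (ltan_comb _ oU Ux0 Cg) in za; rewrite GbE (ltan_comb _ oU Ux0 Cg) in zb.
  by case: nz => /eqP; apply; [exact: (gram_unit_inj (gu Ux0) za)|exact: (gram_unit_inj (gu Ux0) zb)].
exact: (contact_contra N0 CK ts sumQ).
Qed.

End NoContact.

(** * Preservation of the Lagrangian condition *)

Section ManifoldCharts.
Context {R : realType} {n : nat} (M : smooth_manifold R n).
Local Notation Rn := 'rV[R]_n.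
Implicit Types (c d : chart M) (x y : Rn) (p : M).

Lemma paramP c x : chart_image c x -> chart_dom c (param c x) /\ coord c (param c x) = x.
Proof. by move=> [p cp <-]; rewrite coordK. Qed.

Lemma coord_image c p : chart_dom c p -> chart_image c (coord c p).
Proof. by move=> cp; exists p. Qed.

Lemma chart_image_open c : open (chart_image c).
Proof. exact: image_open. Qed.
Arguments chart_image_open : clear implicits.

Lemma overlapP c d x : (coord c @` (chart_dom c `&` chart_dom d)) x <->
  chart_image c x /\ chart_dom d (param c x).
Proof.
split; first by move=> [p [cp dp] <-]; split; [exists p|rewrite coordK].
by move=> [[p cp <-] dp]; exists p => //; split=> //; rewrite coordK in dp.
Qed.

Lemma param_preimage_nbhs c x (W : set M) : chart_image c x -> open W -> W (param c x) ->
  \forall y \near x, W (param c y).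
Proof.
move=> cx oW Wx; have cont := @param_continuous R n M c x cx.
exact: (cont W (open_nbhs_nbhs (conj oW Wx))).
Qed.

Lemma open_param_preimage c (W : set M) : open W ->
  open [set x | chart_image c x /\ W (param c x)].
Proof.
move=> oW; rewrite openE => x [cx Wx].
have n1 := open_nbhs_nbhs (conj (chart_image_open c) cx).
have n2 := param_preimage_nbhs cx oW Wx.
rewrite /interior /=; near=> y; split; [near: y; exact: n1|near: y; exact: n2].
Unshelve. all: by end_near.
Qed.

Lemma overlap_open c d : open (coord c @` (chart_dom c `&` chart_dom d)).
Proof.
rewrite (_ : _ @` _ = [set x | chart_image c x /\ chart_dom d (param c x)]).
  by apply: open_param_preimage; exact: dom_open.
by apply/seteqP; split=> x /overlapP.
Qed.
Arguments overlap_open : clear implicits.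

Lemma transition_Cinf c d k : Cinf (coord c @` (chart_dom c `&` chart_dom d))
  (fun x => (coord d (param c x)) 0 k).
Proof. by apply: smooth_on_open; [exact: overlap_open|exact: transition_smooth]. Qed.

Section Immersion.
Variable F : M -> 'rV[R[i]]_n.
Hypothesis iF : immersion F.

Lemma local_rep_CinfC c : CinfC (chart_image c) (local_rep F c).
Proof. by apply: smooth_onC_open; [exact: chart_image_open|exact: iF.1]. Qed.

Lemma immersion_gram c x : chart_image c x -> gram (ltan (local_rep F c) x) \in unitmx.
Proof. by move=> cx; apply: gram_unit => a; exact: iF.2. Qed.

Lemma local_rep_change c d x : chart_image c x -> chart_dom d (param c x) ->
  local_rep F c x = local_rep F d (coord d (param c x)).
Proof. by move=> cx dx; rewrite /local_rep coordK. Qed.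

Lemma ltan_change c d x (a : Rn) : chart_image c x -> chart_dom d (param c x) ->
  derivC a (local_rep F c) x =
  derivC (a *m transition_jacobian c d x) (local_rep F d) (coord d (param c x)).
Proof.
move=> cx dx; have ox : (coord c @` (chart_dom c `&` chart_dom d)) x by apply/overlapP.
have oW := overlap_open c d.
have dy : chart_image d (coord d (param c x)) by exact: coord_image.
rewrite (ltan_comb _ (chart_image_open d) dy (local_rep_CinfC d)).
rewrite (derivC_ext a oW ox (g := fun z => local_rep F d (coord d (param c z)))); last first.
  by move=> z /overlapP [cz dz]; exact: local_rep_change.
have CC : CinfC (coord c @` (chart_dom c `&` chart_dom d)) (fun z => local_rep F d (coord d (param c z))).
  apply: (CinfC_reparam (chart_image_open d) oW _ (local_rep_CinfC d) (transition_Cinf c d)).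
  by move=> z /overlapP [cz dz]; exact: coord_image.
rewrite (ltan_comb a oW ox CC) -comb_reparam; congr comb; apply/funext => i.
rewrite (ltan_reparam (chart_image_open d) _ (local_rep_CinfC d) (transition_Cinf c d)) //.
by move=> z /overlapP [cz dz]; exact: coord_image.
Qed.

Lemma lH_change c d x : chart_image c x -> chart_dom d (param c x) ->
  transition_jacobian c d x \in unitmx ->
  lH (local_rep F c) x = lH (local_rep F d) (coord d (param c x)).
Proof.
move=> cx dx Ju; have ox : (coord c @` (chart_dom c `&` chart_dom d)) x by apply/overlapP.
have oW := overlap_open c d.
have WU z : (coord c @` (chart_dom c `&` chart_dom d)) z -> chart_image d (coord d (param c z)).
  by move=> /overlapP [cz dz]; exact: coord_image.
have gu : gram (ltan (local_rep F d) (coord d (param c x))) \in unitmx by apply: immersion_gram; exact: WU.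
apply: etrans (lH_reparam (chart_image_open d) oW WU (local_rep_CinfC d) (transition_Cinf c d) ox gu Ju).
by apply: (lH_ext oW ox) => z /overlapP [cz dz]; exact: local_rep_change.
Qed.

Local Transparent gram nrm mcurv lH.
Lemma mean_curvature_lH p :
  mean_curvature F p = lH (local_rep F (chart_at p)) (coord (chart_at p) p).
Proof. by []. Qed.
Local Opaque gram nrm mcurv lH.

(** [mean_curvature] uses the chart selected at each point. Positivity of the Jacobian makes the
    transition matrix invertible, which is what [lH_change] asks in order to pass to the chart
    [c]. *)
Lemma mean_curvatureE c x : oriented M -> chart_image c x ->
  mean_curvature F (param c x) = lH (local_rep F c) x.
Proof.
move=> oM cx; rewrite mean_curvature_lH; set d := chart_at _.
have dx : chart_dom d (param c x) by exact: dom_chart_at.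
rewrite -(lH_change cx dx) // unitmxE unitfE gt_eqF //.
by apply: oM; apply/overlapP.
Qed.

End Immersion.
End ManifoldCharts.
Arguments chart_image_open {R n M} c.
Arguments overlap_open {R n M} c d.

Section SpaceTime.
Context {R : realType} {n : nat} {M : smooth_manifold R n}.
Local Notation Cn := 'rV[R[i]]_n.
Local Notation Rn := 'rV[R]_n.

(* Smoothness up to t = 0 gives a genuinely smooth extension across t = 0. *)
Lemma smooth_onC_extend (V : normedModType R) (A : set V) (f : V -> Cn) (x : V) :
  smooth_onC A f -> A x -> exists (O : set V) (G : V -> Cn),
  [/\ open O, O x, CinfC O G & forall y, O y -> A y -> G y = f y].
Proof.
move=> sf Ax.
have /choice [h hP] : forall j : 'I_n, exists h : set V * (V -> R) * (set V * (V -> R)),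
   [/\ open h.1.1, h.1.1 x, Cinf h.1.1 h.1.2 &
      forall y, h.1.1 y -> A y -> h.1.2 y = xcoord (f y) j] /\
   [/\ open h.2.1, h.2.1 x, Cinf h.2.1 h.2.2 &
      forall y, h.2.1 y -> A y -> h.2.2 y = ycoord (f y) j].
  move=> j; have [s1 s2] := sf j.
  have [U1 [g1 [p1 u1 cc1 e1]]] := s1 x Ax; have [U2 [g2 [p2 u2 cc2 e2]]] := s2 x Ax.
  by exists ((U1, g1), (U2, g2)).
pose O := \big[setI/setT]_(j < n) ((h j).1.1 `&` (h j).2.1).
pose G y : Cn := \row_j ((h j).1.2 y +i* (h j).2.2 y).
have OP y : O y <-> forall j, (h j).1.1 y /\ (h j).2.1 y.
  rewrite /O; split.
    by move=> + j; rewrite (bigD1 j) //= => -[].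
  move=> hy; apply: (big_ind (fun S : set V => S y)) => [//|S1 S2 s1 s2|j _]; [by split|exact: hy].
Local Transparent xcoord ycoord.
have Gx y j : xcoord (G y) j = (h j).1.2 y by rewrite /xcoord mxE.
have Gy y j : ycoord (G y) j = (h j).2.2 y by rewrite /ycoord mxE.
Local Opaque xcoord ycoord.
exists O, G; split.
- rewrite /O; apply: big_ind => [|S1 S2 h1 h2|j _]; [exact: openT|exact: openI|].
  by have [[p1 _ _ _] [p2 _ _ _]] := hP j; exact: openI.
- by apply/OP => j; have [[_ u1 _ _] [_ u2 _ _]] := hP j.
- Local Transparent CinfC.
  move=> j; have [[_ _ c1 _] [_ _ c2 _]] := hP j; split.
    under eq_fun do rewrite Gx; apply: Cinf_sub c1; by move=> y /OP /(_ j) [].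
  under eq_fun do rewrite Gy; apply: Cinf_sub c2; by move=> y /OP /(_ j) [].
  Local Opaque CinfC.
- move=> y /OP Oy Ay; apply: vecC_ext => j; have [[_ _ _ e1] [_ _ _ e2]] := hP j.
    by rewrite Gx e1 //; have [] := Oy j.
  by rewrite Gy e2 //; have [] := Oy j.
Qed.

Variables (T : \bar R) (F : M -> R -> Cn).
Hypothesis oM : oriented M.
Hypothesis flow : lagrangian_mcf T F.

Lemma flow_immersion t : time_interval T t -> immersion (F ^~ t).
Proof. by case: flow => _ _ h _ _; exact: h. Qed.

Lemma time_interval_right t : time_interval T t ->
  exists2 r : R, 0 < r & forall h, 0 <= h -> h < r -> time_interval T (t + h).
Proof.
move=> [t0 tT].
have oT : open [set s : R | (s%:E < T)%E] by exact: open_ereal_lt.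
have [r r0 hr] := open_ballP oT tT.
exists r => // h h0 hr'; split; first exact: addr_ge0.
by apply: hr; rewrite addrAC subrr add0r ger0_norm.
Qed.

(** [G] extends [g] across the end t = 0 of the time interval. The two derivatives are compared on a
    single small positive increment, which stays in [0, T) even at t = 0. *)
Lemma time_derivative_unique (g G : R -> R) (W : set R) t l : open W -> W t ->
  time_interval T t -> derivable G t 1 -> (forall s, W s -> time_interval T s -> G s = g s) ->
  is_time_derivative T g t l -> 'D_1 G t = l.
Proof.
move=> oW Wt Tt dG Gg tl.
have [r1 r10 h1] := time_interval_right Tt; have [r2 r20 h2] := open_ballP oW Wt.
apply/eqP; rewrite -subr_eq0 -normr_le0; apply/ler_addgt0Pr => eps e0; rewrite add0r.
have e20 : 0 < eps / 2 by rewrite divr_gt0.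
have [r3 r30 h3] : exists2 r3 : R, 0 < r3 & forall h, `|h| < r3 -> h != 0 ->
    `|h^-1 * (G (t + h) - G t) - 'D_1 G t| < eps / 2.
  have : \forall h \near 0^', `|'D_1 G t - h^-1 *: ((G \o shift t) (h *: 1) - G t)| < eps / 2.
    by apply: cvgr_dist_lt e20; exact: dG.
  rewrite /dnbhs /within => /nbhs_normP [r3 r30 h3]; exists r3 => // h hr hn.
  have := h3 h; rewrite subr0 => /(_ hr hn).
  by rewrite /= [h%:A]mulr1 /GRing.scale /= distrC (addrC h).
have [r4 r40 h4] : exists2 r4 : R, 0 < r4 & forall s, `|s - t| < r4 -> s != t -> time_interval T s ->
    `|(s - t)^-1 * (g s - g t) - l| < eps / 2.
  have : \forall s \near within (time_interval T) t^', `|l - (s - t)^-1 * (g s - g t)| < eps / 2.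
    exact: cvgr_dist_lt e20.
  rewrite /dnbhs /within /= => /nbhs_normP [r4 r40 h4]; exists r4 => // s sr sn sT.
  by have := h4 s sr sn sT; rewrite distrC.
pose m := Num.min (Num.min r1 r2) (Num.min r3 r4).
have m0 : 0 < m by rewrite !lt_min r10 r20 r30 r40.
have [m1 m2 m3 m4] : [/\ m <= r1, m <= r2, m <= r3 & m <= r4].
  by rewrite /m !ge_min !lexx !orbT.
pose h := m / 2.
have h0 : 0 < h by rewrite divr_gt0.
have hm : h < m by rewrite /h; lra.
have hn : h != 0 by rewrite gt_eqF.
have Th : time_interval T (t + h) by apply: h1; [exact: ltW|lra].
have Wh : W (t + h) by apply: h2; rewrite addrAC subrr add0r gtr0_norm //; lra.
have q3 : `|h^-1 * (G (t + h) - G t) - 'D_1 G t| < eps / 2 by apply: h3 => //; rewrite gtr0_norm //; lra.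
have q4 : `|(t + h - t)^-1 * (g (t + h) - g t) - l| < eps / 2.
  apply: h4 => //; last by rewrite -subr_eq0 addrAC subrr add0r.
  by rewrite addrAC subrr add0r gtr0_norm //; lra.
apply: (near_common_value _ q4 q3).
by rewrite addrAC subrr add0r !Gg.
Qed.

Section LocalFlow.
Variables (c : chart M) (x0 : Rn) (t0 : R).
Hypotheses (cx0 : chart_image c x0) (Tt0 : time_interval T t0).

(** The domain is cut below T but may contain negative times, where [G] is merely an extension;
    hence the clause 0 <= t in the comparison with the flow. *)
Lemma local_flow : exists (O : set (Rn * R)) (G : Rn * R -> Cn),
  [/\ open O, O (x0, t0), CinfC O G &
   forall x t, O (x, t) -> [/\ chart_image c x, (t%:E < T)%E &
     0 <= t -> G (x, t) = local_rep (F ^~ t) c x]].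
Proof.
case: (flow) => _ sF _ _ _.
have [B [G [oO Ox CG GF]]] := smooth_onC_extend (sF c) (conj cx0 Tt0 : (chart_image c `*` time_interval T) (x0, t0)).
have oT : open [set s : R | (s%:E < T)%E] by exact: open_ereal_lt.
pose O' := B `&` (chart_image c `*` [set s : R | (s%:E < T)%E]).
have oO' : open O'.
  apply: openI => //; rewrite openE => -[x t] [/= cx tT].
  exists (chart_image c, [set s : R | (s%:E < T)%E]) => //; split=> /=.
    by apply: open_nbhs_nbhs; split=> //; exact: chart_image_open.
  exact: open_nbhs_nbhs.
exists O', G; split=> //.
- by split=> //; split=> //; case: Tt0.
- by apply: CinfC_sub CG => y [].
- move=> x t [Oxt [/= cx tT]]; split=> // t0'.
  by rewrite GF //; split.
Qed.

Variables (O : set (Rn * R)) (G : Rn * R -> Cn).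
Hypotheses (oO : open O) (CG : CinfC O G).
Hypothesis GF : forall x t, O (x, t) -> [/\ chart_image c x, (t%:E < T)%E &
     0 <= t -> G (x, t) = local_rep (F ^~ t) c x].

Lemma flow_slice_derivC x t (a : Rn) : O (x, t) -> 0 <= t ->
  derivC ((a, 0) : Rn * R) G (x, t) = derivC a (local_rep (F ^~ t) c) x.
Proof.
move=> Oxt t0'; rewrite -derivC_slice1.
by apply: (derivC_ext a (open_slice1 t oO) (x := x) Oxt) => y Oy; have [_ _ ->] := GF Oy.
Qed.

Lemma flow_slice_derivC2 x t (a b : Rn) : O (x, t) -> 0 <= t ->
  derivC ((a, 0) : Rn * R) (derivC ((b, 0) : Rn * R) G) (x, t) =
  derivC a (derivC b (local_rep (F ^~ t) c)) x.
Proof.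
move=> Oxt t0'; rewrite -(derivC_slice1 (derivC ((b, 0) : Rn * R) G)).
by apply: (derivC_ext a (open_slice1 t oO) (x := x) Oxt) => y Oy; exact: flow_slice_derivC.
Qed.

Lemma flow_time_derivC x t : O (x, t) -> 0 <= t ->
  derivC ((0, 1) : Rn * R) G (x, t) = lH (local_rep (F ^~ t) c) x.
Proof.
move=> Oxt t0'; have [cx tT GE] := GF Oxt.
have Tt : time_interval T t by split.
rewrite -(mean_curvatureE (flow_immersion Tt) oM cx).
case: (flow) => _ _ _ _ /(_ (param c x) t Tt) tF.
rewrite -(derivC_slice2 G 1 t x).
have oW : open [set s | O (x, s)] by exact: open_slice2.
have dG := CinfC_derivable (1 : R) (CinfC_slice2 x oO CG) (x := t) Oxt.
apply: vecC_ext => j; have [t1 t2] := tF j; have [d1 d2] := dG j.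
  rewrite xcoord_derivC.
  apply: (time_derivative_unique oW Oxt Tt d1 _ t1) => s Os [s0 sT] /=.
  by have [_ _ ->] := GF Os.
rewrite ycoord_derivC.
apply: (time_derivative_unique oW Oxt Tt d2 _ t2) => s Os [s0 sT] /=.
by have [_ _ ->] := GF Os.
Qed.

End LocalFlow.

End SpaceTime.

(** * Bounds on the second fundamental form *)

Section CauchySchwarz.
Context {R : realType} {n : nat}.
Local Notation Cn := 'rV[R[i]]_n.
Local Notation Rn := 'rV[R]_n.
Local Notation nsq u := (euclid u u).
Implicit Types u v : Cn.

Lemma euclid_CS u v : euclid u v ^+ 2 <= nsq u * nsq v.
Proof.
have [/euclid_eq0 ->|v0] := eqVneq (nsq v) 0; first by rewrite !euclid0r expr0n mulr0.
have vp : 0 < nsq v by rewrite lt_neqAle eq_sym v0 euclid_ge0.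
pose s := euclid u v / nsq v.
have := euclid_ge0 (u - s%:C *: v).
rewrite euclidDl !euclidDr !euclidNl !euclidNr !euclidZl !euclidZr opprK (euclidC v u).
have sE : s * nsq v = euclid u v by rewrite /s divfK.
rewrite sE => h.
have -> : nsq u * nsq v = (nsq u - s * euclid u v) * nsq v + (s * nsq v) * euclid u v by ring.
rewrite sE expr2 lerDr; apply: mulr_ge0; last exact: ltW.
lra.
Qed.

(** Cauchy-Schwarz in each real coordinate of C^n. The real inequality is drawn from [euclid_CS] by
    viewing row vectors as complex vectors with zero imaginary part. *)
Lemma comb_CS (a : Rn) (w : 'I_n -> Cn) : nsq (comb a w) <= sqn a * \sum_k nsq (w k).
Proof.
have real_CS (b : Rn) : (\sum_k a 0 k * b 0 k) ^+ 2 <= sqn a * sqn b.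
  pose c (a0 : Rn) : Cn := \row_k (a0 0 k)%:C.
Local Transparent xcoord ycoord.
  have e (a0 b0 : Rn) : euclid (c a0) (c b0) = \sum_k a0 0 k * b0 0 k.
    by apply: eq_bigr => k _; rewrite /xcoord /ycoord !mxE /= mulr0 addr0.
Local Opaque xcoord ycoord.
  have := euclid_CS (c a) (c b); rewrite !e.
  have sE (a0 : Rn) : \sum_k a0 0 k * a0 0 k = sqn a0 by apply: eq_bigr => k _; rewrite expr2.
  by rewrite !sE.
rewrite {1}/euclid mulr_sumr.
have -> : \sum_(i < n) sqn a * nsq (w i) =
  \sum_j (sqn a * (\sum_k xcoord (w k) j ^+ 2) + sqn a * (\sum_k ycoord (w k) j ^+ 2)).
  transitivity (sqn a * \sum_k \sum_j (xcoord (w k) j ^+ 2 + ycoord (w k) j ^+ 2)).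
    by rewrite mulr_sumr; apply: eq_bigr => k _; congr (_ * _); apply: eq_bigr => j _; rewrite !expr2.
  rewrite exchange_big /= mulr_sumr; apply: eq_bigr => j _.
  by rewrite -mulrDr big_split.
apply: ler_sum => j _; rewrite -!expr2; apply: lerD.
  rewrite /comb xcoord_sum.
  have := real_CS (\row_k xcoord (w k) j).
  have -> : \sum_k a 0 k * (\row_k xcoord (w k) j) 0 k = \sum_k xcoord ((a 0 k)%:C *: w k) j.
    by apply: eq_bigr => k _; rewrite mxE coordE.
  by congr (_ <= _ * _); apply: eq_bigr => k _; rewrite mxE.
rewrite /comb ycoord_sum.
have := real_CS (\row_k ycoord (w k) j).
have -> : \sum_k a 0 k * (\row_k ycoord (w k) j) 0 k = \sum_k ycoord ((a 0 k)%:C *: w k) j.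
  by apply: eq_bigr => k _; rewrite mxE coordE.
by congr (_ <= _ * _); apply: eq_bigr => k _; rewrite mxE.
Qed.

Lemma pythagoras_le u v : euclid u v = 0 -> nsq u <= nsq (u + v).
Proof.
by move=> z; rewrite euclidDl !euclidDr z (euclidC v u) z addr0 add0r lerDl euclid_ge0.
Qed.

Lemma nrm_le (t : 'I_n -> Cn) v : gram t \in unitmx -> nsq (nrm t v) <= nsq v.
Proof.
move=> gu; rewrite -[X in _ <= euclid X X](subrK (nrm t v) v) addrC.
have [b bE] : exists b, v - nrm t v = comb b t.
  by rewrite nrm_combE; eexists; rewrite opprB addrC subrK.
have z : euclid (nrm t v) (v - nrm t v) = 0.
  by rewrite bE euclid_comb_r big1 // => i _; rewrite nrm_perp // mulr0.
exact: pythagoras_le z.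
Qed.

(** The sum of the squared norms of the dual basis. A coefficient of [comb a t] is its scalar
    product with a dual vector, so Cauchy-Schwarz bounds [sqn a] by this factor. *)
Definition frame_bound (t : 'I_n -> Cn) : R := \sum_k nsq (comb (row k (invmx (gram t))) t).

Lemma frame_boundP (t : 'I_n -> Cn) (a : Rn) : gram t \in unitmx ->
  sqn a <= frame_bound t * nsq (comb a t).
Proof.
move=> gu; rewrite /frame_bound mulr_suml; apply: ler_sum => k _.
have -> : a 0 k = euclid (comb (row k (invmx (gram t))) t) (comb a t).
  rewrite -[a in LHS]mulmx1 -(mulmxV gu) mulmxA mxE euclid_comb_l.
  by apply: eq_bigr => i _; rewrite [row _ _ _ _]mxE -euclid_comb_gram (invmx_gram_sym t i k) euclidC mulrC.
exact: euclid_CS.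
Qed.

(** A crude bound, but a smooth function of the frame and of the second derivatives wherever the
    Gram matrix is invertible; so it is bounded near each point of space-time, as a compactness
    argument requires. *)
Definition curv_bound (t : 'I_n -> Cn) (h : 'I_n -> 'I_n -> Cn) : R :=
  frame_bound t * frame_bound t * \sum_k \sum_l nsq (h k l).

Lemma derivC2_comb (U : set Rn) (f : Rn -> Cn) x (a b : Rn) : open U -> U x -> CinfC U f ->
  derivC a (derivC b f) x = comb a (fun k => comb b (fun l => lhess f x k l)).
Proof.
move=> oU Ux Cf.
rewrite (derivC_ext a oU Ux (g := fun y => comb b (ltan f y))); last first.
  by move=> y Uy; exact: (ltan_comb _ oU Uy Cf).
have Cc k : Cinf U (fun _ : Rn => b 0 k) by exact: Cinf_cst.
have Ct k : CinfC U (fun x => ltan f x k) by exact: CinfC_derivC.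
rewrite (ltan_comb a oU Ux); last exact: CinfC_comb.
rewrite /comb; apply: eq_bigr => k _; congr (_ *: _); rewrite /ltan (derivC_comb _ oU Ux Cc Ct).
by rewrite (_ : \row_k _ = 0) ?comb0 ?add0r //; apply/rowP => l; rewrite !mxE derive_cst.
Qed.

Lemma curv_boundP (U : set Rn) (f : Rn -> Cn) x (a b : Rn) : open U -> U x -> CinfC U f ->
  gram (ltan f x) \in unitmx ->
  nsq (nrm (ltan f x) (derivC a (derivC b f) x)) <=
  curv_bound (ltan f x) (lhess f x) * nsq (derivC a f x) * nsq (derivC b f x).
Proof.
move=> oU Ux Cf gu; apply: le_trans (nrm_le _ gu) _.
rewrite (derivC2_comb a b oU Ux Cf) !(ltan_comb _ oU Ux Cf).
apply: le_trans (comb_CS _ _) _.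
have h1 := frame_boundP a gu; have h2 := frame_boundP b gu.
have H0 : 0 <= \sum_k \sum_l nsq (lhess f x k l).
  by apply: sumr_ge0 => k _; apply: sumr_ge0 => l _; exact: euclid_ge0.
have h3 : \sum_k nsq (comb b (fun l => lhess f x k l)) <= sqn b * \sum_k \sum_l nsq (lhess f x k l).
  by rewrite mulr_sumr; apply: ler_sum => k _; exact: comb_CS.
apply: le_trans (ler_wpM2l (sqn_ge0 a) h3) _.
rewrite /curv_bound mulrA.
have -> : frame_bound (ltan f x) * frame_bound (ltan f x) * (\sum_k \sum_l nsq (lhess f x k l)) *
   nsq (comb a (ltan f x)) * nsq (comb b (ltan f x)) =
   (frame_bound (ltan f x) * nsq (comb a (ltan f x))) * (frame_bound (ltan f x) * nsq (comb b (ltan f x))) *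
   (\sum_k \sum_l nsq (lhess f x k l)) by ring.
by rewrite ler_wpM2r // ler_pM // sqn_ge0.
Qed.

Lemma Cinf_curv_bound (V : normedModType R) (O : set V) (t : V -> 'I_n -> Cn)
  (h : V -> 'I_n -> 'I_n -> Cn) : open O -> (forall k, CinfC O (fun y => t y k)) ->
  (forall k l, CinfC O (fun y => h y k l)) -> (forall y, O y -> gram (t y) \in unitmx) ->
  Cinf O (fun y => curv_bound (t y) (h y)).
Proof.
move=> oO Ct Ch gu.
have Cg i j : Cinf O (fun y => gram (t y) i j).
  by under eq_fun do rewrite gramE; exact: Cinf_euclid.
have Ci i j : Cinf O (fun y => invmx (gram (t y)) i j) by exact: Cinf_invmx.
have Cfb : Cinf O (fun y => frame_bound (t y)).
  apply: Cinf_sum => // k _; apply: Cinf_euclid => //; apply: CinfC_comb => // l;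
    by rewrite (_ : (fun y => _) = fun y => invmx (gram (t y)) k l) //; apply/funext => y; rewrite mxE.
apply: CinfM => //; first exact: CinfM.
by apply: Cinf_sum => // k _; apply: Cinf_sum => // l _; exact: Cinf_euclid.
Qed.

End CauchySchwarz.

Lemma continuous_fst (A B C : topologicalType) (f : A -> C) (p : A * B) :
  {for p.1, continuous f} -> {for p, continuous (fun w : A * B => f w.1)}.
Proof. by case: p => a b cf P /cf Pf; exact: (@cvg_fst A B (nbhs a) (nbhs b) _ _ Pf). Qed.

Lemma continuous_snd (A B C : topologicalType) (f : B -> C) (p : A * B) :
  {for p.2, continuous f} -> {for p, continuous (fun w : A * B => f w.2)}.
Proof. by case: p => a b cf P /cf Pf; exact: (@cvg_snd A B (nbhs a) (nbhs b) _ _ Pf). Qed.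

(** The tube lemma, phrased with neighbourhoods. *)
Lemma compact_near (X Y : topologicalType) (K : set X) (y0 : Y) (P : X * Y -> Prop) : compact K ->
  (forall x, K x -> nbhs (x, y0) [set z | P z]) -> nbhs y0 [set y | forall x, K x -> P (x, y)].
Proof.
move=> /compact_near_coveringP cov h.
have := cov Y (nbhs y0) (fun y x => P (x, y)) _; apply => x Kx.
have [[A B] /= [nA nB] AB] := h x Kx.
by exists (A, B) => // -[x' y] [/= Ax By]; exact: (AB (x', y)).
Qed.

Section Positivity.
Context {R : realType} {n : nat}.
Local Notation Cn := 'rV[R[i]]_n.
Local Notation Rn := 'rV[R]_n.
Local Notation nsq u := (euclid u u).

Definition tame (k : R) (f : Rn -> Cn) (x : Rn) := forall a b : Rn, a != 0 \/ b != 0 ->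
  omega (derivC a f x) (derivC b f x) < k * (nsq (derivC a f x) + nsq (derivC b f x)).

Lemma unit_sphere_compact : compact [set z : Rn * Rn | `|z| = 1].
Proof.
have cB : compact [set a : Rn | `|a| <= 1].
  apply: bounded_closed_compact.
    exists 1; split; first exact: num_real.
    by move=> M M1 a /= a1; apply: le_trans a1 (ltW M1).
  have -> : [set a : Rn | `|a| <= 1] = (fun a : Rn => `|a|) @^-1` [set r : R | r <= 1] by [].
  by move: (@closed_le R 1); apply: closed_comp => z _; exact: norm_continuous.
apply: (subclosed_compact _ (compact_setX cB cB)).
  have -> : [set z : Rn * Rn | `|z| = 1] = (fun z : Rn * Rn => `|z|) @^-1` [set 1 : R] by [].
  by move: (@closed_eq R 1); apply: closed_comp => z _; exact: norm_continuous.
move=> [a b] /=; rewrite prod_normE /= => ab; split=> /=.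
  by rewrite -ab le_max lexx.
by rewrite -ab le_max lexx orbT.
Qed.

(** Both sides are homogeneous of degree 2 in the pair of vectors. *)
Lemma tame_sphere (k : R) (U : set Rn) (f : Rn -> Cn) (x : Rn) : open U -> U x -> CinfC U f ->
  (forall z : Rn * Rn, `|z| = 1 ->
   omega (derivC z.1 f x) (derivC z.2 f x) < k * (nsq (derivC z.1 f x) + nsq (derivC z.2 f x))) ->
  tame k f x.
Proof.
move=> oU Ux Cf h a b ab; pose r := `|(a, b) : Rn * Rn|.
have r0 : 0 < r.
  rewrite /r normr_gt0; apply/eqP => -[a0 b0].
  by case: ab => /eqP; apply.
have zr : `|(r^-1 *: a, r^-1 *: b) : Rn * Rn| = 1.
  have -> : (r^-1 *: a, r^-1 *: b) = r^-1 *: ((a, b) : Rn * Rn) by [].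
  by rewrite normrZ gtr0_norm ?invr_gt0 // mulVf // gt_eqF.
have := h _ zr; rewrite /= !(ltan_comb _ oU Ux Cf) !combZ !euclidZl !euclidZr !omegaZl !omegaZr.
set w := omega _ _; set p := euclid _ _; set q := euclid _ _ => hh.
have e : r * r * (r^-1 * (r^-1 * w)) = w by field; rewrite gt_eqF.
have e2 : r * r * (k * (r^-1 * (r^-1 * p) + r^-1 * (r^-1 * q))) = k * (p + q) by field; rewrite gt_eqF.
by rewrite -e -e2 ltr_pM2l // mulr_gt0.
Qed.

(* By compactness of the unit sphere the strict inequality is an open condition on [y]. *)
Lemma tame_near (V : normedModType R) (y0 : V) (k : V -> R) (t : V -> 'I_n -> Cn) :
  {for y0, continuous k} ->
  (forall i j, {for y0, continuous (fun y => euclid (t y i) (t y j))}) ->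
  (forall i j, {for y0, continuous (fun y => omega (t y i) (t y j))}) ->
  (forall a b : Rn, a != 0 \/ b != 0 ->
    omega (comb a (t y0)) (comb b (t y0)) < k y0 * (nsq (comb a (t y0)) + nsq (comb b (t y0)))) ->
  \forall y \near y0, forall z : Rn * Rn, `|z| = 1 ->
    omega (comb z.1 (t y)) (comb z.2 (t y)) < k y * (nsq (comb z.1 (t y)) + nsq (comb z.2 (t y))).
Proof.
move=> ck ce cw pos.
pose P (w : (Rn * Rn) * V) : Prop :=
  omega (comb w.1.1 (t w.2)) (comb w.1.2 (t w.2)) < k w.2 * (nsq (comb w.1.1 (t w.2)) + nsq (comb w.1.2 (t w.2))).
suff : \forall y \near y0, forall z, [set z : Rn * Rn | `|z| = 1] z -> P (z, y) by apply: filterS => y h z; exact: h.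
apply: (@compact_near _ _ _ _ P unit_sphere_compact) => z0 z01.
pose S (w : Rn * Rn * V) := k w.2 * (nsq (comb w.1.1 (t w.2)) + nsq (comb w.1.2 (t w.2))) -
   omega (comb w.1.1 (t w.2)) (comb w.1.2 (t w.2)).
have cz i (a : Rn) : {for a, continuous (fun a : Rn => a 0 i)} by exact: (fc_cont (fincoord_rV n)).
have c11 i : {for (z0, y0), continuous (fun w : Rn * Rn * V => w.1.1 0 i)}.
  exact: (@continuous_fst _ _ _ _ (z0, y0) (@continuous_fst _ _ _ _ z0 (cz i _))).
have c12 i : {for (z0, y0), continuous (fun w : Rn * Rn * V => w.1.2 0 i)}.
  exact: (@continuous_fst _ _ _ _ (z0, y0) (@continuous_snd _ _ _ _ z0 (cz i _))).
have c2 (f : V -> R) : {for y0, continuous f} -> {for (z0, y0), continuous (fun w : Rn * Rn * V => f w.2)}.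
  by move=> cf; exact: (@continuous_snd _ _ _ _ (z0, y0) cf).
have cEa : {for (z0, y0), continuous (fun w : Rn * Rn * V => nsq (comb w.1.1 (t w.2)))}.
  rewrite (_ : (fun w : Rn * Rn * V => nsq (comb w.1.1 (t w.2))) =
    fun w => \sum_i \sum_j w.1.1 0 i * (w.1.1 0 j * euclid (t w.2 i) (t w.2 j))); last first.
    apply/funext => w; rewrite euclid_comb_l; apply: eq_bigr => i _.
    by rewrite euclid_comb_r mulr_sumr.
  apply: cont_sum => i; apply: cont_sum => j; apply: cvgM; first exact: c11.
  by apply: cvgM; [exact: c11|exact: (c2 _ (ce i j))].
have cEb : {for (z0, y0), continuous (fun w : Rn * Rn * V => nsq (comb w.1.2 (t w.2)))}.
  rewrite (_ : (fun w : Rn * Rn * V => nsq (comb w.1.2 (t w.2))) =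
    fun w => \sum_i \sum_j w.1.2 0 i * (w.1.2 0 j * euclid (t w.2 i) (t w.2 j))); last first.
    apply/funext => w; rewrite euclid_comb_l; apply: eq_bigr => i _.
    by rewrite euclid_comb_r mulr_sumr.
  apply: cont_sum => i; apply: cont_sum => j; apply: cvgM; first exact: c12.
  by apply: cvgM; [exact: c12|exact: (c2 _ (ce i j))].
have cW : {for (z0, y0), continuous (fun w : Rn * Rn * V => omega (comb w.1.1 (t w.2)) (comb w.1.2 (t w.2)))}.
  rewrite (_ : (fun w : Rn * Rn * V => omega (comb w.1.1 (t w.2)) (comb w.1.2 (t w.2))) =
    fun w => \sum_i \sum_j w.1.1 0 i * (w.1.2 0 j * omega (t w.2 i) (t w.2 j))); last first.
    apply/funext => w; rewrite omega_comb_l; apply: eq_bigr => i _.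
    by rewrite omega_comb_r mulr_sumr.
  apply: cont_sum => i; apply: cont_sum => j; apply: cvgM; first exact: c11.
  by apply: cvgM; [exact: c12|exact: (c2 _ (cw i j))].
have cS : {for (z0, y0), continuous S}.
  by apply: cvgB => //; apply: cvgM; [exact: c2|exact: cvgD].
have S0 : 0 < S (z0, y0).
  rewrite subr_gt0; apply: pos; apply/orP; rewrite -negb_and; apply/negP => /andP[/eqP z1 /eqP z2].
  have e : z0 = 0 by case: (z0) z1 z2 => u v /= -> ->.
  by move: z01; rewrite e /= normr0 => /eqP; rewrite eq_sym oner_eq0.
have nS := @cvgr_gt R _ (nbhs (z0, y0)) _ S _ cS 0 S0.
have {}nS : \forall w \near (z0, y0), 0 < S w by exact: nS.
by apply: filterS nS => -[z y] /=; rewrite /S /P /= subr_gt0.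
Qed.

End Positivity.

Lemma dist_half (R : realType) (t r : R) : 0 < r -> `|t - r / 2 - t| < r.
Proof. by move=> r0; rewrite addrAC subrr add0r normrN gtr0_norm ?divr_gt0 //; lra. Qed.

Lemma nbhsI (X : topologicalType) (x : X) (A B : set X) : nbhs x A -> nbhs x B -> nbhs x (A `&` B).
Proof. exact: filterI. Qed.

Section Preservation.
Context {R : realType} {n : nat} {M : smooth_manifold R n}.
Local Notation Cn := 'rV[R[i]]_n.
Local Notation Rn := 'rV[R]_n.
Local Notation nsq u := (euclid u u).

Lemma coord_near (c : chart M) (p : M) (t : R) (W : set (Rn * R)) : chart_dom c p ->
  nbhs (coord c p, t) W -> nbhs (p, t) [set z : M * R | chart_dom c z.1 /\ W (coord c z.1, z.2)].
Proof.
move=> cp [[A B] /= [nA nB] AB].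
exists (chart_dom c `&` (coord c @^-1` A), B) => /=.
  split=> //; apply: filterI; last exact: (coord_continuous cp).
  by apply: open_nbhs_nbhs; split=> //; exact: dom_open.
by move=> [q s] /= [[cq Aq] Bs]; split=> //; exact: (AB (_, _)).
Qed.

Lemma derivC_neq0 (f : M -> Cn) (c : chart M) x (a : Rn) : immersion f -> chart_image c x ->
  derivC a (local_rep f c) x = 0 -> a = 0.
Proof.
move=> fi cx; rewrite (ltan_comb a (chart_image_open c) cx (local_rep_CinfC fi c)).
exact: fi.2.
Qed.

(** The Jacobian of the transition carries pairs to pairs, and a nonzero pair to a nonzero one
    because an immersion is injective on tangent vectors. *)
Lemma tame_change (f : M -> Cn) (c d : chart M) x (k : R) : immersion f -> chart_image c x ->
  chart_dom d (param c x) -> tame k (local_rep f d) (coord d (param c x)) ->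
  tame k (local_rep f c) x.
Proof.
move=> fi cx dx h a b ab; rewrite !(ltan_change fi _ cx dx); apply: h.
have z (e : Rn) : e *m transition_jacobian c d x = 0 -> e = 0.
  move=> e0; apply: (derivC_neq0 fi cx); rewrite (ltan_change fi _ cx dx) e0.
  have dy : chart_image d (coord d (param c x)) by exact: coord_image.
  rewrite (ltan_comb _ (chart_image_open d) dy (local_rep_CinfC fi d)).
  exact: comb0.
by case: ab => ab; [left|right]; apply/negP => /eqP /z /eqP; apply/negP.
Qed.

Lemma tame_small (w p : R) : 0 <= p -> (forall d : R, 0 < d -> d <= 4^-1 -> w <= d * p) -> w <= 0.
Proof.
move=> p0 h; rewrite leNgt; apply/negP => w0.
have pp : 0 < p.
  rewrite lt_neqAle p0 andbT eq_sym; apply/eqP => pe.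
  by have := h 4^-1; rewrite pe mulr0 => /(_ _ (lexx _)); rewrite leNgt w0 => /(_ ltac:(by [])).
pose d := Num.min 4^-1 (w / (2 * p)).
have p2 : 0 < 2 * p by rewrite mulr_gt0.
have d0 : 0 < d by rewrite /d lt_min divr_gt0 // andbT.
have d1 : d <= 4^-1 by rewrite /d ge_min lexx.
have : d * p <= w / (2 * p) * p by rewrite ler_pM2r // /d ge_min lexx orbT.
have -> : w / (2 * p) * p = w / 2 by field; rewrite gt_eqF.
move=> q; have := le_trans (h d d0 d1) q; lra.
Qed.

Variables (T : \bar R) (F : M -> R -> Cn).
Hypothesis oM : oriented M.
Hypothesis flow : lagrangian_mcf T F.
Hypothesis cM : compact [set: M].

Section LocalFlowAt.
Variables (c : chart M) (O : set (Rn * R)) (G : Rn * R -> Cn).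
Hypotheses (oO : open O) (CG : CinfC O G).
Hypothesis GF : forall x t, O (x, t) -> [/\ chart_image c x, (t%:E < T)%E &
     0 <= t -> G (x, t) = local_rep (F ^~ t) c x].

Definition space_tan (y : Rn * R) (k : 'I_n) : Cn := derivC ((delta_mx 0 k, 0) : Rn * R) G y.
Definition space_hess (y : Rn * R) (k l : 'I_n) : Cn :=
  derivC ((delta_mx 0 k, 0) : Rn * R) (derivC ((delta_mx 0 l, 0) : Rn * R) G) y.

Lemma space_tanE x t : O (x, t) -> 0 <= t -> space_tan (x, t) = ltan (local_rep (F ^~ t) c) x.
Proof. by move=> Oxt t0; apply/funext => k; exact: (flow_slice_derivC oO GF). Qed.

Lemma space_hessE x t : O (x, t) -> 0 <= t -> space_hess (x, t) = lhess (local_rep (F ^~ t) c) x.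
Proof.
by move=> Oxt t0; apply/funext => k; apply/funext => l; exact: (flow_slice_derivC2 oO GF).
Qed.

Lemma space_tan_CinfC k : CinfC O (fun y => space_tan y k).
Proof. exact: CinfC_derivC. Qed.

Lemma space_hess_CinfC k l : CinfC O (fun y => space_hess y k l).
Proof. by apply: CinfC_derivC => //; exact: CinfC_derivC. Qed.

Lemma flow_interval x t : O (x, t) -> 0 <= t -> time_interval T t.
Proof. by move=> /GF[]. Qed.

Lemma flow_gram x t : O (x, t) -> 0 <= t -> gram (space_tan (x, t)) \in unitmx.
Proof.
move=> Oxt t0; rewrite space_tanE //; apply: immersion_gram; last by case: (GF Oxt).
exact: (flow_immersion flow (flow_interval Oxt t0)).
Qed.

End LocalFlowAt.

Definition curv_le (K : R) (f : M -> Cn) (c : chart M) (x : Rn) : Prop := forall a b : Rn,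
  nsq (nrm (ltan (local_rep f c) x) (derivC a (derivC b (local_rep f c)) x)) <=
  K * nsq (derivC a (local_rep f c) x) * nsq (derivC b (local_rep f c) x).

Lemma curv_leW K K' f c x : K <= K' -> curv_le K f c x -> curv_le K' f c x.
Proof.
by move=> KK h a b; apply: le_trans (h a b) _; rewrite !ler_wpM2r // euclid_ge0.
Qed.

Lemma local_curv_bound (p0 : M) (t0 : R) : time_interval T t0 -> exists K : R,
  nbhs (p0, t0) [set z : M * R | 0 <= z.2 -> exists2 c, chart_dom c z.1 &
    curv_le K (F ^~ z.2) c (coord c z.1)].
Proof.
move=> Tt0; set c := chart_at p0; have cp : chart_dom c p0 by exact: dom_chart_at.
have [W [G [pW Oxt CG GF]]] := local_flow flow (coord_image cp) Tt0.
pose dg y := \det (gram (space_tan G y)).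
have Cg i j : Cinf W (fun y => gram (space_tan G y) i j).
  by under eq_fun do rewrite gramE; apply: Cinf_euclid => //; exact: space_tan_CinfC.
have Cdg : Cinf W dg by exact: Cinf_det.
(* At negative times the extension [G] need not be an immersion, so the domain is restricted to
   nonzero Gram determinant. *)
pose O1 := [set y | W y /\ dg y != 0].
have pW1 : open O1.
  rewrite openE => y [Oy dy]; apply: filterI; first exact: (open_nbhs_nbhs (conj pW Oy)).
  have cd : {for y, continuous dg} by exact: (Cinf_cont Cdg Oy).
  have : nbhs (dg y) [set r : R | r != 0] by apply: open_nbhs_nbhs; split=> //; exact: open_neq.
  by move=> /cd.
have gu y : O1 y -> gram (space_tan G y) \in unitmx by move=> [_ dy]; rewrite unitmxE unitfE.
have sub : O1 `<=` W by move=> y [].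
have Ck : Cinf O1 (fun y => curv_bound (space_tan G y) (space_hess G y)).
  apply: Cinf_curv_bound => // [k|k l].
    by apply: CinfC_sub (space_tan_CinfC CG k).
  by apply: CinfC_sub (space_hess_CinfC CG k l).
have O1x : O1 (coord c p0, t0).
  split=> //; have := flow_gram pW GF Oxt Tt0.1; by rewrite unitmxE unitfE.
pose K := curv_bound (space_tan G (coord c p0, t0)) (space_hess G (coord c p0, t0)) + 1.
exists K.
have ck := Cinf_cont Ck O1x.
have nK : nbhs (coord c p0, t0) [set y | curv_bound (space_tan G y) (space_hess G y) < K].
  by apply: (@cvgr_lt R _ (nbhs (coord c p0, t0)) _ _ _ ck); rewrite ltrDl.
have nO : nbhs (coord c p0, t0) O1 by exact: open_nbhs_nbhs.
have := coord_near cp (nbhsI nO nK); apply: filterS => -[p t] /= [cp' [[Oy dy] ky] t_ge0].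
exists c => // a b.
have Tt := flow_interval GF Oy t_ge0.
have gi := flow_immersion flow Tt.
have cx : chart_image c (coord c p) by exact: coord_image.
have := curv_boundP a b (chart_image_open c) cx (local_rep_CinfC gi c) (immersion_gram gi cx).
rewrite -(space_tanE pW GF Oy t_ge0) -(space_hessE pW GF Oy t_ge0) => h.
apply: le_trans h _; rewrite !ler_wpM2r ?euclid_ge0 //; exact: ltW.
Qed.

Lemma global_curv_bound t1 : time_interval T t1 -> exists K : R,
  forall p t, 0 <= t -> t <= t1 -> exists2 c, chart_dom c p &
    curv_le K (F ^~ t) c (coord c p).
Proof.
move=> Tt1.
pose P (K : R) (z : M * R) := 0 <= z.2 -> z.2 <= t1 -> exists2 c, chart_dom c z.1 &
    curv_le K (F ^~ z.2) c (coord c z.1).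
have cK : compact ([set: M] `*` [set` `[0, t1]]) by apply: compact_setX => //; exact: segment_compact.
have /compact_near_coveringP cov := cK.
have : \forall K \near +oo, forall z, ([set: M] `*` [set` `[0, t1]]) z -> P K z.
  apply: cov => -[p0 t0] [_ /=]; rewrite in_itv /= => /andP[t00 t01].
  have Tt0 : time_interval T t0 by split=> //; apply: le_lt_trans Tt1.2; rewrite lee_fin.
  have [K0 nK] := local_curv_bound p0 Tt0.
  exists ([set z : M * R | 0 <= z.2 -> exists2 c, chart_dom c z.1 &
    curv_le K0 (F ^~ z.2) c (coord c z.1)], [set K | K0 < K]).
    by split=> //=; exists K0; split=> //; exact: num_real.
  move=> [z K] [/= hz KK] z0 z1; have [c cz h] := hz z0; exists c => //.
  by apply: curv_leW h; exact: ltW.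
move=> [K [_ hK]]; exists (K + 1) => p t t0 tt1.
by apply: (hK (K + 1) _ (p, t)) => //; rewrite ?ltrDl //; split=> //=; rewrite in_itv /= t0.
Qed.

Definition tame_at (k : R) (t : R) (p : M) : Prop :=
  tame k (local_rep (F ^~ t) (chart_at p)) (coord (chart_at p) p).

Lemma tame_atP (k t : R) (p : M) (c : chart M) : time_interval T t -> chart_dom c p ->
  tame_at k t p <-> tame k (local_rep (F ^~ t) c) (coord c p).
Proof.
move=> Tt cp; have gi := flow_immersion flow Tt.
have dp : chart_dom (chart_at p) p by exact: dom_chart_at.
split=> h.
  apply: (tame_change gi (coord_image cp) (d := chart_at p)); by rewrite coordK.
by apply: (tame_change gi (coord_image dp) (d := c)); rewrite coordK.
Qed.

Lemma tame_at_near (d C : R) (p0 : M) (t0 : R) : time_interval T t0 -> tame_at (d * expR (C * t0)) t0 p0 ->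
  nbhs (p0, t0) [set z : M * R | 0 <= z.2 -> tame_at (d * expR (C * z.2)) z.2 z.1].
Proof.
move=> Tt0 h; set c := chart_at p0; have cp : chart_dom c p0 by exact: dom_chart_at.
have [W [G [pW Oxt CG GF]]] := local_flow flow (coord_image cp) Tt0.
have Ct k := space_tan_CinfC CG k.
have ck : {for (coord c p0, t0), continuous (fun y : Rn * R => d * expR (C * y.2))}.
  apply: cvgM; first exact: cvg_cst.
  apply: (@continuous_snd _ _ _ (fun t => expR (C * t)) (coord c p0, t0)) => /=.
  apply: continuous_comp; last exact: continuous_expR.
  by apply: cvgM; [exact: cvg_cst|exact: cvg_id].
have ce i j : {for (coord c p0, t0), continuous (fun y => euclid (space_tan G y i) (space_tan G y j))}.
  exact: (Cinf_cont (Cinf_euclid pW (Ct i) (Ct j)) Oxt).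
have cw i j : {for (coord c p0, t0), continuous (fun y => omega (space_tan G y i) (space_tan G y j))}.
  exact: (Cinf_cont (Cinf_omega pW (Ct i) (Ct j)) Oxt).
have cb a x t : W (x, t) -> 0 <= t -> comb a (space_tan G (x, t)) = derivC a (local_rep (F ^~ t) c) x.
  move=> Oy t_ge0; have [cx _ _] := GF _ _ Oy.
  rewrite (space_tanE pW GF Oy t_ge0) (ltan_comb a (chart_image_open c) cx) //.
  exact: local_rep_CinfC (flow_immersion flow (flow_interval GF Oy t_ge0)) c.
have nt := tame_near ck ce cw (fun a b ab => ltac:(rewrite /= !(cb _ _ _ Oxt Tt0.1); exact: h)).
have := coord_near cp (nbhsI (open_nbhs_nbhs (conj pW Oxt)) nt).
apply: filterS => -[p t] /= [cp' [Oy hz]] t_ge0.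
have Tt := flow_interval GF Oy t_ge0.
apply/(tame_atP _ Tt cp').
apply: (tame_sphere (chart_image_open c) (coord_image cp') (local_rep_CinfC (flow_immersion flow Tt) c)).
by move=> z z1; rewrite -!(cb _ _ _ Oy t_ge0); exact: hz.
Qed.

Section FirstContact.
Variables (d C K t1 : R).
Hypotheses (d0 : 0 < d) (d4 : d * expR (C * t1) <= 4^-1) (C0 : 0 <= C) (CK : 6 * n%:R * K < C).
Hypothesis Tt1 : time_interval T t1.
Hypothesis KP : forall p t, 0 <= t -> t <= t1 -> exists2 c, chart_dom c p & curv_le K (F ^~ t) c (coord c p).

Let tame_d t p := tame_at (d * expR (C * t)) t p.

Lemma tame_initial p : tame_d 0 p.
Proof.
have T0 : time_interval T 0 by split=> //; case: flow.
have cp := coord_image (dom_chart_at p); have gi := flow_immersion flow T0.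
have cC := local_rep_CinfC gi (chart_at p).
move=> a b ab; rewrite mulr0 expR0 mulr1.
have -> : omega (derivC a (local_rep (F ^~ 0) (chart_at p)) (coord (chart_at p) p))
  (derivC b (local_rep (F ^~ 0) (chart_at p)) (coord (chart_at p) p)) = 0.
  rewrite !(ltan_comb _ (chart_image_open _) cp cC) omega_comb_l big1 // => i _.
  rewrite omega_comb_r big1 ?mulr0 // => j _.
  by case: flow => _ _ _ [_ h] _; rewrite (h _ _ cp i j) mulr0.
apply: mulr_gt0 => //.
have pz (e : Rn) : e != 0 -> 0 < nsq (derivC e (local_rep (F ^~ 0) (chart_at p)) (coord (chart_at p) p)).
  move=> e0; rewrite lt_neqAle euclid_ge0 andbT eq_sym; apply/eqP => /euclid_eq0.
  by move=> /(derivC_neq0 gi cp) /eqP; apply/negP.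
case: ab => /pz h; first exact: (ltr_wpDr (euclid_ge0 _) h).
exact: (ltr_wpDl (euclid_ge0 _) h).
Qed.

(** Strict inequality before t gives the weak one up to t, by continuity, on a whole neighbourhood
    in space. A failure at t is then an equality, which is the contact excluded by [no_contact]. *)
Lemma first_contact t : 0 < t -> t <= t1 -> (forall s p, 0 <= s -> s < t -> tame_d s p) ->
  forall p, tame_d t p.
Proof.
move=> t0 tt1 before p.
have Tt : time_interval T t.
  by split; [exact: ltW|apply: le_lt_trans Tt1.2; rewrite lee_fin].
have [c cp Kc] := KP p (ltW t0) tt1.
apply/(tame_atP _ Tt cp) => a b ab; rewrite ltNge; apply/negP => hab.
have [W [G [pW Oxt CG GF]]] := local_flow flow (coord_image cp) Tt.
(* Only positive times are kept, where [G] is the flow itself. *)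
pose W' := W `&` [set y : Rn * R | 0 < y.2].
have pW' : open W'.
  apply: openI => //; apply: (@open_comp _ _ (fun y : Rn * R => y.2) [set r : R | 0 < r]).
    by move=> y _; exact: (@continuous_snd Rn R R id y cvg_id).
  exact: open_gt.
have Wx : W' (coord c p, t) by split.
have CG' : CinfC W' G by apply: CinfC_sub CG => y [].
have GF' x s : W' (x, s) -> [/\ chart_image c x, (s%:E < T)%E &
     0 <= s -> G (x, s) = local_rep (F ^~ s) c x] by move=> [/GF].
have DE e x s : W' (x, s) -> derivC ((e, 0) : Rn * R) G (x, s) = derivC e (local_rep (F ^~ s) c) x.
  by move=> Wy; apply: (flow_slice_derivC pW' GF' _ Wy); case: Wy => _ /ltW.
have le_before x s (e f : Rn) : W' (x, s) -> s < t ->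
  omega (derivC ((e, 0) : Rn * R) G (x, s)) (derivC ((f, 0) : Rn * R) G (x, s)) <=
  d * expR (C * s) * (nsq (derivC ((e, 0) : Rn * R) G (x, s)) + nsq (derivC ((f, 0) : Rn * R) G (x, s))).
  move=> Wy st; have [cx sT _] := GF' _ _ Wy; have s0 : 0 < s by case: Wy.
  have Ts : time_interval T s by split=> //; exact: ltW.
  rewrite !(DE _ _ _ Wy).
  have [cq xE] := paramP cx; have := before s (param c x) (ltW s0) st.
  move=> /(tame_atP _ Ts cq); rewrite xE => h.
  have [ef|] := boolP ((e != 0) || (f != 0)); first by apply: ltW; apply: h; exact/orP.
  rewrite negb_or !negbK => /andP[/eqP -> /eqP ->].
  have gi := flow_immersion flow Ts.
  rewrite !(ltan_comb _ (chart_image_open c) cx (local_rep_CinfC gi c)) comb0 omegaxx.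
  by rewrite euclid0r addr0 mulr0.
have le_upto x s (e f : Rn) : W' (x, s) -> s <= t ->
  omega (derivC ((e, 0) : Rn * R) G (x, s)) (derivC ((f, 0) : Rn * R) G (x, s)) <=
  d * expR (C * s) * (nsq (derivC ((e, 0) : Rn * R) G (x, s)) + nsq (derivC ((f, 0) : Rn * R) G (x, s))).
  rewrite le_eqVlt => Wy /orP[/eqP sE|]; last exact: le_before.
  rewrite sE in Wy *.
  pose D (r : R) := d * expR (C * r) * (nsq (derivC ((e, 0) : Rn * R) G (x, r)) + nsq (derivC ((f, 0) : Rn * R) G (x, r))) -
    omega (derivC ((e, 0) : Rn * R) G (x, r)) (derivC ((f, 0) : Rn * R) G (x, r)).
  have Ce : CinfC W' (derivC ((e, 0) : Rn * R) G) by exact: CinfC_derivC.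
  have Cf : CinfC W' (derivC ((f, 0) : Rn * R) G) by exact: CinfC_derivC.
  have cD : {for t, continuous D}.
    have [dD _] := exp_contact_derive d C Wy (CinfC_slice2 x pW' Ce) (CinfC_slice2 x pW' Cf).
    by apply: differentiable_continuous; apply/derivable1_diffP; exact: dD.
  rewrite -subr_ge0 leNgt; apply/negP => Dneg.
  have n1 : nbhs t [set r | D r < 0] by exact: (@cvgr_lt R _ (nbhs t) _ _ _ cD).
  have n2 : nbhs t [set r | W' (x, r)] by apply: open_nbhs_nbhs; split=> //; exact: open_slice2.
  have /nbhs_normP [r r0 hr] := nbhsI n1 n2.
  have [|D1 D2] := hr (t - r / 2).
    exact: dist_half.
  move: D1; apply/negP; rewrite -leNgt subr_ge0; apply: le_before => //.
  by rewrite ltrBlDr ltrDl divr_gt0.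
have gE : (fun x => G (x, t)) = (fun x => G (x, t)) by [].
have pU : open [set x | W' (x, t)] by exact: open_slice1.
have gL x : W' (x, t) -> G (x, t) = local_rep (F ^~ t) c x.
  by move=> Wy; have [_ _ ->] := GF' _ _ Wy; rewrite ?ltW.
have gi := flow_immersion flow Tt.
have tanE x : W' (x, t) -> ltan (fun y => G (y, t)) x = ltan (local_rep (F ^~ t) c) x.
  move=> Wy; apply/funext => k; rewrite /ltan.
  by apply: (derivC_ext _ pU Wy) => y Wy'; exact: gL.
apply: (@no_contact R n G W' (coord c p) t d C K a b _ _ gE erefl pW' Wx CG' _ _ d0 _ le_upto _ ab _ CK).
- by move=> x Wy; rewrite (tanE _ Wy); apply: immersion_gram => //; case: (GF' _ _ Wy).
- move=> x Wy; apply: (etrans (flow_time_derivC oM flow pW' CG' GF' Wy (ltW t0))).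
  by symmetry; apply: (lH_ext pU Wy) => y Wy'; exact: gL.
- by apply: le_trans d4; rewrite ler_pM2l // ler_expR ler_wpM2l.
- by apply/eqP; rewrite eq_le (le_upto _ _ _ _ Wx (lexx t)) /= !(DE _ _ _ Wx).
- move=> e f.
  have e1 (h : Rn) x : W' (x, t) -> derivC h (fun y => G (y, t)) x = derivC h (local_rep (F ^~ t) c) x.
    by move=> Wy; apply: (derivC_ext _ pU Wy) => y Wy'; exact: gL.
  rewrite (tanE _ Wx) !(e1 _ _ Wx) (derivC_ext e pU Wx (e1 f)).
  exact: Kc.
Qed.

(** The infimum m of the bad times is itself good, by [first_contact] or, for m = 0, by the initial
    condition. Strict inequality persists near m uniformly on the compact manifold, so no bad time
    follows m closely. *)
Lemma always_tame t p : 0 <= t -> t <= t1 -> tame_d t p.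
Proof.
move=> t0 tt1; apply: contrapT => nt.
pose bad := [set s : R | [/\ 0 <= s, s <= t1 & exists q, ~ tame_d s q]].
have bt : bad t by split=> //; exists p.
have lb : lbound bad 0 by move=> s [].
have hi : has_inf bad by split; [exists t|exists 0].
pose m := inf bad.
have m0 : 0 <= m by apply: lb_le_inf => //; exists t.
have mt : m <= t by apply: ge_inf => //; exists 0.
have mt1 := le_trans mt tt1.
have Tm : time_interval T m by split=> //; apply: le_lt_trans Tt1.2; rewrite lee_fin.
have before s q : 0 <= s -> s < m -> tame_d s q.
  move=> s0 sm; apply: contrapT => nq.
  have : bad s by split; [|exact: ltW (lt_le_trans sm mt1)|exists q].
  move=> bs; have : m <= s by apply: ge_inf => //; exists 0.
  by rewrite leNgt sm.
have atm q : tame_d m q.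
  move: m0; rewrite le_eqVlt => /orP[/eqP mE|mp]; last exact: first_contact.
  by rewrite -mE; exact: tame_initial.
have : nbhs m [set s | forall q, [set: M] q -> 0 <= s -> tame_d s q].
  apply: (@compact_near _ _ _ _ (fun z : M * R => 0 <= z.2 -> tame_d z.2 z.1) cM) => q _.
  exact: (tame_at_near Tm (atm q)).
move=> /nbhs_normP [r r0 hr].
have [s bs sm] := inf_adherent r0 hi.
have ms : m <= s by apply: ge_inf => //; exists 0.
have [s0 _ [q nq]] := bs; apply: nq.
by apply: (hr s _ q) => //=; rewrite ger0_norm ?subr_ge0 // ltrBlDl.
Qed.

End FirstContact.

Theorem lagrangian_preserved t1 : time_interval T t1 -> lagrangian (F ^~ t1).
Proof.
move=> Tt1; have gi := flow_immersion flow Tt1.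
have [K KP] := global_curv_bound Tt1.
pose C := 6 * n%:R * `|K| + 1.
have C0 : 0 <= C by rewrite addr_ge0 // mulr_ge0 // mulr_ge0.
have CK : 6 * n%:R * K < C.
  apply: (@le_lt_trans _ _ (6 * n%:R * `|K|)); last by rewrite ltrDl.
  by rewrite ler_wpM2l ?ler_norm // mulr_ge0.
have om c x (a b : Rn) : chart_image c x ->
  omega (derivC a (local_rep (F ^~ t1) c) x) (derivC b (local_rep (F ^~ t1) c) x) <= 0.
  move=> cx; have [cp xE] := paramP cx.
  set w := omega _ _; set q := nsq (derivC a (local_rep (F ^~ t1) c) x) + nsq (derivC b (local_rep (F ^~ t1) c) x).
  have q0 : 0 <= q by rewrite addr_ge0 ?euclid_ge0.
  apply: (tame_small q0) => d d0 d4.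
  (* Scaled so that the factor at time t1 is exactly d, with C independent of d; letting d tend to 0
     gives omega <= 0, and exchanging the two vectors gives equality. *)
  pose d' := d * expR (- (C * t1)).
  have dE : d' * expR (C * t1) = d by rewrite /d' -mulrA -expRD addNr expR0 mulr1.
  have d'0 : 0 < d' by rewrite mulr_gt0 ?expR_gt0.
  have d'4 : d' * expR (C * t1) <= 4^-1 by rewrite dE.
  have := always_tame d'0 d'4 C0 CK Tt1 KP (param c x) Tt1.1 (lexx t1).
  move=> /(tame_atP _ Tt1 cp); rewrite xE dE => h.
  have [ab|] := boolP ((a != 0) || (b != 0)); first by apply: ltW; apply: h; exact/orP.
  rewrite negb_or !negbK => /andP[/eqP a0 /eqP b0].
  rewrite /w a0 b0 omegaxx mulr_ge0 //; exact: ltW.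
split=> // c x cx i j; apply/eqP; rewrite eq_le om //= omegaC oppr_ge0; exact: om.
Qed.

End Preservation.

(** * The Lagrangian angle *)

Section ComplexDerivative.
Context {R : realType}.
Local Notation C := R[i].
Implicit Types V : normedModType R.

Definition Cinfc V (U : set V) (f : V -> C) :=
  Cinf U (fun x => complex.Re (f x)) /\ Cinf U (fun x => complex.Im (f x)).

Definition is_derivc V (f : V -> C) (x v : V) (d : C) :=
  is_derive x v (fun y => complex.Re (f y)) (complex.Re d) /\
  is_derive x v (fun y => complex.Im (f y)) (complex.Im d).

Lemma ReM (a b : C) : complex.Re (a * b) = complex.Re a * complex.Re b - complex.Im a * complex.Im b.
Proof. by case: a => a1 a2; case: b. Qed.

Lemma ImM (a b : C) : complex.Im (a * b) = complex.Re a * complex.Im b + complex.Im a * complex.Re b.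
Proof. by case: a => a1 a2; case: b. Qed.

Lemma ReD (a b : C) : complex.Re (a + b) = complex.Re a + complex.Re b.
Proof. by case: a => a1 a2; case: b. Qed.

Lemma ImD (a b : C) : complex.Im (a + b) = complex.Im a + complex.Im b.
Proof. by case: a => a1 a2; case: b. Qed.

Lemma Re_sum (I : Type) (r : seq I) (f : I -> C) :
  complex.Re (\sum_(i <- r) f i) = \sum_(i <- r) complex.Re (f i).
Proof. by elim: r => [|i r IH]; rewrite ?big_nil // !big_cons ReD IH. Qed.

Lemma Im_sum (I : Type) (r : seq I) (f : I -> C) :
  complex.Im (\sum_(i <- r) f i) = \sum_(i <- r) complex.Im (f i).
Proof. by elim: r => [|i r IH]; rewrite ?big_nil // !big_cons ImD IH. Qed.

Lemma CinfcD V (U : set V) (f g : V -> C) : open U -> Cinfc U f -> Cinfc U g ->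
  Cinfc U (fun x => f x + g x).
Proof.
move=> oU [f1 f2] [g1 g2]; split.
  by under eq_fun do rewrite ReD; exact: CinfD.
by under eq_fun do rewrite ImD; exact: CinfD.
Qed.

Lemma CinfcM V (U : set V) (f g : V -> C) : open U -> Cinfc U f -> Cinfc U g ->
  Cinfc U (fun x => f x * g x).
Proof.
move=> oU [f1 f2] [g1 g2]; split.
  by under eq_fun do rewrite ReM; apply: CinfB => //; exact: CinfM.
by under eq_fun do rewrite ImM; apply: CinfD => //; exact: CinfM.
Qed.

Lemma Cinfc_cst V (U : set V) (c : C) : Cinfc U (fun=> c).
Proof. by split; exact: Cinf_cst. Qed.

Lemma is_derivc_cst V (c : C) (x v : V) : is_derivc (fun=> c) x v 0.
Proof. by split; exact: is_derive_cst. Qed.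

Lemma is_derivcD V (f g : V -> C) x v df dg : is_derivc f x v df -> is_derivc g x v dg ->
  is_derivc (fun y => f y + g y) x v (df + dg).
Proof.
move=> [f1 f2] [g1 g2]; split.
  by under eq_fun do rewrite ReD; rewrite ReD; exact: is_deriveD.
by under eq_fun do rewrite ImD; rewrite ImD; exact: is_deriveD.
Qed.

Lemma is_derivcM V (f g : V -> C) x v df dg : is_derivc f x v df -> is_derivc g x v dg ->
  is_derivc (fun y => f y * g y) x v (df * g x + f x * dg).
Proof.
move=> [f1 f2] [g1 g2]; split.
  under eq_fun do rewrite ReM.
  have h := is_deriveB (is_deriveM f1 g1) (is_deriveM f2 g2).
  apply: (is_derive_eq h); rewrite /GRing.scale /= ReD !ReM; ring.
under eq_fun do rewrite ImM.
have h := is_deriveD (is_deriveM f1 g2) (is_deriveM f2 g1).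
apply: (is_derive_eq h); rewrite /GRing.scale /= ImD !ImM; ring.
Qed.

Lemma is_derivc_sum V (I : Type) (r : seq I) (f : I -> V -> C) (x v : V) (d : I -> C) :
  (forall i, is_derivc (f i) x v (d i)) ->
  is_derivc (fun y => \sum_(i <- r) f i y) x v (\sum_(i <- r) d i).
Proof.
move=> h; elim: r => [|i r IH].
  by under eq_fun do rewrite big_nil; rewrite big_nil; exact: is_derivc_cst.
by under eq_fun do rewrite big_cons; rewrite big_cons; exact: is_derivcD.
Qed.

Lemma is_derivc_prod V (I : finType) (f : I -> V -> C) (x v : V) (d : I -> C) :
  (forall i, is_derivc (f i) x v (d i)) ->
  is_derivc (fun y => \prod_i f i y) x v (\sum_i \prod_j (if j == i then d j else f j x)).
Proof.
move=> h; rewrite -[X in \sum_(i <- X) _]/(index_enum I).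
have : uniq (index_enum I) by exact: index_enum_uniq.
elim: (index_enum I) => [|i r IH] /=.
  move=> _; rewrite big_nil; under eq_fun do rewrite big_nil; exact: is_derivc_cst.
move=> /andP[ir ur]; under eq_fun do rewrite big_cons.
rewrite big_cons big_cons eqxx.
have := is_derivcM (h i) (IH ur).
congr is_derivc; congr (_ + _).
  congr (_ * _); rewrite big_seq [RHS]big_seq; apply: eq_bigr => j jr.
  by case: eqP => // ji; rewrite -ji jr in ir.
rewrite mulr_sumr big_seq [RHS]big_seq; apply: eq_bigr => j jr.
by rewrite big_cons; case: eqP => // ij; rewrite ij jr in ir.
Qed.

(** Jacobi's formula. Replacing row i by its derivative gives a matrix [B] whose determinant expands
    along that row with the cofactors of [A x]. The terms with factor 0 are the derivatives of the
    constant signs. *)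
Lemma is_derivc_det V n (A : V -> 'M[C]_n) (x v : V) (D : 'M[C]_n) :
  (forall i j, is_derivc (fun y => A y i j) x v (D i j)) ->
  is_derivc (fun y => \det (A y)) x v (\sum_i \sum_j D i j * cofactor (A x) i j).
Proof.
move=> h.
have -> : \sum_i \sum_j D i j * cofactor (A x) i j =
  \sum_(s : 'S_n) (0 * (\prod_i A x i (s i)) +
     (-1) ^+ s * (\sum_i \prod_j (if j == i then D j (s j) else A x j (s j)))).
  under [RHS]eq_bigr do rewrite mul0r add0r mulr_sumr.
  rewrite [RHS]exchange_big /=; apply: eq_bigr => i _.
  pose B := \matrix_(j, k) (if j == i then D j k else A x j k).
  transitivity (\det B).
    rewrite (expand_det_row _ i); apply: eq_bigr => j _; rewrite mxE eqxx /cofactor.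
    congr (_ * (_ * \det _)); apply/matrixP => a b; rewrite !mxE.
    by rewrite eq_sym (negPf (neq_lift _ _)).
  by rewrite /determinant; apply: eq_bigr => s _; congr (_ * _); apply: eq_bigr => j _; rewrite mxE.
rewrite /determinant; apply: is_derivc_sum => s.
by apply: is_derivcM; [exact: is_derivc_cst|exact: is_derivc_prod].
Qed.

Lemma Cinfc_sum V (U : set V) (I : Type) (r : seq I) (f : I -> V -> C) : open U ->
  (forall i, Cinfc U (f i)) -> Cinfc U (fun y => \sum_(i <- r) f i y).
Proof.
move=> oU h; elim: r => [|i r IH].
  by under eq_fun do rewrite big_nil; exact: Cinfc_cst.
by under eq_fun do rewrite big_cons; exact: CinfcD.
Qed.

Lemma Cinfc_prod V (U : set V) (I : Type) (r : seq I) (f : I -> V -> C) : open U ->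
  (forall i, Cinfc U (f i)) -> Cinfc U (fun y => \prod_(i <- r) f i y).
Proof.
move=> oU h; elim: r => [|i r IH].
  by under eq_fun do rewrite big_nil; exact: Cinfc_cst.
by under eq_fun do rewrite big_cons; exact: CinfcM.
Qed.

Lemma Cinfc_det V n (U : set V) (A : V -> 'M[C]_n) : open U ->
  (forall i j, Cinfc U (fun y => A y i j)) -> Cinfc U (fun y => \det (A y)).
Proof.
move=> oU h; rewrite /determinant; apply: Cinfc_sum => // s.
by apply: CinfcM => //; [exact: Cinfc_cst|exact: Cinfc_prod].
Qed.

Lemma quotient_deriv_eq (p q pa qa pb qb qab pab : R) : p * p + q * q != 0 ->
  (p * qb - q * pb) * (- (p * p + q * q) ^- 2 * (p * pa + p * pa + (q * qa + q * qa))) +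
  (p * p + q * q)^-1 * (p * qab + qb * pa - (q * pab + pb * qa)) =
  (pa * qb + p * qab - (qa * pb + q * pab)) / (p ^+ 2 + q ^+ 2) -
  (p * qb - q * pb) * (2 * (p * pa + q * qa)) / (p ^+ 2 + q ^+ 2) ^+ 2.
Proof. by move=> h; rewrite !expr2 -!expr2; field; rewrite !expr2. Qed.

Lemma quotient_deriv_sym (p q pv qv pw qw pvw qvw : R) : p ^+ 2 + q ^+ 2 != 0 ->
  (pv * qw + p * qvw - (qv * pw + q * pvw)) / (p ^+ 2 + q ^+ 2) -
  (p * qw - q * pw) * (2 * (p * pv + q * qv)) / (p ^+ 2 + q ^+ 2) ^+ 2 =
  (pw * qv + p * qvw - (qw * pv + q * pvw)) / (p ^+ 2 + q ^+ 2) -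
  (p * qv - q * pv) * (2 * (p * pw + q * qw)) / (p ^+ 2 + q ^+ 2) ^+ 2.
Proof. by move=> h; field. Qed.

(* Clairaut for the differential of the argument of P + iQ. *)
Lemma angle_closed V (U : set V) (P Q : V -> R) (x v w : V) : open U -> U x ->
  Cinf U P -> Cinf U Q -> (forall y, U y -> P y ^+ 2 + Q y ^+ 2 != 0) ->
  'D_v (fun y => (P y * 'D_w Q y - Q y * 'D_w P y) / (P y ^+ 2 + Q y ^+ 2)) x =
  'D_w (fun y => (P y * 'D_v Q y - Q y * 'D_v P y) / (P y ^+ 2 + Q y ^+ 2)) x.
Proof.
move=> oU Ux CP CQ nz.
have dv (g : V -> R) a : Cinf U g -> is_derive x a g ('D_a g x).
  by move=> Cg; apply: DeriveDef => //; exact: (Cinf_derivable a Cg).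
have D a b : 'D_a (fun y => (P y * 'D_b Q y - Q y * 'D_b P y) / (P y ^+ 2 + Q y ^+ 2)) x =
   ('D_a P x * 'D_b Q x + P x * 'D_a ('D_b Q) x - ('D_a Q x * 'D_b P x + Q x * 'D_a ('D_b P) x)) /
   (P x ^+ 2 + Q x ^+ 2) -
   (P x * 'D_b Q x - Q x * 'D_b P x) * (2 * (P x * 'D_a P x + Q x * 'D_a Q x)) / (P x ^+ 2 + Q x ^+ 2) ^+ 2.
  have p := dv _ a CP; have q := dv _ a CQ.
  have p' := dv _ a (Cinf_derive b CP); have q' := dv _ a (Cinf_derive b CQ).
  have num := is_deriveB (is_deriveM p q') (is_deriveM q p').
  have den := is_deriveD (is_deriveM p p) (is_deriveM q q).
  have nzx : (P * P + Q * Q) x != 0 by rewrite /= [X in X != _](_ : _ = P x ^+ 2 + Q x ^+ 2) ?nz // !expr2.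
  have inv : is_derive x a (fun y => ((P * P + Q * Q) y)^-1)
    (- ((P * P + Q * Q) x) ^- 2 *: (P x *: 'D_a P x + P x *: 'D_a P x + (Q x *: 'D_a Q x + Q x *: 'D_a Q x))).
    by have [e1 e2] := den; apply: DeriveDef; [exact: derivableV|rewrite deriveV // e2].
  have h := is_deriveM num inv.
  rewrite (_ : (fun y => _ / _) = (P * 'D_b Q - Q * 'D_b P) * (fun y => ((P * P + Q * Q) y)^-1)); last first.
    by apply/funext => y; rewrite /= !expr2.
  rewrite (@derive_val _ _ _ _ _ _ _ h) /GRing.scale /=.
  have nx := nz x Ux; rewrite !expr2 in nx.
  have -> : (P * P + Q * Q) x = P x * P x + Q x * Q x by [].
  have -> : (P * 'D_b Q - Q * 'D_b P) x = P x * 'D_b Q x - Q x * 'D_b P x by [].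
  exact: quotient_deriv_eq.
rewrite !D (Clairaut v w oU Ux (CP 2%N)) (Clairaut v w oU Ux (CQ 2%N)).
exact: quotient_deriv_sym (nz x Ux).
Qed.

End ComplexDerivative.

Section LagrangianFrame.
Context {R : realType} {n : nat}.
Local Notation C := R[i].
Local Notation Cn := 'rV[C]_n.
Implicit Types (t : 'I_n -> Cn) (u v : Cn).

Definition tmx t : 'M[C]_n := \matrix_(i, j) (t i) 0 j.
(** The Hermitian product, antilinear in the first argument. On a Lagrangian frame it is real and
    reduces to the Gram matrix. *)
Definition herm u v : C := euclid u v +i* omega u v.

Local Transparent xcoord ycoord.
Lemma hermE u v : herm u v = \sum_j (v 0 j) * (u 0 j)^*%C.
Proof.
apply/eqP; rewrite eq_complex /herm omegaE /euclid Re_sum Im_sum /=.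
apply/andP; split; apply/eqP; apply: eq_bigr => j _; rewrite /xcoord /ycoord;
  case: (u 0 j) => x y; case: (v 0 j) => x' y' /=; ring.
Qed.
Local Opaque xcoord ycoord.

Section Frame.
Variable t : 'I_n -> Cn.
Hypothesis gu : gram t \in unitmx.
Hypothesis lag : forall i j, omega (t i) (t j) = 0.

(** The tangential correction lies in the Lagrangian plane, where omega with [t k] vanishes. *)
Lemma omega_nrm k v : omega (t k) (nrm t v) = omega (t k) v.
Proof.
rewrite nrm_combE omegaDr omegaNr omega_comb_r big1 ?oppr0 ?addr0 // => i _.
by rewrite lag mulr0.
Qed.

Let rc (r : R) : C := r%:C.

Lemma tmx_hermitian : tmx t *m (map_mx (fun z : C => z^*%C) (tmx t))^T = map_mx rc (gram t).
Proof.
apply/matrixP => i l; rewrite !mxE; under eq_bigr do rewrite !mxE.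
by rewrite -hermE /herm lag euclidC.
Qed.

Lemma tmx_inverse : tmx t *m ((map_mx (fun z : C => z^*%C) (tmx t))^T *m map_mx rc (invmx (gram t))) = 1%:M.
Proof.
have -> : rc = real_complex R by [].
by rewrite mulmxA tmx_hermitian -map_mxM mulmxV // map_mx1.
Qed.

Lemma det_tmx_neq0 : \det (tmx t) != 0.
Proof.
apply/negP => /eqP d0; have := congr1 determinant tmx_inverse.
by rewrite det_mulmx d0 mul0r det1 => /eqP; rewrite eq_sym oner_eq0.
Qed.

Lemma adj_tmx : \adj (tmx t) =
  \det (tmx t) *: ((map_mx (fun z : C => z^*%C) (tmx t))^T *m map_mx rc (invmx (gram t))).
Proof.
have h := mulmx1C tmx_inverse.
by rewrite -[LHS]mul1mx -h -mulmxA mul_mx_adj scalar_mxC mul_scalar_mx.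
Qed.

(** The trace of S T^-1, where T and S are the matrices of the frames [t] and [s]: the logarithmic
    derivative of det T when the frame moves with velocity [s]. *)
Definition dlog_det (s : 'I_n -> Cn) : C :=
  \sum_i \sum_l herm (t l) (s i) * (invmx (gram t) l i)%:C.

Lemma cofactor_tmx (s : 'I_n -> Cn) :
  \sum_i \sum_j (s i) 0 j * cofactor (tmx t) i j = \det (tmx t) * dlog_det s.
Proof.
rewrite /dlog_det mulr_sumr; apply: eq_bigr => i _.
transitivity ((tmx s *m \adj (tmx t)) i i).
  by rewrite mxE; apply: eq_bigr => j _; rewrite !mxE.
rewrite adj_tmx -scalemxAr mulmxA mxE; congr (_ * _); rewrite mxE; apply: eq_bigr => l _.
by rewrite !mxE hermE; congr (_ * _); apply: eq_bigr => j _; rewrite !mxE.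
Qed.

Lemma Im_dlog_det s : complex.Im (dlog_det s) =
  \sum_i \sum_l omega (t l) (s i) * invmx (gram t) l i.
Proof.
rewrite /dlog_det Im_sum; apply: eq_bigr => i _; rewrite Im_sum.
by apply: eq_bigr => l _; rewrite ImM /= mulr0 add0r.
Qed.

Local Transparent mcurv.
Lemma omega_mcurv (h : 'I_n -> 'I_n -> Cn) k :
  omega (t k) (mcurv t h) = \sum_i \sum_l omega (t k) (h i l) * invmx (gram t) l i.
Proof.
rewrite /mcurv omega_sumr; apply: eq_bigr => i _; rewrite omega_sumr; apply: eq_bigr => l _.
by rewrite omegaZr omega_nrm mulrC invmx_gram_sym.
Qed.
Local Opaque mcurv.

End Frame.

Local Transparent xcoord ycoord.
Lemma is_derivc_tmx (V : normedModType R) (t : V -> 'I_n -> Cn) (x v : V) :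
  (forall k, derivableC v (t^~ k) x) -> gram (t x) \in unitmx ->
  (forall i j, omega (t x i) (t x j) = 0) ->
  is_derivc (fun y => \det (tmx (t y))) x v
    (\det (tmx (t x)) * dlog_det (t x) (fun k => derivC v (t^~ k) x)).
Proof.
move=> dt gu lag; rewrite -(cofactor_tmx gu lag).
pose D : 'M[C]_n := \matrix_(i, j) (derivC v (t^~ i) x) 0 j.
have -> : \sum_i \sum_j derivC v (t^~ i) x 0 j * cofactor (tmx (t x)) i j =
   \sum_i \sum_j D i j * cofactor (tmx (t x)) i j.
  by apply: eq_bigr => i _; apply: eq_bigr => j _; rewrite /D mxE.
apply: is_derivc_det => i j; have [d1 d2] := dt i j.
under eq_fun do rewrite mxE; rewrite /D mxE; split.
  by apply: DeriveDef d1 _; rewrite -xcoord_derivC.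
by apply: DeriveDef d2 _; rewrite -ycoord_derivC.
Qed.

Lemma Cinfc_tmx (V : normedModType R) (U : set V) (t : V -> 'I_n -> Cn) : open U ->
  (forall k, CinfC U (t^~ k)) -> Cinfc U (fun y => \det (tmx (t y))).
Proof.
move=> oU Ct; apply: Cinfc_det => // i j; under eq_fun do rewrite mxE.
Local Transparent CinfC.
exact: (Ct i j).
Local Opaque CinfC.
Qed.
Local Opaque xcoord ycoord.

End LagrangianFrame.

Section LagrangianForms.
Context {R : realType} {n : nat} {M : smooth_manifold R n}.
Local Notation Cn := 'rV[R[i]]_n.
Local Notation Rn := 'rV[R]_n.
Variable F : M -> Cn.
Hypothesis oM : oriented M.
Hypothesis lF : lagrangian F.

Let iF : immersion F := lF.1.
Implicit Types (c d : chart M) (x : Rn).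

Lemma lagr_gram c x : chart_image c x -> gram (ltan (local_rep F c) x) \in unitmx.
Proof. exact: immersion_gram. Qed.

Lemma lagr_omega c x : chart_image c x -> forall i j,
  omega (ltan (local_rep F c) x i) (ltan (local_rep F c) x j) = 0.
Proof. exact: lF.2. Qed.

Lemma ltan_CinfC c k : CinfC (chart_image c) (fun y => ltan (local_rep F c) y k).
Proof. by apply: CinfC_derivC; exact: local_rep_CinfC. Qed.

Lemma tangent_change c d x i : chart_image c x -> chart_dom d (param c x) ->
  tangent F c x i = comb (row i (transition_jacobian c d x)) (tangent F d (coord d (param c x))).
Proof.
move=> cx dx; rewrite /tangent (ltan_change iF _ cx dx) -rowE.
exact: (ltan_comb _ (chart_image_open d) (coord_image dx) (local_rep_CinfC iF d)).
Qed.

(** Linearity in the tangent vector makes the components change by the Jacobian, since [Z] depends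
    on the point alone. With [Z] the position or the mean curvature vector this serves both
    forms. *)
Lemma is_form1_pairing (B : Cn -> Cn -> R) (Z : M -> Cn) :
  (forall z a t, B z (comb a t) = \sum_j a 0 j * B z (t j)) ->
  (forall c i, Cinf (chart_image c) (fun x => B (Z (param c x)) (tangent F c x i))) ->
  is_form1 (fun c x => \row_i B (Z (param c x)) (tangent F c x i) : Rn).
Proof.
move=> Bl CB; split.
  move=> c i; apply: Cinf_smooth_on; first exact: chart_image_open.
  apply: (Cinf_ext (chart_image_open c) _ (CB c i)) => x _; by rewrite mxE.
move=> c d x /overlapP [cx dx]; apply/rowP => i; rewrite !mxE (tangent_change i cx dx) Bl.
by apply: eq_bigr => j _; rewrite [row _ _ _ _]mxE [in RHS]mxE coordK // [_^T _ _]mxE mulrC.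
Qed.

Lemma pullback_lambda_form1 : is_form1 (pullback_lambda F).
Proof.
apply: (is_form1_pairing (B := @lambda_form R n) (Z := F)).
  move=> z a t; rewrite lambda_formE omega_comb_r mulr_sumr; apply: eq_bigr => j _.
  by rewrite lambda_formE; ring.
move=> c i; under eq_fun do rewrite lambda_formE.
apply: CinfM; [exact: chart_image_open|exact: Cinf_cst|apply: Cinf_omega].
- exact: chart_image_open.
- exact: local_rep_CinfC.
- exact: ltan_CinfC.
Qed.

Lemma mean_curvature_form1 : is_form1 (mean_curvature_form F).
Proof.
have h : is_form1 (fun c x => \row_i (fun z v => omega v z) (mean_curvature F (param c x)) (tangent F c x i) : Rn).
  apply: (is_form1_pairing (B := fun z v => omega v z)).
    by move=> z a t; rewrite omega_comb_l.
  move=> c i; have oc := chart_image_open c; apply: (Cinf_omega oc (ltan_CinfC c i)).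
  apply: (CinfC_ext oc (f := lH (local_rep F c))).
    by move=> x cx; rewrite mean_curvatureE.
  by apply: (CinfC_lH oc (local_rep_CinfC iF c)) => x cx; exact: lagr_gram.
exact: h.
Qed.

(** The derivative along a of lambda (F, d_b F) is half of omega (d_a F, d_b F) + omega (F, d_a d_b
    F): the first term vanishes on a Lagrangian, the second is symmetric in a and b. *)
Lemma pullback_lambda_closed : closed_form (pullback_lambda F).
Proof.
split; first exact: pullback_lambda_form1.
move=> c x cx i j; have oc := chart_image_open c.
have Cf := local_rep_CinfC iF c.
have D a b : partial_deriv a (fun y => pullback_lambda F c y 0 b) x =
  2^-1 * omega (local_rep F c x) (lhess (local_rep F c) x a b).
  rewrite /partial_deriv.
  have -> : (fun y => pullback_lambda F c y 0 b) =
    (2^-1 : R) *: (fun y => omega (local_rep F c y) (ltan (local_rep F c) y b)).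
    by apply/funext => y; rewrite mxE lambda_formE.
  have d1 := CinfC_derivable (delta_mx 0 a : Rn) Cf cx.
  have d2 := CinfC_derivable (delta_mx 0 a : Rn) (ltan_CinfC c b) cx.
  rewrite deriveZ; last by have [] := is_derive_omega d1 d2.
  rewrite (derive_omega d1 d2); have e := lagr_omega cx a b; rewrite /ltan in e.
  by rewrite e add0r.
have e : lhess (local_rep F c) x i j = lhess (local_rep F c) x j i by exact: (ClairautC _ _ oc cx Cf).
have e' := congr1 (fun h => 2^-1 * omega (local_rep F c x) h) e.
exact: (etrans (D i j) (etrans e' (esym (D j i)))).
Qed.

Definition lagr_det c x : R[i] := \det (tmx (tangent F c x)).

Lemma lagr_det_neq0 c x : chart_image c x -> lagr_det c x != 0.
Proof. by move=> cx; apply: det_tmx_neq0; [exact: lagr_gram|exact: lagr_omega]. Qed.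

Lemma lagr_det_norm c x : chart_image c x ->
  complex.Re (lagr_det c x) ^+ 2 + complex.Im (lagr_det c x) ^+ 2 != 0.
Proof.
move=> cx; apply: contra (lagr_det_neq0 cx) => h; rewrite eq_complex /=.
by move: h; rewrite paddr_eq0 ?sqr_ge0 // !sqrf_eq0.
Qed.

Lemma Cinfc_lagr_det c : Cinfc (chart_image c) (lagr_det c).
Proof. by apply: Cinfc_tmx; [exact: chart_image_open|move=> k; exact: ltan_CinfC]. Qed.

(** Obtained by differentiating omega (t_k, t_j) = 0. With the symmetry of second derivatives, omega
    (t_k, h_ij) is totally symmetric. *)
Lemma hess_swap c x i j k : chart_image c x ->
  omega (ltan (local_rep F c) x k) (lhess (local_rep F c) x i j) =
  omega (ltan (local_rep F c) x j) (lhess (local_rep F c) x i k).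
Proof.
move=> cx; have oc := chart_image_open c.
have d1 := CinfC_derivable (delta_mx 0 i : Rn) (ltan_CinfC c k) cx.
have d2 := CinfC_derivable (delta_mx 0 i : Rn) (ltan_CinfC c j) cx.
have := derive_omega d1 d2.
rewrite (_ : 'D_(delta_mx 0 i : Rn) (fun y => omega (ltan (local_rep F c) y k) (ltan (local_rep F c) y j)) x = 0).
  move=> /esym /eqP; rewrite addrC addr_eq0 => /eqP ->; rewrite -omegaC.
  by [].
have dc := derive_cst (0 : R) x (delta_mx 0 i : Rn).
apply: etrans dc; apply: near_eq_derive.
by apply: (near_open_eq oc cx) => y cy; exact: lagr_omega.
Qed.

(* The mean curvature form is the differential of the Lagrangian angle arg det. *)
Lemma mean_curvature_angle c x k : chart_image c x ->
  let P y := complex.Re (lagr_det c y) in let Q y := complex.Im (lagr_det c y) in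
  mean_curvature_form F c x 0 k =
  (P x * partial_deriv k Q x - Q x * partial_deriv k P x) / (P x ^+ 2 + Q x ^+ 2).
Proof.
move=> cx P Q; have oc := chart_image_open c.
set t := ltan (local_rep F c).
have dt i : derivableC (delta_mx 0 k : Rn) (fun y => t y i) x by exact: (CinfC_derivable _ (ltan_CinfC c i) cx).
have [h1 h2] := is_derivc_tmx dt (lagr_gram cx) (lagr_omega cx).
set z := dlog_det _ _ in h1 h2.
have e1 : partial_deriv k P x = complex.Re (lagr_det c x * z) by have [_ <-] := h1.
have e2 : partial_deriv k Q x = complex.Im (lagr_det c x * z) by have [_ <-] := h2.
(* By this total symmetry the trace of omega (t_k, h_il) over i, l equals that of omega (t_l, d_k
   t_i), the imaginary part of the logarithmic derivative of the determinant. *)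
have Hz : mean_curvature_form F c x 0 k = complex.Im z.
  rewrite mxE (mean_curvatureE iF oM cx) /z Im_dlog_det.
  rewrite (_ : lH _ _ = mcurv (t x) (lhess (local_rep F c) x)); last first.
    Local Transparent lH.
    by rewrite /lH.
    Local Opaque lH.
  rewrite [LHS](omega_mcurv (lagr_omega cx)); apply: eq_bigr => i _; apply: eq_bigr => l _.
  have e : lhess (local_rep F c) x i k = derivC (delta_mx 0 k : Rn) (fun y => t y i) x.
    exact: (ClairautC _ _ oc cx (local_rep_CinfC iF c)).
  apply: (congr1 (fun r => r * invmx (gram (t x)) l i)).
  by apply: (etrans (hess_swap i l k cx)); exact: (congr1 (omega (t x l)) e).
have nz := lagr_det_norm cx.
rewrite Hz e1 e2 ReM ImM -/(P x) -/(Q x); apply: (mulIf nz); rewrite -/(P x) -/(Q x) divfK //; ring.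
Qed.

Lemma mean_curvature_closed : closed_form (mean_curvature_form F).
Proof.
split; first exact: mean_curvature_form1.
move=> c x cx i j; have oc := chart_image_open c; have [CP CQ] := Cinfc_lagr_det c.
have ext k l : partial_deriv k (fun y => mean_curvature_form F c y 0 l) x =
  'D_(delta_mx 0 k : Rn) (fun y => (complex.Re (lagr_det c y) * 'D_(delta_mx 0 l : Rn) (fun y => complex.Im (lagr_det c y)) y -
    complex.Im (lagr_det c y) * 'D_(delta_mx 0 l : Rn) (fun y => complex.Re (lagr_det c y)) y) /
   (complex.Re (lagr_det c y) ^+ 2 + complex.Im (lagr_det c y) ^+ 2)) x.
  apply: near_eq_derive.
  by apply: (near_open_eq oc cx) => y cy; rewrite (mean_curvature_angle _ cy).
rewrite !ext; apply: (angle_closed _ _ oc cx CP CQ) => y; exact: lagr_det_norm.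
Qed.

End LagrangianForms.

(** * Loops and exactness *)

Section Primitives.
Context {R : realType}.
Implicit Types f g : R -> R.

Lemma is_derive_scale_R f (x v d : R) : is_derive x (1 : R) f d -> is_derive x v f (v * d).
Proof. by move=> [d1 <-]; have := is_derive_scale v d1; rewrite [v *: 1]mulr1. Qed.

(** The integral from [A]; at [A] itself only one side is controlled, hence the strict
    inequality. *)
Lemma primitive_above (A : R) g : continuous g -> exists G : R -> R, forall x : R, A < x -> is_derive x (1 : R) G (g x).
Proof.
move=> cg; exists (fun x => \int[lebesgue_measure]_(t in `[A, x]) g t)%R => x x1.
have gi : lebesgue_measure.-integrable `[A, x + 1] (EFin \o g).
  apply: continuous_compact_integrable; first exact: segment_compact.
  by apply: continuous_subspaceT.
have [d e] := @continuous_FTC1_closed R g A x (x + 1) (ltac:(by rewrite ltrDl)) gi x1 (cg x).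
by rewrite derive1E in e; apply: DeriveDef.
Qed.

Lemma same_derive_diff (G H g : R -> R) (a b : R) : a <= b ->
  (forall x : R, a <= x <= b -> is_derive x (1 : R) G (g x)) ->
  (forall x : R, a <= x <= b -> is_derive x (1 : R) H (g x)) -> G b - G a = H b - H a.
Proof.
move=> ab dG dH; pose K := G - H.
have dK x : a <= x <= b -> is_derive x (1 : R) K 0.
  by move=> xab; rewrite -(subrr (g x)); apply: is_deriveB; [exact: dG|exact: dH].
have inab (t : R) : 0 <= t <= 1 -> a <= a + t *: (b - a) <= b.
  move=> /andP[t0 t1]; have ba : 0 <= b - a by rewrite subr_ge0.
  rewrite lerDl mulr_ge0 //= -[X in _ <= X](subrK a) addrC lerD2r.
  by rewrite -[X in _ <= X]mul1r ler_wpM2r.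
have [|t t01] := @MVT_line R R K a (b - a).
  by move=> t t01; have [] := is_derive_scale_R (b - a) (dK _ (inab t t01)).
have [_ ->] := is_derive_scale_R (b - a) (dK _ (inab t t01)); rewrite mulr0 (addrC a) subrK.
move=> e; have e' : G b - H b - (G a - H a) = 0 by exact: e.
lra.
Qed.

End Primitives.

Section Bump.
Context {R : realType}.

(* t^-j e^(-1/t), extended by 0 to t <= 0: this family is stable under derivation. *)
Definition flat (j : nat) (t : R) : R := if 0 < t then t^-1 ^+ j * expR (- t^-1) else 0.

Lemma flat_ge0 j t : 0 <= flat j t.
Proof.
by rewrite /flat; case: ifP => // t0; rewrite mulr_ge0 ?expR_ge0 // exprn_ge0 // invr_ge0 ltW.
Qed.

Lemma flat_gt0 t : 0 < t -> 0 < flat 0 t.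
Proof. by move=> t0; rewrite /flat t0 mul1r expR_gt0. Qed.

Lemma flat_le0 j t : t <= 0 -> flat j t = 0.
Proof. by move=> t0; rewrite /flat ltNge t0. Qed.

(** From y^(j+2) <= (j+2)! e^y with y = 1/t. Quadratic decay yields the zero derivative at 0. *)
Lemma flat_bound j (t : R) : flat j t <= (j.+2)`!%:R * t ^+ 2.
Proof.
have [t0|t0] := leP t 0; first by rewrite flat_le0 // mulr_ge0 ?sqr_ge0.
rewrite /flat t0; set y := t^-1; have y0 : 0 < y by rewrite invr_gt0.
have h := expR_ge1Dxn j.+1 (ltW y0).
have f0 : 0 < (j.+2)`!%:R :> R by rewrite ltr0n fact_gt0.
have h2 : y ^+ j.+2 <= (j.+2)`!%:R * expR y.
  by rewrite mulrC -ler_pdivrMr //; apply: le_trans h; rewrite lerDr.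
rewrite expRN ler_pdivrMr ?expR_gt0 // mulrAC.
have -> : t ^+ 2 = (y ^+ 2)^-1 by rewrite /y exprVn invrK.
by rewrite ler_pdivlMr ?exprn_gt0 // -exprD addn2.
Qed.

Lemma is_derive_flat j (t : R) : is_derive t (1 : R) (flat j) (flat j.+2 t - j%:R * flat j.+1 t).
Proof.
have [t0|t0|->] := ltgtP t 0.
- rewrite !flat_le0 ?ltW // mulr0 subrr.
  have e : \forall x \near t, cst 0 x = flat j x.
    have : \forall x \near t, x < 0 by apply: open_nbhs_nbhs; split; [exact: open_lt|].
    by apply: filterS => x x0; rewrite flat_le0 // ltW.
  by apply: near_eq_is_derive e _; exact: is_derive_cst.
- have e : \forall x \near t, (fun x => x^-1 ^+ j * expR (- x^-1)) x = flat j x.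
    have : \forall x \near t, 0 < x by apply: open_nbhs_nbhs; split; [exact: open_gt|].
    by apply: filterS => x x0; rewrite /flat x0.
  apply: near_eq_is_derive e _.
  have tn : t != 0 by rewrite gt_eqF.
  have di : is_derive t (1 : R) (fun x : R => x^-1) (- (t^-1 * t^-1)).
    have [d1 d2] := is_derive_id t (1 : R).
    apply: DeriveDef; first exact: derivableV.
    by rewrite deriveV // d2 /GRing.scale /= mulr1 expr2 invfM.
  have dm : is_derive t (1 : R) (fun x : R => - x^-1) (t^-1 * t^-1).
    by rewrite -[t^-1 * t^-1]opprK; exact: is_deriveN.
  have de : is_derive t (1 : R) (fun x => expR (- x^-1)) (expR (- t^-1) * (t^-1 * t^-1)).
    exact: (is_derive1_comp (is_derive_expR _) dm).
  have dp : is_derive t (1 : R) (fun x : R => x^-1 ^+ j) (- (j%:R * t^-1 ^+ j.+1)).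
    elim: (j) => [|i IH]; first by rewrite mul0r oppr0; exact: is_derive_cst.
    have h := is_deriveM di IH.
    rewrite (_ : (fun x => _) = (fun x : R => x^-1) * (fun x => x^-1 ^+ i)); last first.
      by apply/funext => x; rewrite exprS.
    apply: (is_derive_eq h); rewrite /GRing.scale /= !exprS -natr1; ring.
  have h := is_deriveM dp de.
  apply: (is_derive_eq h); rewrite /GRing.scale /flat t0 /= !exprS; ring.
- rewrite !flat_le0 // mulr0 subrr.
  have cv : (fun h : R => h^-1 *: ((flat j \o shift 0) (h *: 1) - flat j 0)) @ 0^' --> (0 : R).
    apply/cvgrPdist_le => eps e0; pose C : R := (j.+2)`!%:R.
    have C0 : 0 < C by rewrite ltr0n fact_gt0.
    have ec : 0 < eps / C by rewrite divr_gt0.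
    rewrite /dnbhs /within /=; apply/nbhs_normP; exists (eps / C) => // h; rewrite subr0 => hr hn.
    rewrite sub0r normrN /= addr0 (flat_le0 j (lexx 0)) subr0 [h%:A]mulr1 /GRing.scale /= normrM normfV.
    rewrite (ger0_norm (flat_ge0 _ _)) ler_pdivrMl ?normr_gt0 //.
    apply: (le_trans (flat_bound j h)); rewrite -/C -(real_normK (num_real h)) expr2.
    by rewrite mulrCA ler_wpM2l // mulrC -ler_pdivlMr // ltW.
  by apply: DeriveDef; [apply/cvg_ex; exists 0|exact: cvg_lim cv].
Qed.

Lemma Cinf_flat j : Cinf setT (flat j).
Proof.
move=> k; elim: k j => [|k IH] j.
  split=> // x _; apply: differentiable_continuous; apply/derivable1_diffP.
  by have [] := is_derive_flat j x.
split=> [x _|v].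
  apply: differentiable_continuous; apply/derivable1_diffP.
  by have [] := is_derive_flat j x.
have dv x := is_derive_scale_R v (is_derive_flat j x).
split=> [x _|]; first by have [] := dv x.
rewrite (_ : (fun x => _) = (fun x => v * (flat j.+2 x - j%:R * flat j.+1 x))); last first.
  by apply/funext => x; have [_ ->] := dv x.
apply: CkM; [exact: openT|exact: Ck_cst|].
rewrite (_ : (fun x => _) = (fun x => flat j.+2 x + (- j%:R) * flat j.+1 x)); last first.
  by apply/funext => x; rewrite mulNr.
apply: CkD; [exact: openT|exact: IH|apply: CkM; [exact: openT|exact: Ck_cst|exact: IH]].
Qed.

Definition smooth_step (t : R) : R := flat 0 t / (flat 0 t + flat 0 (1 - t)).

Lemma smooth_step_den t : flat 0 t + flat 0 (1 - t) != 0.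
Proof.
rewrite gt_eqF //; have [t0|t0] := leP t 0.
  apply: ltr_wpDl; first exact: flat_ge0; apply: flat_gt0; lra.
by apply: ltr_wpDr; [exact: flat_ge0|exact: flat_gt0].
Qed.

Lemma smooth_step0 t : t <= 0 -> smooth_step t = 0.
Proof. by move=> t0; rewrite /smooth_step flat_le0 // mul0r. Qed.

Lemma smooth_step1 t : 1 <= t -> smooth_step t = 1.
Proof.
move=> t1; have := smooth_step_den t; rewrite /smooth_step (flat_le0 0 (t := 1 - t)) ?subr_le0 // addr0.
exact: divff.
Qed.

Lemma Cinf_affine (U : set R) (a b : R) : open U -> Cinf U (fun x => a * x + b).
Proof.
move=> oU; apply: CinfD => //; last exact: Cinf_cst.
by apply: CinfM => //; [exact: Cinf_cst|exact: Cinf_id].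
Qed.

Lemma Cinf_comp_R (V : normedModType R) (U : set V) (f : R -> R) (g : V -> R) : open U ->
  Cinf setT f -> Cinf U g -> Cinf U (fun x => f (g x)).
Proof. by move=> oU Cf Cg; apply: (Cinf_comp fincoord_R openT oU _ Cf) => // i. Qed.

Lemma Cinf_smooth_step : Cinf setT smooth_step.
Proof.
apply: CinfM; [exact: openT|exact: Cinf_flat|].
apply: CinfV; [exact: openT|by move=> x _; exact: smooth_step_den|].
apply: CinfD; [exact: openT|exact: Cinf_flat|].
apply: Cinf_comp_R; [exact: openT|exact: Cinf_flat|].
rewrite (_ : (fun x => _) = (fun x => (-1) * x + 1)); first by apply: Cinf_affine; exact: openT.
by apply/funext => x; rewrite mulN1r addrC.
Qed.

End Bump.

(** * Smooth paths and integrals along them *)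

Section Paths.
Context {R : realType} {n : nat} {M : smooth_manifold R n}.
Local Notation Rn := 'rV[R]_n.
Implicit Types (g : R -> M) (c d : chart M) (alpha beta : form1 M).

Lemma continuous_rV (V : normedModType R) (f : V -> Rn) x :
  (forall j, {for x, continuous (fun y => f y 0 j)}) -> {for x, continuous f}.
Proof.
move=> cf; have fE : f = fun y => \sum_j f y 0 j *: delta_mx 0 j.
  by apply/funext => y; exact: row_sum_delta.
by rewrite fE; apply: cont_sum => j; apply: cvgZ; [exact: cf|exact: cvg_cst].
Qed.

Definition smooth_path g := forall s : R, exists (W : set R) (c : chart M),
  [/\ open W, W s, (forall r, W r -> chart_dom c (g r)) &
   forall j, Cinf W (fun r => (coord c (g r)) 0 j)].

Lemma smooth_path_continuous g : smooth_path g -> continuous g.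
Proof.
move=> pg s; have [W [c [pW Ws Wc CW]]] := pg s.
have cx : {for s, continuous (fun r => coord c (g r))}.
  by apply: continuous_rV => j; exact: (Cinf_cont (CW j) Ws).
have cs := coord_image (Wc s Ws).
have cp := @param_continuous R n M c _ cs.
have h : {for s, continuous (fun r => param c (coord c (g r)))} by exact: (continuous_comp cx cp).
move: h; rewrite /prop_for /continuous_at coordK; last exact: Wc.
apply: cvg_trans; apply: near_eq_cvg.
by apply: filterS (open_nbhs_nbhs (conj pW Ws)) => r Wr; rewrite coordK //; exact: Wc.
Qed.

Lemma path_preimage_open g c : smooth_path g -> open (g @^-1` chart_dom c).
Proof.
move=> pg; apply: open_comp; last exact: dom_open.
by move=> r _; exact: smooth_path_continuous.
Qed.

Lemma smooth_path_coord g c j : smooth_path g ->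
  Cinf (g @^-1` chart_dom c) (fun r => (coord c (g r)) 0 j).
Proof.
move=> pg; apply: Cinf_local => s cs; have [W [d [pW Ws Wd CW]]] := pg s.
have pP := @path_preimage_open g c pg.
have pW' : open (W `&` g @^-1` chart_dom c) by exact: openI.
exists (W `&` g @^-1` chart_dom c); split=> //.
apply: (Cinf_ext pW' (f := fun r => (coord c (param d (coord d (g r)))) 0 j)).
  by move=> r [Wr cr]; rewrite coordK //; exact: Wd.
apply: (Cinf_comp (fincoord_rV n) (overlap_open d c) pW' _ (transition_Cinf d c j)).
  move=> r [Wr cr]; apply/overlapP; split; first exact: coord_image (Wd r Wr).
  by rewrite coordK //; exact: Wd.
by move=> i; apply: Cinf_sub (CW i) => r [].
Qed.

Lemma smooth_loopP g : smooth_loop g <-> smooth_path g /\ forall s, g (s + 2 * pi) = g s.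
Proof.
split=> [[cg pg sg]|[pg per]].
  split=> // s; pose c := chart_at (g s).
  have pc : open (g @^-1` chart_dom c) by apply: open_comp; [move=> r _; exact: cg|exact: dom_open].
  exists (g @^-1` chart_dom c), c; split=> //; first exact: dom_chart_at.
  by move=> j; apply: smooth_on_open => //; exact: sg.
split=> //; first exact: smooth_path_continuous.
move=> c j; apply: Cinf_smooth_on; first exact: path_preimage_open.
exact: smooth_path_coord.
Qed.

Lemma smooth_path_local g : (forall s, exists (W : set R) (h : R -> M),
  [/\ open W, W s, smooth_path h & forall r, W r -> g r = h r]) -> smooth_path g.
Proof.
move=> loc s; have [W [h [pW Ws ph e]]] := loc s; have [W' [c [pW' Ws' Wc CW]]] := ph s.
have pI : open (W `&` W') by exact: openI.
exists (W `&` W'), c; split=> // [r [Wr Wr']|j]; first by rewrite e //; exact: Wc.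
apply: (Cinf_ext pI (f := fun r => (coord c (h r)) 0 j)) => [r [Wr _]|]; first by rewrite e.
by apply: Cinf_sub (CW j) => r [].
Qed.

Lemma smooth_path_comp g (phi : R -> R) : smooth_path g -> Cinf setT phi -> smooth_path (fun s => g (phi s)).
Proof.
move=> pg Cphi s; have [W [c [pW Ws Wc CW]]] := pg (phi s).
have pI : open (phi @^-1` W) by apply: open_comp pW => r _; exact: (Cinf_cont Cphi).
exists (phi @^-1` W), c; split=> // [r|j]; first exact: Wc.
apply: (Cinf_comp fincoord_R pW pI _ (CW j)) => // _.
exact: Cinf_sub Cphi.
Qed.

Lemma smooth_path_cst (p : M) : smooth_path (fun=> p).
Proof.
move=> s; exists setT, (chart_at p); split=> //; [exact: openT|move=> r _; exact: dom_chart_at|].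
by move=> j; exact: Cinf_cst.
Qed.

Definition chart_pairing alpha c g (s : R) : R :=
  \sum_i alpha c (coord c (g s)) 0 i * 'D_(1 : R) (fun r => (coord c (g r)) 0 i) s.

(** The chart is selected anew at each [s]; [pairingE] replaces it by one chart valid around the
    point, which is how smoothness in [s] is seen. *)
Definition pairing alpha g (s : R) : R := chart_pairing alpha (chart_at (g s)) g s.

Lemma pairingE alpha g c (s : R) : is_form1 alpha -> smooth_path g -> chart_dom c (g s) ->
  pairing alpha g s = chart_pairing alpha c g s.
Proof.
move=> fa pg cs; set d := chart_at (g s); rewrite /pairing /chart_pairing -/d.
have ds : chart_dom d (g s) by exact: dom_chart_at.
have ox : (coord c @` (chart_dom c `&` chart_dom d)) (coord c (g s)).
  by apply/overlapP; split; [exact: coord_image|rewrite coordK].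
rewrite (fa.2 c d _ ox) coordK //.
pose J := transition_jacobian c d (coord c (g s)).
have dx i : derivable (fun r => (coord c (g r)) 0 i) s 1.
  by apply: (Cinf_derivable (1 : R) (smooth_path_coord c i pg)).
have dy j : 'D_(1 : R) (fun r => (coord d (g r)) 0 j) s =
   \sum_i J i j * 'D_(1 : R) (fun r => (coord c (g r)) 0 i) s.
  have CT := transition_Cinf c d j.
  have [_ E] := chain_rule (fincoord_rV n) (overlap_open c d) ox (CT 1%N) dx.
  transitivity ('D_(1 : R) (fun r => (coord d (param c (coord c (g r)))) 0 j) s); last first.
    by apply: (etrans E); apply: eq_bigr => i _; rewrite /J mxE.
  apply: near_eq_derive.
  have pC := @path_preimage_open g c pg.
  by apply: filterS (open_nbhs_nbhs (conj pC cs)) => r cr; rewrite coordK.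
under eq_bigr => j _ do rewrite dy mulr_sumr.
rewrite exchange_big /=; apply: eq_bigr => i _; rewrite mxE mulr_suml; apply: eq_bigr => j _.
by rewrite [X in _ = _ * X * _]mxE mulrA.
Qed.

Lemma pairing_Cinf alpha g : is_form1 alpha -> smooth_path g -> Cinf setT (pairing alpha g).
Proof.
move=> fa pg; apply: Cinf_local => s _; pose c := chart_at (g s).
have pC := @path_preimage_open g c pg.
exists (g @^-1` chart_dom c); split=> //; first exact: dom_chart_at.
apply: (Cinf_ext pC (f := chart_pairing alpha c g)); first by move=> r cr; rewrite (pairingE fa pg cr).
apply: Cinf_sum => // i _; apply: CinfM => //; last first.
  by apply: Cinf_derive; exact: smooth_path_coord.
have Ca : Cinf (chart_image c) (fun x => (alpha c x) 0 i).
  by apply: smooth_on_open; [exact: chart_image_open|exact: fa.1].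
apply: (Cinf_comp (fincoord_rV n) (chart_image_open c) pC _ Ca); first by move=> r; exact: coord_image.
by move=> j; exact: smooth_path_coord.
Qed.

Lemma pairing_continuous alpha g : is_form1 alpha -> smooth_path g -> continuous (pairing alpha g).
Proof. by move=> fa pg s; exact: (Cinf_cont (pairing_Cinf fa pg)). Qed.

Lemma pairing_near alpha g h (s : R) : (\forall r \near s, g r = h r) -> pairing alpha g s = pairing alpha h s.
Proof.
move=> e; rewrite /pairing /chart_pairing (nbhs_singleton e).
apply: eq_bigr => i _; congr (_ * _); apply: near_eq_derive.
by apply: filterS e => r ->.
Qed.

Lemma pairing_comp alpha g (phi : R -> R) (s : R) : is_form1 alpha -> smooth_path g -> Cinf setT phi ->
  pairing alpha (fun r => g (phi r)) s = pairing alpha g (phi s) * 'D_(1 : R) phi s.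
Proof.
move=> fa pg Cphi; rewrite /pairing /chart_pairing mulr_suml; apply: eq_bigr => i _.
rewrite -mulrA; congr (_ * _); set c := chart_at _.
have cs : (g @^-1` chart_dom c) (phi s) by exact: dom_chart_at.
have [d1 d2] := @is_derive1_comp R (fun r => (coord c (g r)) 0 i) phi s _ _
  (DeriveDef (Cinf_derivable (1 : R) (smooth_path_coord c i pg) cs) erefl)
  (DeriveDef (Cinf_derivable (1 : R) Cphi (I : setT s)) erefl).
exact: d2.
Qed.

Lemma pairing_sub alpha beta g s :
  pairing (sub_form alpha beta) g s = pairing alpha g s - pairing beta g s.
Proof.
rewrite /pairing /chart_pairing -sumrB; apply: eq_bigr => i _.
by rewrite /sub_form !mxE mulrBl.
Qed.

Lemma pairing_scale a alpha g s : pairing (scale_form a alpha) g s = a * pairing alpha g s.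
Proof.
rewrite /pairing /chart_pairing mulr_sumr; apply: eq_bigr => i _.
by rewrite /scale_form mxE mulrA.
Qed.

(** An integral as the increment of a primitive. Two-sided derivatives are asked at the endpoints as
    well, since the integrands live on the whole line; substitution, linearity and concatenation
    then become statements about derivatives. *)
Definition has_integral (a b : R) (f : R -> R) (v : R) := exists2 G : R -> R,
  (forall s : R, a <= s <= b -> is_derive s (1 : R) G (f s)) & v = G b - G a.

Lemma has_integral_uniq (a b : R) f v w : a <= b -> has_integral a b f v -> has_integral a b f w -> v = w.
Proof. by move=> ab [G dG ->] [H dH ->]; exact: same_derive_diff dG dH. Qed.

Lemma has_integral_exists (a b : R) f : 0 <= a -> continuous f -> exists v, has_integral a b f v.
Proof.
move=> a0 /(primitive_above (-1)) [G dG]; exists (G b - G a), G => // s /andP[ls _]; apply: dG.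
by apply: lt_le_trans (le_trans a0 ls); rewrite oppr_lt0.
Qed.

Lemma has_integral_cat (a b c : R) f v w : 0 <= a -> a <= b -> b <= c -> continuous f ->
  has_integral a b f v -> has_integral b c f w -> has_integral a c f (v + w).
Proof.
move=> a0 ab bc cf iv iw; have [G dG] := primitive_above (-1) cf.
have dG' s : a <= s -> is_derive s (1 : R) G (f s).
  by move=> ls; apply: dG; apply: lt_le_trans (le_trans a0 ls); rewrite oppr_lt0.
have -> : v = G b - G a by apply: (has_integral_uniq ab iv); exists G => // s /andP[ls _]; exact: dG'.
have -> : w = G c - G b.
  by apply: (has_integral_uniq bc iw); exists G => // s /andP[ls _]; apply: dG'; exact: le_trans ls.
by exists G => [s /andP[ls _]|]; [exact: dG'|rewrite addrC addrA subrK].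
Qed.

(* [phi] need not be monotone: [g] may be run through backwards. *)
Lemma has_integral_subst alpha g h (phi : R -> R) (a b v : R) : is_form1 alpha -> smooth_path g ->
  Cinf setT phi -> (forall s, a <= s <= b -> \forall r \near s, h r = g (phi r)) ->
  (forall s, a <= s <= b -> 0 <= phi s <= 1) ->
  (exists2 G : R -> R, forall s : R, 0 <= s <= 1 -> is_derive s (1 : R) G (pairing alpha g s) &
    v = G (phi b) - G (phi a)) ->
  has_integral a b (pairing alpha h) v.
Proof.
move=> fa pg Cphi e rg [G dG ->]; exists (fun s => G (phi s)) => // s sab.
rewrite (pairing_near alpha (e s sab)) (pairing_comp _ fa pg Cphi).
apply: is_derive1_comp; first exact: dG (rg s sab).
by apply: DeriveDef => //; exact: (Cinf_derivable (1 : R) Cphi).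
Qed.

End Paths.

Section Trigonometry.
Context {R : realType}.

Lemma Cinf_sincos : Cinf setT (@sin R) /\ Cinf setT (@cos R).
Proof.
suff h k : Ck k setT (@sin R) /\ Ck k setT (@cos R) by split=> k; have [] := h k.
elim: k => [|k [IHs IHc]].
  by split; split=> // x _; [exact: continuous_sin|exact: continuous_cos].
have ds v x := is_derive_scale_R v (@is_derive_sin R x).
have dc v x := is_derive_scale_R v (@is_derive_cos R x).
have oT : open [set: R] by exact: openT.
split; split=> [x _|v]; [exact: continuous_sin| |exact: continuous_cos|]; split=> [x _|].
- by have [] := ds v x.
- rewrite (_ : (fun x => _) = (fun x => v * cos x)); last by apply/funext => x; have [_ ->] := ds v x.
  by apply: CkM => //; exact: Ck_cst.
- by have [] := dc v x.
- rewrite (_ : (fun x => _) = (fun x => (- v) * sin x)); last first.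
    by apply/funext => x; have [_ ->] := dc v x; rewrite mulrN mulNr.
  by apply: CkM => //; exact: Ck_cst.
Qed.

(** Runs from 0 to 1 on [0, pi] and back on [pi, 2 pi]: two paths with common ends, one on each half
    circle, close up into a loop. *)
Definition half_turn (s : R) : R := (1 - cos s) / 2.

Lemma Cinf_half_turn : Cinf setT half_turn.
Proof.
have oT : open [set: R] by exact: openT.
apply: CinfM => //; last exact: Cinf_cst.
by apply: CinfB => //; [exact: Cinf_cst|exact: Cinf_sincos.2].
Qed.

Lemma half_turn01 s : 0 <= half_turn s <= 1.
Proof. by have := cos_le1 s; have := cos_geN1 s; rewrite /half_turn => h1 h2; apply/andP; split; lra. Qed.

Lemma half_turn_ends s : sin s = 0 -> half_turn s = 0 \/ half_turn s = 1.
Proof.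
move=> s0; have /eqP := cos2Dsin2 s; rewrite s0 expr0n addr0 sqrf_eq1 => /orP[] /eqP c.
  by left; rewrite /half_turn c subrr mul0r.
by right; rewrite /half_turn c; field.
Qed.

End Trigonometry.

Lemma xget_indep (T : choiceType) (P : set T) (x y : T) : P !=set0 -> xget x P = xget y P.
Proof.
move=> [z Pz]; have h := xgetI x Pz; have h' := xgetI y Pz.
rewrite /xget; case: pselect => // h1.
by case: h1; exists z; exact/asboolP.
Qed.

Section Joining.
Context {R : realType} {n : nat} {M : smooth_manifold R n}.
Local Notation Rn := 'rV[R]_n.
Implicit Types (g : R -> M) (c d : chart M) (p q r : M).

(* Being constant near the ends makes concatenation smooth. *)
Definition path_from_to p q g := smooth_path g /\ exists2 e : R, 0 < e &
  (forall s : R, s < e -> g s = p) /\ (forall s : R, 1 - e < s -> g s = q).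

Definition joined p q := exists g, path_from_to p q g.

Lemma joined_refl p : joined p p.
Proof. by exists (fun=> p); split; [exact: smooth_path_cst|exists 1]. Qed.

Lemma path_rev p q g : path_from_to p q g -> path_from_to q p (fun s => g (1 - s)).
Proof.
move=> [pg [e e0 [h1 h2]]]; split.
  apply: (smooth_path_comp pg).
  rewrite (_ : (fun s => _) = (fun s => (-1) * s + 1)); first exact: Cinf_affine openT.
  by apply/funext => s; rewrite mulN1r addrC.
by exists e => //; split=> s hs; [apply: h2; lra|apply: h1; lra].
Qed.

Lemma joined_sym p q : joined p q -> joined q p.
Proof. by move=> [g /path_rev h]; eexists; exact: h. Qed.

Definition path_cat g h (s : R) : M := if s < 2^-1 then g (2 * s) else h (2 * s - 1).

Lemma path_catP p q r g h : path_from_to p q g -> path_from_to q r h ->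
  path_from_to p r (path_cat g h) /\ exists2 e : R, 0 < e &
   (forall s : R, s < 2^-1 + e -> path_cat g h s = g (2 * s + 0)) /\
   (forall s : R, 2^-1 - e < s -> path_cat g h s = h (2 * s + (-1))).
Proof.
move=> [pg [e e0 [g1 g2]]] [ph [f f0 [h1 h2]]].
pose m := Num.min e f; have m0 : 0 < m by rewrite lt_min e0 f0.
have [me mf] : m <= e /\ m <= f by rewrite /m !ge_min !lexx orbT.
have L (s : R) : s < 2^-1 + m / 2 -> path_cat g h s = g (2 * s + 0).
  move=> s2; rewrite /path_cat addr0; case: (ltP s 2^-1) => // s1; rewrite g2; last lra.
  by rewrite h1 //; lra.
have L' (s : R) : 2^-1 - m / 2 < s -> path_cat g h s = h (2 * s + (-1)).
  move=> s2; rewrite /path_cat; case: (ltP s 2^-1) => // s1; rewrite g2; last lra.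
  by rewrite h1 //; lra.
have m2 : 0 < m / 2 by rewrite divr_gt0.
split; last by exists (m / 2).
split.
  apply: smooth_path_local => s; have [s1|s1] := ltP s (2^-1 + m / 2).
    exists [set s | s < 2^-1 + m / 2], (fun s => g (2 * s + 0)); split; [exact: open_lt|exact: s1| |exact: L].
    by apply: (smooth_path_comp pg); exact: Cinf_affine openT.
  exists [set s | 2^-1 - m / 2 < s], (fun s => h (2 * s + (-1))); split; [exact: open_gt|rewrite /=; lra| |exact: L'].
  by apply: (smooth_path_comp ph); exact: Cinf_affine openT.
pose m' := Num.min 1 m.
have m'0 : 0 < m' by rewrite lt_min ltr01 m0.
have m1 : m' <= 1 by rewrite /m' ge_min lexx.
have m2' : m' <= m by rewrite /m' ge_min lexx orbT.
exists (m' / 2); first by rewrite divr_gt0.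
split=> s hs.
  by rewrite L; [apply: g1; lra|lra].
by rewrite L'; [apply: h2; lra|lra].
Qed.

Lemma joined_trans p q r : joined p q -> joined q r -> joined p r.
Proof. by move=> [g Pg] [h Ph]; have [k _] := path_catP Pg Ph; eexists; exact: k. Qed.

Variable alpha : form1 M.
Hypothesis fa : is_form1 alpha.
Hypothesis loops : forall g, smooth_loop g -> has_integral 0 (2 * pi) (pairing alpha g) 0.

Definition value p q (v : R) := exists2 g, path_from_to p q g & has_integral 0 1 (pairing alpha g) v.

Lemma value_exists p q : joined p q -> exists v, value p q v.
Proof.
move=> [g pg]; have [v iv] := has_integral_exists 1 (lexx 0) (pairing_continuous fa pg.1).
by exists v, g.
Qed.

Lemma value_trans p q r v w : value p q v -> value q r w -> value p r (v + w).
Proof.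
move=> [g pg iv] [h ph iw]; have [pk [e e0 [kl kr]]] := path_catP pg ph.
exists (path_cat g h) => //.
have h2 : (0 : R) <= 2^-1 by rewrite invr_ge0.
apply: (has_integral_cat (lexx 0) h2 _ (pairing_continuous fa pk.1)).
- by lra.
- apply: (has_integral_subst fa pg.1 (phi := fun s => 2 * s + 0)).
  + exact: Cinf_affine openT.
  + move=> s /andP[_ s1]; have : \forall r \near s, r < 2^-1 + e.
      by apply: open_nbhs_nbhs; split; [exact: open_lt|rewrite /=; lra].
    by apply: filterS => r0; exact: kl.
  + by move=> s /andP[s0 s1]; apply/andP; split; lra.
  + case: iv => G dG ->; exists G => //; congr (G _ - G _); last by rewrite mulr0 addr0.
    by rewrite addr0 divff.
- apply: (has_integral_subst fa ph.1 (phi := fun s => 2 * s + (-1))).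
  + exact: Cinf_affine openT.
  + move=> s /andP[s1 _]; have : \forall r \near s, 2^-1 - e < r.
      by apply: open_nbhs_nbhs; split; [exact: open_gt|rewrite /=; lra].
    by apply: filterS => r0; exact: kr.
  + by move=> s /andP[s0 s1]; apply/andP; split; lra.
  + case: iw => G dG ->; exists G => //; congr (G _ - G _); first by ring.
    by rewrite divff // subrr.
Qed.

Definition loop_of g h (s : R) : M := if 0 <= sin s then g (half_turn s) else h (half_turn s).

(** The halves meet where sin s = 0. There [half_turn] is near 0 or 1, where both paths are constant
    with the same value, so either formula holds in a neighbourhood. *)
Lemma loop_ofP p q g h : path_from_to p q g -> path_from_to p q h ->
  [/\ smooth_loop (loop_of g h),
   (forall s : R, 0 <= sin s -> \forall r \near s, loop_of g h r = g (half_turn r)) &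
   (forall s : R, sin s <= 0 -> \forall r \near s, loop_of g h r = h (half_turn r))].
Proof.
move=> [pg [e e0 [g1 g2]]] [ph [f f0 [h1 h2]]].
pose m := Num.min e f; have m0 : 0 < m by rewrite lt_min e0 f0.
have [me mf] : m <= e /\ m <= f by rewrite /m !ge_min !lexx orbT.
have ends (s : R) : sin s = 0 -> \forall r \near s, g (half_turn r) = h (half_turn r).
  move=> /half_turn_ends hs; have ch : {for s, continuous (@half_turn R)} by exact: (Cinf_cont Cinf_half_turn).
  case: hs => hs.
    have : \forall r \near s, half_turn r < m by apply: (@cvgr_lt R _ (nbhs s) _ _ _ ch); rewrite hs.
    by apply: filterS => r rm; rewrite g1 ?h1 //; lra.
  have : \forall r \near s, 1 - m < half_turn r.
    by apply: (@cvgr_gt R _ (nbhs s) _ _ _ ch); rewrite hs; lra.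
  by apply: filterS => r rm; rewrite g2 ?h2 //; lra.
have L (s : R) : 0 <= sin s -> \forall r \near s, loop_of g h r = g (half_turn r).
  rewrite le_eqVlt => /orP[/eqP s0|s0].
    by apply: filterS (ends s (esym s0)) => r gh; rewrite /loop_of gh if_same.
  have : \forall r \near s, 0 < sin r.
    by apply: (@cvgr_gt R _ (nbhs s) _ _ _ (@continuous_sin R s)).
  by apply: filterS => r r0; rewrite /loop_of ltW.
have L' (s : R) : sin s <= 0 -> \forall r \near s, loop_of g h r = h (half_turn r).
  rewrite le_eqVlt => /orP[/eqP s0|s0].
    by apply: filterS (ends s s0) => r gh; rewrite /loop_of gh if_same.
  have : \forall r \near s, sin r < 0.
    by apply: (@cvgr_lt R _ (nbhs s) _ _ _ (@continuous_sin R s)).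
  by apply: filterS => r r0; rewrite /loop_of leNgt r0.
split=> //; apply/smooth_loopP; split.
  apply: smooth_path_local => s; have [s0|s0] := leP 0 (sin s).
    have /nbhs_normP [r r0 hr] := L s s0.
    exists (ball s r), (fun s => g (half_turn s)); split.
    - exact: ball_open.
    - exact: ballxx.
    - exact: (smooth_path_comp pg Cinf_half_turn).
    - by move=> t; rewrite /ball /= distrC => /hr.
  have /nbhs_normP [r r0 hr] := L' s (ltW s0).
  exists (ball s r), (fun s => h (half_turn s)); split.
  - exact: ball_open.
  - exact: ballxx.
  - exact: (smooth_path_comp ph Cinf_half_turn).
  - by move=> t; rewrite /ball /= distrC => /hr.
by move=> s; rewrite /loop_of /half_turn mulr_natl cosD2pi sinD2pi.
Qed.

(** Going along [g] and back along [h] is a loop, whose integral v - w is 0 by hypothesis. *)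
Lemma value_uniq p q v w : value p q v -> value p q w -> v = w.
Proof.
move=> [g pg iv] [h ph iw]; have [sl L L'] := loop_ofP pg ph.
have pi0 : (0 : R) <= pi by exact: pi_ge0.
have pl := (smooth_loopP _).1 sl.
have i1 : has_integral 0 pi (pairing alpha (loop_of g h)) v.
  apply: (has_integral_subst fa pg.1 Cinf_half_turn).
  - by move=> s sp; apply: L; apply: sin_ge0_pi.
  - by move=> s _; exact: half_turn01.
  - case: iv => G dG ->; exists G => //; rewrite /half_turn cospi cos0 subrr mul0r; congr (G _ - G _); by field.
have i2 : has_integral pi (2 * pi) (pairing alpha (loop_of g h)) (- w).
  apply: (has_integral_subst fa ph.1 Cinf_half_turn).
  - move=> s /andP[s1 s2]; apply: L'.
    have -> : s = (s - pi) + pi by rewrite subrK.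
    rewrite sinDpi oppr_le0; apply: sin_ge0_pi; apply/andP; split; lra.
  - by move=> s _; exact: half_turn01.
  - case: iw => G dG ->; exists G => //; rewrite /half_turn mulr_natl cos2pi cospi subrr mul0r opprB.
    congr (G _ - G _); by field.
have p2 : pi <= 2 * pi :> R by lra.
have := has_integral_cat (lexx 0) pi0 p2 (pairing_continuous fa pl.1) i1 i2.
have p02 : 0 <= 2 * pi :> R by lra.
by move=> /(has_integral_uniq p02 (loops sl)) e; apply/eqP; rewrite -subr_eq0 -e.
Qed.

(** A base point in the class of the points joined to [p], one per class since connectedness is not
    assumed. It depends on the class alone: [xget_indep] removes the influence of the default value
    [p]. *)
Definition component p : M := xget p [set q | joined q p].

Lemma component_joined p : joined (component p) p.
Proof. by rewrite /component; exact: (@xgetI _ p [set q | joined q p] p (joined_refl p)). Qed.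

Lemma component_eq p q : joined p q -> component p = component q.
Proof.
move=> pq; rewrite /component.
have -> : [set r | joined r p] = [set r | joined r q].
  apply/seteqP; split=> r /= h; first exact: joined_trans pq.
  exact: joined_trans (joined_sym pq).
by apply: xget_indep; exists q; exact: joined_refl.
Qed.

Definition potential p : R := xget 0 [set v | value (component p) p v].

Lemma potentialP p : value (component p) p (potential p).
Proof.
have [v vv] := value_exists (component_joined p).
exact: (@xgetI _ 0 [set v | value (component p) p v] v vv).
Qed.

Lemma potential_diff p q v : value p q v -> potential q = potential p + v.
Proof.
move=> vv; have pq : joined p q by case: vv => g pg _; exists g.
have := value_trans (potentialP p) vv; rewrite (component_eq pq).
exact: value_uniq (potentialP q).
Qed.

End Joining.

Section Exactness.
Context {R : realType} {n : nat} {M : smooth_manifold R n}.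
Local Notation Rn := 'rV[R]_n.
Implicit Types (c d : chart M) (x v : Rn).

Lemma is_derive_mulr (g : R -> R) (k s l : R) : is_derive s (1 : R) g l ->
  is_derive s (1 : R) (fun r => g r * k) (l * k).
Proof.
move=> dg; have h := is_deriveM dg (is_derive_cst k s (1 : R)); apply: (is_derive_eq h).
by rewrite /GRing.scale /= mulr0 add0r mulrC.
Qed.

Lemma local_primitive (g : R -> R) (r : R) : 0 < r -> (forall h : R, `|h| <= r -> {for h, continuous g}) ->
  exists G : R -> R, forall h : R, `|h| < r -> is_derive h (1 : R) G (g h).
Proof.
move=> r0 cg; exists (fun x : R => \int[lebesgue_measure]_(t in `[- r, x]) g t)%R => h hr.
have gi : lebesgue_measure.-integrable `[- r, r] (EFin \o g).
  apply: continuous_compact_integrable; first exact: segment_compact.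
  apply: continuous_in_subspaceT => y; rewrite inE /= in_itv /= => yr.
  by apply: cg; rewrite ler_norml.
move: (hr); rewrite ltr_norml => /andP[h1 h2].
have [d e] := @continuous_FTC1_closed R g (- r) h r h2 gi h1 (cg h (ltW hr)).
by rewrite derive1E in e; apply: DeriveDef.
Qed.

Local Transparent derive.
Lemma derivable_of_line (V : normedModType R) (f : V -> R) (x v : V) (l : R) :
  is_derive (0 : R) (1 : R) (fun h => f (x + h *: v)) l -> is_derive x v f l.
Proof.
move=> [d e].
have E : (fun s : R => s^-1 *: (((fun h : R => f (x + h *: v)) \o shift 0) (s *: 1) - f (x + 0 *: v))) =
  (fun s : R => s^-1 *: ((f \o shift x) (s *: v) - f x)).
  apply/funext => s /=; congr (_ *: (f _ - f _)); last by rewrite scale0r addr0.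
  by rewrite [s%:A]mulr1 addr0 addrC.
by split; [move: d; rewrite /derivable E|move: e; rewrite /derive E].
Qed.

Local Opaque derive.

Lemma linear_combination_bound (b w : 'rV[R]_n) (K : 'I_n -> R) : (forall i, `|b 0 i| <= K i) ->
  `|\sum_i b 0 i * w 0 i| <= (\sum_i K i) * `|w|.
Proof.
move=> bK; apply: le_trans (ler_norm_sum _ _ _) _; rewrite mulr_suml; apply: ler_sum => i _.
rewrite normrM ler_pM // [`|w|]mx_normrE.
by apply: (le_bigmax _ (fun ij => `|w ij.1 ij.2|) (0, i)).
Qed.

Lemma continuous_of_bound (V : normedModType R) (f : V -> R) (x : V) (r C : R) : 0 < r -> 0 <= C ->
  (forall w : V, `|w| < r -> `|f (x + w) - f x| <= C * `|w|) -> {for x, continuous f}.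
Proof.
move=> r0 C0 est; apply/cvgrPdist_lt => e e0; apply/nbhs_normP.
have C1 : 0 < C + 1 by rewrite ltr_wpDl.
exists (Num.min r (e / (C + 1))); first by rewrite lt_min r0 divr_gt0.
move=> y; rewrite lt_min => /andP[y1 y2]; rewrite distrC.
have := est _ y1; rewrite (addrC x) subrK => h; apply: le_lt_trans h _; apply: (@le_lt_trans _ _ ((C + 1) * `|y - x|)).
  by rewrite ler_wpM2r // lerDl.
by rewrite mulrC -ltr_pdivlMr.
Qed.

(* All directional derivatives exist and are smooth, so f is continuous by the mean value theorem. *)
Lemma Cinf_of_gradient (U : set Rn) (f : Rn -> R) (b : Rn -> Rn) : open U ->
  (forall i, Cinf U (fun x => b x 0 i)) ->
  (forall x v, U x -> is_derive x v f (\sum_i b x 0 i * v 0 i)) -> Cinf U f.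
Proof.
move=> oU Cb df.
have cf x : U x -> {for x, continuous f}.
  move=> Ux; pose K i := `|b x 0 i| + 1.
  have nb : \forall y \near x, forall i, `|b y 0 i| <= K i.
    suff hi : forall i, \forall y \near x, `|b y 0 i| <= K i by exact: (@filter_forall _ _ (fun i y => `|b y 0 i| <= K i) (nbhs x) _ hi).
    move=> i.
    have cb : {for x, continuous (fun y => b y 0 i)} by exact: (Cinf_cont (Cb i) Ux).
    have := cont_near cb ltr01; apply: filterS => y h.
    rewrite -[b y 0 i](subrK (b x 0 i)); apply: le_trans (ler_normD _ _) _.
    by rewrite addrC lerD2l ltW.
  have /nbhs_normP [r r0 hr] := nbhsI nb (open_nbhs_nbhs (conj oU Ux)).
  have K0 : 0 <= \sum_i K i by apply: sumr_ge0 => i _; rewrite addr_ge0.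
  have est w : `|w| < r -> `|f (x + w) - f x| <= (\sum_i K i) * `|w|.
    move=> wr; have inb (t : R) : 0 <= t <= 1 -> `|x + t *: w - x| < r.
      move=> /andP[t0 t1]; rewrite addrAC subrr add0r normrZ ger0_norm //.
      by apply: le_lt_trans wr; rewrite ler_piMl.
    have [|t t01 ->] := @MVT_line R _ f x w.
      by move=> t /inb /hr [_ Ut]; have [] := df _ w Ut.
    have [bt Ut] := hr _ (inb t t01); have [_ ->] := df _ w Ut.
    exact: linear_combination_bound.
  exact: (continuous_of_bound r0 K0 est).
move=> k; case: k => [|k]; first by split.
split=> // v; split=> [x Ux|]; first by have [] := df x v Ux.
apply: (Ck_ext oU (f := fun x => \sum_i b x 0 i * v 0 i)).
  by move=> x Ux; have [_ ->] := df x v Ux.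
have : Cinf U (fun x => \sum_i b x 0 i * v 0 i).
  by apply: Cinf_sum => // i _; apply: CinfM => //; exact: Cinf_cst.
by apply.
Qed.

Variable alpha : form1 M.
Hypothesis fa : is_form1 alpha.
Hypothesis loops : forall g : R -> M, smooth_loop g -> has_integral 0 (2 * pi) (pairing alpha g) 0.

Local Notation f := (potential alpha).

Lemma form_Cinf c i : Cinf (chart_image c) (fun x => (alpha c x) 0 i).
Proof. by apply: smooth_on_open; [exact: chart_image_open|exact: fa.1]. Qed.

(** Constant before 1/3 and after 2/3, so that a segment run through in this way is constant near
    its ends, as [path_from_to] demands. *)
Definition ramp (s : R) : R := smooth_step (3 * s + (-1)).

Lemma Cinf_ramp : Cinf setT ramp.
Proof. by apply: Cinf_comp_R; [exact: openT|exact: Cinf_smooth_step|exact: Cinf_affine openT]. Qed.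

Lemma ramp0 s : s <= 3^-1 -> ramp s = 0.
Proof. by move=> h; apply: smooth_step0; lra. Qed.

Lemma ramp1 s : 2 / 3 <= s -> ramp s = 1.
Proof. by move=> h; apply: smooth_step1; lra. Qed.

Lemma ramp01 s : 0 <= ramp s <= 1.
Proof.
rewrite /ramp /smooth_step; set t := 3 * s + _.
have a0 := flat_ge0 0 t; have b0 := flat_ge0 0 (1 - t); have d0 := smooth_step_den t.
have d1 : 0 < flat 0 t + flat 0 (1 - t) by rewrite lt_neqAle eq_sym d0 addr_ge0.
by rewrite divr_ge0 ?addr_ge0 // ler_pdivrMr // mul1r lerDl.
Qed.

(** Along a segment in direction [v] the potential grows by the integral of [alpha], whatever the
    parametrization; [ramp] supplies an admissible one. The growth A h - A 0 has derivative alpha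
    (v) at h = 0. *)
Lemma potential_derive c x v : chart_image c x ->
  is_derive x v (fun y => f (param c y)) (\sum_i (alpha c x) 0 i * v 0 i).
Proof.
move=> cx; apply: derivable_of_line.
have [rho rho0 hrho] := open_ballP (chart_image_open c) cx.
(* Keeps x + h v in the chart for |h| <= r; the + 1 covers v = 0. *)
pose r := rho / (2 * (`|v| + 1)).
have v1 : 0 < `|v| + 1 by rewrite ltr_wpDl.
have r0 : 0 < r by rewrite divr_gt0 // mulr_gt0.
have inU (h : R) : `|h| <= r -> chart_image c (x + h *: v).
  move=> hr; apply: hrho; rewrite addrAC subrr add0r normrZ.
  apply: (@le_lt_trans _ _ (r * (`|v| + 1))); first by rewrite ler_pM // lerDl.
  have -> : r * (`|v| + 1) = rho / 2 by rewrite /r; field; rewrite gt_eqF.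
  by rewrite ltr_pdivrMr // ltr_pMr // ltr1n.
pose a (h : R) := \sum_i (alpha c (x + h *: v)) 0 i * v 0 i.
have ca (h : R) : `|h| <= r -> {for h, continuous a}.
  move=> hr; apply: cont_sum => i; apply: cvgM; last exact: cvg_cst.
  have cc : {for x + h *: v, continuous (fun y => (alpha c y) 0 i)}.
    exact: (Cinf_cont (form_Cinf c i) (inU h hr)).
  have cl : {for h, continuous (fun s : R => x + s *: v)}.
    by apply: cvgD; [exact: cvg_cst|apply: cvgZ; [exact: cvg_id|exact: cvg_cst]].
  exact: (continuous_comp cl cc).
have [A dA] := local_primitive r0 ca.
have line (h : R) : `|h| < r -> f (param c (x + h *: v)) = f (param c x) + (A h - A 0).
  move=> hr; apply: (potential_diff fa loops).
  pose g s := param c (x + (ramp s * h) *: v).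
  have rh s : `|ramp s * h| < r.
    have /andP[q0 q1] := ramp01 s; rewrite normrM ger0_norm //.
    by apply: le_lt_trans hr; rewrite ler_piMl.
  have gc s : chart_image c (x + (ramp s * h) *: v) by apply: inU; exact: ltW.
  have gd s : chart_dom c (g s) by have [] := paramP (gc s).
  have gE s : coord c (g s) = x + (ramp s * h) *: v by have [] := paramP (gc s).
  have cE i : (fun s => (coord c (g s)) 0 i) = fun s => ramp s * (h * v 0 i) + x 0 i.
    by apply/funext => s; rewrite gE !mxE addrC mulrA.
  have pg : smooth_path g.
    move=> s; exists setT, c; split=> // [|i]; first exact: openT.
    rewrite cE; apply: CinfD; [exact: openT| |exact: Cinf_cst].
    by apply: CinfM; [exact: openT|exact: Cinf_ramp|exact: Cinf_cst].
  exists g.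
    split=> //; exists 3^-1; first by rewrite invr_gt0.
    split=> s hs; first by rewrite /g ramp0 ?mul0r ?scale0r ?addr0 // ltW.
    by rewrite /g ramp1 ?mul1r //; lra.
  exists (fun s => A (ramp s * h)); last first.
    by rewrite (ramp0 (s := 0)) ?invr_ge0 // ramp1 ?mul0r ?mul1r //; lra.
  move=> s _; rewrite (pairingE fa pg (gd s)) /chart_pairing gE.
  have dr : is_derive s (1 : R) ramp ('D_(1 : R) ramp s).
    by apply: DeriveDef => //; exact: (Cinf_derivable (1 : R) Cinf_ramp).
  have drh : is_derive s (1 : R) (fun s => ramp s * h) ('D_(1 : R) ramp s * h).
    exact: is_derive_mulr.
  have := @is_derive1_comp R A (fun s => ramp s * h) s _ _ (dA _ (rh s)) drh.
  congr is_derive; rewrite /a mulr_suml; apply: eq_bigr => i _; rewrite -mulrA; congr (_ * _).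
  rewrite cE; have dv : is_derive s (1 : R) (fun s => ramp s * (h * v 0 i) + x 0 i) ('D_(1 : R) ramp s * (h * v 0 i)).
    have hd := is_deriveD (is_derive_mulr (h * v 0 i) dr) (is_derive_cst (x 0 i) s (1 : R)).
    by apply: (is_derive_eq hd); rewrite addr0.
  have [_ ->] := dv; ring.
have near : \forall h \near (0 : R), (fun h => f (param c x) + (A h - A 0)) h = f (param c (x + h *: v)).
  apply/nbhs_normP; exists r => // h; rewrite subr0 => hr; by rewrite line.
apply: near_eq_is_derive near _.
have d0 := dA 0 (ltac:(by rewrite normr0)).
have dc := is_deriveD (is_derive_cst (f (param c x)) (0 : R) (1 : R)) (is_deriveB d0 (is_derive_cst (A 0) (0 : R) (1 : R))).
apply: (is_derive_eq dc); rewrite add0r subr0 /a; apply: eq_bigr => i _.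
by rewrite scale0r addr0.
Qed.

Theorem exact_of_loops : exact_form alpha.
Proof.
exists f; split=> [c|c x cx i].
  apply: Cinf_smooth_on; first exact: chart_image_open.
  apply: (Cinf_of_gradient (b := alpha c) (chart_image_open c) (form_Cinf c)) => x v cx.
  exact: potential_derive.
have [_ e] := potential_derive (delta_mx 0 i) cx.
rewrite /partial_deriv e (bigD1 i) //= big1 ?addr0; first by rewrite mxE !eqxx mulr1.
by move=> j ji; rewrite mxE (negPf ji) andbF mulr0.
Qed.

End Exactness.

(** * Stokes' formula on the disk *)

Section PlaneMeasure.
Context {R : realType}.
Local Notation mu := (@lebesgue_measure R).
Local Notation mu2 := (mu \x mu)%E.

Definition rational_box (a b c d : rat) : set (R * R) :=
  [set` `](ratr a : R), ratr b[] `*` [set` `](ratr c : R), ratr d[].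

(** Measurability refers to the product sigma-algebra, which contains boxes; those with rational
    corners form a countable base of the topology. *)
Lemma open_measurable_plane (O : set (R * R)) : open O -> measurable O.
Proof.
move=> oO.
have -> : O = \bigcup_a \bigcup_b \bigcup_c \bigcup_d
   (if `[< rational_box a b c d `<=` O >] then rational_box a b c d else set0).
  apply/seteqP; split=> [z Oz|z [a _ [b _ [c _ [d _]]]]]; last by case: asboolP => // h; exact: h.
  have [r r0 hr] := open_ballP oO Oz.
  have near_rat (x : R) : exists a b : rat, [/\ ratr a < x, x < ratr b &
      forall y : R, ratr a < y -> y < ratr b -> `|y - x| < r].
    have h1 : x - r < x by rewrite ltrBlDr ltrDl.
    have h2 : x < x + r by rewrite ltrDl.
    have [a] := rat_in_itvoo h1; have [b] := rat_in_itvoo h2.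
    rewrite !in_itv /= => /andP[b1 b2] /andP[a1 a2]; exists a, b; split=> // y y1 y2.
    by rewrite ltr_norml; apply/andP; split; lra.
  have [a [b [a1 b1 hab]]] := near_rat z.1; have [c [d [c1 d1 hcd]]] := near_rat z.2.
  have bz : rational_box a b c d z by split; rewrite /= in_itv /=; apply/andP.
  exists a => //; exists b => //; exists c => //; exists d => //; case: asboolP => // ns.
  case: ns => y [] /=; rewrite !in_itv /= => /andP[y1 y2] /andP[y3 y4]; apply: hr.
  by rewrite prod_normE /= gt_max hab // hcd.
do 4! (apply: bigcupT_measurable_rat => ?).
by case: ifP => // _; apply: measurableX; exact: measurable_itv.
Qed.

Lemma open_continuous_measurable_plane (O : set (R * R)) (f : R * R -> R) : open O ->
  (forall z, O z -> {for z, continuous f}) -> measurable_fun O f.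
Proof.
move=> oO cf; have mO := open_measurable_plane oO.
apply: (measurability _ (measurable_realfun.RGenOpens.measurableE R)) => // _ [_ [a [b ->] <-]].
apply: open_measurable_plane; rewrite openE => z [Oz fz].
apply: nbhsI; first exact: open_nbhs_nbhs.
by apply: (cf z Oz); apply: open_nbhs_nbhs; split=> //; exact: interval_open.
Qed.

Definition disk (r : R) : set (R * R) := [set z | z.1 ^+ 2 + z.2 ^+ 2 <= r ^+ 2].

Lemma normsq_continuous : continuous (fun z : R * R => z.1 ^+ 2 + z.2 ^+ 2).
Proof.
move=> z; have c1 : {for z, continuous (fun z : R * R => z.1)} by exact: cvg_fst.
have c2 : {for z, continuous (fun z : R * R => z.2)} by exact: cvg_snd.
by under eq_fun do rewrite !expr2; rewrite /continuous_at; apply: cvgD; apply: cvgM.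
Qed.

Lemma open_disk_open : open (@open_disk R).
Proof.
apply: (@open_comp _ _ (fun z : R * R => z.1 ^+ 2 + z.2 ^+ 2) [set x | x < 1]).
  by move=> z _; exact: normsq_continuous.
exact: open_lt.
Qed.

Lemma disk_measurable r : measurable (disk r).
Proof.
rewrite -[disk r]setCK; apply: measurableC; apply: open_measurable_plane.
have -> : ~` disk r = (fun z : R * R => z.1 ^+ 2 + z.2 ^+ 2) @^-1` [set x | r ^+ 2 < x].
  by apply/seteqP; split=> z; rewrite /disk /= ltNge => h; exact/negP.
apply: open_comp; last exact: open_gt.
by move=> z _; exact: normsq_continuous.
Qed.

Lemma disk_sub_open r : 0 <= r -> r < 1 -> disk r `<=` @open_disk R.
Proof.
move=> r0 r1 z /= h; apply: le_lt_trans h _.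
by rewrite -[X in _ < X](expr1n _ 2) ltr_pXn2r ?nnegrE.
Qed.

Lemma disk_box (z : R * R) : z.1 ^+ 2 + z.2 ^+ 2 <= 1 -> -1 <= z.1 <= 1 /\ -1 <= z.2 <= 1.
Proof.
have h (x y : R) : x ^+ 2 + y ^+ 2 <= 1 -> -1 <= x <= 1.
  move=> xy; rewrite -ler_norml -(@ler_pXn2r _ 2%N) ?nnegrE // expr1n real_normK ?num_real //.
  by apply: le_trans xy; rewrite lerDl sqr_ge0.
by move=> zz; split; [exact: h zz|apply: h; rewrite addrC; exact: zz].
Qed.

Lemma plane_measure_fin (A : set (R * R)) : measurable A ->
  (forall z, A z -> z.1 ^+ 2 + z.2 ^+ 2 <= 1) -> (mu2 A < +oo)%E.
Proof.
move=> mA sub; pose B : set (R * R) := [set` `[(-1 : R), 1]] `*` [set` `[(-1 : R), 1]].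
have mB : measurable B by apply: measurableX; exact: measurable_itv.
apply: (@le_lt_trans _ _ (mu2 B)).
  apply: le_measure; rewrite ?inE // => z Az.
  by have [h1 h2] := disk_box (sub z Az); split; rewrite /= in_itv.
rewrite product_measure1E; [|exact: measurable_itv|exact: measurable_itv].
by rewrite /= !lebesgue_measure_itv /= lte_fin (ltac:(lra) : (-1 < 1 :> R) = true) -EFinB -EFinM ltry.
Qed.

Lemma plane_integrable (A : set (R * R)) (f : R * R -> R) (B : R) : measurable A ->
  (forall z, A z -> z.1 ^+ 2 + z.2 ^+ 2 <= 1) -> measurable_fun A f ->
  (forall z, A z -> `|f z| <= B) -> mu2.-integrable A (EFin \o f).
Proof.
move=> mA sub mf bf; apply: measurable_bounded_integrable => //.
  exact: plane_measure_fin.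
exists B; split; first exact: num_real.
by move=> M BM z Az; apply: le_trans (bf z Az) (ltW BM).
Qed.

Lemma measurable_sub_disk (f : R * R -> R) r : 0 <= r -> r < 1 ->
  (forall z, open_disk z -> {for z, continuous f}) -> measurable_fun (disk r) f.
Proof.
move=> r0 r1 cf; apply: (@measurable_funS _ _ _ _ (@open_disk R)).
- by apply: open_measurable_plane; exact: open_disk_open.
- exact: disk_sub_open.
- by apply: open_continuous_measurable_plane; [exact: open_disk_open|].
Qed.

Lemma disk_section (r x y : R) : 0 <= r -> `|y| <= r ->
  disk r (x, y) <-> x \in `[- Num.sqrt (r ^+ 2 - y ^+ 2), Num.sqrt (r ^+ 2 - y ^+ 2)].
Proof.
move=> r0 yr; have d0 : 0 <= r ^+ 2 - y ^+ 2.
  by rewrite subr_ge0 -(real_normK (num_real y)) ler_pXn2r ?nnegrE.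
rewrite in_itv /= -ler_norml -(@ler_pXn2r _ 2%N) ?nnegrE ?sqrtr_ge0 //.
by rewrite sqr_sqrtr // real_normK ?num_real // lerBrDr.
Qed.

Lemma disk_section0 (r x y : R) : 0 <= r -> r < `|y| -> ~ disk r (x, y).
Proof.
move=> r0 yr; rewrite /disk /= => h.
have : r ^+ 2 < y ^+ 2 by rewrite -(real_normK (num_real y)) ltr_pXn2r ?nnegrE.
by rewrite ltNge; move/negP; apply; apply: le_trans h; rewrite lerDr sqr_ge0.
Qed.

End PlaneMeasure.

Section Green.
Context {R : realType}.
Local Notation mu := (@lebesgue_measure R).
Local Notation mu2 := (mu \x mu)%E.

Definition chord (b : R * R -> R) (r y : R) : R :=
  b (Num.sqrt (r ^+ 2 - y ^+ 2), y) - b (- Num.sqrt (r ^+ 2 - y ^+ 2), y).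

Lemma FTC_smooth (f : R -> R) (W : set R) (a b : R) : open W -> Cinf W f -> a <= b ->
  (forall x, a <= x <= b -> W x) ->
  (\int[mu]_(x in `[a, b]) ('D_(1 : R) f x)%:E = (f b - f a)%:E)%E.
Proof.
move=> oW Cf ab sub; move: ab; rewrite le_eqVlt => /orP[/eqP ->|ab].
  by rewrite set_itv1 integral_set1 subrr.
have cf x : W x -> {for x, continuous f} by exact: Cinf_cont.
have inW x : x \in `]a, b[ -> W x.
  by rewrite in_itv /= => /andP[x1 x2]; apply: sub; rewrite !ltW.
rewrite (@continuous_FTC2 _ _ f a b ab) ?EFinB //.
- apply: continuous_in_subspaceT => x; rewrite inE /= in_itv /= => xab.
  exact: (Cinf_cont (Cinf_derive (1 : R) Cf) (sub x xab)).
- split.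
  + by move=> x /inW Wx; exact: (Cinf_derivable (1 : R) Cf Wx).
  + by apply: cvg_at_right_filter; apply: cf; apply: sub; rewrite lexx ltW.
  + by apply: cvg_at_left_filter; apply: cf; apply: sub; rewrite lexx ltW.
- by move=> x _; rewrite derive1E.
Qed.

Local Notation dx b z := ('D_((1%R, 0%R) : R * R) b z).

(** On a horizontal chord the fundamental theorem applies because a disk of radius r < 1 lies inside
    the open unit disk. A line that misses the disk contributes 0 on both sides. *)
Lemma slice_integral (b : R * R -> R) (r y : R) : 0 <= r -> r < 1 -> Cinf (@open_disk R) b ->
  (\int[mu]_x ((EFin \o (fun z => dx b z)) \_ (disk r)) (x, y) =
   (((chord b r) \_ `[- r, r]) y)%:E)%E.
Proof.
move=> r0 r1 Cb; have [yr|yr] := leP `|y| r; last first.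
  rewrite patchE ifF; last by apply/negP; rewrite inE /= in_itv /= -ler_norml leNgt yr.
  rewrite integral0_eq // => x _; rewrite patchE ifF //.
  by apply/negP; rewrite inE; exact: disk_section0.
rewrite patchE ifT; last by rewrite inE /= in_itv /= -ler_norml.
set c := Num.sqrt (r ^+ 2 - y ^+ 2).
have c0 : 0 <= c by exact: sqrtr_ge0.
have cc : - c <= c by lra.
have oW : open [set x | @open_disk R (x, y)] by exact: (open_slice1 y open_disk_open).
have CW : Cinf [set x | @open_disk R (x, y)] (fun x => b (x, y)).
  by move=> k; exact: (Ck_slice1 y open_disk_open (Cb k)).
rewrite -(FTC_smooth oW CW cc); last first.
  move=> x xc; apply: (disk_sub_open r0 r1); apply/(disk_section _ r0 yr).
  by rewrite in_itv.
rewrite [RHS]integral_mkcond; apply: eq_integral => x _; rewrite !patchE.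
have -> : ((x, y) \in disk r) = (x \in [set` `[- c, c]]).
  by apply/idP/idP; rewrite !inE => /(disk_section _ r0 yr).
by case: ifP => // _ /=; rewrite (derive_slice1 b).
Qed.

Lemma green_x (b : R * R -> R) (r B : R) : 0 <= r -> r < 1 -> Cinf (@open_disk R) b ->
  (forall z, disk r z -> `|dx b z| <= B) ->
  (\int[mu2]_(z in disk r) (dx b z)%:E = \int[mu]_(y in `[(- r)%R, r]) (chord b r y)%:E)%E.
Proof.
move=> r0 r1 Cb bB.
have cd z : open_disk z -> {for z, continuous (fun z => dx b z)}.
  exact: (Cinf_cont (Cinf_derive _ Cb)).
have fi : mu2.-integrable (disk r) (EFin \o (fun z => dx b z)).
  apply: (plane_integrable (B := B)) => //; first exact: disk_measurable.
    by move=> z zr; apply: ltW; exact: (disk_sub_open r0 r1 zr).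
  exact: measurable_sub_disk.
have {}fi : mu2.-integrable setT ((EFin \o (fun z => dx b z)) \_ (disk r)).
  exact: ((@integrable_mkcond _ _ _ mu2 (disk r) _ (disk_measurable r)).1 fi).
rewrite integral_mkcond -(integral21_prod_meas1 fi) [RHS]integral_mkcond.
apply: eq_integral => y _; rewrite /fubini_G (slice_integral _ r0 r1 Cb).
by rewrite restrict_EFin.
Qed.

End Green.

Lemma continuous_pair (V A B : topologicalType) (f : V -> A) (g : V -> B) (s : V) :
  {for s, continuous f} -> {for s, continuous g} -> {for s, continuous (fun y => (f y, g y))}.
Proof. by move=> cf cg; exact: (@cvg_pair V A B (nbhs s) (nbhs (f s)) (nbhs (g s)) _ _ _ f g cf cg). Qed.

Section ChordIntegral.
Context {R : realType}.
Local Notation mu := (@lebesgue_measure R).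

(** The integral over a period does not depend on its starting point, because s |-> Q (s + 2 pi) and
    Q have the same derivative. *)
Lemma has_integral_shift (p : R -> R) (A a v : R) (Q : R -> R) : a <= 0 -> A < a ->
  (forall s, p (s + 2 * pi) = p s) -> (forall s, A < s -> is_derive s (1 : R) Q (p s)) ->
  has_integral 0 (2 * pi) p v -> Q (a + 2 * pi) - Q a = v.
Proof.
move=> a0 Aa per dQ iv; have pi0 : 0 < pi :> R by exact: pi_gt0.
have -> : v = Q (2 * pi) - Q 0.
  apply: (has_integral_uniq _ iv); first lra.
  by exists Q => // s /andP[s0 _]; apply: dQ; lra.
have dS s : A < s -> is_derive s (1 : R) (fun s => Q (s + 2 * pi)) (p s).
  move=> As; have d1 : is_derive s (1 : R) (fun s => s + 2 * pi) 1.
    rewrite -[X in is_derive _ _ _ X]addr0.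
    exact: is_deriveD (is_derive_id _ _) (is_derive_cst _ _ _).
  have d2 : is_derive (s + 2 * pi) (1 : R) Q (p (s + 2 * pi)) by apply: dQ; lra.
  by have := @is_derive1_comp R Q (fun s => s + 2 * pi) s _ _ d2 d1; rewrite mulr1 per.
have d1 s : a <= s <= 0 -> is_derive s (1 : R) (fun s => Q (s + 2 * pi)) (p s).
  by move=> /andP[s1 _]; apply: dS; exact: lt_le_trans s1.
have d2 s : a <= s <= 0 -> is_derive s (1 : R) Q (p s).
  by move=> /andP[s1 _]; apply: dQ; exact: lt_le_trans s1.
have := same_derive_diff a0 d1 d2; rewrite add0r => e; lra.
Qed.

Lemma polar_norm (r s : R) : (r * cos s) ^+ 2 + (r * sin s) ^+ 2 = r ^+ 2.
Proof. by rewrite !exprMn -mulrDr cos2Dsin2 mulr1. Qed.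

Lemma polar_open_disk (r s : R) : 0 <= r -> r < 1 -> open_disk (r * cos s, r * sin s).
Proof. by move=> r0 r1; rewrite /open_disk /= polar_norm expr_lt1. Qed.

Lemma polar_continuous (r : R) : continuous (fun s : R => (r * cos s, r * sin s)).
Proof.
move=> s; apply: (@continuous_pair R R R (fun s => r * cos s) (fun s => r * sin s)).
  by apply: cvgM; [exact: cvg_cst|exact: continuous_cos].
by apply: cvgM; [exact: cvg_cst|exact: continuous_sin].
Qed.

Variables (b : R * R -> R) (r : R).
Hypotheses (r0 : 0 < r) (r1 : r < 1).
Hypothesis cb : forall z, open_disk z -> {for z, continuous b}.

Definition arc_x (s : R) : R := b (r * cos s, r * sin s) * (r * cos s).

Lemma arc_x_continuous : continuous arc_x.
Proof.
move=> s; apply: cvgM.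
  apply: (@continuous_comp _ _ _ (fun s : R => (r * cos s, r * sin s)) b); first exact: polar_continuous.
  by apply: cb; apply: polar_open_disk => //; exact: ltW.
by apply: cvgM; [exact: cvg_cst|exact: continuous_cos].
Qed.

Lemma chord_continuous (y : R) : `|y| <= r -> {for y, continuous (chord b r)}.
Proof.
move=> yr; have h (e : R) : e ^+ 2 = 1 -> {for y, continuous (fun y : R => b (e * Num.sqrt (r ^+ 2 - y ^+ 2), y))}.
  move=> e1; apply: (@continuous_comp _ _ _ (fun y : R => (e * Num.sqrt (r ^+ 2 - y ^+ 2), y)) b).
    apply: continuous_pair; last exact: cvg_id.
    apply: cvgM; first exact: cvg_cst.
    apply: (@continuous_comp _ _ _ (fun y : R => r ^+ 2 - y ^+ 2) Num.sqrt); last exact: sqrt_continuous.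
    by apply: cvgB; [exact: cvg_cst|exact: exprn_continuous].
  apply: cb; rewrite /open_disk /= exprMn e1 mul1r sqr_sqrtr; last first.
    by rewrite subr_ge0 -(real_normK (num_real y)) ler_pXn2r ?nnegrE // ltW.
  by rewrite subrK expr_lt1 // ltW.
have e1 : (fun y : R => b (1 * Num.sqrt (r ^+ 2 - y ^+ 2), y)) = fun y => b (Num.sqrt (r ^+ 2 - y ^+ 2), y).
  by apply/funext => z; rewrite mul1r.
have e2 : (fun y : R => b (-1 * Num.sqrt (r ^+ 2 - y ^+ 2), y)) = fun y => b (- Num.sqrt (r ^+ 2 - y ^+ 2), y).
  by apply/funext => z; rewrite mulN1r.
have h1 := h 1 (expr1n _ _); have h2 := h (-1) (etrans (sqrrN 1) (expr1n _ _)).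
by rewrite e1 in h1; rewrite e2 in h2; exact: cvgB.
Qed.

(** The substitution y = r sin s on [- pi/2, pi/2] carries the right ends of the chords to the right
    half circle and, through s |-> pi - s, the left ends to the left half. [H] is the primitive
    gathering both arcs, which together make one period. *)
Lemma chord_integral (v : R) : has_integral 0 (2 * pi) arc_x v ->
  (\int[mu]_(y in `[(- r)%R, r]) (chord b r y)%:E = v%:E)%E.
Proof.
move=> iv; have pi0 : 0 < pi :> R by exact: pi_gt0.
pose F (s : R) := r * sin s; pose a : R := - (pi / 2); pose a' : R := pi / 2.
have aa : a < a' by rewrite /a /a'; lra.
have dF s : is_derive s (1 : R) F (r * cos s).
  have h := is_deriveM (is_derive_cst r s (1 : R)) (is_derive_sin s).
  by apply: (is_derive_eq h); rewrite /GRing.scale /= mulr0 addr0.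
have F' : derive1 F = fun s => r * cos s.
  by apply/funext => s; rewrite derive1E; have [_ ->] := dF s.
have cF s : {for s, continuous F} by apply: cvgM; [exact: cvg_cst|exact: continuous_sin].
have cF' s : {for s, continuous (fun s => r * cos s)}.
  by apply: cvgM; [exact: cvg_cst|exact: continuous_cos].
have Fa : F a = - r by rewrite /F /a sinN sin_pihalf mulrN1.
have Fa' : F a' = r by rewrite /F /a' sin_pihalf mulr1.
have cG : {within `[(- r)%R, r], continuous (chord b r)}.
  apply: continuous_in_subspaceT => y; rewrite inE /= in_itv /= => yr.
  by apply: chord_continuous; rewrite ler_norml.
rewrite -{1}Fa -[X in `[_, X]]Fa' integration_by_substitution_increasing; [|exact: ltW| | | | | |by rewrite Fa Fa'].
- have [Q dQ] := primitive_above (- pi) arc_x_continuous.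
  pose H s := Q s - Q (pi - s).
  have dH (s : R) : - pi < s -> s < 2 * pi -> is_derive s (1 : R) H (arc_x s + arc_x (pi - s)).
    move=> s1 s2; have e1 := dQ s s1; have e2 : is_derive (pi - s) (1 : R) Q (arc_x (pi - s)) by apply: dQ; lra.
    have e3 : is_derive s (1 : R) (fun s => pi - s) (-1).
      rewrite -[X in is_derive _ _ _ X]add0r.
      exact: is_deriveB (is_derive_cst _ _ _) (is_derive_id _ _).
    have e4 := is_deriveB e1 (@is_derive1_comp R Q (fun s => pi - s) s _ _ e2 e3).
    by apply: (is_derive_eq e4); rewrite mulrN1 opprK.
  have dHab (s : R) : a <= s <= a' -> is_derive s (1 : R) H (arc_x s + arc_x (pi - s)).
    by rewrite /a /a' => /andP[s1 s2]; apply: dH; lra.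
  have cH (s : R) : a <= s <= a' -> {for s, continuous H}.
    move=> /dHab [d _]; apply: differentiable_continuous; exact/derivable1_diffP.
  have HE (s : R) : a < s < a' -> arc_x s + arc_x (pi - s) = ((chord b r \o F) * derive1 F) s.
    move=> /andP[s1 s2]; have c0 : 0 < cos s by apply: cos_gt0_pihalf; apply/andP.
    rewrite !fctE F' /chord /F /arc_x /=.
    have -> : Num.sqrt (r ^+ 2 - (r * sin s) ^+ 2) = r * cos s.
      by rewrite -(polar_norm r s) addrK sqrtr_sqr ger0_norm // mulr_ge0 // ltW.
    have -> : cos (pi - s) = - cos s by rewrite -[pi - s]opprB cosN cosB cospi sinpi; ring.
    have -> : sin (pi - s) = sin s by rewrite sinB cospi sinpi; ring.
    rewrite mulrN; ring.
  rewrite (@continuous_FTC2 _ _ H a a' aa).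
  + rewrite -EFinB; have -> : H a' - H a = Q (a + 2 * pi) - Q a.
      rewrite /H /a /a'; have -> : pi - pi / 2 = pi / 2 :> R by lra.
      have -> : pi - - (pi / 2) = - (pi / 2) + 2 * pi :> R by lra.
      ring.
    congr EFin; apply: (has_integral_shift (A := - pi) _ _ _ _ iv) => //.
    * by rewrite /a; lra.
    * by rewrite /a; lra.
    * by move=> s; rewrite /arc_x mulr_natl cosD2pi sinD2pi.
  + apply: continuous_in_subspaceT => s; rewrite inE /= in_itv /= => /andP[s1 s2].
    rewrite F'; apply: cvgM; last exact: cF'.
    apply: (continuous_comp (cF s)); apply: chord_continuous.
    rewrite /F normrM (gtr0_norm r0) ler_piMr //; first exact: ltW.
    by rewrite ler_norml sin_geN1 sin_le1.
  + split.
    * by move=> s; rewrite in_itv /= => /andP[s1 s2]; have [] := dHab s (ltac:(by rewrite !ltW)).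
    * by apply: cvg_at_right_filter; apply: cH; rewrite lexx ltW.
    * by apply: cvg_at_left_filter; apply: cH; rewrite lexx ltW.
  + move=> s; rewrite in_itv /= => s12; rewrite derive1E -(HE s s12).
    by case/andP: s12 => s1 s2; have [_ ->] := dHab s (ltac:(by rewrite !ltW)).
- move=> s t; rewrite !in_itv /= => s1 t1 st; rewrite /F ltr_pM2l // ltr_sin // in_itv //.
- by rewrite F' => s _; exact: cF'.
- by rewrite F'; apply/cvg_ex; exists (r * cos a); apply: cvg_at_right_filter; exact: cF'.
- by rewrite F'; apply/cvg_ex; exists (r * cos a'); apply: cvg_at_left_filter; exact: cF'.
- split.
  + by move=> s _; have [] := dF s.
  + by apply: cvg_at_right_filter; exact: cF.
  + by apply: cvg_at_left_filter; exact: cF.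
Qed.

End ChordIntegral.

Section Green.
Context {R : realType}.
Local Notation mu := (@lebesgue_measure R).
Local Notation mu2 := (mu \x mu)%E.
Local Notation dx b z := ('D_((1%R, 0%R) : R * R) b z).
Local Notation dy b z := ('D_((0%R, 1%R) : R * R) b z).

Lemma Cinf_linear (V : normedModType R) (U : set V) (l : V -> R) :
  (forall (a : R) u v, l (a *: u + v) = a * l u + l v) -> continuous l -> Cinf U l.
Proof.
move=> lin cl.
have dl x v : is_derive x v l (l v).
  apply: derivable_of_line; rewrite (_ : (fun h => _) = (fun h : R => h * l v + l x)); last first.
    by apply/funext => h; rewrite addrC lin.
  have h := is_deriveD (is_derive_mulr (l v) (is_derive_id (0 : R) (1 : R))) (is_derive_cst (l x) (0 : R) (1 : R)).
  by apply: (is_derive_eq h); rewrite addr0 mul1r.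
move=> k; case: k => [|k]; first by split=> // x _; exact: cl.
split=> [x _|v]; first exact: cl.
split=> [x _|]; first by have [] := dl x v.
rewrite (_ : (fun x => _) = (fun=> l v)); first exact: Ck_cst.
by apply/funext => x; have [_ ->] := dl x v.
Qed.

Lemma Cinf_fst (U : set (R * R)) : Cinf U (fun z => z.1).
Proof. by apply: Cinf_linear => // z; exact: cvg_fst. Qed.

Lemma Cinf_snd (U : set (R * R)) : Cinf U (fun z => z.2).
Proof. by apply: Cinf_linear => // z; exact: cvg_snd. Qed.

Lemma Cinf_plane_comp (V : normedModType R) (U : set (R * R)) (W : set V) (f : R * R -> R) (p q : V -> R) :
  open U -> open W -> (forall x, W x -> U (p x, q x)) -> Cinf U f -> Cinf W p -> Cinf W q ->
  Cinf W (fun x => f (p x, q x)).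
Proof.
move=> oU oW sub Cf Cp Cq.
by apply: (Cinf_comp (fincoord_prod fincoord_R fincoord_R) oU oW (phi := fun x => (p x, q x)) sub Cf) => -[].
Qed.

(** Exchanging the coordinates reduces the derivative in y to the one in x; on circles this is the
    substitution s |-> pi/2 - s. *)
Definition flip (a : R * R -> R) (z : R * R) : R := a (z.2, z.1).

Lemma Cinf_flip a : Cinf (@open_disk R) a -> Cinf (@open_disk R) (flip a).
Proof.
move=> Ca; apply: (Cinf_plane_comp open_disk_open open_disk_open _ Ca (Cinf_snd _) (Cinf_fst _)).
by move=> z; rewrite /open_disk /= addrC.
Qed.

Lemma derive_flip a x y : dx (flip a) (y, x) = dy a (x, y).
Proof. by rewrite -(derive_slice1 (flip a)) -(derive_slice2 a). Qed.

Lemma disk_flip (r x y : R) : disk r (y, x) <-> disk r (x, y).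
Proof. by rewrite /disk /= addrC. Qed.

Lemma disk_integrable (f : R * R -> R) (r B : R) : 0 <= r -> r < 1 ->
  (forall z, open_disk z -> {for z, continuous f}) -> (forall z, disk r z -> `|f z| <= B) ->
  mu2.-integrable (disk r) (EFin \o f).
Proof.
move=> r0 r1 cf bf; apply: (plane_integrable (B := B)) => //; first exact: disk_measurable.
  by move=> z zr; apply: ltW; exact: (disk_sub_open r0 r1 zr).
exact: measurable_sub_disk.
Qed.

Lemma green_y (a : R * R -> R) (r B : R) : 0 <= r -> r < 1 -> Cinf (@open_disk R) a ->
  (forall z, disk r z -> `|dy a z| <= B) ->
  (\int[mu2]_(z in disk r) (dy a z)%:E = \int[mu]_(y in `[(- r)%R, r]) (chord (flip a) r y)%:E)%E.
Proof.
move=> r0 r1 Ca aB.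
have cd z : open_disk z -> {for z, continuous (fun z => dy a z)}.
  exact: (Cinf_cont (Cinf_derive _ Ca)).
have fi := disk_integrable r0 r1 cd aB.
have {}fi : mu2.-integrable setT ((EFin \o (fun z => dy a z)) \_ (disk r)).
  exact: ((@integrable_mkcond _ _ _ mu2 (disk r) _ (disk_measurable r)).1 fi).
rewrite integral_mkcond -(integral12_prod_meas1 fi) [RHS]integral_mkcond.
apply: eq_integral => x _.
rewrite (_ : fubini_F _ _ _ = \int[mu]_y ((EFin \o (fun z => dx (flip a) z)) \_ (disk r)) (y, x))%E.
  by rewrite (slice_integral _ r0 r1 (Cinf_flip Ca)) restrict_EFin.
apply: eq_integral => y _; rewrite !patchE /= derive_flip.
have -> : ((x, y) \in disk r) = ((y, x) \in disk r); last by [].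
by apply/idP/idP; rewrite !inE => /disk_flip.
Qed.

Definition arc_y (a : R * R -> R) (r s : R) : R := a (r * cos s, r * sin s) * (r * sin s).

Lemma arc_y_continuous (a : R * R -> R) (r : R) : 0 < r -> r < 1 ->
  (forall z, open_disk z -> {for z, continuous a}) -> continuous (arc_y a r).
Proof.
move=> r0 r1 ca s; apply: cvgM.
  apply: (@continuous_comp _ _ _ (fun s : R => (r * cos s, r * sin s)) a); first exact: polar_continuous.
  by apply: ca; apply: polar_open_disk => //; exact: ltW.
by apply: cvgM; [exact: cvg_cst|exact: continuous_sin].
Qed.

Lemma has_integral_flip (a : R * R -> R) (r w : R) : 0 < r -> r < 1 ->
  (forall z, open_disk z -> {for z, continuous a}) ->
  has_integral 0 (2 * pi) (arc_y a r) w -> has_integral 0 (2 * pi) (arc_x (flip a) r) w.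
Proof.
move=> r0 r1 ca iw; have pi0 : 0 < pi :> R by exact: pi_gt0.
(* For s in [0, 2 pi] the argument pi/2 - s goes down to - 3 pi/2, so the primitive has to start
   further left. *)
have [Q dQ] := primitive_above (- (3 * pi)) (arc_y_continuous r0 r1 ca).
exists (fun s => - Q (pi / 2 - s)) => [s /andP[s0 s1]|].
  have e2 : is_derive (pi / 2 - s) (1 : R) Q (arc_y a r (pi / 2 - s)) by apply: dQ; lra.
  have e3 : is_derive s (1 : R) (fun s => pi / 2 - s) (-1).
    rewrite -[X in is_derive _ _ _ X]add0r.
    exact: is_deriveB (is_derive_cst _ _ _) (is_derive_id _ _).
  have e4 := is_deriveN (@is_derive1_comp R Q (fun s => pi / 2 - s) s _ _ e2 e3).
  apply: (is_derive_eq e4); rewrite mulrN1 opprK /arc_y /arc_x /flip /=.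
  by rewrite cosB sinB cos_pihalf sin_pihalf !mul0r !mul1r add0r subr0.
have e : Q (- (3 * pi / 2) + 2 * pi) - Q (- (3 * pi / 2)) = w.
  apply: (has_integral_shift (A := - (3 * pi)) _ _ _ _ iw) => //; try lra.
  by move=> s; rewrite /arc_y mulr_natl cosD2pi sinD2pi.
rewrite -e subr0 opprK [RHS]addrC; congr (Q _ - Q _); lra.
Qed.

Lemma green (a b : R * R -> R) (r B v : R) : 0 < r -> r < 1 -> Cinf (@open_disk R) a -> Cinf (@open_disk R) b ->
  (forall z, disk r z -> `|dx b z| <= B) -> (forall z, disk r z -> `|dy a z| <= B) ->
  has_integral 0 (2 * pi) (fun s => arc_x b r s - arc_y a r s) v ->
  (\int[mu2]_(z in disk r) (dx b z - dy a z)%:E = v%:E)%E.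
Proof.
move=> r0 r1 Ca Cb bB aB iv; have r0' := ltW r0.
have ca z : open_disk z -> {for z, continuous a} by exact: (Cinf_cont Ca).
have cb z : open_disk z -> {for z, continuous b} by exact: (Cinf_cont Cb).
have cfa z : open_disk z -> {for z, continuous (flip a)} by exact: (Cinf_cont (Cinf_flip Ca)).
have [x ix] := has_integral_exists (2 * pi) (lexx 0) (arc_x_continuous r0 r1 cb).
have [y iy] := has_integral_exists (2 * pi) (lexx 0) (arc_y_continuous r0 r1 ca).
have cda z : open_disk z -> {for z, continuous (fun z => dy a z)}.
  exact: (Cinf_cont (Cinf_derive _ Ca)).
have cdb z : open_disk z -> {for z, continuous (fun z => dx b z)}.
  exact: (Cinf_cont (Cinf_derive _ Cb)).
have ia := disk_integrable r0' r1 cda aB; have ib := disk_integrable r0' r1 cdb bB.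
under eq_integral do rewrite EFinB.
rewrite (integralB_EFin _ ib ia); last exact: disk_measurable.
rewrite (green_x r0' r1 Cb bB) (green_y r0' r1 Ca aB).
rewrite (chord_integral r0 r1 cb ix) (chord_integral r0 r1 cfa (has_integral_flip r0 r1 ca iy)).
have pi2 : 0 <= 2 * pi :> R by rewrite mulr_ge0 ?pi_ge0.
rewrite -EFinB; congr EFin; apply: (has_integral_uniq pi2 _ iv).
case: ix => X dX ->; case: iy => Y dY ->; exists (X - Y).
  by move=> s s01; apply: is_deriveB; [exact: dX|exact: dY].
by rewrite !fctE; ring.
Qed.

Lemma bounded_on_compact (T : topologicalType) (K D : set T) (f : T -> R) : compact K ->
  (forall z, K z -> exists B, nbhs z [set y | D y -> `|f y| <= B]) ->
  exists B, forall z, K z -> D z -> `|f z| <= B.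
Proof.
move=> /compact_near_coveringP cov loc.
have : \forall B \near +oo, forall z, K z -> D z -> `|f z| <= B.
  apply: (cov _ _ (fun B z => D z -> `|f z| <= B)) => z Kz; have [B nB] := loc z Kz.
  exists ([set y | D y -> `|f y| <= B], [set C | B < C]).
    by split=> //=; exists B; split=> //; exact: num_real.
  by move=> [y C] [/= hy BC] Dy; apply: le_trans (hy Dy) (ltW BC).
by move=> [B [_ hB]]; exists (B + 1) => z Kz Dz; apply: (hB (B + 1)) => //; rewrite ltrDl.
Qed.

Lemma closed_disk_compact : compact (@closed_disk R).
Proof.
have cs : compact [set` `[(-1 : R), 1]] by exact: segment_compact.
apply: (subclosed_compact _ (compact_setX cs cs)).
  have -> : @closed_disk R = (fun z : R * R => z.1 ^+ 2 + z.2 ^+ 2) @^-1` [set r | r <= 1] by [].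
  by move: (@closed_le R 1); apply: closed_comp => z _; exact: normsq_continuous.
by move=> z /disk_box [h1 h2]; split; rewrite /= in_itv.
Qed.

End Green.

(** * Passage to the boundary of the disk *)

Section Stokes.
Context {R : realType} {n : nat} {M : smooth_manifold R n}.
Local Notation Cn := 'rV[R[i]]_n.
Local Notation Rn := 'rV[R]_n.
Local Notation mu := (@lebesgue_measure R).
Local Notation mu2 := (mu \x mu)%E.
Local Notation ex := ((1%R, 0%R) : R * R).
Local Notation ey := ((0%R, 1%R) : R * R).

Lemma has_integral_close (a b e : R) (p q : R -> R) (v w : R) : a <= b ->
  (forall s, a <= s <= b -> `|p s - q s| <= e) ->
  has_integral a b p v -> has_integral a b q w -> `|v - w| <= (b - a) * e.
Proof.
move=> ab pq [P dP ->] [Q dQ ->]; pose K := P - Q.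
have dK s : a <= s <= b -> is_derive s (1 : R) K (p s - q s).
  by move=> sab; apply: is_deriveB; [exact: dP|exact: dQ].
have ba : 0 <= b - a by rewrite subr_ge0.
have inab (t : R) : 0 <= t <= 1 -> a <= a + t *: (b - a) <= b.
  move=> /andP[t0 t1]; rewrite lerDl mulr_ge0 //= -[X in _ <= X](subrK a) addrC lerD2r.
  by rewrite -[X in _ <= X]mul1r ler_wpM2r.
have [|t t01] := @MVT_line R R K a (b - a).
  by move=> t t01; have [] := is_derive_scale_R (b - a) (dK _ (inab t t01)).
have [_ ->] := is_derive_scale_R (b - a) (dK _ (inab t t01)); rewrite (addrC a) subrK => e0.
have -> : P b - P a - (Q b - Q a) = K b - K a by rewrite /K !fctE; ring.
rewrite e0 normrM ger0_norm // ler_wpM2l //; exact: pq (inab t t01).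
Qed.

Lemma Cinf_lambda (V : normedModType R) (U : set V) (f g : V -> Cn) : open U -> CinfC U f -> CinfC U g ->
  Cinf U (fun z => lambda_form (f z) (g z)).
Proof.
move=> oU Cf Cg; under eq_fun do rewrite lambda_formE.
by apply: CinfM => //; [exact: Cinf_cst|exact: Cinf_omega].
Qed.

(** The identity d lambda = omega pulled back by [u]: second derivatives cancel by symmetry, and the
    two halves of omega add up by antisymmetry. *)
Lemma lambda_exterior (U : set (R * R)) (u : R * R -> Cn) z : open U -> U z -> CinfC U u ->
  'D_ex (fun z => lambda_form (u z) (derivC ey u z)) z - 'D_ey (fun z => lambda_form (u z) (derivC ex u z)) z =
  omega (derivC ex u z) (derivC ey u z).
Proof.
move=> oU Uz Cu.
have D v w : 'D_v (fun z => lambda_form (u z) (derivC w u z)) z =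
    2^-1 * (omega (derivC v u z) (derivC w u z) + omega (u z) (derivC v (derivC w u) z)).
  have -> : (fun z => lambda_form (u z) (derivC w u z)) = (2^-1 : R) *: (fun z => omega (u z) (derivC w u z)).
    by apply/funext => y; rewrite lambda_formE.
  have d1 := CinfC_derivable v Cu Uz; have d2 := CinfC_derivable v (CinfC_derivC w Cu) Uz.
  rewrite deriveZ; last by have [] := is_derive_omega d1 d2.
  by rewrite (derive_omega d1 d2).
have e := ClairautC ex ey oU Uz Cu.
have q (w1 w2 w3 : R) : 2^-1 * (w1 + w2) - 2^-1 * (- w1 + w2) = w1 by field.
apply: (etrans (congr2 (fun x y => x - y) (D ex ey) (D ey ex))).
rewrite (omegaC (derivC ey u z)); apply: (etrans _ (q _ (omega (u z) (derivC ey (derivC ex u) z)) 0)).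
exact: (congr1 (fun h => 2^-1 * (omega (derivC ex u z) (derivC ey u z) + omega (u z) h) -
   2^-1 * (- omega (derivC ex u z) (derivC ey u z) + omega (u z) (derivC ey (derivC ex u) z))) e).
Qed.

Lemma continuous_mulB (f1 g1 f2 g2 : R * R -> R) w : {for w, continuous f1} -> {for w, continuous g1} ->
  {for w, continuous f2} -> {for w, continuous g2} ->
  {for w, continuous (fun w => f1 w * g1 w - f2 w * g2 w)}.
Proof. by move=> c1 d1 c2 d2; apply: cvgB; apply: cvgM; assumption. Qed.

Lemma near_radius (K : R * R -> R) (s0 eps : R) : {for (s0, (1 : R)), continuous K} -> 0 < eps ->
  nbhs (s0, (1 : R)) [set w : R * R | `|K w - K (w.1, 1)| <= eps].
Proof.
move=> cK e0; have e2 : 0 < eps / 2 by rewrite divr_gt0.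
have n1 : nbhs (s0, (1 : R)) [set w : R * R | `|K w - K (s0, 1)| < eps / 2] by exact: (cont_near cK e2).
have cp : {for (s0, (1 : R)), continuous (fun w : R * R => (w.1, (1 : R)))}.
  by apply: continuous_pair; [exact: cvg_fst|exact: cvg_cst].
have n2 : nbhs (s0, (1 : R)) [set w : R * R | `|K (w.1, 1) - K (s0, 1)| < eps / 2] by exact: (cp _ n1).
apply: filterS (nbhsI n1 n2) => w /= [h1 h2].
rewrite -(subrK (K (s0, 1)) (K w)) -addrA.
apply: le_trans (ler_normD _ _) _; rewrite (distrC (K (s0, 1))) (splitr eps).
by apply: lerD; exact: ltW.
Qed.

(** From (1 - r)^2 >= 0 comes r^2 >= 2 r - 1, whence the half in the hypothesis. *)
Lemma radius_square (r m : R) : 0 < r -> r < 1 -> 1 - r < (1 - m) / 2 -> m <= r ^+ 2.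
Proof. by move=> r0 r1 h; have := sqr_ge0 (1 - r); rewrite sqrrB expr1n mul1r; lra. Qed.

Lemma radius_bounds (q : R) : 0 < q -> q <= 1 -> 0 < 1 - q / 2 /\ 1 - q / 2 < 1 /\ 1 - (1 - q / 2) < q.
Proof. by move=> q0 q1; split; [|split]; lra. Qed.

(** The halving keeps the radius positive at k = 0. *)
Definition radius (k : nat) : R := 1 - k.+1%:R^-1 / 2.

Lemma radiusP k : 0 < radius k /\ radius k < 1 /\ 1 - radius k < k.+1%:R^-1.
Proof. by apply: radius_bounds; [rewrite invr_gt0 ltr0n|rewrite invf_le1 ?ltr0n // ler1n]. Qed.
Lemma radius_gt0 k : 0 < radius k. Proof. exact: (radiusP k).1. Qed.
Lemma radius_lt1 k : radius k < 1. Proof. exact: (radiusP k).2.1. Qed.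

Lemma radius_near (d : R) : 0 < d -> \forall k \near \oo, 1 - radius k < d.
Proof.
move=> d0; apply: filterS (near_infty_natSinv_lt (PosNum d0)) => k /=.
exact: lt_trans (radiusP k).2.2.
Qed.

(** Dominated convergence with a constant dominating function: each point of the open disk lies in
    all but finitely many of the smaller disks. *)
Lemma disk_exhaustion (w : R * R -> R) (B : R) (vn : nat -> R) (v : R) :
  (forall z, open_disk z -> {for z, continuous w}) -> (forall z, open_disk z -> `|w z| <= B) ->
  (forall k, \int[mu2]_(z in disk (radius k)) (w z)%:E = (vn k)%:E)%E -> vn k @[k --> \oo] --> v ->
  Rintegral mu2 (@open_disk R) w = v.
Proof.
move=> cw hB area_n vn_v; have oD := @open_disk_open R.
have mD : measurable (@open_disk R) by exact: open_measurable_plane.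
have mw : measurable_fun (@open_disk R) w.
  exact: open_continuous_measurable_plane.
have iB : mu2.-integrable (@open_disk R) (EFin \o cst B).
  by apply: (plane_integrable (B := `|B|)) => // z h; exact: ltW.
have sub k : disk (radius k) `<=` @open_disk R by move=> z zr; exact: (disk_sub_open (ltW (radius_gt0 k)) (radius_lt1 k) zr).
pose f_ (k : nat) : (measurableTypeR R * measurableTypeR R)%type -> \bar R := (EFin \o w) \_ (disk (radius k)).
have int_n k : (\int[mu2]_(z in setT) f_ k z = (vn k)%:E)%E.
  by rewrite -(area_n k) /f_ -integral_mkcond.
have cvg_f z : f_ k z @[k --> \oo] --> ((EFin \o w) \_ (@open_disk R)) z.
  rewrite /f_ !patchE; have [zD|zD] := pselect (open_disk z); last first.
    rewrite [X in _ --> X]ifF; last by apply/negP => /set_mem.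
    by apply: cvg_near_cst; apply: nearW => k; rewrite patchE ifF //; apply/negP => /set_mem /sub.
  rewrite [X in _ --> X]ifT ?inE //; apply: cvg_near_cst.
  have d0 : 0 < (1 - (z.1 ^+ 2 + z.2 ^+ 2)) / 2 by rewrite divr_gt0 // subr_gt0.
  apply: filterS (radius_near d0) => k kd; rewrite patchE ifT // inE; exact: radius_square (radius_gt0 k) (radius_lt1 k) kd.
have iB' : mu2.-integrable setT ((EFin \o cst B) \_ (@open_disk R)) by rewrite -integrable_mkcond.
have dom z k : (`|f_ k z| <= ((EFin \o cst B) \_ (@open_disk R)) z)%E.
  rewrite /f_ !patchE; case: ifPn => [/set_mem zk|zk].
    by rewrite (mem_set (sub k z zk)) lee_fin; exact: hB (sub k z zk).
  by case: ifPn => [zD|_]; rewrite abse0 // lee_fin; apply: le_trans (normr_ge0 _) (hB z (set_mem zD)).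
have [| | | | |_ _] := @dominated_convergence _ _ _ mu2 setT measurableT f_ ((EFin \o w) \_ (@open_disk R))
  ((EFin \o cst B) \_ (@open_disk R)).
- move=> k; have mk := measurable_funS mD (@sub k) mw.
  have /(@integrable_mkcond _ _ _ mu2 _ _ (disk_measurable _)) ik : mu2.-integrable (disk (radius k)) (EFin \o w).
    apply: (plane_integrable (B := B)) => //; first exact: disk_measurable.
      by move=> z zr; exact: ltW (sub k z zr).
    by move=> z zr; exact: hB (sub k z zr).
  exact: (measurable_int _ ik).
- have /(@integrable_mkcond _ _ _ mu2 _ _ mD) ik : mu2.-integrable (@open_disk R) (EFin \o w).
    by apply: (plane_integrable (B := B)) => // z zr; exact: ltW.
  exact: (measurable_int _ ik).
- by apply: aeW => z _; exact: cvg_f.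
- exact: iB'.
- by apply: aeW => z k _; exact: dom.
rewrite (_ : (fun k => _) = EFin \o vn); last by apply/funext => k; rewrite int_n.
move=> h; have h' : (EFin \o vn) k @[k --> \oo] --> v%:E by apply: cvg_EFin vn_v; exact: nearW.
have E := cvg_unique (@ereal_hausdorff R) h h'.
rewrite -integral_mkcond in E.
by rewrite /Rintegral E.
Qed.

Lemma plane_chainC (W : set (R * R)) (G : R * R -> Cn) (p q : R -> R) (s dp dq : R) : open W -> CinfC W G ->
  W (p s, q s) -> is_derive s (1 : R) p dp -> is_derive s (1 : R) q dq ->
  derivC (1 : R) (fun t => G (p t, q t)) s = dp%:C *: derivC ex G (p s, q s) + dq%:C *: derivC ey G (p s, q s).
Proof.
move=> oW CG Ws [Dp Ep] [Dq Eq].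
have d (k : unit + unit) : derivable (fun t : R => match k with
    inl _ => (p t, q t).1 | inr _ => (p t, q t).2 end) s (1 : R) by case: k.
have [_ E] := @chain_ruleC R n _ _ _ _ (fincoord_prod fincoord_R fincoord_R) _ W G (fun t => (p t, q t)) s (1 : R)
  oW Ws CG d.
apply: etrans E _; rewrite big_sumType /= !(big_pred1 tt) /=; try by case.
by rewrite Ep Eq.
Qed.

(** The pullback of lambda to the circle of radius [r]: the second argument is the velocity of s |->
    u (r cos s, r sin s). *)
Definition circle_form (u : R * R -> Cn) (r s : R) : R :=
  lambda_form (u (r * cos s, r * sin s))
    ((r * cos s)%:C *: derivC ey u (r * cos s, r * sin s) - (r * sin s)%:C *: derivC ex u (r * cos s, r * sin s)).

Lemma lambda_form_lin (p v w : Cn) (x y : R) :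
  lambda_form p (x%:C *: v - y%:C *: w) = lambda_form p v * x - lambda_form p w * y.
Proof. by rewrite !lambda_formE omegaDr omegaNr !omegaZr; ring. Qed.

Lemma circle_formE u r s : circle_form u r s =
  arc_x (fun z => lambda_form (u z) (derivC ey u z)) r s - arc_y (fun z => lambda_form (u z) (derivC ex u z)) r s.
Proof.
exact: lambda_form_lin.
Qed.

Section Velocity.
Variables (F : M -> Cn) (g : R -> M) (s : R).
Hypotheses (iF : immersion F) (pg : smooth_path g).

Lemma path_velocity c : chart_dom c (g s) -> derivC (1 : R) (fun r => F (g r)) s =
  \sum_i ('D_(1 : R) (fun r => (coord c (g r)) 0 i) s)%:C *: tangent F c (coord c (g s)) i.
Proof.
move=> cs; have pc := @path_preimage_open _ _ _ g c pg.
have e : \forall r \near s, F (g r) = local_rep F c (coord c (g r)).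
  by apply: filterS (open_nbhs_nbhs (conj pc cs)) => r cr; rewrite /local_rep coordK.
rewrite (derivC_near (1 : R) e).
have dx i : derivable (fun r => (coord c (g r)) 0 i) s (1 : R).
  exact: (Cinf_derivable (1 : R) (smooth_path_coord c i pg) cs).
by have [_ E] := chain_ruleC (fincoord_rV n) (chart_image_open c) (coord_image cs) (local_rep_CinfC iF c) dx.
Qed.

Lemma pairing_pullback_lambda : is_form1 (pullback_lambda F) ->
  pairing (pullback_lambda F) g s = lambda_form (F (g s)) (derivC (1 : R) (fun r => F (g r)) s).
Proof.
move=> fl; have cs := dom_chart_at (g s); rewrite (pairingE fl pg cs) /chart_pairing.
apply: (etrans _ (congr1 (lambda_form (F (g s))) (esym (path_velocity cs)))).
rewrite lambda_formE omega_sumr mulr_sumr.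
by apply: eq_bigr => i _; rewrite mxE lambda_formE /local_rep coordK // omegaZr mulrCA mulrC.
Qed.

Lemma pairing_mean_curvature : is_form1 (mean_curvature_form F) ->
  pairing (mean_curvature_form F) g s = omega (derivC (1 : R) (fun r => F (g r)) s) (mean_curvature F (g s)).
Proof.
move=> fH; have cs := dom_chart_at (g s); rewrite (pairingE fH pg cs) /chart_pairing.
apply: (etrans _ (congr1 (fun v => omega v (mean_curvature F (g s))) (esym (path_velocity cs)))).
rewrite omega_suml; apply: eq_bigr => i _; by rewrite mxE coordK // omegaZl mulrC.
Qed.

End Velocity.

Variables (F : M -> Cn) (u : R * R -> Cn) (g : R -> M).
Hypotheses (iF : immersion F) (fl : is_form1 (pullback_lambda F)).
Hypothesis disk_u : smooth_disk_with_boundary F u g.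

Lemma disk_CinfC : CinfC (@open_disk R) u.
Proof.
apply: smooth_onC_open; first exact: open_disk_open.
have [su _ _] := disk_u; have sub (z : R * R) : open_disk z -> closed_disk z by move=> h; exact: ltW.
move=> j; have [s1 s2] := su j; split=> z zD.
  by have [U [h [oU Uz Ch e]]] := s1 z (sub z zD); exists U, h; split=> // y Uy /sub; exact: e.
by have [U [h [oU Uz Ch e]]] := s2 z (sub z zD); exists U, h; split=> // y Uy /sub; exact: e.
Qed.

Lemma disk_extend z : closed_disk z -> exists (W : set (R * R)) (G : R * R -> Cn),
  [/\ open W, W z, CinfC W G, (forall y, W y -> closed_disk y -> G y = u y) &
    forall y v, W y -> open_disk y -> derivC v u y = derivC v G y].
Proof.
move=> zD; have [su _ _] := disk_u; have [W [G [pW Wz CG e]]] := smooth_onC_extend su zD.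
exists W, G; split=> // y v Wy yD; have oI := openI pW open_disk_open.
by apply: (derivC_ext v oI (conj Wy yD)) => x [Wx xD]; rewrite e //; exact: ltW.
Qed.

(** Near every point of the closed disk some smooth extension of [u] has a locally bounded area
    form, equal to that of [u] inside; compactness does the rest. *)
Lemma area_form_bounded : exists B, forall z, open_disk z -> `|omega (derivC ex u z) (derivC ey u z)| <= B.
Proof.
have [|B hB] := @bounded_on_compact R _ (@closed_disk R) (@open_disk R)
  (fun z => omega (derivC ex u z) (derivC ey u z)) closed_disk_compact.
  move=> z zD; have [W [G [pW Wz CG _ e]]] := disk_extend zD.
  have Co := Cinf_omega pW (CinfC_derivC ex CG) (CinfC_derivC ey CG).
  exists (`|omega (derivC ex G z) (derivC ey G z)| + 1).
  have := nbhsI (open_nbhs_nbhs (conj pW Wz)) (cont_near (Cinf_cont Co Wz) ltr01).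
  apply: filterS => y [Wy h] yD; rewrite !e //.
  rewrite -[X in `|X|](subrK (omega (derivC ex G z) (derivC ey G z))) addrC.
  by apply: le_trans (ler_normD _ _) _; rewrite lerD2l ltW.
by exists B => z zD; apply: hB => //; exact: ltW.
Qed.

Lemma bounded_on_disk (f : R * R -> R) r : 0 <= r -> r < 1 -> (forall z, open_disk z -> {for z, continuous f}) ->
  exists B, forall z, disk r z -> `|f z| <= B.
Proof.
move=> r0 r1 cf; have [|B hB] := @bounded_on_compact R _ (@closed_disk R) (disk r) (fun z => if (z \in disk r) then f z else 0) closed_disk_compact.
  move=> z zD; have [zr|zr] := pselect (disk r z).
    exists (`|f z| + 1); have := cont_near (cf z (disk_sub_open r0 r1 zr)) ltr01.
    apply: filterS => y h yr; rewrite ifT; last by rewrite inE.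
    rewrite -[f y](subrK (f z)) addrC.
    by apply: le_trans (ler_normD _ _) _; rewrite lerD2l ltW.
  exists 0.
  have oc : open (~` disk r).
    have -> : ~` disk r = (fun z : R * R => z.1 ^+ 2 + z.2 ^+ 2) @^-1` [set x | r ^+ 2 < x].
      by apply/seteqP; split=> y; rewrite /disk /= ltNge => h; exact/negP.
    by apply: open_comp; [move=> y _; exact: normsq_continuous|exact: open_gt].
  by apply: filterS (open_nbhs_nbhs (conj oc zr)) => y ny /ny.
exists B => z zr; have := hB z _ zr; rewrite ifT ?inE //; apply.
by apply: ltW; exact: (disk_sub_open r0 r1 zr).
Qed.

Lemma disk_area r v : 0 < r -> r < 1 -> has_integral 0 (2 * pi) (circle_form u r) v ->
  (\int[mu2]_(z in disk r) (omega (derivC ex u z) (derivC ey u z))%:E = v%:E)%E.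
Proof.
move=> r0 r1 iv; have oD := @open_disk_open R; have Cu := disk_CinfC.
pose b z := lambda_form (u z) (derivC ey u z); pose a z := lambda_form (u z) (derivC ex u z).
have Cb : Cinf (@open_disk R) b by exact: (Cinf_lambda oD Cu (CinfC_derivC ey Cu)).
have Ca : Cinf (@open_disk R) a by exact: (Cinf_lambda oD Cu (CinfC_derivC ex Cu)).
have [B1 h1] := bounded_on_disk (ltW r0) r1 (fun z zD => Cinf_cont (Cinf_derive ex Cb) zD).
have [B2 h2] := bounded_on_disk (ltW r0) r1 (fun z zD => Cinf_cont (Cinf_derive ey Ca) zD).
pose B := Num.max B1 B2.
have hb z : disk r z -> `|'D_ex b z| <= B by move=> /h1 h; apply: le_trans h _; rewrite le_max lexx.
have ha z : disk r z -> `|'D_ey a z| <= B by move=> /h2 h; apply: le_trans h _; rewrite le_max lexx orbT.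
have iv' : has_integral 0 (2 * pi) (fun s => arc_x b r s - arc_y a r s) v.
  by rewrite (_ : (fun s => _) = circle_form u r) //; apply/funext => s; rewrite circle_formE.
have := green r0 r1 Ca Cb hb ha iv'.
move=> <-; apply: eq_integral => z; rewrite inE => /(disk_sub_open (ltW r0) r1) zD.
by congr EFin; rewrite -(lambda_exterior oD zD Cu).
Qed.

Lemma boundary_pairing (s : R) : pairing (pullback_lambda F) g s =
  lambda_form (u (cos s, sin s)) (derivC (1 : R) (fun s => u (cos s, sin s)) s).
Proof.
have [_ sl ug] := disk_u; have [pg _] := (smooth_loopP g).1 sl.
have -> : (fun s => u (cos s, sin s)) = fun s => F (g s) by apply/funext => t; exact: ug.
by rewrite ug; exact: pairing_pullback_lambda.
Qed.

(** On the circle [u] and its extension [G] have the same values, so the loop can be differentiated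
    through [G], for which the chain rule is available there. *)
Lemma boundary_extension (W : set (R * R)) (G : R * R -> Cn) (s : R) : open W -> CinfC W G ->
  (forall y, W y -> closed_disk y -> G y = u y) -> W (cos s, sin s) ->
  pairing (pullback_lambda F) g s = circle_form G 1 s.
Proof.
move=> pW CG e Ws; rewrite boundary_pairing.
have cD (t : R) : closed_disk (cos t, sin t) by rewrite /closed_disk /= cos2Dsin2.
have cp : {for s, continuous (fun t : R => (cos t, sin t))}.
  by apply: (@continuous_pair R R R); [exact: continuous_cos|exact: continuous_sin].
have nW : nbhs (cos s, sin s) W by exact: open_nbhs_nbhs.
have nW' : nbhs s [set t : R | W (cos t, sin t)] by exact: (cp _ nW).
have near_e : nbhs s [set t : R | u (cos t, sin t) = G (cos t, sin t)].
  by apply: filterS nW' => t Wt /=; rewrite e.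
rewrite (derivC_near (1 : R) near_e) -(e _ Ws (cD s)).
have E := plane_chainC pW CG Ws (is_derive_cos s) (is_derive_sin s).
apply: (etrans (congr1 (lambda_form (G (cos s, sin s))) E)).
rewrite /circle_form !mul1r addrC; congr (lambda_form _ (_ + _)).
by rewrite rmorphN scaleNr.
Qed.

Lemma circle_form_continuous (W : set (R * R)) (G : R * R -> Cn) (s r : R) : open W -> CinfC W G ->
  W (r * cos s, r * sin s) -> {for (s, r), continuous (fun w : R * R => circle_form G w.2 w.1)}.
Proof.
move=> pW CG Ws.
pose b z := lambda_form (G z) (derivC ey G z); pose a z := lambda_form (G z) (derivC ex G z).
have Cb : Cinf W b by exact: (Cinf_lambda pW CG (CinfC_derivC ey CG)).
have Ca : Cinf W a by exact: (Cinf_lambda pW CG (CinfC_derivC ex CG)).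
have -> : (fun w : R * R => circle_form G w.2 w.1) =
    fun w => b (w.2 * cos w.1, w.2 * sin w.1) * (w.2 * cos w.1) - a (w.2 * cos w.1, w.2 * sin w.1) * (w.2 * sin w.1).
  by apply/funext => w; rewrite circle_formE.
have c1 : {for (s, r), continuous (fun w : R * R => w.2 * cos w.1)}.
  by apply: cvgM; [exact: cvg_snd|exact: (@continuous_fst R R R cos (s, r) (@continuous_cos R s))].
have c2 : {for (s, r), continuous (fun w : R * R => w.2 * sin w.1)}.
  by apply: cvgM; [exact: cvg_snd|exact: (@continuous_fst R R R sin (s, r) (@continuous_sin R s))].
have cz : {for (s, r), continuous (fun w : R * R => (w.2 * cos w.1, w.2 * sin w.1))}.
  exact: continuous_pair c1 c2.
have cb : {for (s, r), continuous (fun w : R * R => b (w.2 * cos w.1, w.2 * sin w.1))}.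
  exact: (continuous_comp cz (Cinf_cont Cb Ws)).
have ca : {for (s, r), continuous (fun w : R * R => a (w.2 * cos w.1, w.2 * sin w.1))}.
  exact: (continuous_comp cz (Cinf_cont Ca Ws)).
exact: continuous_mulB cb c1 ca c2.
Qed.

Lemma circle_near (s0 eps : R) : 0 < eps -> nbhs (s0, (1 : R)) [set w : R * R | 0 < w.2 -> w.2 < 1 ->
  `|circle_form u w.2 w.1 - pairing (pullback_lambda F) g w.1| <= eps].
Proof.
move=> e0; have zD : closed_disk (cos s0, sin s0) by rewrite /closed_disk /= cos2Dsin2.
have [W [G [pW Wz CG e de]]] := disk_extend zD.
have Wz1 : W (1 * cos s0, 1 * sin s0) by rewrite !mul1r.
have n1 : nbhs (s0, (1 : R)) [set w : R * R | `|circle_form G w.2 w.1 - circle_form G 1 w.1| <= eps].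
  exact: (near_radius (K := fun w => circle_form G w.2 w.1) (circle_form_continuous pW CG Wz1) e0).
have polar (f : R * R -> R * R) : {for (s0, (1 : R)), continuous f} -> f (s0, 1) = (cos s0, sin s0) ->
   nbhs (s0, (1 : R)) (f @^-1` W).
  by move=> cf fE; apply: cf; rewrite fE; exact: open_nbhs_nbhs.
have c1 : {for (s0, (1 : R)), continuous (fun w : R * R => w.2 * cos w.1)}.
  by apply: cvgM; [exact: cvg_snd|exact: (@continuous_fst R R R cos (s0, 1) (@continuous_cos R s0))].
have c2 : {for (s0, (1 : R)), continuous (fun w : R * R => w.2 * sin w.1)}.
  by apply: cvgM; [exact: cvg_snd|exact: (@continuous_fst R R R sin (s0, 1) (@continuous_sin R s0))].
have n3 := polar _ (continuous_pair c1 c2) (ltac:(by rewrite /= !mul1r)).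
have c3 : {for (s0, (1 : R)), continuous (fun w : R * R => (cos w.1, sin w.1))}.
  apply: continuous_pair; [exact: (@continuous_fst R R R cos (s0, 1) (@continuous_cos R s0))|].
  exact: (@continuous_fst R R R sin (s0, 1) (@continuous_sin R s0)).
have n4 := polar _ c3 erefl.
have := nbhsI n1 (nbhsI n3 n4); apply: filterS => -[s r] /= [h1 [W1 W2]] r0 r1.
rewrite (boundary_extension pW CG e W2).
have zo : open_disk (r * cos s, r * sin s) by apply: polar_open_disk => //; exact: ltW.
have -> : circle_form u r s = circle_form G r s.
  by rewrite /circle_form !(de _ _ W1 zo) (e _ W1) //; exact: ltW.
exact: h1.
Qed.

Lemma circle_uniform (eps : R) : 0 < eps -> exists2 d : R, 0 < d & forall r : R, 0 < r -> r < 1 -> 1 - r < d ->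
  forall s, 0 <= s <= 2 * pi -> `|circle_form u r s - pairing (pullback_lambda F) g s| <= eps.
Proof.
move=> e0; pose P (w : R * R) : Prop := 0 < w.2 -> w.2 < 1 ->
  `|circle_form u w.2 w.1 - pairing (pullback_lambda F) g w.1| <= eps.
have cK : compact [set` `[(0 : R), 2 * pi]] by exact: segment_compact.
have := @compact_near R R _ 1 P cK (fun s _ => circle_near s e0).
move=> /nbhs_normP [d d0 hd]; exists d => // r r0 r1 rd s s01.
apply: (hd r _ s) => //; first by rewrite distrC gtr0_norm // subr_gt0.
Qed.

(** Green's formula applies to [u] on disks of radius below 1. As the radius tends to 1, the areas
    converge since the area form is bounded, and the circle integrals since their integrands
    converge uniformly to the boundary pairing. *)
Theorem stokes : has_integral 0 (2 * pi) (pairing (pullback_lambda F) g) (symplectic_area u).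
Proof.
have [_ sl _] := disk_u; have [pg _] := (smooth_loopP g).1 sl.
have pi2 : 0 < 2 * pi :> R by rewrite mulr_gt0 ?pi_gt0.
have [v iv] := has_integral_exists (2 * pi) (lexx 0) (pairing_continuous fl pg).
suff -> : symplectic_area u = v by [].
pose w z := omega (derivC ex u z) (derivC ey u z).
have oD := @open_disk_open R; have Cu := disk_CinfC.
have Cw : Cinf (@open_disk R) w by exact: (Cinf_omega oD (CinfC_derivC ex Cu) (CinfC_derivC ey Cu)).
have [B hB] := area_form_bounded.
have cb k : continuous (circle_form u (radius k)).
  move=> s; have zo := polar_open_disk s (ltW (radius_gt0 k)) (radius_lt1 k).
  have cp : {for s, continuous (fun s : R => (s, radius k))}.
    by apply: continuous_pair; [exact: cvg_id|exact: cvg_cst].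
  exact: (@continuous_comp _ _ _ (fun s : R => (s, radius k)) (fun w : R * R => circle_form u w.2 w.1) s cp
    (circle_form_continuous oD Cu zo)).
have /choice [vn hv] : forall k, exists x, has_integral 0 (2 * pi) (circle_form u (radius k)) x.
  by move=> k; exact: (has_integral_exists _ (lexx 0) (cb k)).
have area_n k : (\int[mu2]_(z in disk (radius k)) (w z)%:E = (vn k)%:E)%E.
  exact: (disk_area (radius_gt0 k) (radius_lt1 k) (hv k)).
have vn_v : vn k @[k --> \oo] --> v.
  apply/cvgrPdist_le => eps e0.
  have e1 : 0 < eps / (2 * pi) by rewrite divr_gt0.
  have [d d0 hd] := circle_uniform e1.
  apply: filterS (radius_near d0) => k kd'; rewrite distrC.
  apply: le_trans (has_integral_close (ltW pi2) (hd (radius k) (radius_gt0 k) (radius_lt1 k) kd') (hv k) iv) _.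
  by rewrite subr0 mulrC divfK // gt_eqF.
have cw z : open_disk z -> {for z, continuous w} by exact: Cinf_cont.
exact: (disk_exhaustion cw hB area_n vn_v).
Qed.

End Stokes.

(** * Filling a loop by a cone *)

Section Angles.
Context {R : realType}.

Lemma angle_exists (c d : R) : c ^+ 2 + d ^+ 2 = 1 -> exists s, c = cos s /\ d = sin s.
Proof.
move=> cd; have c1 : -1 <= c <= 1.
  rewrite -ler_norml -(@ler_pXn2r _ 2) ?nnegrE // expr1n real_normK ?num_real // -cd lerDl; exact: sqr_ge0.
have sE : sin (acos c) = `|d| by rewrite sin_acos // -cd (addrC (c ^+ 2)) addrK sqrtr_sqr.
have cE : cos (acos c) = c by apply: acosK; rewrite in_itv.
have [d0|d0] := leP 0 d; [exists (acos c)|exists (- acos c)]; rewrite ?cosN ?sinN cE sE.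
  by rewrite ger0_norm.
by rewrite ltr0_norm // opprK.
Qed.

Lemma periodic_int (T : Type) (f : R -> T) : (forall s, f (s + 2 * pi) = f s) ->
  forall (k : int) s, f (s + k%:~R * (2 * pi)) = f s.
Proof.
move=> per; have nat_case (m : nat) t : f (t + m%:R * (2 * pi)) = f t.
  elim: m t => [|m IH] t; first by rewrite mul0r addr0.
  by rewrite -natr1 mulrDl mul1r addrA per.
case=> m s; first exact: nat_case.
by rewrite NegzE mulrNz mulNr -[LHS](nat_case m.+1) subrK.
Qed.

Lemma cos_eq1 (s : R) : cos s = 1 -> exists k : int, s = k%:~R * (2 * pi).
Proof.
have pi2 : 0 < 2 * pi :> R by rewrite mulr_gt0 ?pi_gt0.
have cos_int := periodic_int (f := @cos R) (fun s => etrans (congr1 (fun x => cos (s + x)) (mulr_natl pi 2)) (cosD2pi s)).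
pose k := Num.floor (s / (2 * pi)); pose r := s - k%:~R * (2 * pi).
have [r0 r1] : 0 <= r /\ r < 2 * pi.
  have /andP[h1 h2] := floor_itv (s / (2 * pi)).
  rewrite /r subr_ge0 ltrBlDl -ler_pdivlMr // h1; split => //.
  by rewrite -[X in _ + X]mul1r -mulrDl -ltr_pdivrMr // (_ : 1 = 1%:~R) // -intrD.
move=> s1; have c1 : cos r = 1 by rewrite -s1 -[in RHS](subrK (k%:~R * (2 * pi)) s) cos_int.
exists k; apply/eqP; rewrite -subr_eq0 -/r.
have inj (t : R) : 0 <= t <= pi -> cos t = 1 -> t = 0.
  by move=> tp ct; apply: cos_inj; rewrite ?in_itv //= ?lexx ?pi_ge0 // ct cos0.
have [rp|rp] := leP r pi; first by rewrite (inj r) ?r0 ?eqxx.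
have := inj (2 * pi - r); rewrite subr_ge0 (ltW r1) lerBlDl; have := pi_gt0 R => p0.
have -> : 2 * pi <= r + pi by rewrite mulr_natl mulr2n lerD2r ltW.
have -> : cos (2 * pi - r) = 1 by rewrite -cosN opprB -(cos_int 1) mul1r subrK.
by move=> /(_ isT erefl) h; move: r1; rewrite -subr_gt0 h ltxx.
Qed.

Lemma same_angle (s t : R) : cos s = cos t -> sin s = sin t -> exists k : int, s = t + k%:~R * (2 * pi).
Proof.
move=> cst sst; have [|k hk] := @cos_eq1 (s - t).
  by rewrite cosB cst sst -!expr2 cos2Dsin2.
by exists k; rewrite -hk addrC subrK.
Qed.

Definition polar_of (z : R * R) (s : R) := exists2 r : R, 0 < r & z = (r * cos s, r * sin s).

Lemma polar_uniq z s t : polar_of z s -> polar_of z t -> exists k : int, s = t + k%:~R * (2 * pi).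
Proof.
move=> [r r0 ->] [r' r0' [e1 e2]].
have rr : r = r'.
  apply/eqP; rewrite -(@eqrXn2 _ 2) ?ltW //; apply/eqP.
  rewrite -[LHS]mulr1 -[RHS]mulr1 -{1}(cos2Dsin2 s) -(cos2Dsin2 t) !mulrDr -!exprMn.
  by rewrite e1 e2.
rewrite -rr in e1 e2; have rn : r != 0 by rewrite gt_eqF.
by apply: same_angle; [exact: (mulfI rn e1)|exact: (mulfI rn e2)].
Qed.

Lemma polar_exists z : z != (0, 0) -> exists s, polar_of z s.
Proof.
case: z => x y z0; pose m := x ^+ 2 + y ^+ 2; pose r := Num.sqrt m.
have m0 : 0 < m.
  rewrite lt_neqAle eq_sym addr_ge0 ?sqr_ge0 // andbT paddr_eq0 ?sqr_ge0 // !sqrf_eq0.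
  by apply: contra z0 => /andP[/eqP -> /eqP ->].
have r0 : 0 < r by rewrite sqrtr_gt0.
have rr : r ^+ 2 = m by rewrite sqr_sqrtr // ltW.
have [|s [c d]] := @angle_exists (x / r) (y / r).
  by rewrite !expr_div_n rr -mulrDl divff // gt_eqF.
by exists s, r => //; rewrite -c -d !(mulrC r) !divfK ?gt_eqF.
Qed.

(** A smooth branch of the argument around the direction [s]: after rotation by - s the points of
    [half_plane s] have positive first coordinate, and the arctangent of their slope is the
    remaining angle. *)
Definition arg_near (s : R) (z : R * R) : R :=
  s + atan ((- z.1 * sin s + z.2 * cos s) / (z.1 * cos s + z.2 * sin s)).

Definition half_plane (s : R) : set (R * R) := [set z | 0 < z.1 * cos s + z.2 * sin s].

Lemma rotation_back (x y c d : R) : c ^+ 2 + d ^+ 2 = 1 ->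
  (x * c + y * d) * c - (- x * d + y * c) * d = x /\ (x * c + y * d) * d + (- x * d + y * c) * c = y.
Proof.
move=> e; split; first by transitivity (x * (c ^+ 2 + d ^+ 2)); [ring|rewrite e mulr1].
by transitivity (y * (c ^+ 2 + d ^+ 2)); [ring|rewrite e mulr1].
Qed.

Lemma polar_arg_near s z : half_plane s z -> polar_of z (arg_near s z).
Proof.
rewrite /half_plane /= => p0; have := rotation_back z.1 z.2 (cos2Dsin2 s).
rewrite /arg_near; set p := (z.1 * cos s + _) in p0 *; set q := (- _ * _ + _).
set a := atan _; have ca : 0 < cos a by rewrite cos_atan invr_gt0 sqrtr_gt0 ltr_wpDr ?sqr_ge0.
have qa : q / p = sin a / cos a by rewrite -[LHS](atanK (q / p)).
have p1 : p != 0 by rewrite gt_eqF.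
have c1 : cos a != 0 by rewrite gt_eqF.
have qE : q = p / cos a * sin a by rewrite -(divfK p1 q) qa; ring.
move=> [xE yE]; exists (p / cos a); first by rewrite divr_gt0.
rewrite [z]surjective_pairing -xE -yE cosD sinD qE; congr pair; field => //.
Qed.

Lemma Cinf_atan : Cinf setT (@atan R).
Proof.
have oT : open [set: R] by exact: openT.
have dv (v x : R) := is_derive_scale_R v (is_derive1_atan x).
have Ci : Cinf setT (fun x : R => (1 + x ^+ 2)^-1).
  apply: CinfV => //; first by move=> x _; rewrite gt_eqF // ltr_wpDr ?sqr_ge0.
  apply: CinfD => //; first exact: Cinf_cst.
  by under eq_fun do rewrite expr2; apply: CinfM => //; exact: Cinf_id.
have step : Ck 0 setT (@atan R) /\ forall v, (forall x, setT x -> derivable (@atan R) x v) /\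
    Cinf setT (fun x => 'D_v (@atan R) x).
  split; first by split=> // x _; exact: continuous_atan.
  move=> v; split=> [x _|]; first by have [] := dv v x.
  rewrite (_ : (fun x => _) = (fun x => v * (1 + x ^+ 2)^-1)); last by apply/funext => x; have [_ ->] := dv v x.
  by apply: CinfM => //; exact: Cinf_cst.
have [s0 s1] := step; case=> [//|k]; split; first by have [] := s0.
by move=> v; have [d C] := s1 v; split=> //; exact: C.
Qed.

Lemma half_plane_open s : open (half_plane s).
Proof.
rewrite (_ : half_plane s = (fun z : R * R => z.1 * cos s + z.2 * sin s) @^-1` [set x | 0 < x]) //.
apply: open_comp; last exact: open_gt.
move=> z _; apply: cvgD; apply: cvgM; [exact: cvg_fst|exact: cvg_cst|exact: cvg_snd|exact: cvg_cst].
Qed.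

Lemma Cinf_arg_near s : Cinf (half_plane s) (arg_near s).
Proof.
have oW : open (half_plane s) by exact: half_plane_open.
have Cl a b : Cinf (half_plane s) (fun z => z.1 * a + z.2 * b).
  by apply: CinfD => //; apply: CinfM => //; [exact: Cinf_fst|exact: Cinf_cst|exact: Cinf_snd|exact: Cinf_cst].
apply: CinfD => //; first exact: Cinf_cst.
apply: Cinf_comp_R => //; first exact: Cinf_atan.
apply: CinfM => //.
  apply: (Cinf_ext oW _ (Cl (- sin s) (cos s))) => z _; by rewrite mulrN mulNr.
by apply: CinfV => // z; rewrite /half_plane /= => h; rewrite gt_eqF.
Qed.

(** An arbitrary argument, with no continuity. It is composed with a periodic loop, so [arg_near]
    may replace it locally. *)
Definition angle (z : R * R) : R := xget 0 (polar_of z).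

Lemma angleP z : z != (0, 0) -> polar_of z (angle z).
Proof. by move=> /polar_exists [s ps]; apply: xgetPex; exists s. Qed.

Lemma half_plane_polar s r : 0 < r -> half_plane s (r * cos s, r * sin s).
Proof. by move=> r0; rewrite /half_plane /= -!mulrA -mulrDr -!expr2 cos2Dsin2 mulr1. Qed.

End Angles.

Section ConeDisk.
Context {R : realType} {n : nat} {M : smooth_manifold R n}.
Local Notation Cn := 'rV[R[i]]_n.
Variables (F : M -> Cn) (g : R -> M).
Hypotheses (iF : immersion F) (lg : smooth_loop g).

Lemma loop_image_CinfC : CinfC setT (fun s : R => F (g s)).
Proof.
have [pg _] := (smooth_loopP g).1 lg.
apply: CinfC_local => s _; pose c := chart_at (g s).
have pc := @path_preimage_open _ _ _ g c pg.
exists (g @^-1` chart_dom c); split=> //; first exact: dom_chart_at.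
apply: (@CinfC_ext _ _ _ _ (fun r => local_rep F c (coord c (g r)))) => //.
  by move=> r cr; rewrite /local_rep coordK.
apply: (CinfC_comp (fincoord_rV n) (chart_image_open c) pc _ (local_rep_CinfC iF c)).
  by move=> r cr; exact: coord_image.
by move=> i; exact: smooth_path_coord.
Qed.

Lemma near_zero_open : open [set z : R * R | z.1 ^+ 2 + z.2 ^+ 2 < 3^-1].
Proof.
rewrite (_ : [set _ | _] = (fun z : R * R => z.1 ^+ 2 + z.2 ^+ 2) @^-1` [set x | x < 3^-1]) //.
by apply: open_comp; [move=> y _; exact: normsq_continuous|exact: open_lt].
Qed.

(** The ramp in |z|^2 vanishes up to 1/3, which smooths the apex and hides the undefined angle at
    the origin, and equals 1 on the unit circle. *)
Definition cone (z : R * R) : Cn := (ramp (z.1 ^+ 2 + z.2 ^+ 2))%:C *: F (g (angle z)).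

Lemma cone_CinfC : CinfC setT cone.
Proof.
have [_ per] := (smooth_loopP g).1 lg.
apply: CinfC_local => z _; have [->|z0] := eqVneq z (0, 0).
  exists [set z : R * R | z.1 ^+ 2 + z.2 ^+ 2 < 3^-1]; split.
  - exact: near_zero_open.
  - by rewrite /= expr0n addr0 invr_gt0.
  - apply: (@CinfC_ext _ _ _ _ (fun=> 0)) => [|y /= hy|]; last exact: CinfC_cst.
      exact: near_zero_open.
    by rewrite /cone ramp0 ?scale0r //; exact: ltW.
have [r r0 zE] := angleP z0; set s := angle z in zE.
have oW : open (half_plane s) by exact: half_plane_open.
exists (half_plane s); split=> //; first by rewrite zE; exact: half_plane_polar.
have e y : half_plane s y -> F (g (arg_near s y)) = F (g (angle y)).
  move=> hy; have y0 : y != (0, 0) by apply: contraPneq hy => ->; rewrite /half_plane /= !mul0r addr0 ltxx.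
  by have [k ->] := polar_uniq (polar_arg_near hy) (angleP y0); rewrite (periodic_int per).
pose G (y : R * R) : Cn := (ramp (y.1 ^+ 2 + y.2 ^+ 2))%:C *: F (g (arg_near s y)).
apply: (CinfC_ext oW (f := G)) => [y hy|]; first by rewrite /G e.
apply: CinfCZ => //.
  apply: Cinf_comp_R => //; first exact: Cinf_ramp.
  by apply: CinfD => //; under eq_fun do rewrite expr2; apply: CinfM => //;
    first [exact: Cinf_fst|exact: Cinf_snd].
apply: (CinfC_comp fincoord_R openT oW (f := fun s => F (g s)) _ loop_image_CinfC) => // _.
exact: Cinf_arg_near.
Qed.

Lemma disk_exists : smooth_disk_with_boundary F cone g.
Proof.
have [_ per] := (smooth_loopP g).1 lg; split=> //.
  move=> j; have [C1 C2] := cone_CinfC j.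
  by split=> z _; [exists setT, (fun z => xcoord (cone z) j)|exists setT, (fun z => ycoord (cone z) j)];
    split=> //; exact: openT.
move=> s; have z0 : (cos s, sin s) != (0, 0).
  apply/eqP => -[c0 s0]; have /eqP := cos2Dsin2 s; rewrite c0 s0 expr0n addr0 eq_sym; exact/negP/oner_neq0.
rewrite /cone /= cos2Dsin2 ramp1; last by lra.
have ps : polar_of (cos s, sin s) s by exists 1; rewrite ?mul1r.
have [k ->] := polar_uniq (angleP z0) ps.
by rewrite (periodic_int per) scale1r.
Qed.

End ConeDisk.

(** * The Maslov index *)

Section PhaseCalculus.
Context {R : realType}.

Lemma normalized_square (d : R[i]) : d != 0 ->
  let P := complex.Re d in let Q := complex.Im d in
  (d / `|d|) ^+ 2 = ((P ^+ 2 - Q ^+ 2) / (P ^+ 2 + Q ^+ 2)) +i* (2 * P * Q / (P ^+ 2 + Q ^+ 2)).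
Proof.
case: d => P Q d0 /=; set N := P ^+ 2 + Q ^+ 2.
have N0 : N != 0.
  by apply: contra d0; rewrite paddr_eq0 ?sqr_ge0 // !sqrf_eq0 eq_complex.
have nE : `|P +i* Q| ^+ 2 = N%:C.
  rewrite normc_def /= -rmorphXn /= sqr_sqrtr //; by rewrite addr_ge0 ?sqr_ge0.
have NC : N%:C != 0 :> R[i] by rewrite eq_complex /= negb_and N0.
rewrite expr_div_n nE; apply: (mulIf NC); rewrite divfK //; apply/eqP; rewrite eq_complex /=.
by apply/andP; split; apply/eqP; rewrite mulr0 ?subr0 ?addr0 ?add0r ?divfK //; ring.
Qed.

Lemma mulr_frac_sub (p q a b d m : R) :
  (p * a - q * b) / m * d = (p * (a * d) - q * (b * d)) / m.
Proof. by ring. Qed.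

Lemma angle_derivative (P Q : R -> R) (s p q : R) : P s ^+ 2 + Q s ^+ 2 != 0 ->
  is_derive s (1 : R) P p -> is_derive s (1 : R) Q q ->
  let N s := P s ^+ 2 + Q s ^+ 2 in let h := (P s * q - Q s * p) / N s in
  is_derive s (1 : R) (fun s => (P s ^+ 2 - Q s ^+ 2) / N s) (- (2 * h) * (2 * P s * Q s / N s)) /\
  is_derive s (1 : R) (fun s => 2 * P s * Q s / N s) (2 * h * ((P s ^+ 2 - Q s ^+ 2) / N s)).
Proof.
move=> N0 dP dQ N h.
have dPP := is_deriveM dP dP; have dQQ := is_deriveM dQ dQ.
have N0' : (P * P + Q * Q) s != 0 by rewrite -[(_ + _) s]/(P s * P s + Q s * Q s) -!expr2.
have dV := is_deriveV N0' (is_deriveD dPP dQQ).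
have e1 : (fun s => (P s ^+ 2 - Q s ^+ 2) / N s) = (P * P - Q * Q) * (fun y => ((P * P + Q * Q) y)^-1).
  by apply/funext => y; rewrite /N !expr2.
have e2 : (fun s => 2 * P s * Q s / N s) = (P * Q + P * Q) * (fun y => ((P * P + Q * Q) y)^-1).
  by apply/funext => y; rewrite /N !expr2 !fctE; congr (_ * _); ring.
have dPQ := is_deriveM dP dQ.
have N1 : P s * P s + Q s * Q s != 0 by rewrite -!expr2.
have a1 := is_deriveM (is_deriveB dPP dQQ) dV; have a2 := is_deriveM (is_deriveD dPQ dPQ) dV.
split.
  rewrite e1; apply: (is_derive_eq a1).
  rewrite /GRing.scale /= !fctE /h /N; move: N0 N1; rewrite !expr2 => _; set x := P s; set y := Q s => N1; field => //.
rewrite e2; apply: (is_derive_eq a2).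
rewrite /GRing.scale /= !fctE /h /N; move: N0 N1; rewrite !expr2 => _; set x := P s; set y := Q s => N1; field => //.
Qed.

Lemma is_derive_near (f k : R -> R) (s d : R) : nbhs s [set t | f t = k t] ->
  is_derive s (1 : R) f d -> is_derive s (1 : R) k d.
Proof.
move=> ne [df e]; split; first exact: near_eq_derivable ne df.
by rewrite -e; apply/esym; exact: near_eq_derive.
Qed.

Lemma is_derive_shift (f : R -> R) (c s d : R) : is_derive s (1 : R) f d ->
  is_derive s (1 : R) (fun t => f t + c) d.
Proof.
move=> df; have := is_deriveD df (is_derive_cst c s (1 : R)); rewrite addr0.
exact.
Qed.

(** A primitive of [h] and one of its reflection, both valid beyond -1, are glued at 0; after
    normalisation they agree on ]-1, 1[, so the result is differentiable at 0. *)
Lemma primitive_everywhere (h : R -> R) : continuous h ->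
  exists G : R -> R, forall s : R, is_derive s (1 : R) G (h s).
Proof.
move=> ch; have [G1 d1] := primitive_above (-1) ch.
have ch2 : continuous (fun s => h (- s)).
  by move=> s; apply: (@continuous_comp _ _ _ (fun s : R => - s) h); [exact: opp_continuous|exact: ch].
have [G2 d2] := primitive_above (-1) ch2.
have d2' (s : R) : s < 1 -> is_derive s (1 : R) (fun s => - G2 (- s)) (h s).
  move=> s1; have dN : is_derive s (1 : R) (fun s : R => - s) (-1).
    by have := is_deriveN (@is_derive_id R R s 1).
  have dG := d2 (- s) (ltac:(by rewrite ltrN2)).
  have [e1 e2] := @is_derive1_comp R G2 (fun s : R => - s) s _ _ dG dN.
  have := is_deriveN (DeriveDef e1 e2); rewrite opprK mulrN1 opprK.
  exact.
exists (fun s => if 0 <= s then G1 s - G1 0 else - G2 (- s) + G2 0) => s.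
have e1 (t : R) : -1 < t -> t < 1 -> G1 t - G1 0 = - G2 (- t) + G2 0.
  move=> t1 t2; have [t0|t0] := leP 0 t.
    have := @same_derive_diff R G1 (fun s => - G2 (- s)) h 0 t t0; rewrite oppr0 opprK; apply=> x /andP[x0 xt].
      by apply: d1; apply: lt_le_trans x0; rewrite oppr_lt0.
    by apply: d2'; exact: le_lt_trans xt t2.
  have := @same_derive_diff R G1 (fun s => - G2 (- s)) h t 0 (ltW t0); rewrite oppr0 => H.
  have : G1 0 - G1 t = - G2 0 - - G2 (- t).
    apply: H => x /andP[x0 xt]; first by apply: d1; exact: lt_le_trans t1 x0.
    by apply: d2'; exact: le_lt_trans xt ltr01.
  by move=> E; rewrite -[LHS]opprB E; ring.
have [s0|s0] := leP 0 s.
  have d : is_derive s (1 : R) (fun s => G1 s - G1 0) (h s).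
    by apply: is_derive_shift; apply: d1; apply: lt_le_trans s0; rewrite oppr_lt0.
  have ne : nbhs s [set t | G1 t - G1 0 = if 0 <= t then G1 t - G1 0 else - G2 (- t) + G2 0].
    have o : nbhs s [set t : R | -1 < t].
      by apply: open_nbhs_nbhs; split; [exact: open_gt|apply: lt_le_trans s0; rewrite oppr_lt0].
    apply: filterS o => t t1 /=; case: (leP 0 t) => // t0; apply: e1 => //; exact: lt_trans t0 ltr01.
  exact: is_derive_near ne d.
have d : is_derive s (1 : R) (fun s => - G2 (- s) + G2 0) (h s).
  by apply: (is_derive_shift (f := fun s => - G2 (- s))); apply: d2'; exact: lt_trans s0 ltr01.
have ne : nbhs s [set t | - G2 (- t) + G2 0 = if 0 <= t then G1 t - G1 0 else - G2 (- t) + G2 0].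
  have o : nbhs s [set t : R | t < 0] by apply: open_nbhs_nbhs; split; [exact: open_lt|].
  by apply: filterS o => t t0 /=; case: (leP 0 t) => // t0'; move: (lt_le_trans t0 t0'); rewrite ltxx.
exact: is_derive_near ne d.
Qed.

(** The scalar and cross products of (A, B) with (cos th, sin th), where th has speed 2 h, have zero
    derivative; their initial values 1 and 0 force the two vectors to agree. *)
Lemma rotating_unit_vector (A B G h : R -> R) (t0 : R) : A 0 = cos t0 -> B 0 = sin t0 ->
  (forall s : R, is_derive s (1 : R) A (- (2 * h s) * B s)) ->
  (forall s : R, is_derive s (1 : R) B (2 * h s * A s)) ->
  (forall s : R, is_derive s (1 : R) G (h s)) ->
  forall s, A s = cos (2 * (G s - G 0) + t0) /\ B s = sin (2 * (G s - G 0) + t0).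
Proof.
move=> A0 B0 dA dB dG; pose th s := 2 * (G s - G 0) + t0.
have dth s : is_derive s (1 : R) th (2 * h s).
  have dk : is_derive s (1 : R) (fun s => G s - G 0) (h s).
    exact: is_derive_shift (dG s).
  exact: is_derive_shift (is_deriveZ 2 dk).
have dc s := @is_derive1_comp R cos th s _ _ (is_derive_cos (th s)) (dth s).
have ds s := @is_derive1_comp R sin th s _ _ (is_derive_sin (th s)) (dth s).
have dp (s : R) : is_derive s (1 : R) (A * (cos \o th) + B * (sin \o th)) 0.
  have h1 := is_deriveD (is_deriveM (dA s) (dc s)) (is_deriveM (dB s) (ds s)).
  by apply: (is_derive_eq h1); rewrite /GRing.scale /=; ring.
have dq (s : R) : is_derive s (1 : R) (B * (cos \o th) - A * (sin \o th)) 0.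
  have h1 := is_deriveB (is_deriveM (dB s) (dc s)) (is_deriveM (dA s) (ds s)).
  by apply: (is_derive_eq h1); rewrite /GRing.scale /=; ring.
move=> s; have p1 : A s * cos (th s) + B s * sin (th s) = 1.
  apply: etrans (@is_derive_0_is_cst R _ s 0 dp) _.
  by rewrite !fctE /= /th subrr mulr0 add0r A0 B0 -!expr2 cos2Dsin2.
have q1 : B s * cos (th s) - A s * sin (th s) = 0.
  apply: etrans (@is_derive_0_is_cst R _ s 0 dq) _.
  by rewrite !fctE /= /th subrr mulr0 add0r A0 B0 mulrC subrr.
have n1 := cos2Dsin2 (th s); rewrite -/(th s).
split.
  transitivity ((A s * cos (th s) + B s * sin (th s)) * cos (th s) -
    (B s * cos (th s) - A s * sin (th s)) * sin (th s)); last by rewrite p1 q1; ring.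
  by transitivity (A s * (cos (th s) ^+ 2 + sin (th s) ^+ 2)); [rewrite n1 mulr1|ring].
transitivity ((A s * cos (th s) + B s * sin (th s)) * sin (th s) +
    (B s * cos (th s) - A s * sin (th s)) * cos (th s)); last by rewrite p1 q1; ring.
by transitivity (B s * (cos (th s) ^+ 2 + sin (th s) ^+ 2)); [rewrite n1 mulr1|ring].
Qed.

(** Otherwise the intermediate value theorem would produce the value (m + 1/2) c, with m the smaller
    of the two integers at the ends. *)
Lemma integer_valued_cst (f : R -> R) (a b c : R) : a <= b -> {within `[a, b], continuous f} -> 0 < c ->
  (forall s, s \in `[a, b] -> exists k : int, f s = k%:~R * c) -> f a = f b.
Proof.
move=> ab cf c0 fZ.
have [ka fa] : exists k : int, f a = k%:~R * c by apply: fZ; rewrite in_itv /= lexx.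
have [kb fb] : exists k : int, f b = k%:~R * c by apply: fZ; rewrite in_itv /= lexx ab.
apply: contrapT => nab.
have neq : ka != kb by apply: contra_notN nab => /eqP kk; rewrite fa fb kk.
pose m := Num.min ka kb.
have mv (k : int) : (m%:~R + 2^-1) * c <> k%:~R * c.
  move=> /(mulIf (lt0r_neq0 c0)) e; have e2 : (2 * m + 1)%:~R = (2 * k)%:~R :> R.
    by rewrite !intrD !intrM -e; field.
  have /eqP := e2; rewrite eqr_int => /eqP; lia.
have [x xab fx] : exists2 x, x \in `[a, b] & f x = (m%:~R + 2^-1) * c.
  apply: IVT => //; rewrite fa fb; have h2 : 0 <= 2^-1 :> R by rewrite invr_ge0.
  have h1 : 2^-1 <= 1 :> R by rewrite invf_le1 // ler1n.
  have up (k l : int) : k < l -> k%:~R * c <= (k%:~R + 2^-1) * c <= l%:~R * c.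
    move=> kl; rewrite !ler_pM2r // lerDl h2 /=; apply: le_trans (_ : (k + 1)%:~R <= _).
      by rewrite intrD lerD2l.
    by rewrite ler_int lezD1.
  rewrite ge_min le_max /m; case: (ltgtP ka kb) neq => // kk _.
    by have /andP[-> ->] := up _ _ kk; rewrite orbT.
  by have /andP[-> ->] := up _ _ kk; rewrite orbT.
by have [k kx] := fZ x xab; apply: (mv k); rewrite -fx.
Qed.

End PhaseCalculus.

Section Maslov.
Context {R : realType} {n : nat} {M : smooth_manifold R n}.
Local Notation Cn := 'rV[R[i]]_n.
Local Notation Rn := 'rV[R]_n.
Variables (F : M -> Cn) (g : R -> M).
Hypotheses (oM : oriented M) (lF : lagrangian F) (lg : smooth_loop g).
Let iF : immersion F := lF.1.

Lemma lagr_det_change c d x : chart_image c x -> chart_dom d (param c x) ->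
  exists2 J : R, J != 0 & lagr_det F c x = J%:C * lagr_det F d (coord d (param c x)).
Proof.
move=> cx dx; exists (\det (transition_jacobian c d x)).
  by rewrite gt_eqF //; apply: oM; apply/overlapP.
pose rc (r : R) : R[i] := r%:C.
rewrite /lagr_det; set t := tangent F d _.
have -> : tmx (tangent F c x) = map_mx rc (transition_jacobian c d x) *m tmx t.
  apply/matrixP => i j; rewrite mxE (tangent_change lF i cx dx) /comb summxE [RHS]mxE.
  apply: eq_bigr => k _; by rewrite !mxE.
by rewrite det_mulmx; congr (_ * _); rewrite (_ : rc = real_complex R) // det_map_mx.
Qed.

Definition chart_phase c x : R[i] := (lagr_det F c x / `|lagr_det F c x|) ^+ 2.

(** A change of chart multiplies the determinant by a nonzero real Jacobian, whose normalised square
    is 1. *)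
Lemma phaseE c x : chart_image c x -> phase F (param c x) = chart_phase c x.
Proof.
move=> cx; pose d := chart_at (param c x).
have [J J0 e] := lagr_det_change cx (dom_chart_at (param c x)).
rewrite /chart_phase e normrM; set z := lagr_det F _ _.
have -> : phase F (param c x) = (z / `|z|) ^+ 2 by [].
have JJ : (J%:C / `|J%:C|) ^+ 2 = 1 :> R[i].
  have JC : J%:C != 0 :> R[i] by rewrite eq_complex /= negb_and J0.
  rewrite (normalized_square JC) /= expr0n subr0 addr0 divff ?sqrf_eq0 // mulr0 mul0r.
  by [].
by rewrite invfM mulrACA [RHS]exprMn JJ mul1r.
Qed.

Let A s := complex.Re (phase F (g s)).
Let B s := complex.Im (phase F (g s)).
Let h := pairing (mean_curvature_form F) g.

(** The phase is the square of the normalised determinant, so its argument turns twice as fast as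
    arg det, whose speed is [h]. *)
Lemma phase_derivative s : is_derive s (1 : R) A (- (2 * h s) * B s) /\ is_derive s (1 : R) B (2 * h s * A s).
Proof.
have [pg _] := (smooth_loopP g).1 lg; have fH := mean_curvature_form1 oM lF.
set c := chart_at (g s); have cs : chart_dom c (g s) by exact: dom_chart_at.
have pc := @path_preimage_open _ _ _ g c pg.
pose P y := complex.Re (lagr_det F c y); pose Q y := complex.Im (lagr_det F c y).
pose x r := coord c (g r).
have oc := chart_image_open c; have cx := coord_image cs.
have [CP CQ] := Cinfc_lagr_det lF c.
have dx i : derivable (fun r => x r 0 i) s (1 : R) by exact: (Cinf_derivable (1 : R) (smooth_path_coord c i pg) cs).
pose D (K : Rn -> R) := \sum_i 'D_(delta_mx 0 i : Rn) K (x s) * 'D_(1 : R) (fun r => x r 0 i) s.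
have dP : is_derive s (1 : R) (fun r => P (x r)) (D P) by exact: (chain_rule (fincoord_rV n) oc cx (CP 1%N) dx).
have dQ : is_derive s (1 : R) (fun r => Q (x r)) (D Q) by exact: (chain_rule (fincoord_rV n) oc cx (CQ 1%N) dx).
have N0 : P (x s) ^+ 2 + Q (x s) ^+ 2 != 0 by exact: lagr_det_norm.
have [dA dB] := angle_derivative N0 dP dQ.
have hE : h s = (P (x s) * D Q - Q (x s) * D P) / (P (x s) ^+ 2 + Q (x s) ^+ 2).
  rewrite /h (pairingE fH pg cs) /chart_pairing /D !mulr_sumr -sumrB mulr_suml.
  apply: eq_bigr => i _; rewrite (mean_curvature_angle oM lF i cx) -/(x s).
  rewrite /partial_deriv -/(P (x s)) -/(Q (x s)) -/P -/Q.
  exact: mulr_frac_sub.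
have near_A : nbhs s [set r | (P (x r) ^+ 2 - Q (x r) ^+ 2) / (P (x r) ^+ 2 + Q (x r) ^+ 2) = A r].
  apply: filterS (open_nbhs_nbhs (conj pc cs)) => r cr /=.
  rewrite /A -(coordK cr) (phaseE (coord_image cr)) /chart_phase (normalized_square (lagr_det_neq0 lF (coord_image cr))).
  by [].
have near_B : nbhs s [set r | 2 * P (x r) * Q (x r) / (P (x r) ^+ 2 + Q (x r) ^+ 2) = B r].
  apply: filterS (open_nbhs_nbhs (conj pc cs)) => r cr /=.
  rewrite /B -(coordK cr) (phaseE (coord_image cr)) /chart_phase (normalized_square (lagr_det_neq0 lF (coord_image cr))).
  by [].
rewrite -(nbhs_singleton near_A) -(nbhs_singleton near_B) hE.
by split; [exact: is_derive_near near_A dA|exact: is_derive_near near_B dB].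
Qed.

Lemma phase_unit s : A s ^+ 2 + B s ^+ 2 = 1.
Proof.
have cs := dom_chart_at (g s); have cx := coord_image cs.
have e : phase F (g s) = chart_phase (chart_at (g s)) (coord (chart_at (g s)) (g s)) by rewrite -phaseE ?coordK.
have N0 := lagr_det_norm lF cx.
rewrite /A /B e /chart_phase (normalized_square (lagr_det_neq0 lF cx)) /=.
by move: N0; set p := complex.Re _; set q := complex.Im _ => N0; field.
Qed.

(** With [G] a primitive of the pairing, th = 2 (G - G 0) + t0 is a determination of the argument of
    the phase; it grows by 2 pi k over the loop, so the period of H is k pi. *)
Lemma maslov_integral :
  has_integral 0 (2 * pi) (pairing (mean_curvature_form F) g) ((maslov_index F g)%:~R * pi).
Proof.
have [pg per] := (smooth_loopP g).1 lg.
have pi2 : 0 < 2 * pi :> R by rewrite mulr_gt0 ?pi_gt0.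
have [G dG] := primitive_everywhere (pairing_continuous (mean_curvature_form1 oM lF) pg).
have [t0 [A0 B0]] := angle_exists (phase_unit 0).
pose th s := 2 * (G s - G 0) + t0.
have thE s : A s = cos (th s) /\ B s = sin (th s).
  exact: (rotating_unit_vector A0 B0 (fun s => (phase_derivative s).1) (fun s => (phase_derivative s).2) dG).
have cth : continuous th.
  move=> s; apply: cvgD; last exact: cvg_cst; apply: cvgM; first exact: cvg_cst.
  apply: cvgB; last exact: cvg_cst.
  by apply: differentiable_continuous; apply/derivable1_diffP; have [] := dG s.
have phE s : phase F (g s) = cos (th s) +i* sin (th s).
  by have [<- <-] := thE s; apply/eqP; rewrite eq_complex !eqxx.
have g2 : g (2 * pi) = g 0 by rewrite -(per 0) add0r.
have [k hk] : exists k : int, th (2 * pi) - th 0 = k%:~R * (2 * pi).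
  have [||k e] := @same_angle R (th (2 * pi)) (th 0).
  - by rewrite -(thE _).1 -(thE _).1 /A g2.
  - by rewrite -(thE _).2 -(thE _).2 /B g2.
  by exists k; rewrite e addrC addKr.
(* Any other determination differs from [th] by a continuous function with values in 2 pi Z, hence
   by a constant; so the integer selected by [xget] is [k]. *)
have -> : maslov_index F g = k.
  rewrite /maslov_index; apply: xget_unique; first by exists th.
  move=> l [th' [cth' ph' l']]; pose D s := th' s - th s.
  have DZ s : exists m : int, D s = m%:~R * (2 * pi).
    have := ph' s; rewrite phE => -[e1 e2].
    by have [m e] := same_angle e1 e2; exists (- m); rewrite /D e mulrNz mulNr; ring.
  have cD : {within `[0, 2 * pi], continuous D}.
    by apply: continuous_subspaceT => s; apply: cvgB; [exact: cth'|exact: cth].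
  have := integer_valued_cst (ltW pi2) cD pi2 (fun s _ => DZ s).
  rewrite /D => e; apply/eqP; rewrite -(eqr_int R); apply/eqP; apply: (mulIf (lt0r_neq0 pi2)).
  rewrite -l' -hk; lra.
have -> : k%:~R * pi = G (2 * pi) - G 0.
  move: hk; rewrite /th subrr mulr0 add0r addrK => hk.
  by apply: (@mulfI R 2); rewrite ?pnatr_eq0 // hk; ring.
by exists G.
Qed.

End Maslov.

(** * Evolution of the periods *)

Section Increment.
Context {R : realType}.
Local Notation ex := ((1%R, 0%R) : R * R).
Local Notation ey := ((0%R, 1%R) : R * R).

(** The expansion in the second variable is centred at (w.1, t0) with w.1 varying, so the error is
    uniform in the loop parameter near [s0], as needed for a compactness argument. *)
Lemma near_increment (W : set (R * R)) (a : R * R -> R) (s0 t0 eps : R) : open W -> W (s0, t0) -> Cinf W a -> 0 < eps ->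
  nbhs (s0, t0) [set w : R * R | `|a w - a (w.1, t0) - (w.2 - t0) * 'D_ey a (w.1, t0)| <= eps * `|w.2 - t0| ].
Proof.
move=> pW Ww Ca e0; have e2 : 0 < eps / 2 by rewrite divr_gt0.
pose d w := 'D_ey a w.
have Cd : Cinf W d by exact: Cinf_derive.
have n1 : nbhs (s0, t0) [set w | W w /\ `|d w - d (s0, t0)| < eps / 2].
  exact: nbhsI (open_nbhs_nbhs (conj pW Ww)) (cont_near (Cinf_cont Cd Ww) e2).
have [r r0 hr] := (nbhs_normP _ _).1 n1.
have box s t : `|s - s0| < r -> `|t - t0| < r -> W (s, t) /\ `|d (s, t) - d (s0, t0)| < eps / 2.
  by move=> h1 h2; apply: hr; rewrite prod_normE gt_max h1 h2.
apply/nbhs_normP; exists r => // -[s t] /=; rewrite prod_normE gt_max => /andP[hs ht].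
pose f t := a (s, t).
have df (t' : R) : `|t' - t0| < r -> is_derive t' (1 : R) f (d (s, t')).
  move=> h; have [Wt _] := box s t' hs h.
  split; first by apply: derivable_slice2; exact: (Cinf_derivable ey Ca Wt).
  exact: (derive_slice2 a (1 : R) t' s).
have inr (th : R) : 0 <= th <= 1 -> `|t0 + th *: (t - t0) - t0| < r.
  move=> /andP[h0 h1]; rewrite addrAC subrr add0r normrZ ger0_norm //.
  by apply: le_lt_trans ht; rewrite -[X in _ <= X]mul1r ler_wpM2r.
have [|th th01 E] := @MVT_line R R f t0 (t - t0).
  by move=> th th01; have [] := is_derive_scale_R (t - t0) (df _ (inr th th01)).
have [_ E2] := is_derive_scale_R (t - t0) (df _ (inr th th01)).
have tE : t0 + (t - t0) = t by rewrite addrC subrK.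
rewrite E2 tE in E.
have -> : a (s, t) - a (s, t0) = (t - t0) * d (s, t0 + th *: (t - t0)) by exact: E.
rewrite -/(d (s, t0)) -mulrBr normrM mulrC ler_wpM2r //.
have [_ b1] := box s _ hs (inr th th01).
have [_ b2] : W (s, t0) /\ `|d (s, t0) - d (s0, t0)| < eps / 2 by apply: box => //; rewrite subrr normr0.
rewrite -(subrK (d (s0, t0)) (d (s, _))) -addrA (splitr eps).
by apply: le_trans (ler_normD _ _) _; apply: lerD; [exact: ltW|rewrite distrC; exact: ltW].
Qed.

Lemma near_slice (a : R * R -> R) (s0 t0 eps : R) : {for (s0, t0), continuous a} -> 0 < eps ->
  nbhs (s0, t0) [set w : R * R | `|a w - a (w.1, t0)| <= eps].
Proof.
move=> ca e0; have e2 : 0 < eps / 2 by rewrite divr_gt0.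
have n1 : nbhs (s0, t0) [set w : R * R | `|a w - a (s0, t0)| < eps / 2] by exact: (cont_near ca e2).
have cp : {for (s0, t0), continuous (fun w : R * R => (w.1, t0))}.
  by apply: continuous_pair; [exact: cvg_fst|exact: cvg_cst].
have n2 : nbhs (s0, t0) [set w : R * R | `|a (w.1, t0) - a (s0, t0)| < eps / 2] by exact: (cp _ n1).
apply: filterS (nbhsI n1 n2) => w /= [h1 h2].
rewrite -(subrK (a (s0, t0)) (a w)) -addrA.
apply: le_trans (ler_normD _ _) _; rewrite (distrC (a (s0, t0))) (splitr eps).
by apply: lerD; exact: ltW.
Qed.

Lemma is_derive_of_bound (f : R -> R) (t d : R) :
  (forall eps, 0 < eps -> nbhs t [set x | `|f x - f t - (x - t) * d| <= eps * `|x - t| ]) ->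
  is_derive t (1 : R) f d.
Proof.
move=> h; have c : h^-1 *: ((f \o shift t) (h *: (1 : R)) - f t) @[h --> 0^'] --> d.
  apply/cvgrPdist_le => eps e0; have [r r0 hr] := (nbhs_normP _ _).1 (h eps e0).
  rewrite /dnbhs /within; apply/nbhs_normP; exists r => // x; rewrite /= subr0 => xr x0.
  have := hr (x + t); rewrite /= addrK => /(_ xr) b.
  rewrite [x%:A]mulr1 /GRing.scale /= distrC.
  have -> : x^-1 * (f (x + t) - f t) - d = x^-1 * (f (x + t) - f t - x * d) by field.
  by rewrite normrM normfV ler_pdivrMl ?normr_gt0 // [`|x| * _]mulrC.
Local Transparent derive.
by split; [apply/cvg_ex; exists d|exact: cvg_lim].
Local Opaque derive.
Qed.

(** The retraction of the line onto [0, t1]. Composing with it makes a function continuous on all of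
    R out of one controlled on [0, t1] alone. *)
Definition clamp (t1 t : R) : R := Num.max 0 (Num.min t t1).

Lemma clamp_in t1 t : 0 <= t1 -> 0 <= clamp t1 t <= t1.
Proof. by move=> h; rewrite /clamp le_max lexx /= ge_max h ge_min lexx orbT. Qed.

Lemma clamp_id t1 t : 0 <= t <= t1 -> clamp t1 t = t.
Proof. by move=> /andP[t0 tt]; rewrite /clamp min_l // max_r. Qed.

Lemma clamp_dist t1 s t : `|clamp t1 s - clamp t1 t| <= `|s - t|.
Proof.
have maxl (x y : R) : `|Num.max 0 x - Num.max 0 y| <= `|x - y|.
  case: (leP 0 x) (leP 0 y) => [x0|x0] [y0|y0] //; rewrite ?subrr ?normr0 //.
    by rewrite subr0 !ger0_norm ?subr_ge0 ?lerBrDr; lra.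
  by rewrite sub0r normrN distrC !ger0_norm ?subr_ge0; lra.
have minl (x y : R) : `|Num.min x t1 - Num.min y t1| <= `|x - y|.
  case: (leP x t1) (leP y t1) => [x0|x0] [y0|y0] //; rewrite ?subrr ?normr0 //.
    by rewrite distrC (distrC x) !ger0_norm ?subr_ge0; lra.
  by rewrite !ger0_norm ?subr_ge0; lra.
exact: le_trans (maxl _ _) (minl _ _).
Qed.

End Increment.

Section Evolution.
Context {R : realType} {n : nat} {M : smooth_manifold R n}.
Local Notation Cn := 'rV[R[i]]_n.
Local Notation Rn := 'rV[R]_n.
Local Notation ex := ((1%R, 0%R) : R * R).
Local Notation ey := ((0%R, 1%R) : R * R).
Variables (T : \bar R) (F : M -> R -> Cn) (g : R -> M).
Hypotheses (oM : oriented M) (flow : lagrangian_mcf T F) (cM : compact [set: M]).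
Hypothesis lg : smooth_loop g.

Let pg : smooth_path g := ((smooth_loopP g).1 lg).1.
Let Ft t : M -> Cn := F ^~ t.
Let lagr t (Tt : time_interval T t) : lagrangian (Ft t) := lagrangian_preserved oM flow cM Tt.

Definition lambda_density t s := pairing (pullback_lambda (Ft t)) g s.
Definition curvature_density t s := pairing (mean_curvature_form (Ft t)) g s.

(** Locally the moving loop is a smooth map [u] of two real variables, extended below t = 0, whose
    t-velocity is the mean curvature vector for t >= 0. The evolution of both densities becomes
    calculus of [u]. *)
Lemma flow_along_loop s0 t0 : time_interval T t0 -> exists (W : set (R * R)) (u : R * R -> Cn),
  [/\ open W, W (s0, t0), CinfC W u & forall s t, W (s, t) -> 0 <= t ->
   [/\ time_interval T t, u (s, t) = F (g s) t, derivC ey u (s, t) = mean_curvature (Ft t) (g s),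
    lambda_density t s = lambda_form (u (s, t)) (derivC ex u (s, t)) &
    curvature_density t s = omega (derivC ex u (s, t)) (derivC ey u (s, t))]].
Proof.
move=> Tt0; set c := chart_at (g s0); have cs0 : chart_dom c (g s0) by exact: dom_chart_at.
have [B [G [pB Bx CG GF]]] := local_flow flow (coord_image cs0) Tt0.
have pc := @path_preimage_open _ _ _ g c pg.
pose x s := coord c (g s).
pose D := [set w : R * R | (g @^-1` chart_dom c) w.1].
have pD : open D by apply: (@open_comp _ _ (fun w : R * R => w.1)) => // w _; exact: cvg_fst.
have Cx i : Cinf D (fun w => x w.1 0 i).
  apply: (Cinf_comp fincoord_R pc pD _ (smooth_path_coord c i pg)) => // _.
  exact: Cinf_fst.
have cx w : D w -> {for w, continuous (fun w : R * R => (x w.1, w.2))}.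
  move=> Dw; apply: (@continuous_pair _ Rn R); last exact: cvg_snd.
  by apply: continuous_rV => j; exact: (Cinf_cont (Cx j) Dw).
pose W := [set w : R * R | D w /\ B (x w.1, w.2)].
have pW : open W.
  rewrite openE => w [Dw Bw]; have nB : nbhs (x w.1, w.2) B by exact: open_nbhs_nbhs.
  exact: nbhsI (open_nbhs_nbhs (conj pD Dw)) (cx w Dw _ nB).
pose u (w : R * R) := G (x w.1, w.2).
have Cu : CinfC W u.
  apply: (CinfC_comp (fincoord_prod (fincoord_rV n) fincoord_R) pB pW (phi := fun w => (x w.1, w.2)) _ CG).
    by move=> w [].
  case=> [i|_]; last exact: Cinf_snd.
  by apply: Cinf_sub (Cx i) => w [].
exists W, u; split=> // s t [Ds Bst] t0'.
have [cxs tT GE] := GF _ _ Bst.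
have Tt : time_interval T t by [].
have gE : param c (x s) = g s by rewrite coordK.
have uE : u (s, t) = F (g s) t by rewrite /u /= GE // /local_rep gE.
have iF := flow_immersion flow Tt; have lF := lagr Tt.
have u1 : derivC ex u (s, t) = derivC (1 : R) (fun r => Ft t (g r)) s.
  rewrite -derivC_slice1; apply: (derivC_ext (1 : R) (open_slice1 t pW) (x := s)) => // r [Dr Br].
  by have [_ _ e] := GF _ _ Br; rewrite /u /= e // /local_rep coordK.
have u2 : derivC ey u (s, t) = mean_curvature (Ft t) (g s).
  rewrite -derivC_slice2 -gE (mean_curvatureE iF oM cxs) -(flow_time_derivC oM flow pB CG GF Bst t0').
  by rewrite -derivC_slice2.
split=> //.
  by rewrite u1 uE; exact: (pairing_pullback_lambda _ iF pg (pullback_lambda_form1 lF)).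
by rewrite u1 u2; exact: (pairing_mean_curvature _ iF pg (mean_curvature_form1 oM lF)).
Qed.

Definition potential_along t s : R := lambda_form (F (g s) t) (mean_curvature (Ft t) (g s)).

(** This is [lambda_exterior] for the local map u: d_s lambda (u, d_t u) = d_t lambda (u, d_s u) +
    omega (d_s u, d_t u). *)
Lemma potential_derivative t0 s0 : time_interval T t0 -> exists (W : set (R * R)) (a : R * R -> R),
  [/\ open W, W (s0, t0), Cinf W a,
   (forall s t, W (s, t) -> 0 <= t -> lambda_density t s = a (s, t)) &
   forall s, W (s, t0) -> is_derive s (1 : R) (potential_along t0) ('D_ey a (s, t0) + curvature_density t0 s)].
Proof.
move=> Tt0; have [W [u [pW Ww Cu uP]]] := flow_along_loop s0 Tt0.
pose a w := lambda_form (u w) (derivC ex u w); pose b w := lambda_form (u w) (derivC ey u w).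
have Ca : Cinf W a by exact: (Cinf_lambda pW Cu (CinfC_derivC ex Cu)).
have Cb : Cinf W b by exact: (Cinf_lambda pW Cu (CinfC_derivC ey Cu)).
exists W, a; split=> //; first by move=> s t Wst t0'; have [_ _ _ ->] := uP s t Wst t0'.
move=> s Ws; have t00 : 0 <= t0 by case: Tt0.
have [_ _ _ _ ->] := uP s t0 Ws t00.
have d1 : is_derive s (1 : R) (fun r => b (r, t0)) ('D_ex b (s, t0)).
  split; first by apply: derivable_slice1; exact: (Cinf_derivable ex Cb Ws).
  exact: (derive_slice1 b (1 : R) s t0).
have ne : nbhs s [set r | b (r, t0) = potential_along t0 r].
  apply: filterS (open_nbhs_nbhs (conj (open_slice1 t0 pW) Ws)) => r Wr /=.
  by have [_ e1 e2 _ _] := uP r t0 Wr t00; rewrite /b e1 e2.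
have e := lambda_exterior pW Ws Cu.
have sub_eqD (x y z : R) : x - y = z -> x = y + z by move=> <-; rewrite addrC subrK.
exact: (is_derive_eq (is_derive_near ne d1) (sub_eqD _ _ _ e)).
Qed.

Lemma potential_periodic t s : potential_along t (s + 2 * pi) = potential_along t s.
Proof. by have [_ per] := (smooth_loopP g).1 lg; rewrite /potential_along per. Qed.

(** The time derivative of [lambda_density], written with functions defined along the whole loop,
    whereas the map u exists only locally. *)
Definition lambda_velocity t s := 'D_(1 : R) (potential_along t) s - curvature_density t s.

Lemma velocity_integral t w : time_interval T t -> has_integral 0 (2 * pi) (curvature_density t) w ->
  has_integral 0 (2 * pi) (lambda_velocity t) (- w).
Proof.
move=> Tt [G dG ->]; exists (fun s => potential_along t s - G s) => [s s01|].
  have [W [a [_ Ws _ _ h]]] := potential_derivative s Tt.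
  have [d _] := h s Ws.
  apply: is_deriveB; last exact: dG.
  by apply: DeriveDef.
have := potential_periodic t 0; rewrite add0r => ->; ring.
Qed.

Lemma density_increment t0 eps : time_interval T t0 -> 0 < eps -> nbhs t0 [set t | 0 <= t ->
  forall s, 0 <= s <= 2 * pi ->
   `|lambda_density t s - lambda_density t0 s - (t - t0) * lambda_velocity t0 s| <= eps * `|t - t0| ].
Proof.
move=> Tt0 e0; have t00 : 0 <= t0 by case: Tt0.
pose P (w : R * R) : Prop := 0 <= w.2 ->
  `|lambda_density w.2 w.1 - lambda_density t0 w.1 - (w.2 - t0) * lambda_velocity t0 w.1| <= eps * `|w.2 - t0|.
have cK : compact [set` `[(0 : R), 2 * pi]] by exact: segment_compact.
have near (s : R) : nbhs (s, t0) [set w | P w].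
  have [W [a [pW Ww Ca la h]]] := potential_derivative s Tt0.
  have n1 := near_increment pW Ww Ca e0.
  have n2 : nbhs (s, t0) W by exact: open_nbhs_nbhs.
  have cp : {for (s, t0), continuous (fun w : R * R => (w.1, t0))}.
    by apply: continuous_pair; [exact: cvg_fst|exact: cvg_cst].
  have n3 : nbhs (s, t0) [set w : R * R | W (w.1, t0)] by exact: (cp _ n2).
  apply: filterS (nbhsI n1 (nbhsI n2 n3)) => -[r t] /= [h1 [h2 h3]] t0'.
  rewrite /= (la r t h2 t0') (la r t0 h3 t00).
  have [_ e] := h r h3.
  by rewrite /lambda_velocity e addrK.
have := compact_near cK (fun s _ => near s); apply: filterS => t h t0' s s01.
by apply: (h s) => //; rewrite /= in_itv.
Qed.

Lemma curvature_density_near t0 eps : time_interval T t0 -> 0 < eps -> nbhs t0 [set t | 0 <= t ->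
  forall s, 0 <= s <= 2 * pi -> `|curvature_density t s - curvature_density t0 s| <= eps].
Proof.
move=> Tt0 e0; have t00 : 0 <= t0 by case: Tt0.
pose P (w : R * R) : Prop := 0 <= w.2 -> `|curvature_density w.2 w.1 - curvature_density t0 w.1| <= eps.
have cK : compact [set` `[(0 : R), 2 * pi]] by exact: segment_compact.
have near (s : R) : nbhs (s, t0) [set w | P w].
  have [W [u [pW Ww Cu uP]]] := flow_along_loop s Tt0.
  pose a w := omega (derivC ex u w) (derivC ey u w).
  have Ca : Cinf W a by exact: (Cinf_omega pW (CinfC_derivC ex Cu) (CinfC_derivC ey Cu)).
  have n1 := near_slice (Cinf_cont Ca Ww) e0.
  have n2 : nbhs (s, t0) W by exact: open_nbhs_nbhs.
  have cp : {for (s, t0), continuous (fun w : R * R => (w.1, t0))}.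
    by apply: continuous_pair; [exact: cvg_fst|exact: cvg_cst].
  have n3 : nbhs (s, t0) [set w : R * R | W (w.1, t0)] by exact: (cp _ n2).
  apply: filterS (nbhsI n1 (nbhsI n2 n3)) => -[r t] /= [h1 [h2 h3]] t0'.
  by have [_ _ _ _ ->] := uP r t h2 t0'; have [_ _ _ _ ->] := uP r t0 h3 t00.
have := compact_near cK (fun s _ => near s); apply: filterS => t h t0' s s01.
by apply: (h s) => //; rewrite /= in_itv.
Qed.

Section Periods.
Variables (P W : R -> R) (t1 : R).
Hypothesis Tt1 : time_interval T t1.
Hypothesis P_int : forall t, 0 <= t <= t1 -> has_integral 0 (2 * pi) (lambda_density t) (P t).
Hypothesis W_int : forall t, 0 <= t <= t1 -> has_integral 0 (2 * pi) (curvature_density t) (W t).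

Lemma time_interval_le t : 0 <= t <= t1 -> time_interval T t.
Proof. by move=> /andP[t0 tt]; split=> //; apply: le_lt_trans Tt1.2; rewrite lee_fin. Qed.

Let pi2 : 0 < 2 * pi :> R. Proof. by rewrite mulr_gt0 ?pi_gt0. Qed.

Lemma curvature_period_near t0 eps : 0 <= t0 <= t1 -> 0 < eps ->
  nbhs t0 [set t | 0 <= t <= t1 -> `|W t - W t0| <= eps].
Proof.
move=> t01 e0; have e1 : 0 < eps / (2 * pi) by rewrite divr_gt0.
apply: filterS (curvature_density_near (time_interval_le t01) e1) => t h t01'.
have t0' : 0 <= t by case/andP: t01'.
apply: le_trans (has_integral_close (ltW pi2) (h t0') (W_int t01') (W_int t01)) _.
by rewrite subr0 mulrC divfK // gt_eqF.
Qed.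

Lemma curvature_period_constant : (forall t, 0 <= t <= t1 -> exists k : int, W t = k%:~R * pi) ->
  forall t, 0 <= t <= t1 -> W t = W 0.
Proof.
move=> WZ t /andP[t0 tt1]; have t10 : 0 <= t1 := le_trans t0 tt1.
pose V s := W (clamp t1 s).
have nV (x eps : R) : 0 < eps -> nbhs x [set y | `|V x - V y| <= eps].
  move=> e0; have [r r0 hr] := (nbhs_normP _ _).1 (curvature_period_near (clamp_in x t10) e0).
  apply/nbhs_normP; exists r => // y /= yr; rewrite distrC; apply: hr; last exact: clamp_in.
  by apply: le_lt_trans yr; exact: clamp_dist.
have cV : {within `[0, t], continuous V}.
  by apply: continuous_subspaceT => x; apply/cvgrPdist_le => eps e0; exact: nV.
have := integer_valued_cst t0 cV (pi_gt0 R) (fun s _ => WZ _ (clamp_in s t10)).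
by rewrite /V !clamp_id ?lexx ?t0 // => ->.
Qed.

Lemma lambda_period_derivative t0 eps : 0 <= t0 <= t1 -> 0 < eps ->
  nbhs t0 [set t | 0 <= t <= t1 -> `|P t - P t0 + (t - t0) * W t0| <= eps * `|t - t0| ].
Proof.
move=> t01 e0; have e1 : 0 < eps / (2 * pi) by rewrite divr_gt0.
have Tt0 := time_interval_le t01.
apply: filterS (density_increment Tt0 e1) => t h t01'.
have t0' : 0 <= t by case/andP: t01'.
have [Q dQ Qv] := P_int t01; have [Q' dQ' Qv'] := P_int t01'.
have [K dK Kv] := velocity_integral Tt0 (W_int t01).
have i1 : has_integral 0 (2 * pi) (fun s => lambda_density t s - lambda_density t0 s) (P t - P t0).
  by exists (Q' - Q) => [s s01|]; [apply: is_deriveB; [exact: dQ'|exact: dQ]|rewrite Qv Qv' !fctE; ring].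
have i2 : has_integral 0 (2 * pi) (fun s => (t - t0) * lambda_velocity t0 s) ((t - t0) * - W t0).
  exists ((t - t0) *: K) => [s s01|]; first by apply: is_deriveZ; exact: dK.
  by rewrite Kv !fctE /GRing.scale /= mulrBr.
have := has_integral_close (ltW pi2) (h t0') i1 i2.
rewrite subr0 mulrN opprK mulrA (mulrC (2 * pi)) divfK // gt_eqF //.
Qed.

Lemma lambda_period : (forall t, 0 <= t <= t1 -> W t = W 0) -> P t1 = P 0 - t1 * W 0.
Proof.
move=> Wc; have t10 : 0 <= t1 by case: Tt1.
have z0 : 0 <= (0 : R) <= t1 by rewrite lexx.
(* [P] is prolonged by affine functions of slope - W 0 on both sides of [0, t1], so that two-sided
   derivatives exist at the ends and [E] can be compared with a linear function. *)
pose E t := if t < 0 then P 0 - t * W 0 else if t <= t1 then P t else P t1 - (t - t1) * W 0.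
have dE t : 0 <= t <= t1 -> is_derive t (1 : R) E (- W 0).
  move=> t01; have /andP[t0 tt] := t01; apply: is_derive_of_bound => eps e0.
  have n1 : nbhs t [set x | x < 0 -> t = 0].
    have [->|tn] := eqVneq t 0; first by apply: filterS filterT => x.
    have o : nbhs t [set x : R | 0 < x] by apply: open_nbhs_nbhs; split; [exact: open_gt|rewrite /= lt_def tn].
    by apply: filterS o => x /= x0 x0'; move: (lt_trans x0 x0'); rewrite ltxx.
  have n2 : nbhs t [set x | t1 < x -> t = t1].
    have [->|tn] := eqVneq t t1; first by apply: filterS filterT => x.
    have o : nbhs t [set x : R | x < t1] by apply: open_nbhs_nbhs; split; [exact: open_lt|rewrite /= lt_neqAle tn].
    by apply: filterS o => x /= x0 x0'; move: (lt_trans x0 x0'); rewrite ltxx.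
  have Et : E t = P t by rewrite /E (ltNge t) t0 /= tt.
  apply: filterS (nbhsI (lambda_period_derivative t01 e0) (nbhsI n1 n2)) => x /= [h1 [h2 h3]].
  rewrite Et mulrN opprK /E; case: (ltP x 0) => [x0|x0].
    have e : P 0 - x * W 0 - P t + (x - t) * W 0 = 0 by rewrite (h2 x0); ring.
    by rewrite e normr0 mulr_ge0 // ltW.
  case: (leP x t1) => [x1|x1].
    by have := h1; rewrite x0 x1 (Wc _ t01); apply.
  have e : P t1 - (x - t1) * W 0 - P t + (x - t) * W 0 = 0 by rewrite (h3 x1); ring.
  by rewrite e normr0 mulr_ge0 // ltW.
have EL t : 0 <= t <= t1 -> is_derive t (1 : R) (fun t => - W 0 * t) (- W 0).
  move=> _; have := is_deriveZ (- W 0) (@is_derive_id R R t 1); rewrite [_%:A]mulr1.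
  exact.
have := same_derive_diff t10 dE EL.
rewrite /E ltxx t10 (ltNge t1) t10 /= lexx mulr0 subr0 => e; lra.
Qed.

End Periods.
End Evolution.

Section Forms.
Context {R : realType} {n : nat} {M : smooth_manifold R n}.
Local Notation Rn := 'rV[R]_n.
Implicit Types alpha beta : form1 M.

Lemma scale_form1 (a : R) alpha : is_form1 alpha -> is_form1 (scale_form a alpha).
Proof.
move=> [s t]; split=> [c i|c d x ox]; last by rewrite /scale_form (t c d x ox) scalemxAl.
have oc := chart_image_open c; apply: Cinf_smooth_on => //.
apply: (Cinf_ext oc (f := fun x => a * alpha c x 0 i)) => [x _|]; first by rewrite mxE.
by apply: CinfM => //; [exact: Cinf_cst|exact: smooth_on_open].
Qed.

Lemma sub_form1 alpha beta : is_form1 alpha -> is_form1 beta -> is_form1 (sub_form alpha beta).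
Proof.
move=> [s t] [s' t']; split=> [c i|c d x ox]; last by rewrite /sub_form (t c d x ox) (t' c d x ox) mulmxBl.
have oc := chart_image_open c; apply: Cinf_smooth_on => //.
apply: (Cinf_ext oc (f := fun x => alpha c x 0 i - beta c x 0 i)) => [x _|]; first by rewrite !mxE.
by apply: CinfB => //; exact: smooth_on_open.
Qed.

Lemma scale_closed (a : R) alpha : closed_form alpha -> closed_form (scale_form a alpha).
Proof.
move=> [fa ca]; split; first exact: scale_form1.
move=> c x cx i j; have oc := chart_image_open c.
have e k l : partial_deriv k (fun y => scale_form a alpha c y 0 l) x =
    a * partial_deriv k (fun y => alpha c y 0 l) x.
  rewrite /partial_deriv (_ : (fun y => _) = a *: (fun y => alpha c y 0 l)); last first.
    by apply/funext => y; rewrite mxE.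
  by rewrite deriveZ //; exact: (Cinf_derivable _ (smooth_on_open oc (fa.1 c l)) cx).
by rewrite !e ca.
Qed.

End Forms.

Section Periods.
Context {R : realType} {n : nat} {M : smooth_manifold R n}.
Variables (T : \bar R) (F : M -> R -> 'rV[R[i]]_n) (eps0 : R).
Hypotheses (oM : oriented M) (flow : lagrangian_mcf T F) (cM : compact [set: M]).
Hypothesis mono : monotone_lagrangian (F ^~ 0) eps0.

Lemma loop_periods g t : smooth_loop g -> time_interval T t -> exists2 w,
  has_integral 0 (2 * pi) (pairing (mean_curvature_form (F ^~ t)) g) w &
  has_integral 0 (2 * pi) (pairing (pullback_lambda (F ^~ t)) g) (1 / eps0 * (1 - eps0 * t) * w).
Proof.
move=> lg Tt; have t0 : 0 <= t by case: Tt.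
have [pg _] := (smooth_loopP g).1 lg.
have pi2 : 0 <= 2 * pi :> R by rewrite mulr_ge0 ?pi_ge0.
have T0 : time_interval T 0 by split=> //; case: flow.
have Ts s : 0 <= s <= t -> time_interval T s by exact: time_interval_le.
have lagr s (h : time_interval T s) : lagrangian (F ^~ s) := lagrangian_preserved oM flow cM h.
(* Taking the Maslov index times pi as the period makes its values in pi Z, needed for constancy in
   time, immediate. *)
pose W s : R := (maslov_index (F ^~ s) g)%:~R * pi.
have W_int s : 0 <= s <= t -> has_integral 0 (2 * pi) (curvature_density F g s) (W s).
  by move=> /Ts /lagr ls; exact: maslov_integral.
have P_ex s : exists v, 0 <= s <= t -> has_integral 0 (2 * pi) (lambda_density F g s) v.
  have [h|h] := pselect (0 <= s <= t); last by exists 0.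
  have [v iv] := has_integral_exists (2 * pi) (lexx 0) (pairing_continuous (pullback_lambda_form1 (lagr s (Ts s h))) pg).
  by exists v.
have [P P_int] := choice P_ex.
have Wc := curvature_period_constant oM flow cM lg Tt W_int (fun s _ => ex_intro _ _ erefl).
have Pt := lambda_period oM flow cM lg Tt P_int W_int Wc.
have [l0 e0 m0] := mono.
have i0 : 0 <= (0 : R) <= t by rewrite lexx.
have du := disk_exists l0.1 lg.
have P0 : P 0 = symplectic_area (cone (F ^~ 0) g).
  exact: (has_integral_uniq pi2 (P_int 0 i0) (stokes l0.1 (pullback_lambda_form1 l0) du)).
have W0 : W 0 = eps0 * P 0.
  by rewrite /W (m0 _ _ du) P0 mulrAC divfK // gt_eqF ?pi_gt0.
have tt : 0 <= t <= t by rewrite t0 lexx.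
exists (W t); first exact: W_int.
have -> : 1 / eps0 * (1 - eps0 * t) * W t = P t.
  rewrite (Wc t tt) Pt W0; field; by rewrite gt_eqF.
exact: P_int.
Qed.

End Periods.

Theorem proposition1p4 (R : realType) (n : nat) (L : smooth_manifold R n)
    (Tsing : \bar R) (F : L -> R -> 'rV[R[i]]_n) (eps0 : R) :
  compact [set: L] ->
  oriented L ->
  maximal_lagrangian_mcf Tsing F ->
  monotone_lagrangian (F ^~ 0) eps0 ->
  (forall t : R, 0 <= t -> (t%:E < Tsing)%E ->
     same_class (pullback_lambda (F ^~ t))
       (scale_form (1 / eps0 * (1 - eps0 * t))
          (mean_curvature_form (F ^~ t)))) /\
  (forall t : R, 0 <= t -> (t%:E < Tsing)%E -> t < 1 / eps0 ->
     0 < eps0 / (1 - eps0 * t) /\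
     monotone_lagrangian (F ^~ t) (eps0 / (1 - eps0 * t))).
Proof.
move=> cL oL [flow _] mono; have [_ e0 _] := mono.
have pi2 : 0 <= 2 * pi :> R by rewrite mulr_ge0 ?pi_ge0.
split=> t t0 tT.
  have Tt : time_interval Tsing t by [].
  have lF := lagrangian_preserved oL flow cL Tt.
  have cl := pullback_lambda_closed lF.
  have cH := scale_closed (1 / eps0 * (1 - eps0 * t)) (mean_curvature_closed oL lF).
  split=> //; apply: exact_of_loops => [|g lg]; first by apply: sub_form1; [case: cl|case: cH].
  have [w [G dG Gw] [K dK Kw]] := loop_periods oL flow cL mono lg Tt.
  set c := 1 / eps0 * (1 - eps0 * t) in Kw *.
  (* The increment of this primitive over the loop is 0 because both periods are expressed by the
     same w. *)
  exists (K - c *: G) => [s s01|].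
    rewrite pairing_sub pairing_scale; apply: is_deriveB; first exact: dK.
    by apply: is_deriveZ; exact: dG.
  transitivity (K (2 * pi) - K 0 - c * (G (2 * pi) - G 0)); first by rewrite -Kw -Gw subrr.
  by rewrite !fctE /GRing.scale /=; ring.
move=> te; have Tt : time_interval Tsing t by [].
have lF := lagrangian_preserved oL flow cL Tt.
have d0 : 0 < 1 - eps0 * t by rewrite subr_gt0 mulrC -ltr_pdivlMr.
have et : 0 < eps0 / (1 - eps0 * t) by rewrite divr_gt0.
split=> //; split=> // u g du; have [_ lg _] := du.
have [w iw il] := loop_periods oL flow cL mono lg Tt.
(* Stokes' formula and the Maslov formula hold for the Lagrangian at time t; uniqueness of integrals
   transfers the ratio of periods over [g] to every disk bounded by it. *)
have area := has_integral_uniq pi2 (stokes lF.1 (pullback_lambda_form1 lF) du) il.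
have mw := has_integral_uniq pi2 (maslov_integral oL lF lg) iw.
have p0 : pi != 0 :> R by rewrite gt_eqF ?pi_gt0.
have cancel (e d p : R) : e != 0 -> d != 0 -> p != 0 -> w = e / d / p * (1 / e * d * w) * p.
  by move=> e1 d1 p1; field; rewrite e1 d1 p1.
have e1 : eps0 != 0 by rewrite gt_eqF.
have d1 : 1 - eps0 * t != 0 by rewrite gt_eqF.
by apply: (mulIf p0); rewrite mw area; exact: cancel.
Qed.
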